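(* Let $s\in(0,1]$, $l>0$ and $d\ge0$. Then there exists $\tau\in(1,2]$ such that, for every size function $\sigma(\varepsilon)>0$ satisfying, as $\varepsilon\to0$, $\sigma(\varepsilon)/\varepsilon\le C$ for a fixed $C>0$ and $\varepsilon^\tau/\sigma(\varepsilon)\to 0$, there exist $\varepsilon_0>0$ and a (large) constant $L>0$ such that for every $\varepsilon\in(0,\varepsilon_0)$ the gSQG equation has a travelling-wave solution, $l$-periodic in $x_2$, of the form $\vartheta_\varepsilon(x,t)=\vartheta_{0,\varepsilon}(x-tW_\varepsilon\boldsymbol e_2)$ with $W_\varepsilon\in\mathbb R$, where $\vartheta_{0,\varepsilon}\in C^1(\mathbb R^2)$ is symmetric with respect to each of the lines $x_2=kl\pm l/4$, $k\in\mathbb Z$, and has the form $$\vartheta_{0,\varepsilon}(x)=\sum_{k\in\mathbb Z}\vartheta_{1,\varepsilon}(x+kl\boldsymbol e_2)-\sum_{k\in\mathbb Z}\vartheta_{2,\varepsilon}(x+kl\boldsymbol e_2),$$ with $\mathrm{supp}(\vartheta_{1,\varepsilon})\subset B_{L\varepsilon}((-d,-l/4))$ and $\mathrm{supp}(\vartheta_{2,\varepsilon})\subset B_{L\sigma(\varepsilon)}((d,l/4))$. The speed satisfies $$W_\varepsilon=\mathcal C_s\lim_{N\to\infty}\sum_{|k|\le N}\frac{2d}{\left(4d^2+(kl+\frac l2)^2\right)^{2-s}}+o_\varepsilon(1)\qquad\text{as }\varepsilon\to0.$$ Moreover, in the sense of measures, $$\vartheta_{0,\varepsilon}(x)\rightharpoonup\sum_{k\in\mathbb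 Z}\boldsymbol\delta_{(-d,kl-l/4)}(x)-\sum_{k\in\mathbb Z}\boldsymbol\delta_{(d,kl+l/4)}(x)\qquad\text{as }\varepsilon\to0.$$
   Context: The generalized surface quasi-geostrophic (gSQG) equation with parameter $0<s\le1$ is $$\partial_t\vartheta+\mathbf v\cdot\nabla\vartheta=0,\qquad \mathbf v=\nabla^\perp\psi,\qquad \psi=(-\Delta)^{-s}\vartheta\qquad\text{in }\mathbb R^2,$$ where $\nabla^\perp=(\partial_{x_2},-\partial_{x_1})$ and $(-\Delta)^{-s}\vartheta(x)=\int_{\mathbb R^2}G_s(x-y)\vartheta(y)\,dy$, with $G_s(x)=\frac1{2\pi}\ln\frac1{|x|}$ if $s=1$ and $G_s(x)=c_s|x|^{2s-2}$, $c_s=\frac{\Gamma(1-s)}{2^{2s}\pi\Gamma(s)}$, if $0<s<1$. The case $s=1$ is the 2D incompressible Euler equation in vorticity form. For functions that are $l$-periodic in $x_2$, the stream function is understood through the periodized kernel $\sum_{k\in\mathbb Z}G_s(x+kl\boldsymbol e_2)$ acting on one period $\mathbb R\times(-l/2,l/2)$, the sum over periods being taken as the limit of the symmetric partial sums $|k|\le N$ of the combined contribution of the positive and negative vortices. A function $\vartheta_0(x-t\mathbf U)$ is a travelling-wave solution when $(\nabla^\perp\psi_0-\mathbf U)\cdot\nabla\vartheta_0=0$ in $\mathbb R^2$, with $\psi_0=(-\Delta)^{-s}\vartheta_0$. Constants: $\mathcal C_s=\frac1{2\pi}$ if $s=1$, and $\mathcal C_s=(2-2s)c_s$ if $0<s<1$.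 $\boldsymbol e_2=(0,1)$; $B_r(z)$ is the open disc of radius $r$ centred at $z$; $\boldsymbol\delta_z$ is the Dirac measure at $z$; $o_\varepsilon(1)$ denotes a quantity tending to $0$ as $\varepsilon\to0$. The functions $\vartheta_{1,\varepsilon},\vartheta_{2,\varepsilon}$ belong to $C^1(\mathbb R^2)$. *)

(* Defs.v *)
From HB Require Import structures.
From mathcomp Require Import all_boot all_order all_algebra.
From mathcomp Require Import all_classical all_reals all_analysis.
Set Implicit Arguments.
Unset Strict Implicit.
Unset Printing Implicit Defensive.
Import Order.TTheory GRing.Theory Num.Theory.
Import numFieldNormedType.Exports.
Local Open Scope classical_set_scope.
Local Open Scope ring_scope.

(* MathComp-Analysis.  The plane is [R * R], whose library norm is the sup
   norm; [enorm] and [disc] are the Euclidean ones. *)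
Definition enorm (R : realType) (x : R * R) : R :=
  Num.sqrt (x.1 ^+ 2 + x.2 ^+ 2).

Definition disc (R : realType) (z : R * R) (r : R) : set (R * R) :=
  [set x | enorm (x - z) < r].

Definition supp (R : realType) (f : R * R -> R) : set (R * R) :=
  closure [set x | f x != 0].

Definition lebesgue2 (R : realType) :
    {measure set (measurableTypeR R * measurableTypeR R) -> \bar R} :=
  (@lebesgue_measure R \x @lebesgue_measure R)%E.
Arguments lebesgue2 R : clear implicits.

Definition d1 (R : realType) (f : R * R -> R) (x : R * R) : R :=
  'D_((1, 0) : R * R) f x.

Definition d2 (R : realType) (f : R * R -> R) (x : R * R) : R :=
  'D_((0, 1) : R * R) f x.

Definition C1 (R : realType) (f : R * R -> R) : Prop :=
  [/\ forall x : R * R, differentiable f x,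
      continuous (d1 f) & continuous (d2 f)].

(* Euler's Gamma function; only used at positive arguments. *)
Definition Gamma (R : realType) (a : R) : R :=
  \int[@lebesgue_measure R]_(t in `]0, +oo[) (t `^ (a - 1) * expR (- t)).

Definition cs (R : realType) (s : R) : R :=
  Gamma (1 - s) / (2 `^ (2 * s) * pi * Gamma s).

Definition Cs (R : realType) (s : R) : R :=
  if s == 1 then (2 * pi)^-1 else (2 - 2 * s) * cs s.

(* The value at [x = 0] is a junk real; it is immaterial in the integrals. *)
Definition Gs (R : realType) (s : R) (x : R * R) : R :=
  if s == 1 then (2 * pi)^-1 * ln (enorm x)^-1
  else cs s * enorm x `^ (2 * s - 2).

(* [symsum F N] is the sum of [F k] over the integers [|k| <= N], here
   enumerated as [k = i - N] with [0 <= i <= 2 N]. *)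
Definition symsum (R : realType) (F : int -> R) (N : nat) : R :=
  \sum_(i < N.*2.+1) F (i%:Z - N%:Z).

(* [x + k l e_2] *)
Definition shift (R : realType) (l : R) (k : int) (x : R * R) : R * R :=
  (x.1, x.2 + k%:~R * l).

(* The sum over all integers of [fsbigop] is the sum over the indices with a
   non-zero term when these are finitely many, as is the case at every point
   for a compactly supported [f] and [0 < l]. *)
Definition periodize (R : realType) (l : R) (f : R * R -> R) (x : R * R) : R :=
  \sum_(k \in [set: int]) f (shift l k x).

Definition periodic2 (R : realType) (l : R) (f : R * R -> R) : Prop :=
  forall x : R * R, f (x.1, x.2 + l) = f x.

Definition symmetric_line2 (R : realType) (c : R) (f : R * R -> R) : Prop :=
  forall x : R * R, f (x.1, 2 * c - x.2) = f x.

Definition strip (R : realType) (l : R) : set (R * R) :=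
  [set y | - (l / 2) < y.2 < l / 2].

Definition periodic_integrand (R : realType) (s l : R) (theta : R * R -> R)
    (N : nat) (x y : R * R) : R :=
  symsum (fun k => Gs s (shift l k (x - y))) N * theta y.

(* [psi = (-Delta)^{-s} theta] for [theta] l-periodic in [x_2].  The positive
   and negative parts of [theta] are integrated together before the limit in
   [N] is taken: separately the limits are infinite for [1/2 <= s]. *)
Definition stream_function (R : realType) (s l : R)
    (theta psi : R * R -> R) : Prop :=
  forall x : R * R,
    (forall N, (lebesgue2 R).-integrable (strip l)
       (EFin \o periodic_integrand s l theta N x)) /\
    (fun N : nat => \int[lebesgue2 R]_(y in strip l)
       periodic_integrand s l theta N x y) @ \oo --> psi x.

(* [theta (x - t U)] solves the gSQG equation among functions that are
   l-periodic in [x_2]: [(nabla^perp psi - U) . nabla theta = 0] with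
   [nabla^perp = (d_2, - d_1)]. *)
Definition travelling_wave (R : realType) (s l : R)
    (theta : R * R -> R) (U : R * R) : Prop :=
  periodic2 l theta /\
  exists psi : R * R -> R,
    [/\ stream_function s l theta psi,
        forall x : R * R, differentiable psi x &
        forall x : R * R,
          (d2 psi x - U.1) * d1 theta x + (- d1 psi x - U.2) * d2 theta x = 0].

(* [f e dx] tends, as [e -> 0+], to the signed measure
   [\sum_k \d_(p k) - \sum_k \d_(q k)], in duality with continuous compactly
   supported functions (the limit may have infinite total variation).  The sums
   of pairings have finitely many non-zero terms when [p] and [q] are locally
   finite. *)
Definition cvg_to_dirac_combs (R : realType) (f : R -> R * R -> R)
    (p q : int -> R * R) : Prop :=
  forall phi : R * R -> R, continuous phi -> compact (supp phi) ->
    (\int[lebesgue2 R]_x (f e x * phi x)) @[e --> 0^'+] -->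
      \sum_(k \in [set: int]) (\int[\d_(p k)]_x phi x)
      - \sum_(k \in [set: int]) (\int[\d_(q k)]_x phi x).

(* Main.v *)
(* The two vortices are images of each other under [x |-> - x], up to sign, at
   the common scale [dl = min e (sigma e)], which is enough since the supports
   need only be contained in the given discs.  With centre [zz] and scale [dl],
   the positive one is [dl ^- 2 * w ((X - zz) / dl - ac w * e_1)], and it
   travels if [w = ff (Pot w - mu)] near its support, where [Pot w] is the
   rescaled stream function plus a multiple [lam w * x.1] of the first
   coordinate: then the gradients of the vorticity and of the relative stream
   function are parallel.  The speed is proportional to [lam w], an average of
   the [x_1] derivative of the periodized kernel near the lattice of opposite
   vortices, and it converges to the value at the centres.

   The profile [w] maximizes an energy (interaction minus an entropy [FF])
   among functions of mass 1, symmetric in [x_2], cut off at a box of side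
   [Rb].  Compactness gives a maximizer, a dichotomy between strips of positive
   mass and gaps confines its support to a smaller box uniformly in [dl], and
   the cut-off disappears from the equation.  The periodic images and the
   opposite vortices enter only through Lipschitz perturbations of size
   [O(dl)]. *)
Require Import Defs.
From HB Require Import structures.
From mathcomp Require Import all_boot all_order all_algebra.
From mathcomp Require Import all_classical all_reals all_analysis.
From mathcomp Require Import measurable_realfun.
From mathcomp Require Import ring lra.
Import Order.TTheory GRing.Theory Num.Theory.
Import numFieldNormedType.Exports.
Set Implicit Arguments.
Unset Strict Implicit.
Unset Printing Implicit Defensive.
Local Open Scope classical_set_scope.
Local Open Scope ring_scope.

(** The cut-off [chi] breaks translation invariance, so a maximizer might lean on the edge of its
    box. This is excluded because all the constants of the confinement (strip width, mass of a
    strip, number of strips) depend on [s] alone: the near part of the kernel has small integral,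
    and a test profile bounds the multiplier below by [E1]. They fix [Rb], and only then is the size
    of the perturbations, hence of [dl], restricted. Along [x_2] evenness holds the mass in place;
    along [x_1] the force of the opposite vortices is balanced by the term in [lam]. The other
    obstacle is the sum over the periods. Its terms are of order [|k| ^ (2 * s - 2)] and their
    variations of order [|k| ^ (2 * s - 3)], not summable for [s = 1]. Pairing [k] with [- k],
    subtracting constants that a vorticity of zero mean does not see, and freezing the slope of the
    kernel at [k ^ 2 * l ^ 2] leaves summable terms. Strict differentiability survives limits whose
    error has a small Lipschitz constant, both when the singularity of the kernel is removed and
    when the number of periods grows. *)

Section main.
Variable R : realType.
Notation P := (R * R)%type.
Notation mu2 := (lebesgue2 R).
Notation PM := (measurableTypeR R * measurableTypeR R)%type.

(** * Integration over the plane: affine substitutions, boxes, Fubini *)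

Definition mbl (f : P -> R) := measurable_fun [set: PM] (f : PM -> R).
Definition itg (f : P -> R) : Prop := mu2.-integrable [set: PM] (EFin \o f).
Definition I2 (f : P -> R) : R := \int[mu2]_x f x.

Lemma itg_mbl f : itg f -> mbl f.
Proof. by move=> /integrableP[/measurable_EFinP]. Qed.

Lemma itgD f g : itg f -> itg g -> itg (fun x => f x + g x).
Proof. by move=> hf hg; exact: (integrableD measurableT hf hg). Qed.

Lemma itgB f g : itg f -> itg g -> itg (fun x => f x - g x).
Proof. by move=> hf hg; exact: (integrableB measurableT hf hg). Qed.

Lemma itgZ c f : itg f -> itg (fun x => c * f x).
Proof. by move=> hf; exact: (integrableZl measurableT c hf). Qed.

Lemma itg_le f g : mbl f -> itg g -> (forall x, `|f x| <= g x) -> itg f.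
Proof.
move=> mf ig fg; apply: (le_integrable measurableT _ _ ig).
  exact/measurable_EFinP.
by move=> x _ /=; rewrite lee_fin (le_trans (fg x))// ler_norm.
Qed.

Lemma I2D f g : itg f -> itg g -> I2 (fun x => f x + g x) = I2 f + I2 g.
Proof. exact: RintegralD. Qed.
Lemma I2B f g : itg f -> itg g -> I2 (fun x => f x - g x) = I2 f - I2 g.
Proof. exact: RintegralB. Qed.
Lemma I2Z c f : itg f -> I2 (fun x => c * f x) = c * I2 f.
Proof. exact: RintegralZl. Qed.
Lemma I2_le f g : itg f -> itg g -> (forall x, f x <= g x) -> I2 f <= I2 g.
Proof. by move=> hf hg fg; apply: le_Rintegral => // x _; apply: fg. Qed.
Lemma I2_ge0 f : (forall x, 0 <= f x) -> 0 <= I2 f.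
Proof. by move=> f0; apply: Rintegral_ge0. Qed.
Lemma eq_I2 f g : f =1 g -> I2 f = I2 g.
Proof. by move/funext->. Qed.
Lemma eq_itg f g : f =1 g -> itg f -> itg g.
Proof. by move/funext->. Qed.
Lemma itg_norm f : itg f -> itg (fun x => `|f x|).
Proof. exact: integrable_norm. Qed.
Lemma ler_norm_I2 f : itg f -> `|I2 f| <= I2 (fun x => `|f x|).
Proof. exact: le_normr_Rintegral. Qed.
Lemma itg0 : itg (fun=> 0).
Proof. exact: integrable0. Qed.
Lemma I20 : I2 (fun=> 0) = 0.
Proof. by rewrite /I2 Rintegral_cst// mul0r. Qed.

(** The topology is that of the sup norm and the sigma-algebra is the product one; an open set is
    the union of the rational rectangles that it contains, and these are countably many. *)
Lemma open_prod_mbl (U : set P) : open U -> measurable (U : set PM).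
Proof.
move=> oU.
pose B (q : (rat * rat) * (rat * rat)) : set P :=
  `]ratr q.1.1, ratr q.1.2[%classic `*` `]ratr q.2.1, ratr q.2.2[%classic.
have -> : U = \bigcup_(q in [set q | B q `<=` U]) B q.
  apply/seteqP; split => [x Ux|x [q /= qU /qU//]].
  have /nbhs_ballP[e /= e0 xeU] : nbhs x U by exact: open_nbhs_nbhs.
  have xe (t : R) : t - e < t by lra.
  have ex (t : R) : t < t + e by lra.
  have [a1] := rat_in_itvoo (xe x.1); rewrite in_itv/= => /andP[h1 h2].
  have [b1] := rat_in_itvoo (ex x.1); rewrite in_itv/= => /andP[h3 h4].
  have [a2] := rat_in_itvoo (xe x.2); rewrite in_itv/= => /andP[h5 h6].
  have [b2] := rat_in_itvoo (ex x.2); rewrite in_itv/= => /andP[h7 h8].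
  exists ((a1, b1), (a2, b2)).
    move=> y [/=]; rewrite !in_itv/= => /andP[k1 k2] /andP[k3 k4].
    apply: xeU; split => /=.
      by rewrite /ball/= ltr_norml; apply/andP; split; lra.
    by rewrite /ball/= ltr_norml; apply/andP; split; lra.
  by split => /=; rewrite in_itv/=; apply/andP; split.
rewrite bigcup_mkcond; apply: countable_bigcupT_measurable.
  exact: countableP.
move=> q; case: ifPn => // _.
by apply: measurableX; exact: measurable_itv.
Qed.

Lemma continuous_mbl (f : P -> R) : continuous f -> mbl f.
Proof.
move=> /continuousP cf.
apply: (@measurability _ _ _ _ _ _ (@RGenOpens.G R)).
  exact: RGenOpens.measurableE.
move=> _ [_ [a [b ->]] <-]; rewrite setTI.
by apply: open_prod_mbl; apply: cf; exact: interval_open.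
Qed.

Definition aff (c e x : P) : P := (c.1 * x.1 + e.1, c.2 * x.2 + e.2).

Local Notation leb := (@lebesgue_measure R).

Lemma mbl_aff1 (c e : R) : measurable_fun setT ((fun t => c * t + e) : measurableTypeR R -> measurableTypeR R).
Proof. by apply: measurable_funD => //; exact: measurable_funM. Qed.

(** Both sides are measures in [A], so by uniqueness of Lebesgue measure they need only be compared
    on half-open intervals. For negative [c] the preimage is closed on the left instead of on the
    right, with the same length. *)
Lemma leb_aff1 (c e : R) (A : set R) : c != 0 -> measurable (A : set (measurableTypeR R)) ->
  leb A = (`|c|%:E * leb ((fun t : R => (c * t + e)%R) @^-1` A))%E.
Proof.
move=> c0 mA.
have mphi := mbl_aff1 c e.
pose mm : {measure set (measurableTypeR R) -> \bar R} := mscale (NngNum (normr_ge0 c)) (pushforward leb ((fun t => c * t + e) : measurableTypeR R -> measurableTypeR R)).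
apply: (@lebesgue_measure_unique R (mm mphi)) => //.
move=> _ [[a b] _ <-]; rewrite /mm /= /mscale /= /pushforward.
have [cp|cn] := ltP 0 c.
  have -> : (fun t : measurableTypeR R => c * t + e) @^-1` `]a, b] = `](a - e) / c, (b - e) / c]%classic.
    apply/seteqP; split => t /=; rewrite !in_itv/= ltr_pdivrMr// ler_pdivlMr// => /andP[h1 h2]; apply/andP; split; lra.
  rewrite !lebesgue_measure_itv/= !lte_fin ltr_pM2r ?invr_gt0// ltrD2r.
  case: ifPn => _; last by rewrite mule0.
  rewrite -!EFinB -EFinM gtr0_norm//; congr EFin; field; lra.
have {cn}cn : c < 0 by rewrite lt_neqAle c0.
have -> : (fun t : measurableTypeR R => c * t + e) @^-1` `]a, b] = `[(b - e) / c, (a - e) / c[%classic.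
  apply/seteqP; split => t /=; rewrite !in_itv/= ltr_ndivlMr// ler_ndivrMr// => /andP[h1 h2]; apply/andP; split; lra.
rewrite !lebesgue_measure_itv/= !lte_fin ltr_nM2r ?invr_lt0// ltrD2r.
case: ifPn => _; last by rewrite mule0.
rewrite -!EFinB -EFinM ltr0_norm//; congr EFin; field; lra.
Qed.

Lemma mbl_aff c e : measurable_fun setT (aff c e : PM -> PM).
Proof.
apply/measurable_fun_pairP; split => /=.
  by apply: measurable_funD => //; apply: measurable_funM => //; exact: measurable_fst.
by apply: measurable_funD => //; apply: measurable_funM => //; exact: measurable_snd.
Qed.

(** Uniqueness of the product measure reduces the claim to rectangles, where [leb_aff1] applies to
    each factor. *)
Lemma leb_aff (c e : P) (A : set PM) : c.1 != 0 -> c.2 != 0 -> measurable A ->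
  mu2 A = ((`|c.1| * `|c.2|)%:E * mu2 (aff c e @^-1` A))%E.
Proof.
move=> c10 c20 mA.
have c0 : 0 <= `|c.1| * `|c.2| by rewrite mulr_ge0.
have mphi := mbl_aff c e.
pose mm : {measure set PM -> \bar R} := mscale (NngNum c0) (pushforward mu2 (aff c e : PM -> PM)).
apply: (@product_measure_unique _ _ _ _ R leb leb (mm mphi)) => //.
move=> B C mB mC; rewrite /mm /= /mscale /= /pushforward /=.
have -> : aff c e @^-1` (B `*` C) = ((fun t : R => (c.1 * t + e.1)%R) @^-1` B) `*` ((fun t : R => (c.2 * t + e.2)%R) @^-1` C) by [].
have m1 : measurable ((fun t : measurableTypeR R => (c.1 * t + e.1)%R) @^-1` B).
  by rewrite -[X in measurable X]setTI; exact: mbl_aff1.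
have m2 : measurable ((fun t : measurableTypeR R => (c.2 * t + e.2)%R) @^-1` C).
  by rewrite -[X in measurable X]setTI; exact: mbl_aff1.
rewrite [RHS]/= /lebesgue2 product_measure1E// (leb_aff1 e.1 c10 mB) (leb_aff1 e.2 c20 mC).
by rewrite EFinM muleACA.
Qed.

Lemma ge0_aff (c e : P) (f : PM -> \bar R) : c.1 != 0 -> c.2 != 0 ->
  measurable_fun setT f -> (forall x, 0 <= f x)%E ->
  (\int[mu2]_x f x = (`|c.1| * `|c.2|)%:E * \int[mu2]_x f (aff c e x))%E.
Proof.
move=> c10 c20 mf f0.
have c0 : 0 <= `|c.1| * `|c.2| by rewrite mulr_ge0.
have mphi := mbl_aff c e.
pose pm : {measure set PM -> \bar R} := pushforward mu2 (aff c e : PM -> PM).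
pose mm : {measure set PM -> \bar R} := mscale (NngNum c0) (pm mphi).
have E0 : (\int[mu2]_x f x = \int[mm]_x f x)%E.
  apply: eq_measure_integral => A mA _; exact: leb_aff.
have f0' : forall x, [set: PM] x -> (0 <= f x)%E by move=> x _; exact: f0.
have E1 := @ge0_integral_mscale _ _ R (pm mphi) _ measurableT (NngNum c0) f mf f0'.
have E2 := (@ge0_integral_pushforward _ _ _ _ R _ mphi mu2 _ f measurableT mf (fun x _ => f0 x)).
exact: (etrans E0 (etrans E1 (congr1 (fun z => ((`|c.1| * `|c.2|)%:E * z)%E) E2))).
Qed.

Lemma mul_lty (a : R) (z : \bar R) : 0 < a -> (0 <= z)%E -> (a%:E * z < +oo)%E -> (z < +oo)%E.
Proof. by move=> a0; case: z => [r _ _|_|//]; [rewrite ltry|rewrite gt0_muley]. Qed.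

Lemma fin_mulBr (a : R) (y z : \bar R) : y \is a fin_num -> z \is a fin_num ->
  (a%:E * y - a%:E * z = a%:E * (y - z))%E.
Proof. by case: y => // y _; case: z => // z _; apply: (congr1 EFin (_ : a * y - a * z = a * (y - z))); rewrite mulrBr. Qed.

Lemma itg_aff c e f : c.1 != 0 -> c.2 != 0 -> itg f -> itg (f \o aff c e).
Proof.
move=> c10 c20 fi; apply/integrableP; split.
  apply/measurable_EFinP; apply: measurableT_comp; last exact: mbl_aff.
  exact: itg_mbl.
have /integrableP[mf] := fi.
rewrite (ge0_aff e c10 c20) => //; last by apply: measurableT_comp.
have c0 : 0 < `|c.1| * `|c.2| by rewrite mulr_gt0// normr_gt0.
rewrite [X in (X < _)%E -> _](_ : _ = ((`|c.1| * `|c.2|)%:E * \int[mu2]_x `|(EFin \o (f \o aff c e)) x|)%E)//.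
have := @integral_ge0 _ _ _ mu2 setT (fun x => `|(EFin \o (f \o aff c e)) x|%E) (fun x _ => abse_ge0 _).
exact: mul_lty c0.
Qed.

Lemma I2_aff c e f : c.1 != 0 -> c.2 != 0 -> itg f ->
  I2 (f \o aff c e) = (`|c.1| * `|c.2|)^-1 * I2 f.
Proof.
move=> c10 c20 fi.
have c0 : 0 < `|c.1| * `|c.2| by rewrite mulr_gt0// normr_gt0.
have fci := itg_aff e c10 c20 fi.
rewrite /I2 /Rintegral.
have H : (\int[mu2]_x (EFin \o f) x = (`|c.1| * `|c.2|)%:E * \int[mu2]_x (EFin \o (f \o aff c e)) x)%E.
  have mf := (measurable_int _ fi).
  rewrite integralE [in RHS]integralE.
  rewrite (ge0_aff e c10 c20 (f := (EFin \o f)^\+%E))//; last exact: measurable_funepos.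
  rewrite (ge0_aff e c10 c20 (f := (EFin \o f)^\-%E))//; last exact: measurable_funeneg.
  have fp := integrable_pos_fin_num measurableT fci.
  have fn := integrable_neg_fin_num measurableT fci.
  have -> : (\int[mu2]_x (EFin \o f)^\+ (aff c e x) = \int[mu2]_x (EFin \o (f \o aff c e))^\+ x)%E.
    by apply: eq_integral => x _; rewrite !funeposE.
  have -> : (\int[mu2]_x (EFin \o f)^\- (aff c e x) = \int[mu2]_x (EFin \o (f \o aff c e))^\- x)%E.
    by apply: eq_integral => x _; rewrite !funenegE.
  exact: fin_mulBr fp fn.
rewrite [X in _ = _ * fine X]H fineM//; last exact: integrable_fin_num.
by rewrite /= mulKf// gt_eqF.
Qed.

Lemma norm_le_box (x : P) (B : R) : (`|x| <= B) = (`|x.1| <= B) && (`|x.2| <= B).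
Proof. by rewrite prod_normE ge_max. Qed.

Lemma box_itv (B : R) : [set x : P | `|x| <= B] = `[- B, B] `*` `[- B, B].
Proof.
apply/seteqP; split => x /=; rewrite norm_le_box !in_itv/= -!ler_norml.
  by move=> /andP.
by case=> -> ->.
Qed.

Lemma measurable_box (B : R) : measurable ([set x : P | `|x| <= B] : set PM).
Proof. by rewrite box_itv; apply: measurableX; exact: measurable_itv. Qed.

Lemma mu2_box (B : R) : 0 <= B -> mu2 [set x : P | `|x| <= B] = ((2 * B) ^+ 2)%:E.
Proof.
move=> B0; rewrite box_itv.
have := @product_measure1E _ _ _ _ R leb leb `[- B, B]%classic `[- B, B]%classic (measurable_itv _) (measurable_itv _).
move=> E; rewrite [LHS]E.
have F : leb `[- B, B]%classic = (2 * B)%:E.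
  rewrite lebesgue_measure_itv/= lte_fin -!EFinB.
  case: ltP => h; congr EFin; lra.
transitivity ((2 * B)%:E * (2 * B)%:E)%E; first by congr (_ * _)%E; exact: F.
by rewrite -EFinM; congr EFin; ring.
Qed.

(** [box 0] is the indicator of the origin: it serves later to absorb the default value that a
    singular kernel takes there. *)
Definition box (B : R) (x : P) : R := ((`|x| <= B)%R)%:R.

Lemma box_indic B : box B = \1_[set x : P | `|x| <= B].
Proof. by apply/funext => x; rewrite /box indicE mem_setE. Qed.

Lemma mbl_box B : mbl (box B).
Proof. by rewrite box_indic; apply: measurable_indic; exact: measurable_box. Qed.

Lemma itg_box B : itg (box B).
Proof.
have [B0|B0] := leP 0 B.
  apply/integrableP; split; first by apply/measurable_EFinP; exact: mbl_box.
  rewrite (_ : (\int[mu2]_x `|(EFin \o box B) x|)%E = (\int[mu2]_x (box B x)%:E)%E); last first.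
    by apply: eq_integral => t _; rewrite gee0_abs// lee_fin ler0n.
  rewrite box_indic integral_indic//; last exact: measurable_box.
  by rewrite setIT mu2_box// ltry.
apply: (eq_itg _ itg0) => x /=; rewrite /box.
by case: leP => // h; have := normr_ge0 x; lra.
Qed.

Lemma I2_box B : 0 <= B -> I2 (box B) = (2 * B) ^+ 2.
Proof.
move=> B0; rewrite /I2 box_indic /Rintegral integral_indic//; last exact: measurable_box.
by rewrite setIT mu2_box.
Qed.

Lemma box1 B x : `|x| <= B -> box B x = 1.
Proof. by rewrite /box => ->. Qed.

Lemma box0 B x : B < `|x| -> box B x = 0.
Proof. by rewrite /box ltNge; case: (_ <= _). Qed.

Lemma box_ge0 (B : R) x : 0 <= box B x.
Proof. by rewrite /box ler0n. Qed.

Lemma box_le1 (B : R) x : `|box B x| <= 1.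
Proof. by rewrite ger0_norm ?box_ge0// /box lern1 leq_b1. Qed.

Lemma itg_bnd f M B : mbl f -> (forall x, `|f x| <= M) -> (forall x, B < `|x| -> f x = 0) -> itg f.
Proof.
move=> mf fM f0; apply: (itg_le mf (itgZ M (itg_box B))) => x.
have [h|h] := leP `|x| B; first by rewrite box1// mulr1.
by rewrite box0// f0// mulr0 normr0.
Qed.

Lemma itgM f h M : itg f -> mbl h -> (forall x, `|h x| <= M) -> itg (fun x => f x * h x).
Proof.
move=> fi mh hM; apply: (itg_le _ (itgZ M (itg_norm fi))) => [|x].
  by apply: measurable_funM => //; exact: itg_mbl.
by rewrite normrM mulrC ler_wpM2r.
Qed.

Lemma sigma_finite_mu2 : sigma_finite [set: PM] mu2.
Proof.
exists (fun n => [set x : P | `|x| <= n%:R]).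
  apply/seteqP; split => // x _; exists (Num.bound `|x|) => //=.
  by rewrite ltW// archi_boundP.
move=> n; split; first exact: measurable_box.
by rewrite mu2_box// ltry.
Qed.

(** A copy of [mu2] that carries the sigma-finite structure, which Fubini on the product of two
    planes asks for. *)
Definition mu2s : set PM -> \bar R := (leb \x leb)%E.
HB.instance Definition _ := Measure.on mu2s.
HB.instance Definition _ := Measure_isSigmaFinite.Build _ _ _ mu2s sigma_finite_mu2.
Let smu2 : {sigma_finite_measure set PM -> \bar R} := mu2s.

Lemma Fubini_I2 (h : P * P -> R) :
  measurable_fun [set: (PM * PM)%type] (h : PM * PM -> R) ->
  (forall x, itg (fun y => h (x, y))) -> (forall y, itg (fun x => h (x, y))) ->
  itg (fun x => I2 (fun y => `|h (x, y)|)) ->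
  I2 (fun x => I2 (fun y => h (x, y))) = I2 (fun y => I2 (fun x => h (x, y))).
Proof.
move=> mh h1 h2 h3.
have mh' : measurable_fun [set: (PM * PM)%type] (EFin \o h) by exact/measurable_EFinP.
have hi : (smu2 \x smu2)%E.-integrable [set: (PM * PM)%type] (EFin \o h).
  apply: (proj2 (@integrable12ltyP _ _ PM PM R smu2 smu2 _ mh')).
  have /integrableP[_] := h3.
  apply: le_lt_trans.
  rewrite le_eqVlt; apply/orP; left; apply/eqP; apply: eq_integral => x _ /=.
  have /= H := itg_norm (h1 x).
  rewrite /I2 ger0_norm ?Rintegral_ge0// /Rintegral fineK//.
  exact: integrable_fin_num H.
have E := @Fubini _ _ PM PM R smu2 smu2 _ hi.
have fK (g : P -> R) : itg g -> (\int[mu2]_x (g x)%:E = (I2 g)%:E)%E.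
  by move=> gi; rewrite /I2 /Rintegral fineK//; exact: integrable_fin_num gi.
transitivity (fine (\int[mu2]_x \int[mu2]_y (h (x, y))%:E)%E).
  by congr fine; apply: eq_integral => x _; rewrite fK.
transitivity (fine (\int[mu2]_y \int[mu2]_x (h (x, y))%:E)%E).
  exact: (congr1 fine E).
by congr fine; apply: eq_integral => x _; rewrite fK.
Qed.

(** The partial integral of [|h|] is measurable by Tonelli and dominated by [g]; this supplies the
    integrability in [Fubini_I2]. *)
Lemma Fubini_bnd (h : P * P -> R) (g : P -> R) :
  measurable_fun [set: (PM * PM)%type] (h : PM * PM -> R) ->
  (forall x, itg (fun y => h (x, y))) -> (forall y, itg (fun x => h (x, y))) ->
  itg g -> (forall x, I2 (fun y => `|h (x, y)|) <= g x) ->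
  I2 (fun x => I2 (fun y => h (x, y))) = I2 (fun y => I2 (fun x => h (x, y))).
Proof.
move=> mh h1 h2 ig hg; apply: Fubini_I2 => //.
apply: (itg_le _ ig) => [|x]; last first.
  by rewrite ger0_norm ?hg// I2_ge0.
have mh' : measurable_fun [set: (PM * PM)%type] (fun z : PM * PM => `|h z|%:E).
  by apply/measurable_EFinP; apply: measurableT_comp.
have h0 (z : PM * PM) : (0 <= `|h z|%:E)%E by rewrite lee_fin.
have := @measurable_fun_fubini_tonelli_F _ _ PM PM R smu2 _ mh' h0.
by move=> mF; apply: (measurable_comp measurableT (@subsetT _ _) (fine_measurable measurableT) mF).
Qed.

Lemma mbl2_fst (f : P -> R) : mbl f -> measurable_fun [set: (PM * PM)%type] (fun z : PM * PM => f z.1).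
Proof. by move=> mf; apply: measurableT_comp => //; exact: measurable_fst. Qed.

Lemma mbl2_snd (f : P -> R) : mbl f -> measurable_fun [set: (PM * PM)%type] (fun z : PM * PM => f z.2).
Proof. by move=> mf; apply: measurableT_comp => //; exact: measurable_snd. Qed.

Lemma mbl2_lin (c : R) (a : P) (f : P -> R) : mbl f ->
  measurable_fun [set: (PM * PM)%type]
    (fun z : PM * PM => f (z.1.1 + c * z.2.1 + a.1, z.1.2 + c * z.2.2 + a.2)).
Proof.
move=> mf.
have m1 : measurable_fun [set: (PM * PM)%type] (fun z : PM * PM => z.1.1 : measurableTypeR R).
  by apply: measurableT_comp => //; exact: measurable_fst.
have m2 : measurable_fun [set: (PM * PM)%type] (fun z : PM * PM => z.1.2 : measurableTypeR R).
  by apply: (measurableT_comp measurable_snd); exact: measurable_fst.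
have m3 : measurable_fun [set: (PM * PM)%type] (fun z : PM * PM => z.2.1 : measurableTypeR R).
  by apply: (measurableT_comp measurable_fst); exact: measurable_snd.
have m4 : measurable_fun [set: (PM * PM)%type] (fun z : PM * PM => z.2.2 : measurableTypeR R).
  by apply: measurableT_comp => //; exact: measurable_snd.
have mg : measurable_fun [set: (PM * PM)%type]
    (fun z : PM * PM => (z.1.1 + c * z.2.1 + a.1, z.1.2 + c * z.2.2 + a.2) : PM).
  apply/measurable_fun_pairP; split => /=;
    by do 2 apply: measurable_funD => //; apply: measurable_funM.
exact: (measurableT_comp mf mg).
Qed.

(** * Strict differentiability *)

Definition dot (g v : P) : R := g.1 * v.1 + g.2 * v.2.

(* Strict differentiability: it survives the limits taken below, and it gives [C1] when it holds everywhere. *)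
Definition sdg (f : P -> R) (x0 g : P) := forall e : R, 0 < e -> exists2 r : R, 0 < r &
  forall x y, `|x - x0| < r -> `|y - x0| < r -> `|f x - f y - dot g (x - y)| <= e * `|x - y|.

Definition sd f x0 := exists g, sdg f x0 g.

Definition sd1 (f : R -> R) (t0 c : R) := forall e : R, 0 < e -> exists2 r : R, 0 < r &
  forall s t, `|s - t0| < r -> `|t - t0| < r -> `|f s - f t - c * (s - t)| <= e * `|s - t|.

Lemma norm1 (x : P) : `|x.1| <= `|x|. Proof. by rewrite prod_normE le_max lexx. Qed.
Lemma norm2 (x : P) : `|x.2| <= `|x|. Proof. by rewrite prod_normE le_max lexx orbT. Qed.

Lemma norm_leP (x : P) (b : R) : `|x.1| <= b -> `|x.2| <= b -> `|x| <= b.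
Proof. by rewrite prod_normE ge_max => -> ->. Qed.

Lemma ler_dot g v : `|dot g v| <= (`|g.1| + `|g.2|) * `|v|.
Proof.
rewrite (le_trans (ler_normD _ _))// !normrM mulrDl lerD// ler_wpM2l//;
  [exact: norm1|exact: norm2].
Qed.

Lemma dotDl g g' v : dot (g + g') v = dot g v + dot g' v.
Proof. by rewrite /dot /=; ring. Qed.
Lemma dotBl g g' v : dot (g - g') v = dot g v - dot g' v.
Proof. by rewrite /dot /=; ring. Qed.
Lemma dotZl (c : R) g v : dot (c * g.1, c * g.2) v = c * dot g v.
Proof. by rewrite /dot /=; ring. Qed.
Lemma dotDr g v v' : dot g (v + v') = dot g v + dot g v'.
Proof. by rewrite /dot /=; ring. Qed.
Lemma dotBr g v v' : dot g (v - v') = dot g v - dot g v'.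
Proof. by rewrite /dot /=; ring. Qed.

Lemma dotZr g (t : R) (v : P) : dot g (t *: v) = t * dot g v.
Proof.
by change (g.1 * (t * v.1) + g.2 * (t * v.2) = t * (g.1 * v.1 + g.2 * v.2)); ring.
Qed.

Lemma sdgD f1 f2 x0 g1 g2 : sdg f1 x0 g1 -> sdg f2 x0 g2 -> sdg (fun x => f1 x + f2 x) x0 (g1 + g2).
Proof.
move=> h1 h2 e e0; have e2 : 0 < e / 2 by lra.
have [r1 r10 H1] := h1 _ e2; have [r2 r20 H2] := h2 _ e2.
exists (Num.min r1 r2); first by rewrite lt_min r10.
move=> x y; rewrite !lt_min => /andP[x1 x2] /andP[y1 y2].
have K1 := H1 _ _ x1 y1; have K2 := H2 _ _ x2 y2.
rewrite dotDl.
have -> : f1 x + f2 x - (f1 y + f2 y) - (dot g1 (x - y) + dot g2 (x - y)) =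
  (f1 x - f1 y - dot g1 (x - y)) + (f2 x - f2 y - dot g2 (x - y)) by ring.
rewrite (le_trans (ler_normD _ _))//; lra.
Qed.

Lemma sdgZ f x0 g c : sdg f x0 g -> sdg (fun x => c * f x) x0 (c * g.1, c * g.2).
Proof.
move=> h e e0; have c1 : 0 < `|c| + 1 by have := normr_ge0 c; lra.
have [r r0 H] := h _ (divr_gt0 e0 c1).
exists r => // x y xr yr; rewrite dotZl -!mulrBr normrM.
have K := H x y xr yr.
rewrite (le_trans (ler_wpM2l (normr_ge0 c) K))//.
rewrite mulrA ler_wpM2r// mulrCA ger_pMr// ler_pdivrMr// mul1r; lra.
Qed.

Lemma sdg_dot f x0 g : (forall x y, f x - f y = dot g (x - y)) -> sdg f x0 g.
Proof.
move=> h e e0; exists 1 => // x y _ _.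
by rewrite h subrr normr0 mulr_ge0// ltW.
Qed.

Lemma sdg_local f f' x0 g (r : R) : 0 < r -> (forall x, `|x - x0| < r -> f' x = f x) ->
  sdg f x0 g -> sdg f' x0 g.
Proof.
move=> r0 ff' h e /h[r1 r10 H].
exists (Num.min r r1); first by rewrite lt_min r0.
move=> x y; rewrite !lt_min => /andP[x1 x2] /andP[y1 y2].
by rewrite !ff'//; exact: H.
Qed.

Lemma sdg_lip f x0 g : sdg f x0 g -> exists2 r : R, 0 < r &
  forall x y, `|x - x0| < r -> `|y - x0| < r -> `|f x - f y| <= (`|g.1| + `|g.2| + 1) * `|x - y|.
Proof.
move=> /(_ 1 ltr01)[r r0 H]; exists r => // x y xr yr.
have K := H x y xr yr.
rewrite -(subrK (dot g (x - y)) (f x - f y)) (le_trans (ler_normD _ _))//.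
have := ler_dot g (x - y); lra.
Qed.

Lemma sdg_comp1 (phi : R -> R) f x0 g c : sdg f x0 g -> sd1 phi (f x0) c ->
  sdg (phi \o f) x0 (c * g.1, c * g.2).
Proof.
move=> h hp e e0.
have [rl rl0 L] := sdg_lip h.
set K : R := `|g.1| + `|g.2| + 1 in L.
have K0 : 0 < K by rewrite /K; have := normr_ge0 g.1; have := normr_ge0 g.2; lra.
have [r1 r10 H1] := hp _ (divr_gt0 (divr_gt0 e0 (ltr0n _ 2)) K0).
have c1 : 0 < `|c| + 1 by have := normr_ge0 c; lra.
have [r2 r20 H2] := h _ (divr_gt0 (divr_gt0 e0 (ltr0n _ 2)) c1).
exists (Num.min (Num.min rl r2) (r1 / K)); first by rewrite !lt_min rl0 r20 divr_gt0.
move=> x y; rewrite !lt_min !ltr_pdivlMr// => /andP[/andP[x1 x2] x3] /andP[/andP[y1 y2] y3].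
have fx z : `|z - x0| < rl -> `|z - x0| * K < r1 -> `|f z - f x0| < r1.
  move=> z1 z2; apply: le_lt_trans z2; rewrite mulrC; apply: L => //.
  by rewrite subrr normr0.
have k1 := H1 _ _ (fx _ x1 x3) (fx _ y1 y3).
have k2 := H2 _ _ x2 y2.
have k3 := L _ _ x1 y1.
rewrite dotZl /=.
have -> : phi (f x) - phi (f y) - c * dot g (x - y) =
  (phi (f x) - phi (f y) - c * (f x - f y)) + c * (f x - f y - dot g (x - y)) by ring.
rewrite (le_trans (ler_normD _ _))// normrM.
have -> : e * `|x - y| = e / 2 / K * (K * `|x - y|) + (`|c| + 1) * (e / 2 / (`|c| + 1) * `|x - y|).
  by field; rewrite !gt_eqF.
apply: lerD.
  by rewrite (le_trans k1)// ler_wpM2l// !divr_ge0// ltW.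
by apply: ler_pM => //; lra.
Qed.

Lemma sdg_aff f x0 g c e : sdg f (aff c e x0) g -> sdg (f \o aff c e) x0 (g.1 * c.1, g.2 * c.2).
Proof.
move=> h.
pose C : R := `|c.1| + `|c.2| + 1.
have C0 : 0 < C by rewrite /C; have := normr_ge0 c.1; have := normr_ge0 c.2; lra.
have affC x y : `|aff c e x - aff c e y| <= C * `|x - y|.
  apply: norm_leP => /=.
    rewrite opprD addrACA subrr addr0 -mulrBr normrM ler_pM//.
      by rewrite /C; have := normr_ge0 c.2; lra.
    exact: (norm1 (x - y)).
  rewrite opprD addrACA subrr addr0 -mulrBr normrM ler_pM//.
    by rewrite /C; have := normr_ge0 c.1; lra.
  exact: (norm2 (x - y)).
move=> ep ep0; have [r r0 H] := h _ (divr_gt0 ep0 C0).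
exists (r / C); first by rewrite divr_gt0.
move=> x y; rewrite !ltr_pdivlMr// => x1 y1.
have fx z : `|z - x0| * C < r -> `|aff c e z - aff c e x0| < r.
  by apply: le_lt_trans; rewrite mulrC.
have := H _ _ (fx _ x1) (fx _ y1).
have -> : dot g (aff c e x - aff c e y) = dot (g.1 * c.1, g.2 * c.2) (x - y).
  by rewrite /dot /=; ring.
move=> K; rewrite /= (le_trans K)//.
have eC : 0 <= ep / C by rewrite divr_ge0// ltW.
by rewrite (le_trans (ler_wpM2l eC (affC x y)))// mulrA divfK// gt_eqF.
Qed.

Lemma sandwich (a b : nat -> R) : (forall n m, a n <= b m) -> exists l, forall n, a n <= l <= b n.
Proof.
move=> ab; exists (sup (range a)) => n.
have hs : has_sup (range a).
  split; first by exists (a 0%N), 0%N.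
  by exists (b 0%N) => _ [k _ <-].
apply/andP; split; first by apply: sup_ubound; [exact: hs.2|exists n].
by apply: ge_sup; [exact: hs.1|move=> _ [k _ <-]].
Qed.

(** The explicit rate says that every [u n - C / n.+1] lies below every [u m + C / m.+1], so a
    supremum separates the two families and the limit inherits the rate. *)
Lemma cauchy_lim (u : nat -> R) (C : R) :
  (forall n m, `|u n - u m| <= C / n.+1%:R + C / m.+1%:R) ->
  exists l, forall n, `|u n - l| <= C / n.+1%:R.
Proof.
move=> h.
have ab (n m : nat) : u n - C / n.+1%:R <= u m + C / m.+1%:R.
  have := h n m; move: (C / _) (C / _) => a b.
  by rewrite ler_norml => /andP[h1 h2]; lra.
have [l hl] := sandwich ab.
exists l => n; have := hl n; move: (C / _) => a /andP[h1 h2].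
by rewrite ler_norml; apply/andP; split; lra.
Qed.

(** The gradients of approximants with error [1 / n.+1] form a Cauchy sequence, since two of them
    are compared through one and the same difference quotient of [f]. Their limit is the gradient of
    [f]. *)
Lemma sd_lim (f : P -> R) x0 :
  (forall e : R, 0 < e -> exists h, sd h x0 /\ exists2 r : R, 0 < r & forall x y,
     `|x - x0| < r -> `|y - x0| < r -> `|(f x - h x) - (f y - h y)| <= e * `|x - y|) ->
  sd f x0.
Proof.
move=> H.
have n0 (n : nat) : 0 < n.+1%:R^-1 :> R by rewrite invr_gt0.
have [h hP] := choice (fun n : nat => H _ (n0 n)).
have [g gP] := choice (fun n => (hP n).1).
have key (n : nat) (e : R) : 0 < e -> exists2 r : R, 0 < r & forall x y, `|x - x0| < r -> `|y - x0| < r ->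
    `|f x - f y - dot (g n) (x - y)| <= (n.+1%:R^-1 + e) * `|x - y|.
  move=> e0; have [r1 r10 H1] := (hP n).2; have [r2 r20 H2] := gP n _ e0.
  exists (Num.min r1 r2); first by rewrite lt_min r10.
  move=> x y; rewrite !lt_min => /andP[x1 x2] /andP[y1 y2].
  have -> : f x - f y - dot (g n) (x - y) =
    (f x - h n x - (f y - h n y)) + (h n x - h n y - dot (g n) (x - y)) by ring.
  rewrite (le_trans (ler_normD _ _))// mulrDl lerD//; [exact: H1|exact: H2].
have gd (n m : nat) (v : P) : `|v| = 1 -> `|dot (g n) v - dot (g m) v| <= 1 / n.+1%:R + 1 / m.+1%:R.
  move=> v1; apply/ler_addgt0Pr => e e0.
  have e2 : 0 < e / 2 by rewrite divr_gt0.
  have [r1 r10 H1] := key n _ e2; have [r2 r20 H2] := key m _ e2.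
  pose r : R := Num.min r1 r2 / 2.
  have r0 : 0 < r by rewrite divr_gt0// lt_min r10.
  have rr : r < Num.min r1 r2.
    by rewrite /r ltr_pdivrMr// ltr_pMr ?lt_min ?r10//; lra.
  pose x : P := (x0.1 + r * v.1, x0.2 + r * v.2).
  have xx0 : x - x0 = (r * v.1, r * v.2) by rewrite /x; congr pair => /=; ring.
  have nx : `|x - x0| = r.
    have -> : x - x0 = r *: v by rewrite xx0.
    by rewrite normrZ v1 mulr1 gtr0_norm.
  move: rr; rewrite lt_min => /andP[rr1 rr2].
  have K1 := H1 x x0; have K2 := H2 x x0.
  rewrite nx subrr normr0 in K1 K2.
  have {}K1 := K1 rr1 r10; have {}K2 := K2 rr2 r20.
  have dr (w : P) : dot w (x - x0) = r * dot w v by rewrite xx0 /dot /=; ring.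
  rewrite dr in K1; rewrite dr in K2.
  rewrite -(ler_pM2l r0) -{1}(gtr0_norm r0) -normrM mulrBr.
  have -> : r * dot (g n) v - r * dot (g m) v =
    (f x - f x0 - r * dot (g m) v) - (f x - f x0 - r * dot (g n) v) by ring.
  rewrite (le_trans (ler_normB _ _))// !div1r.
  move: K1 K2; move: (n.+1%:R^-1) (m.+1%:R^-1) => a b K1 K2; lra.
have [l1 l1P] := @cauchy_lim (fun n => (g n).1) 1 ltac:(
  move=> n m; have := gd n m (1, 0); rewrite /dot /= !mulr1 !mulr0 !addr0; apply;
  by rewrite prod_normE/= normr1 normr0 max_l).
have [l2 l2P] := @cauchy_lim (fun n => (g n).2) 1 ltac:(
  move=> n m; have := gd n m (0, 1); rewrite /dot /= !mulr1 !mulr0 !add0r; apply;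
  by rewrite prod_normE/= normr1 normr0 max_r).
exists (l1, l2) => e e0.
have e4 : 0 < e / 4 by rewrite divr_gt0.
have [n nP] : exists n : nat, n.+1%:R^-1 < e / 4.
  exists (Num.bound (e / 4)^-1); rewrite invf_plt ?posrE//.
  have := archi_boundP (ltW (_ : 0 < (e / 4)^-1)); rewrite invr_gt0 => /(_ e4).
  by move=> /lt_trans; apply; rewrite ltr_nat.
have [r r0 Hr] := key n _ e4; exists r => // x y xr yr.
have K := Hr x y xr yr.
have -> : f x - f y - dot (l1, l2) (x - y) =
  (f x - f y - dot (g n) (x - y)) + dot (g n - (l1, l2)) (x - y).
  by rewrite dotBl; ring.
rewrite (le_trans (ler_normD _ _))//.
have D := ler_dot (g n - (l1, l2)) (x - y).
have k1 := l1P n; have k2 := l2P n; rewrite /= !div1r in D k1 k2.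
rewrite (le_trans (lerD K D))// -mulrDl ler_wpM2r//=.
by move: nP k1 k2; move: (n.+1%:R^-1) => a nP k1 k2; lra.
Qed.

Lemma sdg_differentiable (f : P -> R) x0 g : sdg f x0 g ->
  differentiable f x0 /\ forall v, 'D_v f x0 = dot g v.
Proof.
move=> h.
have dlin : linear (dot g : P -> R^o).
  by move=> a u v; rewrite dotDr dotZr.
pose dM := GRing.isLinear.Build _ _ _ _ _ dlin.
pose dL : {linear P -> R^o} := HB.pack (dot g : P -> R^o) dM.
have dc : continuous dL.
  move=> x; apply: cvgD; apply: cvgM; (try exact: cvg_cst); [exact: cvg_fst|exact: cvg_snd].
have E : (f : P -> R^o) \o shift x0 = cst (f x0) + dL +o_ (0 : P) id.
  apply/eqaddoP => _/posnumP[e].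
  have [r r0 H] := h e%:num [gt0 of e%:num].
  have N : \forall y \near (0 : P), `|y| < r := nbhs0_lt r0.
  apply: filterS N => y yr.
  have := H (y + x0) x0; rewrite subrr normr0 addrK => /(_ yr r0).
  change (`|f (y + x0) - f x0 - dot g y| <= e%:num * `|y| -> `|f (y + x0) - (f x0 + dot g y)| <= e%:num * `|y|).
  by move=> K; have -> : f (y + x0) - (f x0 + dot g y) = f (y + x0) - f x0 - dot g y by ring.
have D := diff_unique dc E.
have df : differentiable (f : P -> R^o) x0.
  by apply/diff_locallyP; rewrite D; split.
by split => // v; rewrite deriveE// D.
Qed.

(** For [y] near [x], a small increment [t *: v] at [y] fits both in the neighbourhood of strict
    differentiability at [x] and in the one at [y]. Comparing the two expansions bounds the
    difference of the gradients. *)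
Lemma sd_C1 (f : P -> R) : (forall x, sd f x) -> C1 f.
Proof.
move=> /choice[g gP].
have E1 : d1 f = fun x => (g x).1.
  by apply/funext => x; rewrite /d1 (sdg_differentiable (gP x)).2 /dot/= mulr1 mulr0 addr0.
have E2 : d2 f = fun x => (g x).2.
  by apply/funext => x; rewrite /d2 (sdg_differentiable (gP x)).2 /dot/= mulr1 mulr0 add0r.
have gc (v x : P) (e : R) : 0 < e -> `|v| = 1 -> exists2 r : R, 0 < r & forall y, `|y - x| < r ->
    `|dot (g x) v - dot (g y) v| <= e.
  move=> e0 v1; have e2 : 0 < e / 2 by rewrite divr_gt0.
  have [r r0 H] := gP x _ e2; exists r => // y yr.
  have [r' r'0 H'] := gP y _ e2.
  pose t : R := Num.min r' (r - `|y - x|) / 2.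
  have m0 : 0 < Num.min r' (r - `|y - x|) by rewrite lt_min r'0 subr_gt0.
  have t0 : 0 < t by rewrite divr_gt0.
  have : t < Num.min r' (r - `|y - x|) by rewrite /t ltr_pdivrMr// ltr_pMr//; lra.
  rewrite lt_min => /andP[t1 t2].
  have nv : `|y + t *: v - y| = t by rewrite addrAC subrr add0r normrZ v1 mulr1 gtr0_norm.
  have K1 := H (y + t *: v) y; have K2 := H' (y + t *: v) y.
  have yt : `|y + t *: v - x| < r.
    rewrite addrAC (le_lt_trans (ler_normD _ _))// normrZ v1 mulr1 gtr0_norm//; lra.
  have {}K1 := K1 yt yr.
  rewrite nv subrr normr0 in K2; have {}K2 := K2 t1 r'0; rewrite nv in K1.
  have dt (w : P) : dot w (y + t *: v - y) = t * dot w v.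
    by rewrite addrAC subrr add0r dotZr.
  rewrite dt in K1; rewrite dt in K2.
  rewrite -(ler_pM2l t0) -{1}(gtr0_norm t0) -normrM mulrBr.
  have -> : t * dot (g x) v - t * dot (g y) v =
    (f (y + t *: v) - f y - t * dot (g y) v) - (f (y + t *: v) - f y - t * dot (g x) v) by ring.
  rewrite (le_trans (ler_normB _ _))//; lra.
split; first by move=> x; exact: (sdg_differentiable (gP x)).1.
  move=> x; rewrite E1; apply/cvgrPdist_le => e e0.
  have [|r r0 H] := gc (1, 0) x e e0; first by rewrite prod_normE/= normr1 normr0 max_l.
  near=> y; have := H y; rewrite /dot /= !mulr1 !mulr0 !addr0; apply.
  by rewrite distrC; near: y; exact: cvgr_dist_lt.
move=> x; rewrite E2; apply/cvgrPdist_le => e e0.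
have [|r r0 H] := gc (0, 1) x e e0; first by rewrite prod_normE/= normr1 normr0 max_r.
near=> y; have := H y; rewrite /dot /= !mulr1 !mulr0 !add0r; apply.
by rewrite distrC; near: y; exact: cvgr_dist_lt.
Unshelve. all: by end_near. Qed.

(** * The profile nonlinearity *)

Definition posp (t : R) : R := Num.max t 0.
(* On the positive half-line [ff] inverts [v |-> sqrt v + v], whose primitive is [FF]; so [ff] is of class C1 and [FF v - v t] is minimal at [v = ff t]. *)
Definition gg (t : R) : R := (Num.sqrt (1 + 4 * posp t) - 1) / 2.
Definition ff (t : R) : R := gg t ^+ 2.
Definition FF (v : R) : R := 2 / 3 * (v * Num.sqrt v) + v ^+ 2 / 2.

Lemma gg_spec t : 0 <= gg t /\ gg t + gg t ^+ 2 = posp t.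
Proof.
have p0 : 0 <= posp t by rewrite /posp le_max lexx orbT.
have h : 0 <= 1 + 4 * posp t by lra.
have s2 := sqr_sqrtr h.
rewrite /gg; move: s2 (sqrtr_ge0 (1 + 4 * posp t)); move: (Num.sqrt _) => x x2 x0.
split; last first.
  have -> : (x - 1) / 2 + ((x - 1) / 2) ^+ 2 = (x ^+ 2 - 1) / 4 by field.
  by rewrite x2; lra.
suff : 1 <= x by lra.
rewrite -(ler_pXn2r (ltn0Sn 1)) ?nnegrE// expr1n x2; lra.
Qed.

Lemma gg_ge0 t : 0 <= gg t. Proof. by have [] := gg_spec t. Qed.
Lemma ff_ge0 t : 0 <= ff t. Proof. exact: sqr_ge0. Qed.

Lemma gg_neg t : t <= 0 -> gg t = 0.
Proof. by move=> t0; rewrite /gg /posp max_r// mulr0 addr0 sqrtr1 subrr mul0r. Qed.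

Lemma ff_neg t : t <= 0 -> ff t = 0.
Proof. by move=> t0; rewrite /ff gg_neg// expr0n. Qed.

Lemma gg_pos t : 0 <= t -> gg t + gg t ^+ 2 = t.
Proof. by move=> t0; rewrite (gg_spec t).2 /posp max_l. Qed.

Lemma ff_eq0 t : ff t = 0 -> t <= 0.
Proof.
move/eqP; rewrite sqrf_eq0 => /eqP g0; have := (gg_spec t).2.
rewrite g0 expr0n addr0 /posp => /esym h.
by rewrite -h le_max lexx.
Qed.

Lemma ff_le t : ff t <= posp t.
Proof. by have [h1 h2] := gg_spec t; rewrite /ff -h2; lra. Qed.

Lemma ff_ge1 t : 2 <= t -> 1 <= ff t.
Proof.
move=> t2; have h := @gg_pos t; have g0 := gg_ge0 t.
have {}h : gg t + gg t ^+ 2 = t by apply: h; lra.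
have : 1 <= gg t by rewrite leNgt; apply/negP => g1; nra.
by rewrite /ff => g1; nra.
Qed.

Lemma sqrt_ff t : Num.sqrt (ff t) = gg t.
Proof. by rewrite /ff sqrtr_sqr ger0_norm// gg_ge0. Qed.

(** The second derivative of [FF] is at least 1. With [u = h ^ 2] and [v = g ^ 2] the defect is the
    nonnegative polynomial [(g - h) ^ 2 * (2 * g + h) / 3]. *)
Lemma FF_sub u v : 0 <= u -> 0 <= v ->
  FF u + (Num.sqrt u + u) * (v - u) + (v - u) ^+ 2 / 2 <= FF v.
Proof.
move=> u0 v0; rewrite /FF.
have sq (x : R) : 0 <= x -> exists2 h : R, 0 <= h & x = h ^+ 2.
  by move=> x0; exists (Num.sqrt x); rewrite ?sqrtr_ge0// sqr_sqrtr.
have [h h0 ->] := sq u u0; have [g g0 ->] := sq v v0.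
rewrite !sqrtr_sqr (ger0_norm h0) (ger0_norm g0).
rewrite -subr_ge0.
have -> : 2 / 3 * (g ^+ 2 * g) + (g ^+ 2) ^+ 2 / 2 - (2 / 3 * (h ^+ 2 * h) + (h ^+ 2) ^+ 2 / 2 +
  (h + h ^+ 2) * (g ^+ 2 - h ^+ 2) + (g ^+ 2 - h ^+ 2) ^+ 2 / 2) = 3^-1 * (g - h) ^+ 2 * (2 * g + h) by field.
by apply: mulr_ge0; [rewrite mulr_ge0 ?sqr_ge0|]; lra.
Qed.

(** Young's inequality for [FF] with a quadratic defect. The defect is what later forces a maximizer
    to coincide with the right-hand side of its Euler-Lagrange equation. *)
Lemma FF_gap t v : 0 <= v -> FF (ff t) - ff t * t + (v - ff t) ^+ 2 / 2 <= FF v - v * t.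
Proof.
move=> v0; have H := FF_sub (ff_ge0 t) v0.
rewrite sqrt_ff in H.
have [t0|t0] := leP 0 t.
  by have := gg_pos t0; rewrite -/(ff t) => E; rewrite E in H; lra.
rewrite (ff_neg (ltW t0)) (gg_neg (ltW t0)) in H *; nra.
Qed.

(** In [EL_exists] this turns a lower bound of the energy into a lower bound of the Lagrange
    multiplier. *)
Lemma FF_half t : t * ff t / 2 <= FF (ff t).
Proof.
rewrite /FF sqrt_ff; have g0 := gg_ge0 t.
have [t0|t0] := leP 0 t.
  rewrite -{1}(gg_pos t0) /ff -subr_ge0.
  have -> : 2 / 3 * (gg t ^+ 2 * gg t) + (gg t ^+ 2) ^+ 2 / 2 - (gg t + gg t ^+ 2) * gg t ^+ 2 / 2 =
    6^-1 * gg t ^+ 3 by field.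
  by rewrite mulr_ge0// exprn_ge0.
by rewrite (ff_neg (ltW t0)); lra.
Qed.

Lemma FF_ge0 v : 0 <= v -> 0 <= FF v.
Proof. by move=> v0; rewrite /FF addr_ge0 ?mulr_ge0 ?sqrtr_ge0 ?sqr_ge0//; lra. Qed.

Lemma FF_le v M : 0 <= v <= M -> FF v <= (Num.sqrt M + M) * v.
Proof.
move=> /andP[v0 vM]; rewrite /FF.
have : Num.sqrt v <= Num.sqrt M by rewrite ler_sqrt// (le_trans v0).
have := sqrtr_ge0 v; move: (Num.sqrt v) (Num.sqrt M) => a b; nra.
Qed.

Lemma FF_lip M u v : 0 <= u <= M -> 0 <= v <= M -> `|FF u - FF v| <= (Num.sqrt M + M) * `|u - v|.
Proof.
move=> hu hv.
have key x y : 0 <= x <= M -> 0 <= y <= M -> FF x - FF y <= (Num.sqrt M + M) * `|x - y|.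
  move=> /andP[x0 xM] /andP[y0 yM]; have H := FF_sub x0 y0.
  have : Num.sqrt x <= Num.sqrt M by rewrite ler_sqrt// (le_trans x0).
  have := sqrtr_ge0 x; have := sqr_ge0 (y - x); have := ler_norm (x - y); have := normr_ge0 (x - y).
  move: H; move: (Num.sqrt x) (Num.sqrt M) (`|x - y|) => a b c H h1 h2 h3 h4 h5; nra.
by rewrite ler_norml; apply/andP; split; [have := key v u hv hu; rewrite distrC|have := key u v hu hv]; lra.
Qed.

(** Convexity, from the two tangent inequalities at the intermediate point, weighted by [1 - tau]
    and [tau]. *)
Lemma FF_conv u v (tau : R) : 0 <= u -> 0 <= v -> 0 <= tau <= 1 ->
  FF (u + tau * (v - u)) <= FF u + tau * (FF v - FF u).
Proof.
move=> u0 v0 /andP[t0 t1]; set x : R := u + _.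
have x0 : 0 <= x by rewrite /x; nra.
have H1 := FF_sub x0 u0; have H2 := FF_sub x0 v0.
have := sqr_ge0 (u - x); have := sqr_ge0 (v - x).
have E1 : u - x = - (tau * (v - u)) by rewrite /x; ring.
have E2 : v - x = (1 - tau) * (v - u) by rewrite /x; ring.
rewrite E1 E2 in H1 H2 *; move: (Num.sqrt x + x) H1 H2 => c H1 H2 h1 h2.
have K1 : FF x <= FF u + c * (tau * (v - u)) by lra.
have K2 : FF x <= FF v - c * ((1 - tau) * (v - u)) by lra.
have := ler_wpM2l t0 K2; have : 0 <= 1 - tau by lra.
by move=> /ler_wpM2l /(_ _ _ K1); lra.
Qed.

Lemma gg_lip t t' : `|gg t - gg t'| <= `|t - t'|.
Proof.
have key x y : x <= y -> 0 <= gg y - gg x <= y - x.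
  move=> xy; have [hx0 hx] := gg_spec x; have [hy0 hy] := gg_spec y.
  have : 0 <= posp y - posp x <= y - x.
    by rewrite /posp; case: (leP y 0); case: (leP x 0) => ? ?; apply/andP; split; lra.
  move=> /andP[p1 p2].
  have : 0 <= gg y - gg x by rewrite leNgt; apply/negP => ?; nra.
  by move=> h; apply/andP; split => //; nra.
have [/key|/ltW/key] := leP t t' => /andP[h1 h2].
  by rewrite distrC ger0_norm// distrC ger0_norm//; lra.
by rewrite ger0_norm// ger0_norm//; lra.
Qed.

Lemma ff_lip t t' : `|ff t - ff t'| <= `|t - t'|.
Proof.
have key x y : x <= y -> 0 <= ff y - ff x <= y - x.
  move=> xy; have [hx0 hx] := gg_spec x; have [hy0 hy] := gg_spec y.
  have : 0 <= posp y - posp x <= y - x.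
    by rewrite /posp; case: (leP y 0); case: (leP x 0) => ? ?; apply/andP; split; lra.
  move=> /andP[p1 p2]; rewrite /ff.
  have : 0 <= gg y - gg x by rewrite leNgt; apply/negP => ?; nra.
  by move=> h; apply/andP; split; nra.
have [/key|/ltW/key] := leP t t' => /andP[h1 h2].
  by rewrite distrC ger0_norm// distrC ger0_norm//; lra.
by rewrite ger0_norm// ger0_norm//; lra.
Qed.

(** The derivative of [ff], from [gg' = 1 / (1 + 2 * gg)] on the positive half-line. It tends to 0
    at 0, which makes [ff], and hence the vorticity, C1 across the edge of the support. *)
Definition df (t : R) : R := 2 * gg t / (1 + 2 * gg t).

(** For positive arguments the remainder is exactly [(gg t' - gg t) ^ 2 / (1 + 2 * gg t)]; in the
    other cases one of the values of [ff] is 0 and the bound [gg <= t] on the positive side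
    suffices. *)
Lemma ff_quad t t' : `|ff t' - ff t - df t * (t' - t)| <= 2 * (t' - t) ^+ 2.
Proof.
have g0 := gg_ge0 t; have g0' := gg_ge0 t'.
have [t0|t0] := leP t 0.
  rewrite /df gg_neg// !mulr0 mul0r mul0r subr0 (ff_neg t0) subr0 ger0_norm ?ff_ge0//.
  have [t'0|t'0] := leP t' 0; first by rewrite ff_neg// mulr_ge0// sqr_ge0.
  have := gg_pos (ltW t'0); rewrite /ff => h.
  have : gg t' <= t' by have := sqr_ge0 (gg t'); lra.
  by move=> h1; nra.
have h := gg_pos (ltW t0).
have d0 : 0 < 1 + 2 * gg t by lra.
have [t'0|t'0] := leP t' 0.
  rewrite (ff_neg t'0).
  have df0 : 0 <= df t by rewrite divr_ge0//; lra.
  have df1 : df t <= 2 * gg t by rewrite ler_pdivrMr//; nra.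
  have gt : gg t <= t by have := sqr_ge0 (gg t); lra.
  have k1 : 0 <= df t * (t - t') <= 2 * (t - t') ^+ 2 by apply/andP; split; nra.
  have k2 : 0 <= ff t <= (t - t') ^+ 2 by rewrite /ff; apply/andP; split; nra.
  move/andP: k1 => [k1 k1']; move/andP: k2 => [k2 k2'].
  have -> : 0 - ff t - df t * (t' - t) = df t * (t - t') - ff t by ring.
  have -> : (t' - t) ^+ 2 = (t - t') ^+ 2 by ring.
  by rewrite ler_norml; apply/andP; split; lra.
have h' := gg_pos (ltW t'0).
have -> : ff t' - ff t - df t * (t' - t) = (gg t' - gg t) ^+ 2 / (1 + 2 * gg t).
  have -> : t' - t = (gg t' - gg t) * (1 + gg t' + gg t) by rewrite -[in LHS]h' -[in LHS]h; ring.
  by rewrite /df /ff; field; exact: lt0r_neq0.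
have d0' := ltW d0; rewrite ger0_norm ?divr_ge0 ?sqr_ge0// ler_pdivrMr//.
have : (gg t' - gg t) ^+ 2 <= (t' - t) ^+ 2.
  by rewrite -(real_normK (num_real (gg t' - gg t))) -(real_normK (num_real (t' - t))) ler_sqr ?nnegrE// gg_lip.
by have := sqr_ge0 (t' - t); nra.
Qed.

Lemma df_lip t t' : `|df t - df t'| <= 2 * `|t - t'|.
Proof.
have g0 := gg_ge0 t; have g0' := gg_ge0 t'.
have -> : df t - df t' = 2 * (gg t - gg t') / ((1 + 2 * gg t) * (1 + 2 * gg t')).
  by rewrite /df; field; rewrite !lt0r_neq0//; lra.
have d1 : 1 <= (1 + 2 * gg t) * (1 + 2 * gg t') by nra.
rewrite normrM normfV normrM (ger0_norm (_ : 0 <= 2))// (ger0_norm (le_trans _ d1))//.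
rewrite ler_pdivrMr ?(lt_le_trans _ d1)//.
by have := gg_lip t t'; have := normr_ge0 (t - t'); nra.
Qed.

Lemma sd1_quad (f df : R -> R) (C t0 r : R) : 0 < r ->
  (forall s t, `|s - t0| < r -> `|t - t0| < r -> `|f s - f t - df t * (s - t)| <= C * (s - t) ^+ 2) ->
  (forall t, `|t - t0| < r -> `|df t - df t0| <= C * `|t - t0|) ->
  sd1 f t0 (df t0).
Proof.
move=> r0 h1 h2 e e0.
have C0 : 0 < `|C| + 1 by have := normr_ge0 C; lra.
have CC : C <= `|C| + 1 by have := ler_norm C; lra.
exists (Num.min r (e / (4 * (`|C| + 1)))).
  by rewrite lt_min r0 divr_gt0// mulr_gt0.
move=> s t; rewrite !lt_min !ltr_pdivlMr ?mulr_gt0// => /andP[s1 s2] /andP[t1 t2].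
have -> : f s - f t - df t0 * (s - t) = (f s - f t - df t * (s - t)) + (df t - df t0) * (s - t) by ring.
rewrite (le_trans (ler_normD _ _))// normrM.
have H1 := h1 s t s1 t1; have H2 := h2 t t1.
have st : `|s - t| <= `|s - t0| + `|t - t0|.
  by rewrite (_ : s - t = (s - t0) - (t - t0)) ?ler_normB//; ring.
have E : (s - t) ^+ 2 = `|s - t| * `|s - t| by rewrite -normrM -expr2 ger0_norm ?sqr_ge0.
rewrite E in H1.
have n0 := normr_ge0 (s - t).
have K1 : C * (`|s - t| * `|s - t|) <= (`|C| + 1) * (`|s - t0| + `|t - t0|) * `|s - t|.
  rewrite -mulrA; apply: (le_trans (y := (`|C| + 1) * (`|s - t| * `|s - t|))).
    by rewrite ler_wpM2r// mulr_ge0.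
  by apply: ler_wpM2l; [exact: ltW|exact: ler_wpM2r].
have K2 : `|df t - df t0| * `|s - t| <= (`|C| + 1) * `|t - t0| * `|s - t|.
  by rewrite ler_wpM2r// (le_trans H2)// ler_wpM2r.
apply: (le_trans (lerD (le_trans H1 K1) K2)).
by rewrite -mulrDl ler_wpM2r//; lra.
Qed.

Lemma sd1_ff t : sd1 ff t (df t).
Proof.
apply: (@sd1_quad ff df 2 t 1 ltr01) => [s u _ _|u _]; first exact: ff_quad.
exact: df_lip.
Qed.

Lemma mvt (f df : R -> R) (a b : R) : a <= b ->
  (forall x, a <= x <= b -> is_derive x 1 f (df x)) ->
  exists2 c, a <= c <= b & f b - f a = df c * (b - a).
Proof.
move=> ab H.
have H1 x : x \in `]a, b[ -> is_derive x 1 f (df x).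
  by rewrite in_itv/= => /andP[x1 x2]; apply: H; lra.
have H2 : {within `[a, b], continuous f}.
  apply: derivable_within_continuous => x; rewrite in_itv/= => /H h.
  exact: (@ex_derive _ _ _ _ _ _ _ h).
have [c cab E] := MVT_segment ab H1 H2.
by exists c => //; move: cab; rewrite in_itv.
Qed.

Lemma powR_anti (a b r : R) : 0 < a -> a <= b -> r <= 0 -> b `^ r <= a `^ r.
Proof.
move=> a0 ab r0.
rewrite -(opprK r) !(powRN _ (- r)) lef_pV2 ?posrE ?powR_gt0//; last exact: lt_le_trans ab.
by apply: ge0_ler_powR => //; rewrite ?nnegrE; lra.
Qed.

(** * The kernel as a function of the squared distance *)

Variable s : R.
Hypothesis hs : 0 < s <= 1.

Lemma sbnd : 0 < s /\ s <= 1.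
Proof. by apply/andP. Qed.

Lemma sym_lip (f : R -> R) (C : R) : (forall x y, x <= y -> `|f x - f y| <= C * (y - x)) ->
  forall x y, `|f x - f y| <= C * `|x - y|.
Proof.
move=> h x y; have [xy|/ltW xy] := leP x y.
  by rewrite (distrC x) (@ger0_norm _ (y - x)) ?h ?subr_ge0.
by rewrite distrC (@ger0_norm _ (x - y)) ?h ?subr_ge0.
Qed.

(* [Gs s] is a multiple of [kern x = kap (nq x)].  The factor 128 lets the self-interaction of a test profile dominate its entropy. *)
Definition kap (q : R) : R := if s == 1 then - 128 * ln q else 128 * q `^ (s - 1).
(* [kap' q = - AA * q `^ (s - 2)] *)
Definition AA : R := if s == 1 then 128 else 128 * (1 - s).

Lemma AA_gt0 : 0 < AA.
Proof.
rewrite /AA; case: eqVneq => [//|h].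
have [ss0 ss1] := sbnd; have : s < 1 by rewrite lt_neqAle h.
by move=> ?; lra.
Qed.

Lemma kap_derive (q : R) : 0 < q -> is_derive q 1 kap (- AA * q `^ (s - 2)).
Proof.
move=> q0; rewrite /kap /AA; case: eqVneq => [->|h].
  have -> : 1 - 2 = -1 :> R by ring.
  rewrite (powR_inv1 (ltW q0)); have H := is_derive1_ln q0.
  apply: is_deriveZ.
have -> : - (128 * (1 - s)) * q `^ (s - 2) = 128 * ((s - 1) * q `^ (s - 1 - 1)).
  have -> : s - 1 - 1 = s - 2 by ring.
  by ring.
have H := @is_derive1_powR _ (s - 1) q q0.
apply: is_deriveZ.
Qed.

Lemma phi_derive (r q : R) : 0 < q -> is_derive q 1 (fun q => q `^ r) (r * q `^ (r - 1)).
Proof. by move=> q0; exact: is_derive1_powR. Qed.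

(** [kap] is decreasing and convex: its mean slope lies between the slopes at the two ends. *)
Lemma kap_bounds (q q' : R) : 0 < q -> q <= q' ->
  AA * q' `^ (s - 2) * (q' - q) <= kap q - kap q' <= AA * q `^ (s - 2) * (q' - q).
Proof.
move=> q0 qq; have A0 := AA_gt0.
have [|c /andP[c1 c2] E] := @mvt kap (fun q => - AA * q `^ (s - 2)) q q' qq.
  by move=> x /andP[x1 _]; apply: kap_derive; exact: lt_le_trans x1.
have -> : kap q - kap q' = AA * c `^ (s - 2) * (q' - q) by rewrite -opprB E; ring.
have c0 : 0 < c by lra.
have d0 : 0 <= q' - q by lra.
have [ss0 ss1] := sbnd; have sm : s - 2 <= 0 by lra.
by rewrite !ler_wpM2r// ler_wpM2l ?powR_anti// ltW.
Qed.

Lemma phi_bounds (q q' : R) : 0 < q -> q <= q' ->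
  0 <= q `^ (s - 2) - q' `^ (s - 2) <= 2 * q `^ (s - 3) * (q' - q).
Proof.
move=> q0 qq.
have [|c /andP[c1 c2] E] := @mvt (fun q => q `^ (s - 2)) (fun q => (s - 2) * q `^ (s - 2 - 1)) q q' qq.
  by move=> x /andP[x1 _]; apply: phi_derive; exact: lt_le_trans x1.
have -> : q `^ (s - 2) - q' `^ (s - 2) = (2 - s) * c `^ (s - 3) * (q' - q).
  by rewrite -opprB E (_ : s - 2 - 1 = s - 3); ring.
have c0 : 0 < c by lra.
have d0 : 0 <= q' - q by lra.
have p0 := powR_ge0 c (s - 3).
have [ss0 ss1] := sbnd; have s2 : 0 <= 2 - s by lra.
rewrite mulr_ge0 ?mulr_ge0//= ler_wpM2r//.
apply: ler_pM => //; first by lra.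
by apply: powR_anti => //; lra.
Qed.

(* Below [rho] the kernel is replaced by its tangent line in [q = nq x]: [farK rho] is then regular, and the singular remainder [nearK rho] has a small integral. *)
Definition far (rho q : R) : R := kap (Num.max q rho) + AA * rho `^ (s - 2) * Num.max (rho - q) 0.
Definition dfar (rho q : R) : R := - (AA * (Num.max q rho) `^ (s - 2)).

Lemma far_ge (rho q : R) : rho <= q -> far rho q = kap q.
Proof. by move=> h; rewrite /far max_l// max_r ?mulr0 ?addr0//; lra. Qed.

Lemma far_lt (rho q : R) : q <= rho -> far rho q = kap rho + AA * rho `^ (s - 2) * (rho - q).
Proof. by move=> h; rewrite /far max_r// max_l//; lra. Qed.

(** Again convexity: [far rho] is [kap] continued by a tangent line, so its slope [dfar rho] is
    continuous and increasing across [rho]. *)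
Lemma far_bounds (rho q q' : R) : 0 < rho -> q <= q' ->
  - dfar rho q' * (q' - q) <= far rho q - far rho q' <= - dfar rho q * (q' - q).
Proof.
move=> r0 qq; have [ss0 ss1] := sbnd; rewrite /dfar !opprK.
have [qr|rq] := leP rho q.
  have qr' : rho <= q' by lra.
  have q0 : 0 < q by lra.
  by rewrite !far_ge// !max_l//; apply: kap_bounds.
have [q'r|rq'] := leP q' rho.
  have qr' := ltW rq; rewrite !far_lt//; apply/andP; split; lra.
rewrite (far_lt (ltW rq)) (far_ge (ltW rq')).
have /andP[k1 k2] := kap_bounds r0 (ltW rq').
have p1 : q' `^ (s - 2) <= rho `^ (s - 2) by apply: powR_anti => //; lra.
have A0 := AA_gt0.
have : AA * q' `^ (s - 2) <= AA * rho `^ (s - 2) by rewrite ler_wpM2l// ltW.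
move: (AA * q' `^ _) (AA * rho `^ _) k1 k2 => a b k1 k2 ab.
apply/andP; split; nra.
Qed.

Lemma dfar_bounds (rho q q' : R) : 0 < rho -> q <= q' ->
  0 <= dfar rho q' - dfar rho q <= AA * (2 * rho `^ (s - 3)) * (q' - q).
Proof.
move=> r0 qq; have [ss0 ss1] := sbnd; rewrite /dfar; have A0 := AA_gt0.
set m := Num.max q rho; set m' := Num.max q' rho.
have m0 : rho <= m by rewrite /m le_max lexx orbT.
have [mm md] : m <= m' /\ m' - m <= q' - q.
  by rewrite /m /m'; case: (leP q rho); case: (leP q' rho) => h1 h2; split; lra.
have /andP[h1 h2] := phi_bounds (lt_le_trans r0 m0) mm.
have -> : - (AA * m' `^ (s - 2)) - - (AA * m `^ (s - 2)) = AA * (m `^ (s - 2) - m' `^ (s - 2)) by ring.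
rewrite mulr_ge0 ?(ltW A0)//= -!mulrA ler_wpM2l ?(ltW A0)// (le_trans h2)// -mulrA ler_wpM2l//.
apply: ler_pM => //; [exact: powR_ge0|by lra|].
by apply: powR_anti => //; lra.
Qed.

Lemma dfar_le0 rho q : dfar rho q <= 0.
Proof. by rewrite /dfar oppr_le0 mulr_ge0 ?powR_ge0 ?(ltW AA_gt0). Qed.

Lemma dfar_ge rho q : 0 < rho -> - dfar rho q <= AA * rho `^ (s - 2).
Proof.
move=> r0; have [ss0 ss1] := sbnd.
rewrite /dfar opprK ler_wpM2l ?(ltW AA_gt0)// powR_anti// ?le_max ?lexx ?orbT//; lra.
Qed.

Lemma far_decr (rho q q' : R) : 0 < rho -> q <= q' -> far rho q' <= far rho q.
Proof.
move=> r0 qq; have /andP[h1 h2] := far_bounds r0 qq.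
have := dfar_le0 rho q'; nra.
Qed.

Lemma far_lip (rho q q' : R) : 0 < rho -> `|far rho q - far rho q'| <= AA * rho `^ (s - 2) * `|q - q'|.
Proof.
move=> r0; apply: sym_lip => x y xy; have /andP[h1 h2] := far_bounds r0 xy.
have k1 := dfar_le0 rho y; have k2 := dfar_ge x r0.
by rewrite ger0_norm; nra.
Qed.

(** A tangent line of a convex function lies below it, so the singular remainder [nearK rho] is
    nonnegative off the origin. *)
Lemma kap_far (rho q : R) : 0 < rho -> 0 < q -> 0 <= kap q - far rho q.
Proof.
move=> r0 q0; have [h|h] := leP rho q; first by rewrite far_ge// subrr.
rewrite far_lt ?(ltW h)//; have /andP[h1 h2] := kap_bounds q0 (ltW h); lra.
Qed.

Lemma kap_anti (q q' : R) : 0 < q -> q <= q' -> kap q' <= kap q.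
Proof.
move=> q0 qq; have /andP[h1 h2] := kap_bounds q0 qq.
have : 0 <= AA * q' `^ (s - 2) by rewrite mulr_ge0 ?powR_ge0 ?(ltW AA_gt0).
nra.
Qed.

Definition nq (x : P) : R := x.1 ^+ 2 + x.2 ^+ 2.

Lemma nq_ge0 x : 0 <= nq x. Proof. by rewrite addr_ge0 ?sqr_ge0. Qed.

Lemma nq_norm x : `|x| ^+ 2 <= nq x <= 2 * `|x| ^+ 2.
Proof.
have h (a : R) : `|a| ^+ 2 = a ^+ 2 by rewrite real_normK// num_real.
have h1 : x.1 ^+ 2 <= `|x| ^+ 2 by rewrite -h lerXn2r ?nnegrE ?norm1.
have h2 : x.2 ^+ 2 <= `|x| ^+ 2 by rewrite -h lerXn2r ?nnegrE ?norm2.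
apply/andP; split; last by rewrite /nq; lra.
have : `|x| = `|x.1| \/ `|x| = `|x.2|.
  by rewrite prod_normE; case: leP; [right|left].
by case=> ->; rewrite h /nq ?lerDl ?lerDr sqr_ge0.
Qed.

Lemma nq_gt0 x : x != 0 -> 0 < nq x.
Proof.
move=> x0; have /andP[h _] := nq_norm x; apply: lt_le_trans h.
by rewrite exprn_gt0// normr_gt0.
Qed.

Definition kern (x : P) : R := kap (nq x).
Definition farK rho (x : P) : R := far rho (nq x).
Definition nearK rho (x : P) : R := kern x - farK rho x.

Lemma mbl_nq : mbl nq.
Proof.
apply: measurable_funD; apply: measurable_funX; [exact: measurable_fst|exact: measurable_snd].
Qed.

Lemma measurable_kap : measurable_fun setT kap.
Proof.
rewrite /kap; case: (s == 1); apply: measurable_funM => //.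
Qed.

Lemma mbl_kern : mbl kern.
Proof. exact: (measurableT_comp measurable_kap mbl_nq). Qed.

Lemma mbl_farK rho : mbl (farK rho).
Proof.
have h : measurable_fun setT (far rho).
  apply: measurable_funD.
    apply: (measurableT_comp measurable_kap); exact: measurable_maxr.
  apply: measurable_funM => //; apply: measurable_maxr => //; exact: measurable_funB.
exact: (measurableT_comp h mbl_nq).
Qed.

Lemma mbl_nearK rho : mbl (nearK rho).
Proof. by apply: measurable_funB; [exact: mbl_kern|exact: mbl_farK]. Qed.

(** * The singular part of the kernel *)

Lemma geo_small (r e : R) : 0 <= r < 1 -> 0 < e -> exists n : nat, r ^+ n < e.
Proof.
move=> /andP[r0 r1] e0.
have /cvgrPdist_lt/(_ _ e0)[n _ H] : (fun n => r ^+ n) @ \oo --> (0 : R).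
  by apply: cvg_expr; rewrite ger0_norm.
exists n; have := H n (leqnn n).
by rewrite /= sub0r normrN ger0_norm// exprn_ge0.
Qed.

Lemma geo_sum (r : R) m : 0 <= r < 1 -> \sum_(i < m) r ^+ i <= (1 - r)^-1.
Proof.
move=> /andP[r0 r1]; have d : 0 < 1 - r by lra.
rewrite -div1r ler_pdivlMr//.
have -> : (\sum_(i < m) r ^+ i) * (1 - r) = 1 - r ^+ m.
  by rewrite -[RHS]opprB subrX1; ring.
by have := exprn_ge0 m r0; lra.
Qed.

Section near.
Let a4 (i : nat) : R := 4^-1 ^+ i.
Let a4_gt0 i : 0 < a4 i. Proof. by rewrite exprn_gt0// invr_gt0. Qed.
Let a4_le i j : (i <= j)%N -> a4 j <= a4 i.
Proof.
move=> ij; rewrite /a4 ler_wiXn2l ?invr_ge0//; first by rewrite invf_le1//; lra.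
Qed.
(** The ratio by which the slope of [kap] grows from one scale [a4 i] to the next. The increment of
    [kap] is of order [pp ^ i * 4 ^ (- i)] on a square of area of order [4 ^ (- i)], so
    integrability at the origin asks for [pp < 16], that is, [0 < s]. *)
Let pp : R := 4 `^ (2 - s).
Let pp_bnd : 0 < pp < 16.
Proof.
have [ss0 ss1] := sbnd; rewrite powR_gt0//=.
have -> : 16 = 4 `^ 2 :> R by rewrite powR_mulrn//; ring.
rewrite /pp -ltr_ln ?posrE ?powR_gt0// !ln_powR ltr_pM2r ?ln_gt0//; lra.
Qed.

Let a4_pow i : a4 i `^ (s - 2) = pp ^+ i.
Proof.
have -> : a4 i = (4^-1) `^ i%:R by rewrite powR_mulrn ?invr_ge0.
rewrite powRAC powR_mulrn ?powR_ge0//; congr (_ ^+ _).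
by rewrite -powR_inv1// -powRrM /pp; congr (_ `^ _); ring.
Qed.

Let dl (i : nat) : R := kap (a4 i.+1) - kap (a4 i).

Let dl_bnd i : 0 <= dl i <= AA * pp * pp ^+ i * a4 i.
Proof.
have h := kap_bounds (a4_gt0 i.+1) (a4_le (leqnSn i)).
have A0 := AA_gt0; have /andP[p0 _] := pp_bnd.
rewrite -/(dl i) in h; move: h => /andP[h1 h2].
have d0 := a4_le (leqnSn i).
apply/andP; split.
  by apply: le_trans h1; rewrite mulr_ge0 ?mulr_ge0 ?powR_ge0 ?(ltW A0)//; lra.
apply: (le_trans h2); rewrite a4_pow exprS (mulrA AA).
by rewrite ler_wpM2l ?mulr_ge0 ?exprn_ge0 ?(ltW A0) ?(ltW p0)//; have := a4_gt0 i.+1; lra.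
Qed.

Let b2 (i : nat) : R := 2^-1 ^+ i.
Let b2sq i : b2 i ^+ 2 = a4 i.
Proof. by rewrite /b2 /a4 exprAC; congr (_ ^+ _); field. Qed.
Let b2_gt0 i : 0 < b2 i. Proof. by rewrite exprn_gt0// invr_gt0. Qed.

Let dl_area i : dl i * (2 * b2 i) ^+ 2 <= 4 * AA * pp * (pp / 16) ^+ i.
Proof.
have /andP[h1 h2] := dl_bnd i; rewrite exprMn b2sq.
have a0 := ltW (a4_gt0 i).
have -> : 4 * AA * pp * (pp / 16) ^+ i = AA * pp * pp ^+ i * a4 i * (2 ^+ 2 * a4 i).
  rewrite exprMn.
  have -> : (16^-1) ^+ i = a4 i * a4 i :> R by rewrite /a4 -exprMn; congr (_ ^+ _); field.
  by ring.
by rewrite ler_wpM2r// mulr_ge0.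
Qed.

(** If [nq x] lies between [a4 j.+1] and [a4 j], the remainder is at most
    [kap (a4 j.+1) - kap (a4 n)]. This telescopes into the increments [dl (n + i)] with
    [i <= j - n], and [x] belongs to all the corresponding boxes. *)
Lemma near_dyadic (n : nat) x : x != 0 -> nq x < a4 n ->
  exists m, nearK (a4 n) x <= \sum_(i < m) dl (n + i)%N * box (b2 (n + i)) x.
Proof.
move=> x0 xn; have q0 := nq_gt0 x0.
have ex : exists j, a4 j.+1 <= nq x.
  have h4 : 0 <= (4^-1 : R) < 1 by rewrite invr_ge0 invf_lt1//; lra.
  have [j hj] := geo_small h4 q0; exists j.
  by apply: ltW; apply: le_lt_trans hj; exact: a4_le.
have [j hj jmin] := ex_minnP ex.
have nj : (n <= j)%N.
  by rewrite leqNgt; apply/negP => jn; have := a4_le jn; lra.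
have xj : nq x < a4 j.
  case: j hj jmin nj => [|j] hj jmin nj; first by move: nj; rewrite leqn0 => /eqP n0; rewrite -n0.
  by rewrite ltNge; apply/negP => /jmin; rewrite ltnn.
exists (j - n).+1.
have bx i : (i <= j - n)%N -> box (b2 (n + i)) x = 1.
  move=> ij; apply: box1.
  have /andP[h _] := nq_norm x.
  rewrite -(ler_pXn2r (ltn0Sn 1)) ?nnegrE ?(ltW (b2_gt0 _))// b2sq.
  apply: (le_trans h); apply: (le_trans (ltW xj)); apply: a4_le.
  by rewrite -leq_subRL.
rewrite (eq_bigr (fun i : 'I_(j - n).+1 => kap (a4 (n + i).+1) - kap (a4 (n + i)))); last first.
  by move=> i _; rewrite bx ?mulr1// -ltnS.
rewrite (_ : \sum_(i < (j - n).+1) (kap (a4 (n + i).+1) - kap (a4 (n + i))) = kap (a4 j.+1) - kap (a4 n)).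
  rewrite /nearK /kern /farK far_lt ?(ltW xn)//.
  have k1 := kap_anti (a4_gt0 j.+1) hj.
  have : 0 <= AA * a4 n `^ (s - 2) * (a4 n - nq x).
    by rewrite mulr_ge0 ?mulr_ge0 ?powR_ge0 ?(ltW AA_gt0)//; lra.
  by lra.
under eq_bigr do rewrite -addnS.
rewrite -(big_mkord xpredT (fun i => kap (a4 (n + i.+1)%N) - kap (a4 (n + i)%N))).
by rewrite (telescope_sumr (fun i => kap (a4 (n + i)%N)))// addn0 -subSn// subnKC// leqW.
Qed.

(** The dyadic majorant has integral of order [(pp / 16) ^ n], a geometric tail. Absorbing this
    small singular mass is the device behind the bounds on potentials below. *)
Lemma near_small (e : R) : 0 < e -> exists rho, [/\ 0 < rho <= 1, itg (nearK rho) & I2 (fun x => `|nearK rho x|) <= e].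
Proof.
move=> e0; have A0 := AA_gt0; have /andP[p0 p16] := pp_bnd.
pose r : R := pp / 16.
have r01 : 0 <= r < 1 by rewrite /r divr_ge0 ?(ltW p0)//= ltr_pdivrMr// mul1r.
have d0 : 0 < 1 - r by case/andP: r01 => *; lra.
pose C : R := 4 * AA * pp.
have C0 : 0 < C by rewrite /C !mulr_gt0.
have [n rn] := geo_small r01 (divr_gt0 (mulr_gt0 e0 d0) C0).
pose h (i : nat) (x : PM) : \bar R := (dl (n + i) * box (b2 (n + i)) x)%:E.
pose G (x : PM) : \bar R := (\sum_(0 <= i <oo) h i x)%E.
have h0 i x : (0 <= h i x)%E.
  by rewrite lee_fin mulr_ge0//; have /andP[] := dl_bnd (n + i).
have mh i : measurable_fun setT (h i).
  by apply/measurable_EFinP; apply: measurable_funM => //; exact: mbl_box.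
have mG : measurable_fun setT G.
  by apply: ge0_emeasurable_sum => // *; exact: h0.
have G0 x : (0 <= G x)%E by apply: nneseries_ge0 => *; exact: h0.
(* The dyadic bound excludes the origin, where the kernel has a default value. This term dominates
   it there and has integral 0. *)
pose N0 (x : PM) : \bar R := (`|nearK (a4 n) 0| * box 0 x)%:E.
have mN0 : measurable_fun setT N0.
  by apply/measurable_EFinP; apply: measurable_funM => //; exact: mbl_box.
have dom x : (`|nearK (a4 n) x|%:E <= G x + N0 x)%E.
  have N00 : (0 <= N0 x)%E by rewrite lee_fin mulr_ge0.
  have [->|x0] := eqVneq x 0.
    by rewrite -[leLHS]add0e leeD// /N0 box1 ?normr0// mulr1.
  apply: (@le_trans _ _ (G x)); last by rewrite leeDl.
  have [xn|nx] := leP (a4 n) (nq x).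
    by rewrite /nearK /kern /farK far_ge// subrr normr0.
  rewrite ger0_norm; last by apply: kap_far => //; exact: nq_gt0.
  have [m Hm] := near_dyadic x0 nx.
  apply: (@le_trans _ _ (\sum_(0 <= i < m) h i x)%E); last first.
    by apply: nneseries_lim_ge => *; exact: h0.
  by rewrite big_mkord /h sumEFin lee_fin.
have IG : (\int[mu2]_x (G x + N0 x) <= e%:E)%E.
  rewrite ge0_integralD//; last by move=> x _; rewrite lee_fin mulr_ge0.
  have -> : (\int[mu2]_x N0 x = 0)%E.
    have := I2Z (`|nearK (a4 n) 0|) (itg_box 0).
    rewrite I2_box// mulr0 expr0n/= mulr0 /I2 /Rintegral => E.
    rewrite -(fineK (integrable_fin_num measurableT (itgZ (`|nearK (a4 n) 0|) (itg_box 0)))).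
    by rewrite E.
  rewrite adde0 integral_nneseries//.
  apply: lime_le.
    by apply: is_cvg_nneseries => i _ _; apply: integral_ge0.
  apply: nearW => m.
  apply: (@le_trans _ _ (\sum_(0 <= i < m) (C * r ^+ n * r ^+ i)%:E)%E).
    apply: lee_sum => i _.
    have -> : (\int[mu2]_x h i x = (dl (n + i) * (2 * b2 (n + i)) ^+ 2)%:E)%E.
      have := I2Z (dl (n + i)) (itg_box (b2 (n + i))).
      rewrite I2_box ?(ltW (b2_gt0 _))// /I2 /Rintegral => E.
      rewrite -(fineK (integrable_fin_num measurableT (itgZ (dl (n + i)) (itg_box (b2 (n + i)))))).
      by rewrite E.
    by rewrite lee_fin (le_trans (dl_area _))// exprD mulrA.
  rewrite sumEFin lee_fin -mulr_sumr big_mkord.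
  have Cr : 0 <= C * r ^+ n by rewrite mulr_ge0 ?(ltW C0)// exprn_ge0//; case/andP: r01.
  apply: (le_trans (ler_wpM2l Cr (geo_sum m r01))).
  rewrite ltr_pdivlMr// in rn.
  by rewrite ler_pdivrMr// mulrC; exact: ltW.
have IN : (\int[mu2]_x `|(EFin \o nearK (a4 n)) x| <= e%:E)%E.
  apply: (le_trans _ IG); apply: ge0_le_integral => //.
  - by apply: measurableT_comp => //; apply/measurable_EFinP; exact: mbl_nearK.
  - exact: emeasurable_funD.
  - by move=> x _ /=; exact: dom.
have iN : itg (nearK (a4 n)).
  apply/integrableP; split; first by apply/measurable_EFinP; exact: mbl_nearK.
  by apply: (le_lt_trans IN); rewrite ltry.
exists (a4 n); split => //; first by rewrite a4_gt0 (a4_le (leq0n n)).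
rewrite -lee_fin /I2 /Rintegral fineK//.
exact: (integrable_fin_num measurableT (itg_norm iN)).
Qed.
End near.

(** * Convolutions and bilinear forms *)

Definition lipf (L : R) (f : P -> R) := forall x y, `|f x - f y| <= L * `|x - y|.
(** The class of densities. Lipschitz bounds survive uniform limits, and they are enough for
    convolutions with a singular kernel to be differentiable. *)
Definition cl (f : P -> R) := exists L B : R, [/\ 0 <= L, 0 <= B, lipf L f & forall x, B < `|x| -> f x = 0].
(** The class of multipliers: unlike globally Lipschitz functions it is stable under products, and
    it contains the coordinates and all the potentials. *)
Definition llip (g : P -> R) := forall B : R, exists2 L : R, 0 <= L &
  forall x y, `|x| <= B -> `|y| <= B -> `|g x - g y| <= L * `|x - y|.

Lemma llip_continuous g : llip g -> continuous g.
Proof.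
move=> h x; have [L L0 H] := h (`|x| + 1).
apply/cvgrPdist_le => e e0; near=> y.
have yx : `|x - y| < Num.min 1 (e / (L + 1)).
  by near: y; apply: cvgr_dist_lt => //; rewrite lt_min ltr01 divr_gt0//; lra.
move: yx; rewrite lt_min => /andP[y1 y2].
have L1 : 0 < L + 1 by lra.
rewrite ltr_pdivlMr// in y2.
have ny : `|y| <= `|x| + 1.
  by rewrite -(subrK x y) addrC (le_trans (ler_normD _ _))// lerD2l distrC ltW.
have nx : `|x| <= `|x| + 1 by lra.
have := H x y nx ny; have := normr_ge0 (x - y); nra.
Unshelve. all: by end_near. Qed.

Lemma llip_mbl g : llip g -> mbl g.
Proof. by move=> /llip_continuous; exact: continuous_mbl. Qed.

Lemma lipf_llip L f : 0 <= L -> lipf L f -> llip f.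
Proof. by move=> L0 h B; exists L. Qed.

Lemma cl_llip f : cl f -> llip f.
Proof. by move=> [L [B [L0 B0 h _]]]; exact: lipf_llip h. Qed.

Lemma llip_cst c : llip (fun=> c).
Proof. by move=> B; exists 0 => // x y _ _; rewrite subrr normr0 mul0r. Qed.

Lemma llip_fst : llip fst.
Proof. by move=> B; exists 1 => // x y _ _; rewrite mul1r (norm1 (x - y)). Qed.

Lemma llip_bnd g : llip g -> forall B, exists2 M : R, 0 <= M & forall x, `|x| <= B -> `|g x| <= M.
Proof.
move=> h B; have [L L0 H] := h B; exists (`|g 0| + L * `|B|).
  by rewrite addr_ge0// mulr_ge0.
move=> x xB; have B0 : 0 <= B by apply: le_trans xB.
have k := H x 0 xB; rewrite normr0 subr0 in k; have {}k := k B0.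
rewrite -(subrK (g 0) (g x)) addrC (le_trans (ler_normD _ _))// lerD2l (le_trans k)// ler_wpM2l//.
by rewrite (le_trans xB)// ler_norm.
Qed.

Lemma llipD f g : llip f -> llip g -> llip (fun x => f x + g x).
Proof.
move=> hf hg B; have [L L0 H] := hf B; have [L' L'0 H'] := hg B.
exists (L + L') => [|x y xB yB]; first by rewrite addr_ge0.
have -> : f x + g x - (f y + g y) = (f x - f y) + (g x - g y) by ring.
by rewrite (le_trans (ler_normD _ _))// mulrDl lerD// ?H ?H'.
Qed.

Lemma llipM f g : llip f -> llip g -> llip (fun x => f x * g x).
Proof.
move=> hf hg B; have [L L0 H] := hf B; have [L' L'0 H'] := hg B.
have [M M0 HM] := llip_bnd hf B; have [M' M'0 HM'] := llip_bnd hg B.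
exists (L * M' + M * L') => [|x y xB yB]; first by rewrite addr_ge0 ?mulr_ge0.
have -> : f x * g x - f y * g y = (f x - f y) * g x + f y * (g x - g y) by ring.
rewrite (le_trans (ler_normD _ _))// !normrM mulrDl lerD//.
  by rewrite mulrAC ler_pM// ?H ?HM'.
by rewrite -mulrA ler_pM// ?HM ?H'.
Qed.

Lemma llipZ c g : llip g -> llip (fun x => c * g x).
Proof. by move=> h; apply: llipM => //; exact: llip_cst. Qed.

Lemma llipB f g : llip f -> llip g -> llip (fun x => f x - g x).
Proof.
move=> hf hg; have := llipD hf (llipZ (-1) hg).
by under eq_fun do rewrite mulN1r.
Qed.

Lemma cl_bnd f : cl f -> exists2 M : R, 0 <= M & forall x, `|f x| <= M.
Proof.
move=> h; have [L [B [L0 B0 hL hB]]] := h.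
have [M M0 HM] := llip_bnd (cl_llip h) B; exists M => // x.
by have [/HM//|/hB->] := leP `|x| B; rewrite normr0.
Qed.

Lemma cl_mbl f : cl f -> mbl f.
Proof. by move=> /cl_llip; exact: llip_mbl. Qed.

Lemma cl_itg f : cl f -> itg f.
Proof.
move=> h; have [M M0 HM] := cl_bnd h; have [L [B [L0 B0 hL hB]]] := h.
exact: (itg_bnd (cl_mbl h) HM hB).
Qed.

Lemma clM f g : cl f -> llip g -> cl (fun x => f x * g x).
Proof.
move=> h hg; have [M M0 HM] := cl_bnd h; have [L [B [L0 B0 hL hB]]] := h.
have [L' L'0 H'] := hg B; have [M' M'0 HM'] := llip_bnd hg B.
have C0 : 0 <= L * M' + M * L' by rewrite addr_ge0 ?mulr_ge0.
exists (L * M' + M * L'), B; split => // [x y|x /hB ->]; last by rewrite mul0r.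
have key u v : `|u| <= B -> `|f u * g u - f v * g v| <= (L * M' + M * L') * `|u - v|.
  move=> uB; have [vB|vB] := leP `|v| B.
    have -> : f u * g u - f v * g v = (f u - f v) * g u + f v * (g u - g v) by ring.
    rewrite (le_trans (ler_normD _ _))// !normrM mulrDl lerD//.
      by rewrite mulrAC ler_pM// ?hL ?HM'.
    by rewrite -mulrA ler_pM// ?HM ?H'.
  rewrite (hB _ vB) mul0r subr0 -(subr0 (f u)) -(hB _ vB) normrM.
  apply: (@le_trans _ _ (L * `|u - v| * M')); first by rewrite ler_pM// ?hL ?HM'.
  by rewrite mulrAC ler_wpM2r// lerDl mulr_ge0.
have [xB|xB] := leP `|x| B; first exact: key.
have [yB|yB] := leP `|y| B; first by rewrite distrC (distrC x); exact: key.
by rewrite (hB _ xB) (hB _ yB) !mul0r subrr normr0 mulr_ge0.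
Qed.

Lemma clD f g : cl f -> cl g -> cl (fun x => f x + g x).
Proof.
move=> [L [B [L0 B0 hL hB]]] [L' [B' [L'0 B'0 hL' hB']]].
exists (L + L'), (Num.max B B'); split; [lra|by rewrite le_max B0| |].
  move=> x y; have -> : f x + g x - (f y + g y) = (f x - f y) + (g x - g y) by ring.
  by rewrite (le_trans (ler_normD _ _))// mulrDl lerD// ?hL ?hL'.
by move=> x; rewrite gt_max => /andP[/hB -> /hB' ->]; rewrite addr0.
Qed.

Lemma clZ c f : cl f -> cl (fun x => c * f x).
Proof. by move=> h; have := clM h (llip_cst c); under eq_fun do rewrite mulrC. Qed.

Lemma clB f g : cl f -> cl g -> cl (fun x => f x - g x).
Proof.
by move=> hf hg; have := clD hf (clZ (-1) hg); under eq_fun do rewrite mulN1r.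
Qed.

Lemma aff_norm c e x y : `|c.1| = 1 -> `|c.2| = 1 -> `|aff c e x - aff c e y| = `|x - y|.
Proof.
move=> c1 c2; rewrite !prod_normE /aff /=.
have -> : c.1 * x.1 + e.1 - (c.1 * y.1 + e.1) = c.1 * (x.1 - y.1) by ring.
have -> : c.2 * x.2 + e.2 - (c.2 * y.2 + e.2) = c.2 * (x.2 - y.2) by ring.
by rewrite !normrM c1 c2 !mul1r.
Qed.

Lemma cl_aff f c e : `|c.1| = 1 -> `|c.2| = 1 -> cl f -> cl (f \o aff c e).
Proof.
move=> c1 c2 [L [B [L0 B0 hL hB]]].
exists L, (B + `|e|); split => //; first by rewrite addr_ge0.
  by move=> x y; rewrite -(aff_norm e x y c1 c2); exact: hL.
move=> x xB; apply: hB.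
have := aff_norm e x 0 c1 c2; rewrite subr0 => E.
have e0 : aff c e 0 = e by rewrite /aff /= !mulr0 !add0r; case: (e).
have := ler_normB (aff c e x) (aff c e 0); rewrite E e0 => h.
by move: xB h; move: (`|x|) (`|e|) (`|aff c e x|) => *; lra.
Qed.

Lemma subE (x : P) : (fun y : P => x - y) = aff (-1, -1) x.
Proof. by apply/funext => y; rewrite /aff; apply: (congr2 pair) => /=; ring. Qed.
Lemma addE' (x : P) : (fun y : P => y + x) = aff (1, 1) x.
Proof. by apply/funext => y; rewrite /aff; apply: (congr2 pair) => /=; ring. Qed.

Lemma itg_sub f x : itg f -> itg (fun y => f (x - y)).
Proof.
by move=> fi; have := @itg_aff (-1, -1) x f; rewrite -subE /= oppr_eq0 oner_eq0; apply.
Qed.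
Lemma I2_sub f x : itg f -> I2 (fun y => f (x - y)) = I2 f.
Proof.
move=> fi; have := @I2_aff (-1, -1) x f; rewrite -subE /= oppr_eq0 oner_eq0.
by rewrite normrN1 mulr1 invr1 mul1r; apply.
Qed.
Lemma itg_add f x : itg f -> itg (fun y => f (y + x)).
Proof.
by move=> fi; have := @itg_aff (1, 1) x f; rewrite -addE' /= oner_eq0; apply.
Qed.
Lemma I2_add f x : itg f -> I2 (fun y => f (y + x)) = I2 f.
Proof.
move=> fi; have := @I2_aff (1, 1) x f; rewrite -addE' /= oner_eq0.
by rewrite normr1 mulr1 invr1 mul1r; apply.
Qed.
Lemma I2_neg f : itg f -> I2 (fun y => f (- y)) = I2 f.
Proof. by move=> fi; rewrite -(I2_sub 0 fi); apply: eq_I2 => y; rewrite sub0r. Qed.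

Lemma cl_sub f x : cl f -> cl (fun y => f (x - y)).
Proof. by move=> h; have := @cl_aff f (-1, -1) x; rewrite -subE /= normrN1; apply. Qed.
Lemma cl_add f x : cl f -> cl (fun y => f (y + x)).
Proof. by move=> h; have := @cl_aff f (1, 1) x; rewrite -addE' /= normr1; apply. Qed.
Lemma cl_neg f : cl f -> cl (fun y => f (- y)).
Proof. by move=> h; have := cl_sub 0 h; under eq_fun do rewrite sub0r. Qed.

(** Local integrability is all that is asked of a convolution kernel, so that [kern] and its regular
    perturbations are treated alike. *)
Definition lint (g : P -> R) := mbl g /\ forall B, itg (fun x => g x * box B x).

Definition conv (g v : P -> R) (x : P) : R := I2 (fun y => g (x - y) * v y).

Lemma mbl_sub g x : mbl g -> mbl (fun y => g (x - y)).
Proof. by move=> mg; have := measurableT_comp mg (mbl_aff (-1, -1) x); rewrite -subE. Qed.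
Lemma mbl_add g x : mbl g -> mbl (fun y => g (y + x)).
Proof. by move=> mg; have := measurableT_comp mg (mbl_aff (1, 1) x); rewrite -addE'. Qed.
Lemma mbl_neg g : mbl g -> mbl (fun y => g (- y)).
Proof. by move=> h; have := mbl_sub 0 h; under eq_fun do rewrite sub0r. Qed.

Lemma lintM g v : lint g -> cl v -> itg (fun x => g x * v x).
Proof.
move=> [mg gi] h; have [M M0 HM] := cl_bnd h; have [L [B [L0 B0 hL hB]]] := h.
have := itgM (gi B) (cl_mbl h) HM; apply: eq_itg => x.
by have [xB|xB] := leP `|x| B; [rewrite box1// mulr1|rewrite (hB _ xB) !mulr0].
Qed.

Lemma conv_sub g v x : lint g -> cl v -> conv g v x = I2 (fun z => g z * v (x - z)).
Proof.
move=> hg hv; rewrite -(I2_sub x (lintM hg (cl_sub x hv))).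
by apply: eq_I2 => y; rewrite subKr.
Qed.

Lemma conv_itg g v x : lint g -> cl v -> itg (fun y => g (x - y) * v y).
Proof.
move=> hg hv; have := itg_sub x (lintM hg (cl_sub x hv)); apply: eq_itg => y.
by rewrite subKr.
Qed.

Lemma lint_norm g : lint g -> lint (fun x => `|g x|).
Proof.
move=> [mg gi]; split; first exact: measurableT_comp.
move=> B; have := itg_norm (gi B); apply: eq_itg => x.
by rewrite normrM (@ger0_norm _ (box B x))// /box ler0n.
Qed.

Lemma lint_llip g : llip g -> lint g.
Proof.
move=> h; have mg := llip_mbl h; split=> // B.
have [M M0 HM] := llip_bnd h B.
apply: (@itg_bnd _ M B).
- by apply: measurable_funM => //; exact: mbl_box.
- move=> x; have [xB|xB] := leP `|x| B; first by rewrite box1// mulr1 HM.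
  by rewrite box0// mulr0 normr0.
- by move=> x xB; rewrite box0// mulr0.
Qed.

Lemma lint_bnd g M : mbl g -> (forall x, `|g x| <= M) -> lint g.
Proof.
move=> mg HM; split=> // B; apply: (@itg_bnd _ M B).
- by apply: measurable_funM => //; exact: mbl_box.
- move=> x; have [xB|xB] := leP `|x| B; first by rewrite box1// mulr1 HM.
  by rewrite box0// mulr0 normr0 (le_trans _ (HM 0)).
- by move=> x xB; rewrite box0// mulr0.
Qed.

Lemma lint_itg g : itg g -> lint g.
Proof.
move=> ig; split=> [|B]; first exact: itg_mbl.
apply: (@itgM _ _ 1 ig); first exact: mbl_box.
exact: box_le1.
Qed.

Lemma lintD f g : lint f -> lint g -> lint (fun x => f x + g x).
Proof.
move=> [mf fi] [mg gi]; split; first exact: measurable_funD.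
by move=> B; have := itgD (fi B) (gi B); apply: eq_itg => x; rewrite mulrDl.
Qed.

Lemma lint_add g c : lint g -> lint (fun x => g (x + c)).
Proof.
move=> [mg gi]; split; first exact: mbl_add.
move=> B; have := itg_add c (gi (B + `|c|)) => h.
have := itgM h (mbl_box B) (M := 1) _.
move=> /(_ (box_le1 B)); apply: eq_itg => x.
have [xB|xB] := leP `|x| B; last by rewrite (box0 xB) !mulr0.
by rewrite (@box1 (B + `|c|)) ?mulr1// (le_trans (ler_normD _ _))// lerD2r.
Qed.

Lemma lint_neg g : lint g -> lint (fun x => g (- x)).
Proof.
move=> [mg gi]; split; first exact: mbl_neg.
move=> B; have := itg_sub 0 (gi B); apply: eq_itg => x.
by rewrite sub0r /box normrN.
Qed.

(** The increment is moved onto [v], so that only the integral of [|g|] over a box enters. *)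
Lemma conv_llip g v : lint g -> cl v -> llip (conv g v).
Proof.
move=> hg hv B; have [L [Bv [L0 B0 hL hB]]] := hv.
have ig := (lint_norm hg).2 (B + Bv).
exists (L * I2 (fun z => `|g z| * box (B + Bv) z)).
  by rewrite mulr_ge0// I2_ge0// => x; rewrite mulr_ge0// /box ler0n.
move=> x y xB yB; rewrite !conv_sub// -I2B; [|exact: lintM hg (cl_sub x hv)|exact: lintM hg (cl_sub y hv)].
have ii : itg (fun z => g z * v (x - z) - g z * v (y - z)).
  by apply: itgB; [exact: lintM hg (cl_sub x hv)|exact: lintM hg (cl_sub y hv)].
rewrite (le_trans (ler_norm_I2 ii))// mulrAC -I2Z//.
apply: I2_le; [exact: itg_norm|exact: itgZ|] => z.
rewrite -mulrBr normrM mulrC.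
have [zB|zB] := leP `|z| (B + Bv).
  rewrite box1// mulr1 ler_wpM2r// (le_trans (hL _ _))//.
  by have -> : x - z - (y - z) = x - y by rewrite opprB addrA subrK.
have far u : `|u| <= B -> v (u - z) = 0.
  move=> uB; apply: hB; have := ler_normB u (u - z); rewrite opprB addrC subrK.
  by move: uB zB; move: (`|u|) (`|z|) (`|u - z|) => *; lra.
by rewrite !far// subrr normr0 mul0r !mulr_ge0// /box ler0n.
Qed.

Lemma cl_norm f : cl f -> cl (fun x => `|f x|).
Proof.
move=> [L [B [L0 B0 hL hB]]]; exists L, B; split=> // [x y|x /hB ->]; last by rewrite normr0.
exact: le_trans (ler_dist_dist _ _) (hL x y).
Qed.

Lemma I2_prod_itg u g v : cl u -> lint g -> cl v -> itg (fun x => u x * conv g v x).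
Proof. by move=> hu hg hv; apply: cl_itg; apply: clM => //; exact: conv_llip. Qed.

Lemma convD g u v x : lint g -> cl u -> cl v ->
  conv g (fun y => u y + v y) x = conv g u x + conv g v x.
Proof.
move=> hg hu hv; rewrite -I2D; [|exact: conv_itg..].
by apply: eq_I2 => y; rewrite mulrDr.
Qed.

Lemma convZ g v x c : lint g -> cl v -> conv g (fun y => c * v y) x = c * conv g v x.
Proof.
move=> hg hv; rewrite -I2Z; last exact: conv_itg.
by apply: eq_I2 => y; rewrite mulrCA.
Qed.

Lemma conv_kD g g' v x : lint g -> lint g' -> cl v ->
  conv (fun z => g z + g' z) v x = conv g v x + conv g' v x.
Proof.
move=> hg hg' hv; rewrite -I2D; [|exact: conv_itg..].
by apply: eq_I2 => y; rewrite mulrDl.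
Qed.

Definition fm (g u v : P -> R) : R := I2 (fun x => u x * conv g v x).

Lemma fm_linl g u u' v c : lint g -> cl u -> cl u' -> cl v ->
  fm g (fun x => u x + c * u' x) v = fm g u v + c * fm g u' v.
Proof.
move=> hg hu hu' hv; rewrite -I2Z; last exact: I2_prod_itg.
rewrite -I2D; [|exact: I2_prod_itg|by apply: itgZ; exact: I2_prod_itg].
by apply: eq_I2 => y; ring.
Qed.

Lemma fm_linr g u v v' c : lint g -> cl u -> cl v -> cl v' ->
  fm g u (fun x => v x + c * v' x) = fm g u v + c * fm g u v'.
Proof.
move=> hg hu hv hv'; rewrite -I2Z; last exact: I2_prod_itg.
rewrite -I2D; [|exact: I2_prod_itg|by apply: itgZ; exact: I2_prod_itg].
apply: eq_I2 => y; rewrite convD//; last exact: clZ.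
by rewrite convZ//; ring.
Qed.

Lemma fm_kD g g' u v : lint g -> lint g' -> cl u -> cl v ->
  fm (fun z => g z + g' z) u v = fm g u v + fm g' u v.
Proof.
move=> hg hg' hu hv; rewrite -I2D; [|exact: I2_prod_itg..].
by apply: eq_I2 => y; rewrite conv_kD//; ring.
Qed.

(** Fubini: the double integral is dominated by the form built from [|u|], [|g|] and [|v|]. *)
Lemma fm_sym g u v : lint g -> cl u -> cl v -> fm g u v = fm (fun z => g (- z)) v u.
Proof.
move=> hg hu hv.
pose h (z : P * P) : R := u z.1 * (g (z.1 - z.2) * v z.2).
have mh : measurable_fun [set: (PM * PM)%type] (h : PM * PM -> R).
  apply: measurable_funM; first exact: mbl2_fst (cl_mbl hu).
  apply: measurable_funM; last exact: mbl2_snd (cl_mbl hv).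
  have := @mbl2_lin (-1) 0 g hg.1.
  under eq_fun => z.
    have -> : (z.1.1 + -1 * z.2.1 + (0 : P).1, z.1.2 + -1 * z.2.2 + (0 : P).2) = z.1 - z.2.
      by apply: (congr2 pair) => /=; ring.
    over.
  by [].
have [Mu Mu0 HMu] := cl_bnd hu.
have h1 x : itg (fun y => h (x, y)) by exact: (itgZ (u x) (conv_itg x hg hv)).
have h2 y : itg (fun x => h (x, y)).
  have := itg_add (- y) (lintM hg (cl_add y hu)) => /(itgZ (v y)).
  by apply: eq_itg => x; rewrite /h /= subrK; ring.
have ig : itg (fun x => `|u x| * conv (fun z => `|g z|) (fun y => `|v y|) x).
  by apply: I2_prod_itg; [exact: cl_norm|exact: lint_norm|exact: cl_norm].
have hb x : I2 (fun y => `|h (x, y)|) <= `|u x| * conv (fun z => `|g z|) (fun y => `|v y|) x.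
  rewrite /conv -(I2Z (`|u x|) (conv_itg x (lint_norm hg) (cl_norm hv))).
  by rewrite le_eqVlt; apply/orP; left; apply/eqP; apply: eq_I2 => y; rewrite /h !normrM.
have E := Fubini_bnd mh h1 h2 ig hb.
transitivity (I2 (fun x => I2 (fun y => h (x, y)))).
  by apply: eq_I2 => x; rewrite -I2Z//; exact: conv_itg.
rewrite E; apply: eq_I2 => y; rewrite /conv -(I2Z (v y) (conv_itg y (lint_neg hg) hu)).
by apply: eq_I2 => x; rewrite /h /= opprB; ring.
Qed.

Lemma conv_add g v x c : lint g -> cl v -> conv g (fun y => v (y + c)) x = conv g v (x + c).
Proof.
move=> hg hv; have := I2_add c (conv_itg (x + c) hg hv); rewrite -/(conv g v (x + c)) => <-.
by apply: eq_I2 => y; rewrite opprD addrACA subrr addr0.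
Qed.

Lemma fm_add g u v c : lint g -> cl u -> cl v ->
  fm g (fun y => u (y + c)) (fun y => v (y + c)) = fm g u v.
Proof.
move=> hg hu hv; rewrite /fm -(I2_add c (I2_prod_itg hu hg hv)).
by apply: eq_I2 => x; rewrite conv_add.
Qed.

Definition supB (B : R) (v : P -> R) := forall x, B < `|x| -> v x = 0.

Lemma conv_bnd g v (B B' M : R) x : lint g -> cl v -> supB B v -> `|x| <= B' ->
  (forall z, `|z| <= B + B' -> `|g z| <= M) -> `|conv g v x| <= M * I2 (fun y => `|v y|).
Proof.
move=> hg hv sv xB gM; have ii := conv_itg x hg hv.
rewrite (le_trans (ler_norm_I2 ii))// -I2Z; last by apply: cl_itg; exact: cl_norm.
apply: I2_le; [exact: itg_norm|by apply: itgZ; apply: cl_itg; exact: cl_norm|move=> y].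
rewrite normrM; have [yB|yB] := leP `|y| B; last by rewrite sv// normr0 !mulr0.
by rewrite ler_wpM2r// gM// (le_trans (ler_normB _ _))// addrC lerD.
Qed.

Lemma conv_le g g' v (B B' : R) x : lint g -> lint g' -> cl v -> (forall y, 0 <= v y) -> supB B v ->
  `|x| <= B' -> (forall z, `|z| <= B + B' -> g z <= g' z) -> conv g v x <= conv g' v x.
Proof.
move=> hg hg' hv v0 sv xB gM; apply: I2_le; [exact: conv_itg..|move=> y].
have [yB|yB] := leP `|y| B; last by rewrite sv// !mulr0.
by rewrite ler_wpM2r// gM// (le_trans (ler_normB _ _))// addrC lerD.
Qed.

Lemma fm_le g g' u v (B B' : R) : lint g -> lint g' -> cl u -> cl v ->
  (forall y, 0 <= u y) -> (forall y, 0 <= v y) -> supB B' u -> supB B v ->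
  (forall z, `|z| <= B + B' -> g z <= g' z) -> fm g u v <= fm g' u v.
Proof.
move=> hg hg' hu hv u0 v0 su sv gM; apply: I2_le; [exact: I2_prod_itg..|move=> x].
have [xB|xB] := leP `|x| B'; last by rewrite su// !mul0r.
by rewrite ler_wpM2l//; apply: conv_le gM.
Qed.

(* [convp g v x] is the integral of [g (x + y) * v y], by [convpE]: the action of the image of [v] under [x |-> - x]. *)
Definition neg (v : P -> R) : P -> R := fun y => v (- y).
Definition convp (g v : P -> R) x := conv g (neg v) x.
Definition fmp (g u v : P -> R) : R := fm g u (neg v).

Lemma cl_ng v : cl v -> cl (neg v). Proof. exact: cl_neg. Qed.
Lemma supB_neg B v : supB B v -> supB B (neg v).
Proof. by move=> h x xB; apply: h; rewrite normrN. Qed.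

Lemma convpE g v x : lint g -> cl v -> convp g v x = I2 (fun y => g (x + y) * v y).
Proof.
move=> hg hv; rewrite /convp /conv -(I2_neg (conv_itg x hg (cl_ng hv))).
by apply: eq_I2 => y; rewrite /neg !opprK.
Qed.

(** The kernel [g (x + y)] is symmetric in its two variables whatever the parity of [g], in contrast
    with [fm_sym]. *)
Lemma fmp_sym g u v : lint g -> cl u -> cl v -> fmp g u v = fmp g v u.
Proof.
move=> hg hu hv; rewrite /fmp (fm_sym hg hu (cl_ng hv)).
have ii := I2_prod_itg (cl_ng hv) (lint_neg hg) hu.
rewrite /fm -(I2_neg ii); apply: eq_I2 => x; rewrite /neg opprK; congr (_ * _).
rewrite -/(convp g u x) convpE//.
by apply: eq_I2 => y; rewrite opprB opprK addrC.
Qed.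

Lemma fmp_linl g u u' v c : lint g -> cl u -> cl u' -> cl v ->
  fmp g (fun x => u x + c * u' x) v = fmp g u v + c * fmp g u' v.
Proof. by move=> hg hu hu' hv; apply: fm_linl => //; exact: cl_ng. Qed.

Lemma fmp_linr g u v v' c : lint g -> cl u -> cl v -> cl v' ->
  fmp g u (fun x => v x + c * v' x) = fmp g u v + c * fmp g u v'.
Proof. by move=> hg hu hv hv'; rewrite /fmp -fm_linr//; exact: cl_ng. Qed.

Lemma fm_kZ g u v c : lint g -> cl u -> cl v -> fm (fun z => c * g z) u v = c * fm g u v.
Proof.
move=> hg hu hv; rewrite /fm -(I2Z c (I2_prod_itg hu hg hv)).
apply: eq_I2 => x; rewrite mulrCA; congr (_ * _).
by rewrite /conv -(I2Z c (conv_itg x hg hv)); apply: eq_I2 => y; rewrite mulrA.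
Qed.

Lemma fm_kC u v c : cl u -> cl v -> fm (fun=> c) u v = c * (I2 u * I2 v).
Proof.
move=> hu hv; rewrite /fm.
under eq_fun => x do rewrite /conv (I2Z c (cl_itg hv)) mulrC.
by rewrite (I2Z _ (cl_itg hu)); ring.
Qed.

Lemma lintZ g c : lint g -> lint (fun z => c * g z).
Proof.
move=> [mg gi]; split; first exact: measurable_funM.
by move=> B; have := itgZ c (gi B); apply: eq_itg => x; rewrite mulrA.
Qed.

Lemma lint_cst c : lint (fun=> c).
Proof. exact: lint_llip (llip_cst c). Qed.

Lemma I2_neg' v : cl v -> I2 (neg v) = I2 v.
Proof. by move=> hv; rewrite /neg I2_neg//; exact: cl_itg. Qed.

(** * The rescaled variational problem *)

Definition e1 (t : R) : P := (t, 0).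
Definition refl (x : P) : P := (x.1, - x.2).

Lemma norm_e1 (t : R) : `|e1 t| = `|t|.
Proof. by rewrite prod_normE /= normr0 max_l. Qed.

(** The linear slope between 1 and 2 matters: it gives the definite rate of decrease exploited in
    [chi_slope]. *)
Definition tent (t : R) : R := Num.max 0 (Num.min 1 (2 - `|t|)).

Lemma tent_bnd t : 0 <= tent t <= 1.
Proof.
by rewrite /tent le_max lexx /= ge_max ler01 /= ge_min lexx.
Qed.

Lemma tent_lip t t' : `|tent t - tent t'| <= `|t - t'|.
Proof.
pose m (x : R) := Num.max 0 (Num.min 1 x).
have key (x y : R) : x <= y -> `|m x - m y| <= 1 * (y - x).
  move=> xy; rewrite /m mul1r ler_norml.
  have [y1|y1] := leP 1 y.
    rewrite (max_r ler01); have [x1|x1] := leP 1 x.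
      by rewrite (max_r ler01); apply/andP; split; lra.
    by have [x0|x0] := leP 0 x; apply/andP; split; lra.
  have -> : Num.min 1 x = x by rewrite min_r//; lra.
  by have [x0|x0] := leP 0 x; have [y0|y0] := leP 0 y; apply/andP; split; lra.
have := sym_lip key (2 - `|t|) (2 - `|t'|); rewrite mul1r => h.
apply: (le_trans h); have -> : 2 - `|t| - (2 - `|t'|) = - (`|t| - `|t'|) by ring.
by rewrite normrN; exact: ler_dist_dist.
Qed.

Lemma tent_mono t t' : `|t| <= `|t'| -> tent t' <= tent t.
Proof.
move=> h; rewrite /tent; apply: le_max2 => //; apply: le_min2 => //; lra.
Qed.

Lemma tent1 t : `|t| <= 1 -> tent t = 1.
Proof. by move=> h; rewrite /tent min_l ?max_r//; lra. Qed.

Lemma tent0 t : 2 <= `|t| -> tent t = 0.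
Proof. by move=> h; rewrite /tent max_l// ge_min; apply/orP; right; lra. Qed.

Section scaled.
Variables (Rb eta Cq : R) (Q T T1 : P -> R).

(* [Q] perturbs the interaction of the vortex with itself (its periodic images), [T] is the interaction with the opposite vortices, and [T1] stands for its [x_1] derivative. *)
Definition reg_data : Prop :=
  [/\ 1 <= Rb, 0 <= eta <= 1 & 0 <= Cq] /\
  [/\ Q 0 = 0, lipf eta Q, forall x, Q (- x) = Q x & forall x, Q (refl x) = Q x] /\
  [/\ T 0 = 0, lipf eta T & forall x, T (refl x) = T x] /\
  [/\ mbl T1, forall x, `|T1 x| <= eta & forall u t, `|u| <= 9 * Rb -> `|u + e1 t| <= 9 * Rb ->
    `|T (u + e1 t) - T u - t * T1 u| <= Cq * t ^+ 2].

Hypothesis hd : reg_data.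

Lemma Rb1 : 1 <= Rb. Proof. by have [[]] := hd. Qed.
Lemma eta0 : 0 <= eta. Proof. by have [[_ /andP[]]] := hd. Qed.
Lemma eta1 : eta <= 1. Proof. by have [[_ /andP[]]] := hd. Qed.
Lemma Cq0 : 0 <= Cq. Proof. by have [[]] := hd. Qed.
Lemma Q0 : Q 0 = 0. Proof. by have [_ [[]]] := hd. Qed.
Lemma Qlip : lipf eta Q. Proof. by have [_ [[]]] := hd. Qed.
Lemma Qeven x : Q (- x) = Q x. Proof. by have [_ [[]]] := hd. Qed.
Lemma Qrefl x : Q (refl x) = Q x. Proof. by have [_ [[]]] := hd. Qed.
Lemma T0 : T 0 = 0. Proof. by have [_ [_ [[]]]] := hd. Qed.
Lemma Tlip : lipf eta T. Proof. by have [_ [_ [[]]]] := hd. Qed.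
Lemma Trefl x : T (refl x) = T x. Proof. by have [_ [_ [[]]]] := hd. Qed.
Lemma T1m : mbl T1. Proof. by have [_ [_ [_ []]]] := hd. Qed.
Lemma T1b x : `|T1 x| <= eta. Proof. by have [_ [_ [_ []]]] := hd. Qed.
Lemma T1q u t : `|u| <= 9 * Rb -> `|u + e1 t| <= 9 * Rb ->
    `|T (u + e1 t) - T u - t * T1 u| <= Cq * t ^+ 2.
Proof. by have [_ [_ [_ [_ _]]]] := hd; apply. Qed.

Definition chi (x : P) : R := tent (x.1 / Rb) * tent (x.2 / Rb).

Lemma chi_bnd x : 0 <= chi x <= 1.
Proof.
have /andP[h1 h2] := tent_bnd (x.1 / Rb); have /andP[h3 h4] := tent_bnd (x.2 / Rb).
by rewrite /chi mulr_ge0//= mulr_ile1.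
Qed.

Lemma divRb_norm (t : R) : `|t / Rb| <= `|t|.
Proof.
have R1 := Rb1; have R0 : 0 < Rb by lra.
by rewrite normrM normfV (gtr0_norm R0) ler_pdivrMr// ler_peMr.
Qed.

Lemma chi_lip : lipf 2 chi.
Proof.
move=> x y; rewrite /chi.
have /andP[h1 h2] := tent_bnd (x.1 / Rb); have /andP[h3 h4] := tent_bnd (x.2 / Rb).
have /andP[h5 h6] := tent_bnd (y.1 / Rb); have /andP[h7 h8] := tent_bnd (y.2 / Rb).
have k1 := tent_lip (x.1 / Rb) (y.1 / Rb); have k2 := tent_lip (x.2 / Rb) (y.2 / Rb).
rewrite -mulrBl in k1; rewrite -mulrBl in k2.
have {}k1 := le_trans k1 (le_trans (divRb_norm _) (norm1 (x - y))).
have {}k2 := le_trans k2 (le_trans (divRb_norm _) (norm2 (x - y))).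
have -> : tent (x.1 / Rb) * tent (x.2 / Rb) - tent (y.1 / Rb) * tent (y.2 / Rb) =
  (tent (x.1 / Rb) - tent (y.1 / Rb)) * tent (x.2 / Rb) +
  tent (y.1 / Rb) * (tent (x.2 / Rb) - tent (y.2 / Rb)) by ring.
rewrite (le_trans (ler_normD _ _))// !normrM (ger0_norm h3) (ger0_norm h5).
have n0 := normr_ge0 (tent (x.1 / Rb) - tent (y.1 / Rb)).
have n1 := normr_ge0 (tent (x.2 / Rb) - tent (y.2 / Rb)).
nra.
Qed.

Lemma chi_sup : supB (2 * Rb) chi.
Proof.
have R1 := Rb1; have R0 : 0 < Rb by lra.
have key t : 2 * Rb < `|t| -> tent (t / Rb) = 0.
  by move=> h; apply: tent0; rewrite normrM normfV (gtr0_norm R0) ler_pdivlMr// ltW.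
move=> x; rewrite prod_normE lt_max => /orP[/key h|/key h].
  by rewrite /chi h mul0r.
by rewrite /chi h mulr0.
Qed.

Lemma cl_chi : cl chi.
Proof. by have R1 := Rb1; exists 2, (2 * Rb); split; [lra|lra|exact: chi_lip|exact: chi_sup]. Qed.

Lemma chi1 x : `|x| <= Rb -> chi x = 1.
Proof.
have R1 := Rb1; have R0 : 0 < Rb by lra.
have key t : `|t| <= Rb -> tent (t / Rb) = 1.
  by move=> h; apply: tent1; rewrite normrM normfV (gtr0_norm R0) ler_pdivrMr// mul1r.
by move=> h; rewrite /chi !key ?mulr1// (le_trans _ h)// ?norm1 ?norm2.
Qed.

Lemma chi_refl x : chi (refl x) = chi x.
Proof. by rewrite /chi /refl /= /tent mulNr normrN. Qed.

Definition kk (x : P) : R := kern x + Q x.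

Lemma lint_farK rho : 0 < rho -> llip (farK rho).
Proof.
move=> r0; apply: (_ : llip nq -> _) => [h B|].
  have [L L0 H] := h B; exists (AA * rho `^ (s - 2) * L).
    by rewrite mulr_ge0 ?mulr_ge0 ?powR_ge0 ?(ltW AA_gt0).
  move=> x y xB yB; apply: (le_trans (far_lip _ _ r0)).
  rewrite -[leRHS]mulrA; apply: ler_wpM2l; last exact: H.
  by rewrite mulr_ge0 ?powR_ge0 ?(ltW AA_gt0).
have l2 : llip (fun x => x.2).
  by move=> B; exists 1 => // x y _ _; rewrite mul1r (norm2 (x - y)).
by apply: llipD; apply: llipM => //; exact: llip_fst.
Qed.

Lemma lint_kern : lint kern.
Proof.
have [rho [/andP[r0 _] ni _]] := near_small ltr01.
have := lintD (lint_itg ni) (lint_llip (lint_farK r0)).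
by under eq_fun do rewrite subrK.
Qed.

Lemma llipQ : llip Q. Proof. exact: lipf_llip eta0 Qlip. Qed.
Lemma llipT : llip T. Proof. exact: lipf_llip eta0 Tlip. Qed.

Lemma lint_kk : lint kk.
Proof. by apply: lintD; [exact: lint_kern|exact: lint_llip llipQ]. Qed.

Lemma nqN x : nq (- x) = nq x. Proof. by rewrite /nq /= !sqrrN. Qed.
Lemma nq_refl x : nq (refl x) = nq x. Proof. by rewrite /nq /= sqrrN. Qed.

Lemma kk_even x : kk (- x) = kk x.
Proof. by rewrite /kk /kern nqN Qeven. Qed.

Lemma fm_kk_sym u v : cl u -> cl v -> fm kk u v = fm kk v u.
Proof.
move=> hu hv; apply: (etrans (fm_sym lint_kk hu hv)).
by apply: (congr1 (fun g => fm g v u)); apply/funext => z; exact: kk_even.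
Qed.

Definition Tc (c : R) (u : P) : R := T (u + e1 c).
Definition T1c (c : R) (u : P) : R := T1 (u + e1 c).

Lemma lint_Tc c : lint (Tc c).
Proof. by apply: lint_add; exact: lint_llip llipT. Qed.
Lemma lint_T1c c : lint (T1c c).
Proof. by apply: lint_add; exact: (lint_bnd T1m T1b). Qed.

(* Displacing the opposite vortex by [2 * ac w] makes the energy invariant under translations in [x_1]; differentiating this displacement creates the term [lam w * x.1], which becomes the travelling speed. *)
Definition mom (w : P -> R) : R := I2 (fun x => w x * x.1).
Definition ac (w : P -> R) : R := - mom w.
Definition lam (w : P -> R) : R := fmp (T1c (2 * ac w)) w w.
Definition Pot (w : P -> R) (x : P) : R :=
  conv kk w x - convp (Tc (2 * ac w)) w x + lam w * x.1.
Definition Jw (w : P -> R) : R := fm kk w w / 2 - fmp (Tc (2 * ac w)) w w / 2.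

(* The bounds [M] and [Lam] provide compactness; they turn out not to be active at a maximizer. *)
Definition Kc (M Lam : R) (v : P -> R) : Prop :=
  [/\ lipf Lam v, forall x, 0 <= v x <= M, forall x, v (refl x) = v x & I2 (fun x => chi x * v x) = 1].

Definition ww (v : P -> R) (x : P) : R := chi x * v x.
Definition JJ (v : P -> R) : R := Jw (ww v) - I2 (fun x => chi x * FF (v x)).

Lemma cl_mom w : cl w -> itg (fun x => w x * x.1).
Proof. by move=> h; apply: cl_itg; apply: clM => //; exact: llip_fst. Qed.

Lemma mom_bnd (B : R) w : cl w -> (forall x, 0 <= w x) -> supB B w -> `|mom w| <= B * I2 w.
Proof.
move=> hw w0 sw; rewrite (le_trans (ler_norm_I2 (cl_mom hw)))// -I2Z; last exact: cl_itg.
apply: I2_le; [apply: itg_norm; exact: cl_mom|apply: itgZ; exact: cl_itg|move=> x].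
rewrite normrM (ger0_norm (w0 x)) mulrC.
have [xB|xB] := leP `|x| B; last by rewrite sw// !mulr0.
by rewrite ler_wpM2r// (le_trans (norm1 x)).
Qed.

Lemma FF_llip v (M L : R) : 0 <= L -> lipf L v -> (forall x, 0 <= v x <= M) -> llip (fun x => FF (v x)).
Proof.
move=> L0 hL hM B; have M0 : 0 <= M by have /andP[] := hM 0; exact: le_trans.
exists ((Num.sqrt M + M) * L) => [|x y _ _].
  by rewrite mulr_ge0// addr_ge0// sqrtr_ge0.
rewrite (le_trans (FF_lip (hM x) (hM y)))// -mulrA ler_wpM2l ?hL//.
by rewrite addr_ge0// sqrtr_ge0.
Qed.

(** * First variation, continuity and maximum of the energy *)

Section J.
Variables M Lam : R.
Hypothesis L0 : 0 <= Lam.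

Ltac cln := repeat match goal with H : ?A |- _ =>
  first [constr_eq H hs; fail 1 | constr_eq H hd; fail 1 | constr_eq H L0; fail 1 | constr_eq H smu2; fail 1 | clear H] end.
Ltac lar := cln; intros; lra.
Ltac nar := cln; intros; nra.

Lemma cl_ww v : Kc M Lam v -> cl (ww v).
Proof. by move=> [hL _ _ _]; apply: clM; [exact: cl_chi|exact: lipf_llip hL]. Qed.

Lemma ww_ge0 v x : Kc M Lam v -> 0 <= ww v x.
Proof.
by move=> [_ /(_ x)/andP[h _] _ _]; rewrite mulr_ge0//; have /andP[] := chi_bnd x.
Qed.

Lemma ww_sup v : supB (2 * Rb) (ww v).
Proof. by move=> x /chi_sup h; rewrite /ww h mul0r. Qed.

Lemma cl_chiFF v : Kc M Lam v -> cl (fun x => chi x * FF (v x)).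
Proof. by move=> [hL hM _ _]; apply: clM; [exact: cl_chi|exact: FF_llip hL hM]. Qed.

Lemma Kc_conv v v' (t : R) : Kc M Lam v -> Kc M Lam v' -> 0 <= t <= 1 ->
  Kc M Lam (fun x => v x + t * (v' x - v x)).
Proof.
move=> k k' /andP[t0 t1]; have [hL hM hr hI] := k; have [hL' hM' hr' hI'] := k'.
split.
- move=> x y; have -> : v x + t * (v' x - v x) - (v y + t * (v' y - v y)) =
    (1 - t) * (v x - v y) + t * (v' x - v' y) by ring.
  rewrite (le_trans (ler_normD _ _))// !normrM (ger0_norm t0) (@ger0_norm _ (1 - t)); last by lra.
  have -> : Lam * `|x - y| = (1 - t) * (Lam * `|x - y|) + t * (Lam * `|x - y|) by ring.
  by apply: lerD; apply: ler_wpM2l; rewrite ?hL ?hL'//; lra.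
- by move=> x; have /andP[? ?] := hM x; have /andP[? ?] := hM' x; apply/andP; split; nra.
- by move=> x; rewrite hr hr'.
- have c1 := cl_itg (cl_ww k); have c2 := cl_itg (cl_ww k').
  transitivity ((1 - t) * I2 (ww v) + t * I2 (ww v')); last by rewrite /ww hI hI'; ring.
  rewrite -!I2Z// -I2D; [|exact: itgZ..].
  by apply: eq_I2 => x; rewrite /ww; ring.
Qed.

Lemma ac_bnd v : Kc M Lam v -> `|ac (ww v)| <= 2 * Rb.
Proof.
move=> k; rewrite /ac normrN.
have := mom_bnd (cl_ww k) (fun x => ww_ge0 x k) (@ww_sup v).
by have [_ _ _ hI] := k; rewrite [I2 (ww v)]hI mulr1.
Qed.

(** Differences of points of the cut-off region have norm at most [4 * Rb] and the displacement adds
    at most [4 * Rb]. The last [Rb] of the range in [T1q] is kept for the unit translations in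
    [trans_lhs]. *)
Lemma box9 z c : `|z| <= 2 * Rb + 2 * Rb -> `|c| <= 2 * Rb -> `|z + e1 (2 * c)| <= 9 * Rb.
Proof.
move=> hz hc; have R1 := Rb1; rewrite (le_trans (ler_normD _ _))// norm_e1 normrM (@ger0_norm _ 2)//.
by move: hz hc R1; move: (`|z|) (`|c|) => u v; lra.
Qed.

Lemma step_arith1 (A B X C t al : R) : A - B - X <= C * (2 * t * al) ^+ 2 ->
  A <= B + (X + 4 * C * al ^+ 2 * t ^+ 2).
Proof. have -> : C * (2 * t * al) ^+ 2 = 4 * C * al ^+ 2 * t ^+ 2 by ring. move=> h; lra. Qed.

Lemma step_arith3 (c t A B D : R) : c * A <= c * (B + t * (D - B)) -> c * A <= c * B + t * (c * D - c * B).
Proof. by have -> : c * (B + t * (D - B)) = c * B + t * (c * D - c * B) by ring. Qed.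

Lemma step_arith2 (A0 A1 A2 E E0 E1 E2 X0 X1 X2 C F F0 F1 t al : R) : 0 <= t <= 1 -> 0 <= C ->
  E <= E0 + 2 * t * E1 + t ^+ 2 * E2 + (2 * t * al * (X0 + t * X1 + t ^+ 2 * X2) + 4 * C * al ^+ 2 * t ^+ 2) ->
  F <= F0 + t * (F1 - F0) ->
  A0 / 2 - E0 / 2 - F0 + t * (A1 - E1 - al * X0 - F1 + F0)
    - (`|A2| + `|E2| + 4 * C * al ^+ 2 + 2 * `|al| * (`|X1| + `|X2|)) * t ^+ 2
  <= (A0 + 2 * t * A1 + t ^+ 2 * A2) / 2 - E / 2 - F.
Proof.
move=> /andP[t0 t1] C0 hE hF.
have n1 := ler_norm (- A2); have n2 := ler_norm E2; rewrite normrN in n1.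
have n3 : al * (X1 + t * X2) <= `|al| * (`|X1| + `|X2|).
  rewrite (le_trans (ler_norm _))// normrM ler_wpM2l// (le_trans (ler_normD _ _))// lerD2l.
  by rewrite normrM (ger0_norm t0) ler_piMl.
have tt0 : 0 <= t ^+ 2 by rewrite sqr_ge0.
have m1 := ler_wpM2l tt0 n1; have m2 := ler_wpM2l tt0 n2; have m3 := ler_wpM2l tt0 n3.
have q0 : 0 <= C * al ^+ 2 * t ^+ 2 by apply: mulr_ge0; [apply: mulr_ge0|]; rewrite ?sqr_ge0.
have a0 : 0 <= t ^+ 2 * (`|A2| + `|E2|) by rewrite mulr_ge0 ?addr_ge0.
have a1 : 0 <= t ^+ 2 * (`|al| * (`|X1| + `|X2|)) by rewrite mulr_ge0 ?mulr_ge0 ?addr_ge0.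
move: m1 m2 m3 q0 a0 a1 hE hF; move: (`|A2|) (`|E2|) (`|al|) (`|X1|) (`|X2|) => z1 z2 z3 z4 z5.
move=> m1 m2 m3 q0 a0 a1 hE hF; lra.
Qed.

(** A one-sided Taylor expansion along the segment from [v] to [v']. The bilinear forms expand
    exactly, the entropy is convex, and the displacement, which moves with [t], is expanded to first
    order with the quadratic error of [T1q]. A lower bound is enough to test a maximizer. *)
Lemma JJ_step v v' : Kc M Lam v -> Kc M Lam v' -> exists D : R, forall t, 0 <= t <= 1 ->
  JJ v + t * (I2 (fun x => (ww v' x - ww v x) * Pot (ww v) x) - I2 (fun x => chi x * FF (v' x))
    + I2 (fun x => chi x * FF (v x))) - D * t ^+ 2 <= JJ (fun x => v x + t * (v' x - v x)).
Proof.
move=> k k'; set w := ww v; set h := fun x => ww v' x - w x.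
have cw : cl w := cl_ww k.
have ch : cl h by apply: clB => //; exact: cl_ww.
have lk := lint_kk.
pose a := ac w; pose al := - mom h.
pose Ta := Tc (2 * a); pose T1a := T1c (2 * a).
have lT : lint Ta := lint_Tc _; have lT1 : lint T1a := lint_T1c _.
pose X1 := fmp T1a h w + fmp T1a w h; pose X2 := fmp T1a h h.
exists (`|fm kk h h| + `|fmp Ta h h| + 4 * Cq * al ^+ 2 + 2 * `|al| * (`|X1| + `|X2|)) => t t01.
have /andP[t0 t1] := t01.
have kt := Kc_conv k k' t01; set vt := fun x => v x + t * (v' x - v x).
have Ew : ww vt = fun x => w x + t * h x.
  by apply/funext => x; rewrite /vt /h /w /ww; ring.
have cwt := cl_ww kt; rewrite -/vt in cwt kt.
have hE1 : fm kk (ww vt) (ww vt) = fm kk w w + 2 * t * fm kk h w + t ^+ 2 * fm kk h h.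
  have cs : cl (fun x => w x + t * h x) by apply: clD => //; exact: clZ.
  rewrite Ew (fm_linl t lk cw ch cs) (fm_linr t lk cw cw ch) (fm_linr t lk ch cw ch).
  move: (fm_kk_sym cw ch) => ->; move: (fm kk w w) (fm kk h w) (fm kk h h) => A B C; ring.
have hac : ac (ww vt) = a + t * al.
  rewrite /a /al /ac /mom Ew.
  have -> : I2 (fun x => (w x + t * h x) * x.1) = mom w + t * mom h.
    rewrite /mom -(I2Z t (cl_mom ch)) -(I2D (cl_mom cw) (itgZ t (cl_mom ch))).
    by apply: eq_I2 => x; ring.
  by rewrite /mom; ring.
(* A majorant of the displaced kernel at parameter [t]: the displacement changes by [2 * t * al],
   and [Cq * (2 * t * al) ^ 2] is the Taylor error. *)
pose G u := Ta u + (2 * t * al * T1a u + 4 * Cq * al ^+ 2 * t ^+ 2).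
have lG2 : lint (fun u => 2 * t * al * T1a u + 4 * Cq * al ^+ 2 * t ^+ 2).
  by apply: lintD; [exact: lintZ|exact: lint_cst].
have lG : lint G by apply: lintD.
have hE2 : fmp (Tc (2 * ac (ww vt))) (ww vt) (ww vt) <= fmp G (ww vt) (ww vt).
  apply: (@fm_le _ _ _ _ (2 * Rb) (2 * Rb)) => //.
  - exact: lint_Tc.
  - exact: cl_ng.
  - by move=> y; exact: (ww_ge0 y kt).
  - by move=> y; exact: (ww_ge0 (- y) kt).
  - exact: ww_sup.
  - by apply: supB_neg; exact: ww_sup.
  - move=> z zB; have R1 := Rb1.
    have ba := ac_bnd k; have ba' := ac_bnd kt.
    rewrite -/w -/a in ba; rewrite -/vt in ba'.
    have ez : z + e1 (2 * ac (ww vt)) = z + e1 (2 * a) + e1 (2 * t * al).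
      by rewrite hac -addrA; congr (_ + _); apply: (congr2 pair) => /=; ring.
    have := @T1q (z + e1 (2 * a)) (2 * t * al) (box9 zB ba).
    rewrite -ez => /(_ (box9 zB ba')); rewrite ler_norml => /andP[_].
    exact: step_arith1.
have hI : I2 (ww vt) = 1 by have [] := kt.
have hE3 : fmp G (ww vt) (ww vt) = fmp Ta w w + 2 * t * fmp Ta h w + t ^+ 2 * fmp Ta h h
  + (2 * t * al * (fmp T1a w w + t * X1 + t ^+ 2 * X2) + 4 * Cq * al ^+ 2 * t ^+ 2).
  have cn := cl_ng cwt.
  rewrite /fmp /G (fm_kD lT lG2 cwt cn) (fm_kD (lintZ _ lT1) (lint_cst _) cwt cn).
  rewrite (fm_kZ _ lT1 cwt cn) (fm_kC _ cwt cn) (I2_neg' cwt) hI !mulr1.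
  rewrite -!/(fmp _ _ _) Ew.
  have cs : cl (fun x => w x + t * h x) by apply: clD => //; exact: clZ.
  rewrite (fmp_linl t lT cw ch cs) (fmp_linr t lT cw cw ch) (fmp_linr t lT ch cw ch).
  rewrite (fmp_linl t lT1 cw ch cs) (fmp_linr t lT1 cw cw ch) (fmp_linr t lT1 ch cw ch).
  rewrite (fmp_sym lT cw ch) /X1 /X2.
  move: (fmp Ta w w) (fmp Ta h w) (fmp Ta h h) (fmp T1a w w) (fmp T1a h w) (fmp T1a w h) (fmp T1a h h) => r1 r2 r3 r4 r5 r6 r7.
  ring.
have hE4 : I2 (fun x => chi x * FF (vt x)) <= I2 (fun x => chi x * FF (v x)) +
    t * (I2 (fun x => chi x * FF (v' x)) - I2 (fun x => chi x * FF (v x))).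
  have i1 := cl_itg (cl_chiFF k); have i2 := cl_itg (cl_chiFF k').
  rewrite -I2B// -I2Z; last exact: itgB.
  rewrite -I2D//; last by apply: itgZ; exact: itgB.
  apply: I2_le; [exact: cl_itg (cl_chiFF kt)|by apply: itgD => //; apply: itgZ; exact: itgB|move=> x].
  have [_ /(_ x)/andP[v0 _] _ _] := k; have [_ /(_ x)/andP[v'0 _] _ _] := k'.
  have := FF_conv v0 v'0 t01; have /andP[c0 _] := chi_bnd x.
  by move=> /(ler_wpM2l c0); exact: step_arith3.
(* Moving the displacement contributes [- al * fmp T1a w w]. Since [al = - mom h], this is the
   pairing of [h] with [lam w * x.1], which is why [Pot] contains that term. *)
have hE5 : I2 (fun x => h x * Pot w x) = fm kk h w - fmp Ta h w - al * fmp T1a w w.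
  have l1 := I2_prod_itg ch lk cw; have l2 := I2_prod_itg ch lT (cl_ng cw).
  rewrite /fmp {1 2}/fm -I2B// /al mulNr opprK mulrC -I2Z; last exact: cl_mom.
  rewrite -I2D; [|exact: itgB|by apply: itgZ; exact: cl_mom].
  apply: eq_I2 => x; rewrite /Pot /lam /convp -/a -/Ta -/T1a /fmp.
  move: (conv kk w x) (conv Ta (neg w) x) (fm T1a w (neg w)) (h x) => r1 r2 r3 r4; ring.
rewrite /JJ /Jw -/w -/a -/Ta hE1.
move: hE2; rewrite hE3 hE5 => hE2.
exact: step_arith2 t01 Cq0 hE2 hE4.
Qed.

Lemma conv_supB g u (B A : R) x : lint g -> cl u -> 0 <= A -> supB B u -> (forall y, `|u y| <= A) -> `|x| <= B ->
  `|conv g u x| <= A * I2 (fun z => `|g z| * box (2 * B) z).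
Proof.
move=> lg cu A0 su uA xB.
have [_ ig] := lint_norm lg.
rewrite (conv_sub x lg cu) (le_trans (ler_norm_I2 (lintM lg (cl_sub x cu))))//.
rewrite -(I2Z A (ig _)); apply: I2_le => [||z].
- by apply: itg_norm; exact: lintM lg (cl_sub x cu).
- exact: itgZ.
rewrite normrM.
have [zB|zB] := leP `|z| (2 * B).
  by rewrite box1// mulr1 mulrC ler_wpM2r.
rewrite su ?normr0 ?mulr0 ?mulr_ge0 ?box_ge0//.
have := ler_normB x (x - z); rewrite opprB addrC subrK => h.
by move: h xB zB; move: (`|x|) (`|z|) (`|x - z|) ; lar.
Qed.

Lemma fm_conv_bnd g u v (B N : R) : lint g -> cl u -> cl v -> supB B u ->
  (forall x, `|x| <= B -> `|conv g v x| <= N) -> `|fm g u v| <= N * I2 (fun x => `|u x|).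
Proof.
move=> lg cu cv su hN.
have cu' := cl_itg (cl_norm cu).
have iu := I2_prod_itg cu lg cv.
rewrite /fm (le_trans (ler_norm_I2 iu))// -(I2Z N cu').
apply: I2_le => [||x]; [exact: itg_norm|exact: itgZ|].
rewrite normrM mulrC; have [xB|xB] := leP `|x| B; last by rewrite su// normr0 !mulr0.
by apply: ler_wpM2r => //; exact: hN.
Qed.

Lemma fm_conv_bnd1 g u v (B N : R) : lint g -> cl u -> cl v -> supB B u ->
  (forall x, `|x| <= B -> `|conv g v x| <= N) -> I2 (fun x => `|u x|) = 1 -> `|fm g u v| <= N.
Proof. by move=> lg cu cv su hN m1; have := fm_conv_bnd lg cu cv su hN; rewrite m1 mulr1. Qed.

Lemma I2_supB u (B A : R) : 0 <= B -> cl u -> supB B u -> (forall x, `|u x| <= A) ->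
  I2 (fun x => `|u x|) <= A * (2 * B) ^+ 2.
Proof.
move=> B0 cu su uA; rewrite -I2_box// -I2Z; last exact: itg_box.
apply: I2_le => [||x]; [exact: cl_itg (cl_norm cu)|by apply: itgZ; exact: itg_box|].
have [xB|xB] := leP `|x| B; first by rewrite box1// mulr1.
by rewrite su// normr0 box0// mulr0.
Qed.

Lemma Tc_bnd c z : `|c| <= 4 * Rb -> `|z| <= 4 * Rb -> `|Tc c z| <= 8 * Rb.
Proof.
move=> hc hz; have := Tlip (z + e1 c) 0; rewrite T0 !subr0 => h.
have h1 := ler_normD z (e1 c); rewrite norm_e1 in h1.
rewrite /Tc (le_trans h)//; have := eta1; have := eta0; have R1 := Rb1.
have := normr_ge0 (z + e1 c).
move: h1 hc hz; move: (`|z + e1 c|) (`|z|) (`|c|) ; nar.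
Qed.

Lemma Kc_mass v : Kc M Lam v -> I2 (fun x => `|ww v x|) = 1.
Proof.
move=> k; have [_ _ _ hI] := k; rewrite -[RHS]hI; apply: eq_I2 => x.
by rewrite ger0_norm//; exact: ww_ge0 k.
Qed.

Lemma Kc_M0 v : Kc M Lam v -> 0 <= M.
Proof. by move=> [_ /(_ 0)/andP[h1 h2] _ _]; exact: le_trans h2. Qed.

Lemma ww_le v x : Kc M Lam v -> `|ww v x| <= M.
Proof.
move=> k; rewrite (ger0_norm (ww_ge0 x k)) /ww; have [_ /(_ x)/andP[v0 vM] _ _] := k.
by have /andP[h1 h2] := chi_bnd x; rewrite (le_trans _ vM)// ler_piMl.
Qed.

Lemma JJ_bounded : exists S : R, forall v, Kc M Lam v -> JJ v <= S.
Proof.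
pose N := I2 (fun z => `|kk z| * box (2 * (2 * Rb)) z).
exists ((M * N + 8 * Rb) / 2) => v k.
have R1 := Rb1; have m1 := Kc_mass k; have cw := cl_ww k; have M0 := Kc_M0 k.
have h1 : `|fm kk (ww v) (ww v)| <= M * N.
  apply: (fm_conv_bnd1 lint_kk cw cw (@ww_sup v) _ m1) => x xB.
  by apply: (conv_supB lint_kk cw M0 (@ww_sup v) _ xB) => y; exact: ww_le k.
have lT := lint_Tc (2 * ac (ww v)).
have cn := cl_ng cw; have sn := supB_neg (@ww_sup v).
have mn : I2 (fun x => `|neg (ww v) x|) = 1.
  by rewrite -m1 -[RHS](I2_neg' (cl_norm cw)).
have ha : `|2 * ac (ww v)| <= 4 * Rb.
  by rewrite normrM ger0_norm//; have := ac_bnd k; move: (`|ac _|) ; lar.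
have h2 : `|fmp (Tc (2 * ac (ww v))) (ww v) (ww v)| <= 8 * Rb.
  apply: (fm_conv_bnd1 lT cw cn (@ww_sup v) _ m1) => x xB.
  rewrite (le_trans (conv_bnd lT cn sn xB _ (M := 8 * Rb)))// ?mn ?mulr1// => z zB.
  by apply: Tc_bnd => //; move: zB; move: (`|z|) ; lar.
have h3 : 0 <= I2 (fun x => chi x * FF (v x)).
  apply: I2_ge0 => x; have /andP[c0 _] := chi_bnd x; rewrite mulr_ge0// FF_ge0//.
  by have [_ /(_ x)/andP[]] := k.
rewrite /JJ /Jw; have := ler_norm (- fmp (Tc (2 * ac (ww v))) (ww v) (ww v)); rewrite normrN.
have := ler_norm (fm kk (ww v) (ww v)); move: h1 h2 h3.
move: (fm _ _ _) (fmp _ _ _) (I2 _) => a b c; move: (`|a|) (`|b|) (M * N); lar.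
Qed.

(** One constant serves the whole class. The difference [h] of the cut-off densities is at most [e]
    on a fixed box, so each form changes by a multiple of [e]; the displacement changes by a
    multiple of the integral of [|h|], which [hE3] handles with the Lipschitz bound of [T]. *)
Lemma JJ_cont : exists2 D : R, 0 <= D & forall v v' (e : R), Kc M Lam v -> Kc M Lam v' -> 0 <= e ->
  (forall x, `|x| <= 2 * Rb -> `|v x - v' x| <= e) -> JJ v' <= JJ v + D * e.
Proof.
pose N := I2 (fun z => `|kk z| * box (2 * (2 * Rb)) z).
have N0 : 0 <= N by apply: I2_ge0 => z; rewrite mulr_ge0// box_ge0.
have R1 := Rb1; have R0 : 0 <= 2 * Rb by lra.
have [[v0 k0]|no] := pselect (exists v, Kc M Lam v); last by exists 0 => // v v' e k; case: no; exists v.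
have M0 := Kc_M0 k0; pose m : R := (2 * (2 * Rb)) ^+ 2.
have m0 : 0 <= m by rewrite sqr_ge0.
have sM : 0 <= Num.sqrt M + M by rewrite addr_ge0// sqrtr_ge0.
exists (N + 8 * Rb * m + 2 * Rb * m + (Num.sqrt M + M) * m).
  by rewrite !addr_ge0// ?mulr_ge0//; lra.
move=> v v' e k k' e0 ve.
pose h x := ww v' x - ww v x.
have cw := cl_ww k; have cw' := cl_ww k'; have ch : cl h by apply: clB.
have sh : supB (2 * Rb) h by move=> x xB; rewrite /h !ww_sup// subrr.
have hE x : `|h x| <= e.
  have [xB|xB] := leP `|x| (2 * Rb); last by rewrite sh// normr0.
  rewrite /h /ww -mulrBr normrM; have /andP[c0 c1] := chi_bnd x.
  rewrite (ger0_norm c0) distrC; have := ve x xB; have := normr_ge0 (v x - v' x).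
  by move: c0 c1; move: (chi x) (`|_|) ; nar.
have mh : I2 (fun x => `|h x|) <= e * m by apply: I2_supB.
have m1 := Kc_mass k; have m1' := Kc_mass k'.
have Ew' : ww v' = fun x => ww v x + 1 * h x by apply/funext => x; rewrite /h mul1r addrC subrK.
have kh u : cl u -> supB (2 * Rb) u -> I2 (fun x => `|u x|) = 1 -> `|fm kk u h| <= e * N.
  move=> cu su mu1; apply: (fm_conv_bnd1 lint_kk cu ch su _ mu1) => x xB.
  exact: conv_supB lint_kk ch e0 sh hE xB.
have hE1 : fm kk (ww v') (ww v') <= fm kk (ww v) (ww v) + 2 * (e * N).
  have E : fm kk (ww v') (ww v') = fm kk (ww v) (ww v) + fm kk (ww v) h + fm kk (ww v') h.
    have cs : cl (fun x => ww v x + 1 * h x) by rewrite -Ew'.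
    rewrite {2}Ew' (fm_linr 1 lint_kk cw' cw ch) mul1r (fm_kk_sym cw' cw).
    by rewrite {1}Ew' (fm_linr 1 lint_kk cw cw ch) mul1r.
  have := ler_norm (fm kk (ww v) h); have := ler_norm (fm kk (ww v') h).
  have := kh _ cw (@ww_sup v) m1; have := kh _ cw' (@ww_sup v') m1'.
  rewrite E; move: (fm kk (ww v) (ww v)) (fm kk (ww v) h) (fm kk (ww v') h) => a b c.
  move: (`|b|) (`|c|) (e * N) ; lar.
pose a := 2 * ac (ww v); pose a' := 2 * ac (ww v').
have ha' : `|a'| <= 4 * Rb.
  by rewrite normrM ger0_norm//; have := ac_bnd k'; move: (`|ac _|) ; lar.
have ha : `|a| <= 4 * Rb.
  by rewrite normrM ger0_norm//; have := ac_bnd k; move: (`|ac _|) ; lar.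
have lT := lint_Tc a.
have aa : `|a - a'| <= 2 * (2 * Rb * (e * m)).
  have -> : a - a' = 2 * mom h.
    rewrite /a /a' /ac -mulrBr; congr (_ * _); rewrite opprK addrC /mom.
    rewrite -(I2B (cl_mom cw') (cl_mom cw)); apply: eq_I2 => x; rewrite /h; ring.
  rewrite normrM (@ger0_norm _ 2)// ler_wpM2l// (le_trans (ler_norm_I2 (cl_mom ch)))//.
  apply: (@le_trans _ _ (2 * Rb * I2 (fun x => `|h x|))); last by rewrite ler_wpM2l.
  rewrite -(I2Z _ (cl_itg (cl_norm ch))); apply: I2_le => [||x].
  - by apply: itg_norm; exact: cl_mom.
  - by apply: itgZ; exact: cl_itg (cl_norm ch).
  rewrite normrM mulrC; have [xB|xB] := leP `|x| (2 * Rb); last by rewrite sh// normr0 !mulr0.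
  by rewrite ler_wpM2r// (le_trans (norm1 x)).
have Th u : cl u -> supB (2 * Rb) u -> I2 (fun x => `|u x|) = 1 -> `|fmp (Tc a) u h| <= 8 * Rb * (e * m).
  move=> cu su mu1; have cn := cl_ng ch; apply: (fm_conv_bnd1 lT cu cn su _ mu1) => x xB.
  have mn : I2 (fun x => `|neg h x|) <= e * m.
    by rewrite (_ : I2 _ = I2 (fun x => `|h x|))// -[RHS](I2_neg' (cl_norm ch)).
  apply: (le_trans (conv_bnd lT cn (supB_neg sh) xB _ (M := 8 * Rb))).
    by move=> z zB; apply: Tc_bnd => //; move: zB; move: (`|z|) ; lar.
  by rewrite ler_wpM2l//; lra.
have hE2 : fmp (Tc a) (ww v) (ww v) <= fmp (Tc a) (ww v') (ww v') + 2 * (8 * Rb * (e * m)).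
  have E : fmp (Tc a) (ww v') (ww v') = fmp (Tc a) (ww v) (ww v) + fmp (Tc a) (ww v) h + fmp (Tc a) (ww v') h.
    have cs : cl (fun x => ww v x + 1 * h x) by rewrite -Ew'.
    rewrite {2}Ew' (fmp_linr 1 lT cw' cw ch) mul1r (fmp_sym lT cw' cw).
    by rewrite {1}Ew' (fmp_linr 1 lT cw cw ch) mul1r.
  have := ler_norm (- fmp (Tc a) (ww v) h); have := ler_norm (- fmp (Tc a) (ww v') h); rewrite !normrN.
  have := Th _ cw (@ww_sup v) m1; have := Th _ cw' (@ww_sup v') m1'.
  rewrite E; move: (fmp _ (ww v) (ww v)) (fmp _ (ww v) h) (fmp _ (ww v') h) => x y z.
  move: (`|y|) (`|z|) (e * m) ; lar.
have hE3 : fmp (Tc a) (ww v') (ww v') <= fmp (Tc a') (ww v') (ww v') + 2 * (2 * Rb * (e * m)).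
  set c : R := 2 * (2 * Rb * (e * m)) in aa *.
  have lG : lint (fun u => Tc a' u + c) by apply: lintD; [exact: lint_Tc|exact: lint_cst].
  have cn := cl_ng cw'.
  apply: (@le_trans _ _ (fmp (fun u => Tc a' u + c) (ww v') (ww v'))).
    apply: (fm_le lT lG cw' cn (fun y => ww_ge0 y k') (fun y => ww_ge0 (- y) k') (@ww_sup v') (supB_neg (@ww_sup v'))) => z _.
    have := Tlip (z + e1 a) (z + e1 a').
    have -> : z + e1 a - (z + e1 a') = e1 (a - a').
      by rewrite opprD addrACA subrr add0r; apply: (congr2 pair) => /=; rewrite ?subrr.
    rewrite norm_e1 ler_norml => /andP[_ q]; rewrite /Tc.
    have := eta1; have := eta0; have := normr_ge0 (a - a').
    move: q aa; move: (`|a - a'|) (T _) (T _) ; nar.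
  rewrite /fmp (fm_kD (lint_Tc a') (lint_cst c) cw' cn) (fm_kC c cw' cn) (I2_neg' cw').
  by have [_ _ _ hI] := k'; rewrite [I2 (ww v')]hI !mulr1.
have hE4 : I2 (fun x => chi x * FF (v x)) - I2 (fun x => chi x * FF (v' x)) <= (Num.sqrt M + M) * (e * m).
  have i1 := cl_chiFF k; have i2 := cl_chiFF k'.
  rewrite -(I2B (cl_itg i1) (cl_itg i2)).
  have sx : supB (2 * Rb) (fun x => chi x * FF (v x) - chi x * FF (v' x)).
    by move=> x xB; rewrite !chi_sup// !mul0r subrr.
  have ci := clB i1 i2.
  rewrite mulrA (le_trans (ler_norm _))// (le_trans (ler_norm_I2 (cl_itg ci)))//.
  apply: (I2_supB R0 ci sx) => x; rewrite -mulrBr normrM.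
  have /andP[c0 c1] := chi_bnd x; rewrite (ger0_norm c0).
  have [xB|xB] := leP `|x| (2 * Rb); last by rewrite chi_sup// mul0r mulr_ge0.
  have [_ hM _ _] := k; have [_ hM' _ _] := k'.
  rewrite (@le_trans _ _ (`|FF (v x) - FF (v' x)|))// ?ler_piMl//.
  by rewrite (le_trans (FF_lip (hM x) (hM' x)))// ler_wpM2l// ve.
rewrite /JJ /Jw -/a -/a'; move: hE1 hE2 hE3 hE4.
move: (fm kk _ _) (fm kk _ _) (fmp _ _ _) (fmp _ _ _) (fmp _ _ _) (I2 _) (I2 _) (Num.sqrt M + M) => r1 r2 r3 r4 r5 r6 r7 r8.
move; lar.
Qed.

Lemma ultra_push (U : set_system nat) (f : nat -> R) : UltraFilter U -> UltraFilter (f @ U).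
Proof.
move=> UU; split; first exact: fmap_proper_filter.
move=> G PG FG; apply/seteqP; split => [A GA|]; last exact: FG.
have [//|h] := in_ultra_setVsetC (f @^-1` A) UU.
have /FG GA' : (f @ U) (~` A) by [].
have := filterI GA GA'; rewrite setICr => G0.
by case: (@filter_not_empty _ _ PG (G0 _)).
Qed.

(** Limits along a single ultrafilter containing the neighbourhoods of infinity replace the
    extraction of a subsequence. They exist at all points simultaneously because the values stay in
    the compact [[0, M]]. *)
Lemma ultra_lim (v_ : nat -> P -> R) : (forall n x, 0 <= v_ n x <= M) ->
  exists (U : set_system nat) (v : P -> R), [/\ ProperFilter U, \oo `<=` U &
    forall x (e : R), 0 < e -> U [set n | `|v_ n x - v x| < e]].
Proof.
move=> hv; have [U [UU Uoo]] := @ultraFilterLemma nat \oo _.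
have H x : exists l : R, forall e : R, 0 < e -> U [set n | `|v_ n x - l| < e].
  have UF : UltraFilter (v_ ^~ x @ U) by exact: ultra_push.
  have := @segment_compact R 0 M; rewrite compact_ultra => /(_ _ UF).
  case.
    suff : U ((v_ ^~ x) @^-1` `[0, M]%classic) by [].
    have -> : (v_ ^~ x) @^-1` `[0, M]%classic = setT.
      by apply/seteqP; split => // n _ /=; rewrite in_itv/=; exact: hv.
    exact: filterT.
  move=> l [_ hl]; exists l => e e0.
  have := hl _ (nbhsx_ballx l e e0).
  suff -> : [set n | `|v_ n x - l| < e] = (v_ ^~ x) @^-1` ball l e by [].
  by apply/seteqP; split => n; rewrite /= /ball /= distrC.
have [v hvl] := choice H.
by exists U, v; split => //; exact: ultra_proper.
Qed.

(** The common Lipschitz constant and the compactness of the box of half-side [2 * Rb] turn the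
    pointwise limit of a maximizing sequence into a uniform one ([unif]), so that the mass
    constraint and the energy pass to the limit. *)
Lemma JJ_max : (exists v, Kc M Lam v) ->
  exists2 v, Kc M Lam v & forall v', Kc M Lam v' -> JJ v' <= JJ v.
Proof.
move=> [v0 k0].
pose E := [set y | exists2 v, Kc M Lam v & y = JJ v].
have hE : has_sup E.
  split; first by exists (JJ v0), v0.
  by have [S hS] := JJ_bounded; exists S => _ [v /hS h ->].
have H (n : nat) : exists v, Kc M Lam v /\ sup E - n.+1%:R^-1 < JJ v.
  have [|_ [v k ->] h] := @sup_adherent _ E n.+1%:R^-1 _ hE; first by rewrite invr_gt0.
  by exists v.
have [v_ hv] := choice H.
have [U [v [UP Uoo hU]]] := ultra_lim (fun n x => let: And4 _ h _ _ := (hv n).1 in h x).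
have R1 := Rb1; have R0 : 0 <= 2 * Rb by lra.
have hL n : lipf Lam (v_ n) by have [[]] := hv n.
have hL2 : lipf Lam v.
  move=> x y; apply/ler_addgt0Pr => e e0; have e2 : 0 < e / 2 by lra.
  have [n [/= h1 h2]] := filter_ex (filterI (hU x _ e2) (hU y _ e2)).
  have := hL n x y.
  have -> : v x - v y = (v_ n x - v_ n y) - (v_ n x - v x) + (v_ n y - v y) by ring.
  have := ler_normD ((v_ n x - v_ n y) - (v_ n x - v x)) (v_ n y - v y).
  have := ler_normB (v_ n x - v_ n y) (v_ n x - v x).
  by move: h1 h2; move: (`|_ + _|) (`|v_ n x - v_ n y - (v_ n x - v x)|) (`|v_ n x - v_ n y|) (`|v_ n x - v x|) (`|v_ n y - v y|) (Lam * _); lar.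
have unif (e : R) : 0 < e -> U [set n | forall x, `|x| <= 2 * Rb -> `|v x - v_ n x| <= e].
  move=> e0; pose K : set P := `[- (2 * Rb), 2 * Rb] `*` `[- (2 * Rb), 2 * Rb].
  have cK : compact K by apply: compact_setX; exact: segment_compact.
  have := @compact_near_coveringP _ K; case => /(_ cK nat U (fun n x => `|v x - v_ n x| <= e)) h _.
  have {}h := h _.
  have e4 : 0 < e / 4 by lra.
  have L1 : 0 < Lam + 1 by move: L0; lar.
  have rr : 0 < e / (4 * (Lam + 1)) by rewrite divr_gt0//; lra.
  apply: filterS (h _ _) => [n /= hn x xB|x _]; first by apply: hn; have : [set y : P | `|y| <= 2 * Rb] x by []; rewrite box_itv.
  exists (ball x (e / (4 * (Lam + 1))), [set n | `|v_ n x - v x| < e / 4]).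
    by split => /=; [exact: nbhsx_ballx|exact: hU].
  move=> [y n] [/= yb nn].
  have yx : `|x - y| <= e / (4 * (Lam + 1)).
    by move: yb; rewrite -ball_normE /= => /ltW.
  have := hL n x y; have := hL2 x y.
  have Lr : Lam * `|x - y| <= e / 4.
    apply: (@le_trans _ _ ((Lam + 1) * (e / (4 * (Lam + 1))))).
      by apply: ler_pM => //; move: L0; lar.
    rewrite le_eqVlt; apply/orP; left; apply/eqP; field; rewrite lt0r_neq0//; lra.
  have -> : v y - v_ n y = (v_ n x - v_ n y) - (v_ n x - v x) - (v x - v y) by ring.
  have := ler_normB ((v_ n x - v_ n y) - (v_ n x - v x)) (v x - v y).
  have := ler_normB (v_ n x - v_ n y) (v_ n x - v x).
  by move: nn Lr e0; move: (`|v_ n x - v_ n y - (v_ n x - v x) - _|) (`|v_ n x - v_ n y - (v_ n x - v x)|) (`|v_ n x - v_ n y|) (`|v_ n x - v x|) (`|v x - v y|) (Lam * _); lar.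
have kv : Kc M Lam v.
  split => //.
  - move=> x; apply/andP; split; apply/ler_addgt0Pr => e e0;
      have [n /= h1] := filter_ex (hU x _ e0); have [_ /(_ x)/andP[h2 h3] _ _] := (hv n).1;
      move: h1 h2 h3; rewrite ltr_norml => /andP[]; move: (v x) (v_ n x); lar.
  - move=> x; apply/eqP; rewrite -subr_eq0 -normr_le0; apply/ler_addgt0Pr => e e0; have e2 : 0 < e / 2 by lra.
    have [n [/= h1 h2]] := filter_ex (filterI (hU x _ e2) (hU (refl x) _ e2)).
    have [_ _ /(_ x) h3 _] := (hv n).1; rewrite h3 in h2.
    have -> : v (refl x) - v x = (v_ n x - v x) - (v_ n x - v (refl x)) by ring.
    have := ler_normB (v_ n x - v x) (v_ n x - v (refl x)).
    by move: h1 h2; move: (`|_|) (`|_|) (`|_|); lar.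
  - have llv : llip v := lipf_llip L0 hL2.
    have cv : cl (ww v) by apply: clM; [exact: cl_chi|].
    apply/eqP; rewrite -subr_eq0 -normr_le0; apply/ler_addgt0Pr => e e0.
    have m0 : 0 < (2 * (2 * Rb)) ^+ 2 by rewrite exprn_gt0//; lra.
    have [n /= hn] := filter_ex (unif _ (divr_gt0 e0 m0)).
    have kn := (hv n).1; have cn := cl_ww kn; have [_ _ _ <-] := kn.
    have cB := clB cv cn.
    rewrite -(I2B (cl_itg cv) (cl_itg cn)) (le_trans (ler_norm_I2 (cl_itg cB)))//.
    have sx : supB (2 * Rb) (fun x => ww v x - ww (v_ n) x) by move=> x xB; rewrite !ww_sup// subrr.
    rewrite (le_trans (I2_supB R0 cB sx (A := e / (2 * (2 * Rb)) ^+ 2) _)) => [//|x|].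
      have [xB|xB] := leP `|x| (2 * Rb); last by rewrite sx// normr0 divr_ge0 ?ltW.
      rewrite /ww -mulrBr normrM; have /andP[c0 c1] := chi_bnd x.
      rewrite (ger0_norm c0); have := hn x xB; have := normr_ge0 (v x - v_ n x).
      by move: c0 c1; move: (chi x) (`|_|) (e / _); nar.
    by rewrite divfK ?add0r// lt0r_neq0.
exists v => // v' k'.
have [D D0 hD] := JJ_cont.
apply: (@le_trans _ _ (sup E)); first by apply: sup_upper_bound => //; exists v'.
apply/ler_addgt0Pr => e e0.
have e2 : 0 < e / (2 * (D + 1)) by rewrite divr_gt0//; lra.
have [N hN] : exists N : nat, N.+1%:R^-1 <= e / 2.
  exists (Num.bound (e / 2)^-1); rewrite invf_ple ?posrE//; last by lra.
  have : 0 <= (e / 2)^-1 by rewrite invr_ge0; lra.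
  by move=> /archi_boundP /ltW h; rewrite (le_trans h)// ler_nat.
have [n [/= h1 h2]] := filter_ex (filterI (unif _ e2) (Uoo _ (nbhs_infty_ge N))).
have h3 := hD v (v_ n) _ kv (hv n).1 (ltW e2) h1.
have h4 := (hv n).2.
have h5 : n.+1%:R^-1 <= N.+1%:R^-1 :> R by rewrite lef_pV2 ?posrE// ler_nat.
have h6 : D * (e / (2 * (D + 1))) <= e / 2.
  apply: (@le_trans _ _ ((D + 1) * (e / (2 * (D + 1))))); first by rewrite ler_wpM2r ?(ltW e2)//; lra.
  rewrite le_eqVlt; apply/orP; left; apply/eqP; field; rewrite lt0r_neq0//; lra.
move: h3 h4 h5 h6 hN; move: (JJ v) (JJ (v_ n)) (sup E) (D * _) (n.+1%:R^-1) (N.+1%:R^-1); lar.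
Qed.

End J.

Ltac cln := repeat match goal with H : ?A |- _ =>
  first [constr_eq H hs; fail 1 | constr_eq H hd; fail 1 | constr_eq H smu2; fail 1 | clear H] end.
Ltac lar := cln; intros; lra.
Ltac nar := cln; intros; nra.

(** * Self-improving bounds and the Euler-Lagrange equation *)

Definition clamp1 (B t : R) : R := if t <= - B then - B else if B <= t then B else t.
Definition clamp (B : R) (x : P) : P := (clamp1 B x.1, clamp1 B x.2).

Lemma clamp1_lip (B t t' : R) : 0 <= B -> `|clamp1 B t - clamp1 B t'| <= `|t - t'|.
Proof.
move=> B0; rewrite -[leRHS]mul1r; move: t t'; apply: sym_lip => x y xy; rewrite /clamp1 ler_norml mul1r.
by case: (leP x (- B)) => ?; case: (leP y (- B)) => ?; case: (leP B x) => ?; case: (leP B y) => ?;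
   apply/andP; split; lra.
Qed.

Lemma clamp_lip (B : R) x y : 0 <= B -> `|clamp B x - clamp B y| <= `|x - y|.
Proof.
move=> B0; apply: norm_leP => /=.
  by rewrite (le_trans (clamp1_lip _ _ B0))// (norm1 (x - y)).
by rewrite (le_trans (clamp1_lip _ _ B0))// (norm2 (x - y)).
Qed.

Lemma clamp_bnd (B : R) x : 0 <= B -> `|clamp B x| <= B.
Proof.
move=> B0; have key t : `|clamp1 B t| <= B.
  by rewrite /clamp1 ler_norml; case: (leP t (- B)) => ?; case: (leP B t) => ?; apply/andP; split; lra.
by apply: norm_leP; exact: key.
Qed.

Lemma clamp_id (B : R) x : `|x| <= B -> clamp B x = x.
Proof.
move=> xB; have key t : `|t| <= B -> clamp1 B t = t.
  by rewrite ler_norml /clamp1 => /andP[? ?]; case: (leP t (- B)) => ?; case: (leP B t) => ?; lra.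
case: x xB => x1 x2 xB; rewrite /clamp /= !key//.
  exact: le_trans (norm2 _) xB.
exact: le_trans (norm1 _) xB.
Qed.

Lemma clamp_refl (B : R) x : 0 <= B -> clamp B (refl x) = refl (clamp B x).
Proof.
move=> B0; apply: (congr2 pair) => //=; rewrite /clamp1.
by case: (leP x.2 (- B)) => ?; case: (leP (- x.2) (- B)) => ?;
  case: (leP B x.2) => ?; case: (leP B (- x.2)) => ?; lra.
Qed.

(** If [f x0] were positive, the Lipschitz bound would keep [f] above half of it on a small box, and
    the integral would be positive. *)
Lemma cl_eq0 f x0 : cl f -> (forall x, 0 <= f x) -> I2 f <= 0 -> f x0 = 0.
Proof.
move=> cf f0 If; apply/eqP; rewrite eq_le f0 andbT leNgt; apply/negP => c0.
have [L [B [L0 _ fL _]]] := cf.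
set c := f x0 in c0; have L1 : 0 < 2 * (L + 1) by lra.
pose r := c / (2 * (L + 1)); have r0 : 0 < r by rewrite divr_gt0.
have bi : itg (fun x => box r (x0 - x)) := itg_sub x0 (itg_box r).
have : c / 2 * I2 (fun x => box r (x0 - x)) <= I2 f.
  rewrite -I2Z//; apply: I2_le => [||x]; [exact: itgZ|exact: cl_itg|].
  have [h|h] := leP `|x0 - x| r; last by rewrite box0// mulr0.
  rewrite box1// mulr1; have := fL x0 x; rewrite -/c ler_norml => /andP[_].
  have : L * `|x0 - x| <= c / 2.
    apply: (@le_trans _ _ ((L + 1) * r)); first by apply: ler_pM => //; lra.
    rewrite le_eqVlt /r; apply/orP; left; apply/eqP; field; lra.
  by move: (L * _) (f x); lar.
rewrite (I2_sub x0 (itg_box r)) (I2_box (ltW r0)) => h.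
have : 0 < c / 2 * (2 * r) ^+ 2 by rewrite mulr_gt0 ?exprn_gt0//; lra.
by move: h If; move: (I2 f) (c / 2 * _); lar.
Qed.

Lemma conv_sup g u (A : R) x : itg g -> cl u -> (forall y, `|u y| <= A) ->
  `|conv g u x| <= A * I2 (fun z => `|g z|).
Proof.
move=> ig cu uA; have lg := lint_itg ig.
rewrite (conv_sub x lg cu) (le_trans (ler_norm_I2 (lintM lg (cl_sub x cu))))//.
rewrite -(I2Z A (itg_norm ig)); apply: I2_le => [||z].
- by apply: itg_norm; exact: lintM lg (cl_sub x cu).
- by apply: itgZ; exact: itg_norm.
by rewrite normrM mulrC ler_wpM2r.
Qed.

Lemma conv_lip_u g u (L : R) : itg g -> cl u -> lipf L u -> lipf (L * I2 (fun z => `|g z|)) (conv g u).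
Proof.
move=> ig cu uL x x'; have lg := lint_itg ig.
have i1 := lintM lg (cl_sub x cu); have i2 := lintM lg (cl_sub x' cu).
rewrite !(conv_sub _ lg cu) -(I2B i1 i2) (le_trans (ler_norm_I2 (itgB i1 i2)))//.
have -> : L * I2 (fun z => `|g z|) * `|x - x'| = L * `|x - x'| * I2 (fun z => `|g z|) by ring.
rewrite -(I2Z _ (itg_norm ig)); apply: I2_le => [||z].
- by apply: itg_norm; exact: itgB.
- by apply: itgZ; exact: itg_norm.
rewrite -mulrBr normrM mulrC ler_wpM2r//.
by have := uL (x - z) (x' - z); have -> : x - z - (x' - z) = x - x' by rewrite opprB addrA subrK.
Qed.

Lemma conv_lip_g g u (L B B' : R) : lint g -> cl u -> 0 <= L -> supB B u -> I2 (fun x => `|u x|) = 1 ->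
  (forall x y, `|x| <= B + B' -> `|y| <= B + B' -> `|g x - g y| <= L * `|x - y|) ->
  forall x x', `|x| <= B' -> `|x'| <= B' -> `|conv g u x - conv g u x'| <= L * `|x - x'|.
Proof.
move=> lg cu L0 su mu gL x x' xB xB'.
have i1 := conv_itg x lg cu; have i2 := conv_itg x' lg cu.
have n0 : 0 <= L * `|x - x'| by rewrite mulr_ge0.
rewrite -(I2B i1 i2) (le_trans (ler_norm_I2 (itgB i1 i2)))//.
have -> : L * `|x - x'| = L * `|x - x'| * I2 (fun x => `|u x|) by rewrite mu mulr1.
rewrite -(I2Z _ (cl_itg (cl_norm cu))); apply: I2_le => [||y].
- by apply: itg_norm; exact: itgB.
- by apply: itgZ; exact: cl_itg (cl_norm cu).
rewrite -mulrBl normrM; have [yB|yB] := leP `|y| B; last by rewrite su// normr0 !mulr0.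
rewrite ler_wpM2r//; have := gL (x - y) (x' - y).
have -> : x - y - (x' - y) = x - x' by rewrite opprB addrA subrK.
by apply; rewrite (le_trans (ler_normB _ _))// addrC lerD.
Qed.

Definition even2 (w : P -> R) := forall x, w (refl x) = w x.

Lemma conv_even g w x : lint g -> cl w -> even2 g -> even2 w -> conv g w (refl x) = conv g w x.
Proof.
move=> lg cw eg ew.
have E y : refl y = aff (1, -1) 0 y.
  by apply: (congr2 pair); rewrite /= addr0 ?mul1r ?mulN1r.
have i := conv_itg (refl x) lg cw.
have c1 : ((1, -1) : P).1 != 0 by rewrite oner_neq0.
have c2 : ((1, -1) : P).2 != 0 by rewrite oppr_eq0 oner_neq0.
have := I2_aff 0 c1 c2 i; rewrite /= normrN normr1 mulr1 invr1 mul1r /conv => <-.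
apply: eq_I2 => y /=; rewrite -E ew -(eg (refl x - refl y)).
by congr (g _ * _); apply: (congr2 pair) => //=; rewrite opprB opprK addrC.
Qed.

Lemma lipf1Q : lipf 1 Q.
Proof. by move=> x y; rewrite (le_trans (Qlip x y))// ler_wpM2r// eta1. Qed.

Lemma lipf1T : lipf 1 T.
Proof. by move=> x y; rewrite (le_trans (Tlip x y))// ler_wpM2r// eta1. Qed.

Lemma llip_Pot w : cl w -> llip (Pot w).
Proof.
move=> cw; apply: llipD; last by apply: llipZ; exact: llip_fst.
apply: llipB; first exact: conv_llip lint_kk cw.
exact: conv_llip (lint_Tc _) (cl_ng cw).
Qed.

Lemma kk_refl : even2 kk.
Proof. by move=> x; rewrite /kk Qrefl /kern nq_refl. Qed.

Lemma Pot_even w : cl w -> even2 w -> even2 (Pot w).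
Proof.
move=> cw ew x; rewrite /Pot /convp (conv_even _ lint_kk cw kk_refl ew).
rewrite (conv_even _ (lint_Tc _) (cl_ng cw))//.
  move=> y; rewrite /Tc -[RHS]Trefl; congr (T _).
  by apply: (congr2 pair); rewrite /= ?addr0.
by move=> y; rewrite /neg -(ew (- y)); congr (w _); apply: (congr2 pair).
Qed.

Lemma lam_bnd w : cl w -> I2 (fun x => `|w x|) = 1 -> supB (2 * Rb) w -> `|lam w| <= eta.
Proof.
move=> cw mw sw.
have m1 : I2 (fun x => `|neg w x|) = 1 by rewrite -mw -[RHS](I2_neg' (cl_norm cw)).
apply: (fm_conv_bnd1 (lint_T1c _) cw (cl_ng cw) sw _ mw) => x xB.
have := conv_bnd (lint_T1c (2 * ac w)) (cl_ng cw) (supB_neg sw) xB (fun z _ => T1b _).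
by rewrite m1 mulr1.
Qed.

(** What the maximization delivers: the equation still contains the cut-off, which [el_interior]
    removes once the support is confined. *)
Definition el (w : P -> R) (mu : R) : Prop :=
  [/\ cl w, forall x, 0 <= w x, supB (2 * Rb) w & even2 w] /\
  [/\ I2 w = 1, `|ac w| <= 2 * Rb & forall x, w x = chi x * ff (Pot w x - mu)].

(** The factor [1 / 4] is the mass of the near part of the kernel, and [C] depends on neither [M]
    nor [Lw]. Thus the bounds of a density come back divided by 4 in its potential, and [EL_exists]
    can close them. *)
Lemma Pot_bnds : exists2 C : R, 0 <= C & forall (w : P -> R) (M Lw : R),
  cl w -> (forall x, `|w x| <= M) -> 0 <= Lw -> lipf Lw w -> supB (2 * Rb) w -> I2 (fun x => `|w x|) = 1 ->
  `|ac w| <= 2 * Rb ->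
  (forall x, `|x| <= 2 * Rb -> `|Pot w x| <= M / 4 + C) /\
  (forall x x', `|x| <= 2 * Rb -> `|x'| <= 2 * Rb -> `|Pot w x - Pot w x'| <= (Lw / 4 + C) * `|x - x'|).
Proof.
have q0 : 0 < 4^-1 :> R by lra.
have [rho [/andP[r0 _] ni nS]] := near_small q0.
have [Lf Lf0 hLf] := lint_farK r0 (2 * Rb + 2 * Rb).
have [Mf Mf0 hMf] := llip_bnd (lint_farK r0) (2 * Rb + 2 * Rb).
have R1 := Rb1; have e0 := eta0; have e1' := eta1.
exists (Mf + Lf + 20 * Rb); first by rewrite !addr_ge0//; lra.
move=> w M Lw cw wM Lw0 wL sw mw ba.
have M0 : 0 <= M := le_trans (normr_ge0 (w 0)) (wM 0).
set S := I2 _ in nS.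
have S0 : 0 <= S by apply: I2_ge0.
have ln := lint_itg ni; have lf := lint_llip (lint_farK r0); have lQ := lint_llip llipQ.
have ha : `|2 * ac w| <= 4 * Rb.
  by rewrite normrM ger0_norm//; move: ba; move: (`|ac _|); lar.
have lT := lint_Tc (2 * ac w); have cn := cl_ng cw; have sn := supB_neg sw.
have mn : I2 (fun x => `|neg w x|) = 1 by rewrite -mw -[RHS](I2_neg' (cl_norm cw)).
have PE x : Pot w x = conv (nearK rho) w x + conv (farK rho) w x + conv Q w x - convp (Tc (2 * ac w)) w x + lam w * x.1.
  rewrite -(conv_kD x ln lf cw) -(conv_kD x (lintD ln lf) lQ cw) /Pot.
  congr (_ - _ + _); congr (conv _ w x); apply/funext => z; rewrite /kk /nearK; ring.
have bl := lam_bnd cw mw sw.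
split.
  move=> x xB.
  have h1 : `|conv (nearK rho) w x| <= M / 4.
    by rewrite (le_trans (conv_sup x ni cw wM))// -/S ler_wpM2l.
  have h2 : `|conv (farK rho) w x| <= Mf by rewrite (le_trans (conv_bnd lf cw sw xB hMf))// mw mulr1.
  have h3 : `|conv Q w x| <= 4 * Rb.
    rewrite (le_trans (conv_bnd lQ cw sw xB (M := 4 * Rb) _)) ?mw ?mulr1// => z zB.
    have := lipf1Q z 0; rewrite Q0 !subr0 mul1r => h; rewrite (le_trans h)//.
    by move: zB; move: (`|z|); lar.
  have h4 : `|convp (Tc (2 * ac w)) w x| <= 8 * Rb.
    rewrite (le_trans (conv_bnd lT cn sn xB (M := 8 * Rb) _)) ?mn ?mulr1// => z zB.
    by apply: Tc_bnd => //; move: zB; move: (`|z|); lar.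
  have h5 : `|lam w * x.1| <= 2 * Rb.
    rewrite normrM -[leRHS]mul1r; apply: ler_pM => //; first exact: le_trans bl e1'.
    exact: le_trans (norm1 x) xB.
  rewrite PE; move: h1 h2 h3 h4 h5 R1 Lf0.
  move: (conv (nearK _) _ x) (conv (farK _) _ x) (conv Q _ x) (convp _ _ x) (lam w * _) (M / 4) => a b c d e m.
  move=> h1 h2 h3 h4 h5 R1 Lf0.
  have := ler_normD (a + b + c - d) e; have := ler_normB (a + b + c) d.
  have := ler_normD (a + b) c; have := ler_normD a b.
  by move: h1 h2 h3 h4 h5 R1 Lf0; move: (`|_|) (`|_|) (`|_|) (`|_|) (`|_|) (`|_|) (`|_|) (`|_|) (`|_|); lar.
move=> x x' xB xB'.
have n0 := normr_ge0 (x - x').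
have h1 : `|conv (nearK rho) w x - conv (nearK rho) w x'| <= Lw / 4 * `|x - x'|.
  by rewrite (le_trans (conv_lip_u ni cw wL x x'))// ler_wpM2r// ler_wpM2l.
have h2 : `|conv (farK rho) w x - conv (farK rho) w x'| <= Lf * `|x - x'|.
  exact: (conv_lip_g lf cw Lf0 sw mw hLf).
have h3 : `|conv Q w x - conv Q w x'| <= 1 * `|x - x'|.
  by apply: (@conv_lip_g Q w 1 (2 * Rb) (2 * Rb) lQ cw ler01 sw mw) => // y y' _ _; exact: lipf1Q.
have h4 : `|convp (Tc (2 * ac w)) w x - convp (Tc (2 * ac w)) w x'| <= 1 * `|x - x'|.
  apply: (@conv_lip_g _ _ 1 (2 * Rb) (2 * Rb) lT cn ler01 sn mn) => // y y' _ _; rewrite /Tc.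
  have := lipf1T (y + e1 (2 * ac w)) (y' + e1 (2 * ac w)).
  by rewrite (_ : y + e1 (2 * ac w) - (y' + e1 (2 * ac w)) = y - y')// opprD addrACA subrr addr0.
have h5 : `|lam w * x.1 - lam w * x'.1| <= 1 * `|x - x'|.
  rewrite -mulrBr normrM; apply: ler_pM => //; first exact: le_trans bl e1'.
  exact: norm1 (x - x').
rewrite !PE; move: h1 h2 h3 h4 h5 R1 Mf0 n0.
move: (conv (nearK _) _ x) (conv (farK _) _ x) (conv Q _ x) (convp _ _ x) (lam w * x.1) => a b c d e.
move: (conv (nearK _) _ x') (conv (farK _) _ x') (conv Q _ x') (convp _ _ x') (lam w * x'.1) => a' b' c' d' e'.
have -> : a + b + c - d + e - (a' + b' + c' - d' + e') = ((((a - a') + (b - b')) + (c - c')) - (d - d')) + (e - e') by ring.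
move: (a - a') (b - b') (c - c') (d - d') (e - e') => {a' b' c' d' e'} {}a {}b {}c {}d {}e.
move: (`|x - x'|) => n h1 h2 h3 h4 h5 R1 Mf0 n0.
have := ler_normD (a + b + c - d) e; have := ler_normB (a + b + c) d.
have := ler_normD (a + b) c; have := ler_normD a b.
have mm : 0 <= Mf * n by rewrite mulr_ge0.
have mr : n <= Rb * n by rewrite ler_peMl.
have -> : (Lw / 4 + (Mf + Lf + 20 * Rb)) * n = Lw / 4 * n + Mf * n + Lf * n + 20 * (Rb * n) by ring.
by move: h1 h2 h3 h4 h5 R1 Mf0 n0 mm mr; move: (`|_|) (`|_|) (`|_|) (`|_|) (`|_|) (`|_|) (`|_|) (`|_|) (`|_|) (Rb * n) (Mf * n) (Lf * n) (Lw / 4 * n); lar.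
Qed.

Lemma grad_arith (G D N t j j' : R) : D <= N -> 0 <= N -> 0 < t -> t * (2 * (N + 1)) <= G ->
  j' + t * G - D * t ^+ 2 <= j -> j <= j' -> False.
Proof.
move=> DN N0 t0 t2 h1 h2.
have h : t * (t * (2 * (N + 1))) <= t * G by rewrite ler_wpM2l// ltW.
have tt : 0 < t * t by rewrite mulr_gt0.
nra.
Qed.

Lemma JJ_grad M Lam v v' : 0 <= Lam -> Kc M Lam v -> Kc M Lam v' ->
  (forall u, Kc M Lam u -> JJ u <= JJ v) ->
  I2 (fun x => (ww v' x - ww v x) * Pot (ww v) x) - I2 (fun x => chi x * FF (v' x))
    + I2 (fun x => chi x * FF (v x)) <= 0.
Proof.
move=> L0 k k' hmax; have [D hD] := JJ_step L0 k k'; set G := _ + _ in hD *.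
rewrite leNgt; apply/negP => G0.
pose t := Num.min 1 (G / (2 * (`|D| + 1))).
have D1 : 0 < 2 * (`|D| + 1) by have := normr_ge0 D; lra.
have t0 : 0 < t by rewrite lt_min ltr01 divr_gt0.
have t1 : t <= 1 by rewrite ge_min lexx.
have t01 : 0 <= t <= 1 by rewrite (ltW t0) t1.
have h1 := hD t t01; have h2 := hmax _ (Kc_conv L0 k k' t01).
have t2 : t * (2 * (`|D| + 1)) <= G by rewrite -ler_pdivlMr// ge_min lexx orbT.
exact: (grad_arith (ler_norm D) (normr_ge0 D) t0 t2 h1 h2).
Qed.

(** The mass is continuous in [mu]. It vanishes at [B0]; at [- B0 - 2] the argument of [ff] is at
    least 2, so [ff] is at least 1, and the plateau of [chi] has area at least 4. *)
Lemma mu_exists (w : P -> R) (B0 : R) : 0 <= B0 -> cl w -> (forall x, `|x| <= 2 * Rb -> `|Pot w x| <= B0) ->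
  exists2 mu : R, - B0 - 2 <= mu & I2 (fun x => chi x * ff (Pot w x - mu)) = 1.
Proof.
move=> B00 cw hB.
have R1 := Rb1.
pose h m := I2 (fun x => chi x * ff (Pot w x - m)).
have ll m : llip (fun x => ff (Pot w x - m)).
  move=> B; have [L L0 hL] := llip_Pot cw B; exists L => // x y xB yB.
  rewrite (le_trans (ff_lip _ _))//; have := hL x y xB yB.
  by rewrite (_ : Pot w x - m - (Pot w y - m) = Pot w x - Pot w y)//; ring.
have ci m : cl (fun x => chi x * ff (Pot w x - m)) by apply: clM; [exact: cl_chi|exact: ll].
pose c := I2 chi.
have c0 : 0 <= c by apply: I2_ge0 => x; have /andP[] := chi_bnd x.
have hl m m' : `|h m - h m'| <= c * `|m - m'|.
  have cB := clB (ci m) (ci m').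
  rewrite /h -(I2B (cl_itg (ci m)) (cl_itg (ci m'))) (le_trans (ler_norm_I2 (cl_itg cB)))//.
  rewrite mulrC -(I2Z _ (cl_itg cl_chi)).
  apply: I2_le => [||x]; [exact: cl_itg (cl_norm cB)|exact: itgZ (cl_itg cl_chi)|].
  rewrite -mulrBr normrM; have /andP[k0 k1] := chi_bnd x; rewrite (ger0_norm k0) mulrC ler_wpM2r//.
  rewrite (le_trans (ff_lip _ _))// (_ : Pot w x - m - (Pot w x - m') = m' - m); last by ring.
  by rewrite distrC.
have ch : continuous h.
  move=> m; apply/cvgrPdist_le => e e0; near=> m'.
  rewrite (le_trans (hl _ _))//.
  have : `|m - m'| <= e / (c + 1).
    by near: m'; apply: cvgr_dist_le; rewrite ?divr_gt0//; lra.
  rewrite ler_pdivlMr; last by lra.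
  have := normr_ge0 (m - m'); move: (`|_|); cln; intros; nra.
have hB0 : h B0 = 0.
  rewrite /h -I20; apply: eq_I2 => x; have [xB|xB] := leP `|x| (2 * Rb); last by rewrite chi_sup// mul0r.
  rewrite ff_neg ?mulr0//; have := hB x xB; have := ler_norm (Pot w x).
  by move: (`|Pot w x|) (Pot w x); lar.
have hB2 : 1 <= h (- B0 - 2).
  apply: (@le_trans _ _ (I2 chi)).
    apply: (@le_trans _ _ (I2 (box Rb))).
      rewrite I2_box; last by lra.
      by rewrite (_ : (2 * Rb) ^+ 2 = 4 * Rb * Rb); [nra|ring].
    apply: I2_le => [||x]; [exact: itg_box|exact: cl_itg cl_chi|].
    have [xB|xB] := leP `|x| Rb; first by rewrite box1// chi1.
    by rewrite box0//; have /andP[] := chi_bnd x.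
  apply: I2_le => [||x]; [exact: cl_itg cl_chi|exact: cl_itg|].
  have [xB|xB] := leP `|x| (2 * Rb); last by rewrite chi_sup// mul0r.
  have /andP[k0 k1] := chi_bnd x; rewrite ler_peMr// ff_ge1//.
  have := hB x xB; have := ler_norm (- Pot w x); rewrite normrN.
  by move: (`|Pot w x|) (Pot w x); lar.
have le : - B0 - 2 <= B0 by lra.
have [|mu mui hmu] := @IVT _ h _ _ 1 le (continuous_subspaceT ch).
  by rewrite hB0 ge_min le_max hB2 ler01 orbT.
by exists mu => //; move: mui; rewrite in_itv/= => /andP[].
Unshelve. all: by end_near.
Qed.

(** The right-hand side [v'] of the Euler-Lagrange equation is itself admissible, so it may be
    compared with the maximizer [v]. The quadratic defect in [FF_gap] then forces [v = v'] wherever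
    [chi] is positive. *)
Lemma EL_exists (e0 : R) :
  (forall M Lam : R, 4 <= M -> 4 <= Lam -> exists2 u, Kc M Lam u & e0 <= JJ u) ->
  exists w mu, el w mu /\ 2 * e0 - 2 * Rb * eta <= mu.
Proof.
move=> hu; have [C C0 hC] := Pot_bnds.
(* These values close the bounds: [v' <= 2 * (M / 4 + C) + 2 <= M], and the Lipschitz constant of
   [v'] is at most [(Lam + 2 * M) / 4 + C <= Lam], where [2 * M] comes from the slope of [chi]. *)
pose M := 4 * C + 8; pose Lam := 2 * M + 2 * C + 4.
have M4 : 4 <= M by rewrite /M; lra.
have Lam4 : 4 <= Lam by rewrite /Lam; lra.
have L0 : 0 <= Lam by lra.
have R1 := Rb1; have R0 : 0 <= 2 * Rb by lra.
have [u ku e0u] := hu _ _ M4 Lam4.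
have [v k hmax] := JJ_max L0 (ex_intro _ u ku).
pose w := ww v.
have cw : cl w := cl_ww L0 k.
have w0 x : 0 <= w x := ww_ge0 x k.
have sw : supB (2 * Rb) w := @ww_sup v.
have mw : I2 (fun x => `|w x|) = 1 := Kc_mass k.
have ba : `|ac w| <= 2 * Rb := ac_bnd L0 k.
have [vL vM vr vI] := k.
have wL : lipf (Lam + 2 * M) w.
  move=> x y; rewrite /w /ww.
  have -> : chi x * v x - chi y * v y = chi x * (v x - v y) + (chi x - chi y) * v y by ring.
  rewrite (le_trans (ler_normD _ _))// (normrM (chi x)) (normrM (chi x - chi y)) mulrDl.
  have /andP[k0 k1] := chi_bnd x; have /andP[v0 v1] := vM y.
  apply: lerD; first by rewrite -[leRHS]mul1r; apply: ler_pM => //; rewrite ger0_norm.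
  rewrite mulrAC; apply: ler_pM => //; [exact: chi_lip|by rewrite ger0_norm].
have LM : 0 <= Lam + 2 * M by lra.
have [PB PL] := hC w M (Lam + 2 * M) cw (fun x => ww_le x k) LM wL sw mw ba.
have B0 : 0 <= M / 4 + C by lra.
have [mu hmu Imu] := mu_exists B0 cw PB.
have ew : even2 w by move=> x; rewrite /w /ww vr chi_refl.
(* The bounds on [Pot w] are known only on the box; clamping the argument extends them to the plane
   and changes nothing under [chi]. *)
pose v' x := ff (Pot w (clamp (2 * Rb) x) - mu).
have Ev' x : chi x * v' x = chi x * ff (Pot w x - mu).
  have [xB|xB] := leP `|x| (2 * Rb); first by rewrite /v' clamp_id.
  by rewrite chi_sup// !mul0r.
have k' : Kc M Lam v'.
  split.
  - move=> x y; rewrite (le_trans (ff_lip _ _))//.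
    rewrite (_ : Pot _ _ - mu - (Pot _ _ - mu) = Pot w (clamp (2 * Rb) x) - Pot w (clamp (2 * Rb) y)); last by ring.
    rewrite (le_trans (PL _ _ (clamp_bnd x R0) (clamp_bnd y R0)))//.
    apply: ler_pM => //; [lra|rewrite /Lam /M; lra|exact: clamp_lip].
  - move=> x; rewrite ff_ge0 (le_trans (ff_le _))// /posp ge_max; apply/andP; split; last by lra.
    have := le_trans (ler_norm _) (PB _ (clamp_bnd x R0)).
    by move: hmu C0; rewrite /M; move: (Pot w _); lar.
  - by move=> x; rewrite /v' clamp_refl// Pot_even.
  - by rewrite -Imu; apply: eq_I2 => x; exact: Ev'.
have hG := JJ_grad L0 k k' hmax.
have cw' : cl (ww v') := cl_ww L0 k'.
have iF := cl_itg (cl_chiFF L0 k); have iF' := cl_itg (cl_chiFF L0 k').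
have Iw : I2 w = 1 by [].
have Iw' : I2 (ww v') = 1 by case: k'.
have cp : cl (fun x => w x * Pot w x) by apply: clM => //; exact: llip_Pot.
have cP : cl (fun x => (ww v' x - w x) * Pot w x).
  by apply: clM; [exact: clB|exact: llip_Pot].
have cd := clB cw' cw.
have key x : chi x * (v x - v' x) ^+ 2 / 2 <= (ww v' x - w x) * Pot w x - mu * (ww v' x - w x) - chi x * FF (v' x) + chi x * FF (v x).
  have /andP[k0 k1] := chi_bnd x; have /andP[v0 v1] := vM x.
  have [xB|xB] := leP `|x| (2 * Rb); last by rewrite /w /ww chi_sup// !(mul0r, mulr0, subrr, subr0, addr0).
  have := FF_gap (Pot w x - mu) v0.
  rewrite (_ : ff (Pot w x - mu) = v' x); last by rewrite /v' clamp_id.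
  move=> /(ler_wpM2l k0); rewrite /w /ww; move: (chi x) (v x) (v' x) (FF _) (FF _) (Pot _ _); lar.
have lld : llip (fun x => (v x - v' x) ^+ 2).
  have hh : llip (fun x => v x - v' x).
    have [h1 _ _ _] := k'.
    by apply: llipB; [exact: lipf_llip L0 vL|exact: lipf_llip L0 h1].
  have hh2 := hh; exact: (llipM hh hh2).
have cq : cl (fun x => chi x * (v x - v' x) ^+ 2) by apply: clM; [exact: cl_chi|].
have Ik : I2 (fun x => chi x * (v x - v' x) ^+ 2) <= 0.
  have h2 : I2 (fun x => 2^-1 * (chi x * (v x - v' x) ^+ 2)) <=
    I2 (fun x => (ww v' x - w x) * Pot w x - mu * (ww v' x - w x) - chi x * FF (v' x) + chi x * FF (v x)).
    have iZ := itgZ mu (cl_itg cd).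
    apply: I2_le => [||x]; [exact: itgZ (cl_itg cq)| |by rewrite mulrC; exact: key].
    by apply: itgD => //; apply: itgB => //; exact: (itgB (cl_itg cP) iZ).
  have iZ := itgZ mu (cl_itg cd); have i3 := itgB (cl_itg cP) iZ.
  move: h2; rewrite (I2Z _ (cl_itg cq)) (I2D (itgB i3 iF') iF) (I2B i3 iF') (I2B (cl_itg cP) iZ).
  rewrite (I2Z _ (cl_itg cd)) (I2B (cl_itg cw') (cl_itg cw)) Iw Iw' subrr mulr0 subr0.
  move: hG; rewrite -/w; move: (I2 _) (I2 _) (I2 _) (I2 _); lar.
have vv' x : chi x * v x = chi x * v' x.
  have p0 y : 0 <= chi y * (v y - v' y) ^+ 2.
    by have /andP[k0 _] := chi_bnd y; rewrite mulr_ge0 ?sqr_ge0.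
  have /eqP := cl_eq0 x cq p0 Ik; rewrite mulf_eq0 sqrf_eq0 subr_eq0.
  by move=> /orP[/eqP->|/eqP->//]; rewrite !mul0r.
exists w, mu; split.
  by split; split => // x; rewrite -Ev' -vv'.
have J0 : e0 <= JJ v by exact: le_trans (hmax _ ku).
(* Integrated form of [FF_half]. Subtracting it from the interaction leaves [mu / 2] up to the term
   [lam w * mom w], so [mu] is at least twice the energy up to [2 * Rb * eta]. *)
have hF : (I2 (fun x => w x * Pot w x) - mu) / 2 <= I2 (fun x => chi x * FF (v x)).
  have -> : (I2 (fun x => w x * Pot w x) - mu) / 2 = I2 (fun x => 2^-1 * (w x * Pot w x - mu * w x)).
    rewrite (I2Z _ (itgB (cl_itg cp) (itgZ mu (cl_itg cw)))) (I2B (cl_itg cp) (itgZ mu (cl_itg cw))).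
    by rewrite (I2Z _ (cl_itg cw)) Iw mulr1 mulrC.
  apply: I2_le => [|//|x]; first by apply: itgZ; exact: (itgB (cl_itg cp) (itgZ mu (cl_itg cw))).
  have /andP[k0 k1] := chi_bnd x.
  have [xB|xB] := leP `|x| (2 * Rb); last by rewrite /w /ww chi_sup// !(mul0r, mulr0, subrr, subr0, addr0).
  rewrite {1 3}/w /ww; have [c0|c0] := eqVneq (chi x) 0; first by rewrite c0 !mul0r !mulr0 subrr mulr0.
  have -> : v x = ff (Pot w x - mu).
    by apply: (mulfI c0); rewrite vv' Ev'.
  have := ler_wpM2l k0 (FF_half (Pot w x - mu)).
  by move: (Pot _ _) (chi x) (ff _) (FF _); lar.
have hE : I2 (fun x => w x * Pot w x) = fm kk w w - fmp (Tc (2 * ac w)) w w + lam w * mom w.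
  have lT := lint_Tc (2 * ac w).
  have l1 := I2_prod_itg cw lint_kk cw; have l2 := I2_prod_itg cw lT (cl_ng cw).
  have l3 := cl_mom cw.
  rewrite /fmp /fm /mom -(I2B l1 l2) -(I2Z _ l3) -(I2D (itgB l1 l2) (itgZ _ l3)).
  by apply: eq_I2 => x; rewrite /Pot /convp; move: (conv kk w x) (conv _ _ x) (lam w) (w x) => a b c d; ring.
have hl : `|lam w * mom w| <= eta * (2 * Rb).
  rewrite normrM; apply: ler_pM => //; first exact: lam_bnd.
  by rewrite /ac normrN in ba.
have := ler_norm (- (lam w * mom w)); rewrite normrN.
move: J0; rewrite /JJ /Jw -/w; move: hF hl; rewrite hE.
move: (`|lam w * mom w|) (lam w * mom w) (fm _ _ _) (fmp _ _ _) (I2 _) => e a b c d.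
have -> : 2 * Rb * eta = eta * (2 * Rb) by ring.
by move: (eta * _); lar.
Qed.

(** * Concentration *)

Lemma conv_box0 v x : cl v -> conv (box 0) v x = 0.
Proof.
move=> cv; have [A A0 hA] := cl_bnd cv.
have := conv_sup x (itg_box 0) cv hA.
have -> : I2 (fun z => `|box 0 z|) = I2 (box 0).
  by apply: eq_I2 => z; rewrite ger0_norm// box_ge0.
rewrite I2_box// mulr0 expr0n /= mulr0 => h.
by apply/eqP; rewrite -normr_eq0 eq_le h normr_ge0.
Qed.

Lemma fm_box0 u v : cl v -> fm (box 0) u v = 0.
Proof.
by move=> cv; rewrite /fm -[RHS]I20; apply: eq_I2 => x; rewrite conv_box0// mulr0.
Qed.

(** The bound on [g] is assumed off the origin, since at the origin a kernel has a default value.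
    Adding a multiple of [box 0] repairs it there and leaves the form unchanged. *)
Lemma fm_ge_cst g u v (B B' c : R) : lint g -> cl u -> cl v -> (forall y, 0 <= u y) -> (forall y, 0 <= v y) ->
  supB B' u -> supB B v -> (forall z, z != 0 -> `|z| <= B + B' -> c <= g z) -> c * (I2 u * I2 v) <= fm g u v.
Proof.
move=> lg cu cv u0 v0 su sv gc.
have lb : lint (fun z => (`|c - g 0|) * box 0 z) := lintZ _ (lint_itg (itg_box 0)).
have E : fm g u v = fm (fun z => g z + `|c - g 0| * box 0 z) u v.
  by rewrite (fm_kD lg lb cu cv) (fm_kZ _ (lint_itg (itg_box 0)) cu cv) fm_box0// mulr0 addr0.
rewrite E -fm_kC//; apply: (fm_le (lint_cst c) (lintD lg lb) cu cv u0 v0 su sv) => z zB.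
have [->|z0] := eqVneq z 0.
  by rewrite box1 ?normr0// mulr1 -lerBlDl; exact: ler_norm.
by rewrite (le_trans (gc z z0 zB))// lerDl mulr_ge0// box_ge0.
Qed.

(** The guaranteed lower bound of the multiplier. Points of the support of the test profile [tt]
    differ by at most 4 in sup norm, so their squared distance is at most 32; the 2 pays for entropy
    and perturbations. *)
Definition E1 : R := kap 32 - 2.

Hypothesis hsm : 2 <= Rb /\ 20 * Rb * eta <= 1.

Ltac cln' := repeat match goal with H : ?A |- _ => first [constr_eq H hs; fail 1 | constr_eq H hd; fail 1
  | constr_eq H smu2; fail 1 | constr_eq H hsm; fail 1 | clear H] end.
Ltac lar' := cln'; intros; lra.
Ltac nar' := cln'; intros; nra.

Lemma small_eta : eta <= 1 / 40 /\ 14 * Rb * eta <= 7 / 10.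
Proof. have [h1 h2] := hsm; have e0 := eta0; split; nra. Qed.

Definition tt (x : P) : R := tent x.1 * tent x.2.

Lemma tt_bnd x : 0 <= tt x <= 1.
Proof.
have /andP[h1 h2] := tent_bnd x.1; have /andP[h3 h4] := tent_bnd x.2.
by rewrite /tt mulr_ge0//= mulr_ile1.
Qed.

Lemma tt_lip : lipf 2 tt.
Proof.
move=> x y; rewrite /tt.
have /andP[h1 h2] := tent_bnd x.1; have /andP[h3 h4] := tent_bnd x.2.
have /andP[h5 h6] := tent_bnd y.1; have /andP[h7 h8] := tent_bnd y.2.
have k1 := le_trans (tent_lip x.1 y.1) (norm1 (x - y)).
have k2 := le_trans (tent_lip x.2 y.2) (norm2 (x - y)).
have -> : tent x.1 * tent x.2 - tent y.1 * tent y.2 =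
  (tent x.1 - tent y.1) * tent x.2 + tent y.1 * (tent x.2 - tent y.2) by ring.
rewrite (le_trans (ler_normD _ _))// !normrM (ger0_norm h3) (ger0_norm h5).
have n0 := normr_ge0 (tent x.1 - tent y.1); have n1 := normr_ge0 (tent x.2 - tent y.2).
move: h3 h4 h5 h6 k1 k2 n0 n1; move: (tent x.2) (tent y.1) (`|_|) (`|_|) (`|_|); nar'.
Qed.

Lemma tt_sup : supB 2 tt.
Proof.
move=> x; rewrite prod_normE lt_max => /orP[/ltW/tent0 h|/ltW/tent0 h].
  by rewrite /tt h mul0r.
by rewrite /tt h mulr0.
Qed.

Lemma cl_tt : cl tt.
Proof. by exists 2, 2; split => //; [exact: tt_lip|exact: tt_sup]. Qed.

Lemma tt_mass : 4 <= I2 tt.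
Proof.
have -> : 4 = I2 (box 1) by rewrite I2_box//; ring.
apply: I2_le => [||x]; [exact: itg_box|exact: cl_itg cl_tt|].
have [h|h] := leP `|x| 1; last by rewrite box0//; have /andP[] := tt_bnd x.
by rewrite box1// /tt !tent1 ?mulr1// (le_trans _ h)// ?norm1 ?norm2.
Qed.

(** The normalized [tt] is at most [1 / 4], so its entropy is at most [3 / 4]. As [eta <= 1 / 40],
    the perturbations cost at most [6 * eta <= 15 / 100]; the total loss [9 / 10] is half of
    [18 / 10]. *)
Lemma competitor M Lam : 4 <= M -> 4 <= Lam -> exists2 u, Kc M Lam u & (kap 32 - 18 / 10) / 2 <= JJ u.
Proof.
move=> M4 L4; have [R2 _] := hsm; have [se _] := small_eta; have m4 := tt_mass; have L0 : 0 <= Lam by lra.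
have e0 := eta0.
set m := I2 tt in m4; have m0 : 0 < m by lra.
have mi : m^-1 <= 4^-1 by rewrite lef_pV2 ?posrE//; lra.
have mi0 : 0 < m^-1 by rewrite invr_gt0.
pose u x := m^-1 * tt x.
have uS : supB 2 u by move=> x /tt_sup h; rewrite /u h mulr0.
have ub x : 0 <= u x <= 4^-1.
  have /andP[h1 h2] := tt_bnd x; rewrite /u mulr_ge0 ?(ltW mi0)//=.
  by rewrite -[leRHS]mulr1; apply: ler_pM => //; exact: ltW.
have Ew : ww u = u.
  apply/funext => x; rewrite /ww; have [h|h] := leP `|x| 2; last by rewrite uS// mulr0.
  by rewrite chi1 ?mul1r// (le_trans h).
have cu : cl u := clZ _ cl_tt.
have Iu : I2 u = 1 by rewrite /u (I2Z _ (cl_itg cl_tt)) mulVf// lt0r_neq0.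
have k : Kc M Lam u.
  split.
  - move=> x y; rewrite /u -mulrBr normrM (gtr0_norm mi0).
    have := tt_lip x y; have := normr_ge0 (tt x - tt y); have := normr_ge0 (x - y).
    move: mi mi0 L4; move: (m^-1) (`|_|) (`|_|); nar'.
  - by move=> x; have /andP[h1 h2] := ub x; apply/andP; split => //; lra.
  - by move=> x; rewrite /u /tt /refl /= /tent normrN.
  - by rewrite -[RHS]Iu -[in RHS]Ew.
exists u => //.
have u0 y : 0 <= u y by have /andP[] := ub y.
have h1 : (kap 32 - 4 * eta) * (I2 u * I2 u) <= fm kk u u.
  apply: (fm_ge_cst lint_kk cu cu u0 u0 uS uS) => z z0 z4.
  rewrite /kk /kern; apply: lerD.
    apply: kap_anti; first exact: nq_gt0.
    have /andP[_ h] := nq_norm z; rewrite (le_trans h)//.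
    by have := normr_ge0 z; move: z4; move: (`|z|); nar'.
  have := Qlip z 0; rewrite Q0 !subr0 => h; have := ler_norm (- Q z); rewrite normrN.
  have e4 : eta * `|z| <= eta * 4 by rewrite ler_wpM2l//; move: z4; move: (`|z|); lar'.
  by move: h e4; move: (`|Q z|) (Q z) (eta * _); lar'.
have ha : `|2 * ac u| <= 4.
  rewrite normrM ger0_norm// /ac normrN.
  have := mom_bnd cu u0 uS; rewrite Iu mulr1; move: (`|_|); lar'.
have cn := cl_ng cu; have mu1 : I2 (fun x => `|u x|) = 1.
  by rewrite -Iu; apply: eq_I2 => x; rewrite ger0_norm.
have mn : I2 (fun x => `|neg u x|) = 1 by rewrite -mu1 -[RHS](I2_neg' (cl_norm cu)).
have lT := lint_Tc (2 * ac u).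
have h2 : `|fmp (Tc (2 * ac u)) u u| <= 8 * eta.
  apply: (fm_conv_bnd1 lT cu cn uS _ mu1) => x xB.
  rewrite (le_trans (conv_bnd lT cn (supB_neg uS) xB (M := 8 * eta) _)) ?mn ?mulr1// => z zB.
  have := Tlip (z + e1 (2 * ac u)) 0; rewrite T0 !subr0 => h; rewrite (le_trans h)// mulrC ler_wpM2r//.
  rewrite (le_trans (ler_normD _ _))// norm_e1; move: zB ha; move: (`|z|) (`|_|); lar'.
have h3 : I2 (fun x => chi x * FF (u x)) <= 3 / 4 * I2 u.
  rewrite -(I2Z _ (cl_itg cu)); apply: I2_le => [||x]; [exact: cl_itg (cl_chiFF L0 k)|exact: itgZ (cl_itg cu)|].
  have := FF_le (ub x); have -> : Num.sqrt (4^-1) = 2^-1 :> R.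
    by rewrite (_ : 4^-1 = (2^-1) ^+ 2) ?sqrtr_sqr ?ger0_norm ?invr_ge0//; field.
  have /andP[c0 c1] := chi_bnd x; have := FF_ge0 (u0 x).
  move: c0 c1 (u0 x); move: (chi x) (u x) (FF _); nar'.
move: h1 h3; rewrite /JJ /Jw Ew Iu !mulr1; have := ler_norm (fmp (Tc (2 * ac u)) u u).
move: h2 se; move: (fmp _ _ _) (fm _ _ _) (I2 _) (kap _) => a b c d; move: (`|a|); lar'.
Qed.

Lemma el_exists : exists w mu, el w mu /\ E1 <= mu.
Proof.
have [w [mu [h hmu]]] := EL_exists competitor; exists w, mu; split => //.
have [h1 h2] := hsm; rewrite /E1; move: hmu h2; rewrite mulrAC (mulrAC 20).
have -> : 2 * eta * Rb = (20 * eta * Rb) / 10 by field.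
by move: (20 * eta * Rb) (kap 32); lar'.
Qed.

Section conc.
Variables (w : P -> R) (mu : R).
Hypothesis hw : el w mu.
Hypothesis hmu : E1 <= mu.

Ltac clnw := repeat match goal with H : ?A |- _ => first [constr_eq H hs; fail 1 | constr_eq H hd; fail 1
  | constr_eq H smu2; fail 1 | constr_eq H hsm; fail 1 | constr_eq H hw; fail 1 | constr_eq H hmu; fail 1 | clear H] end.
Ltac larw := clnw; intros; lra.
Ltac narw := clnw; intros; nra.

Lemma wcl : cl w. Proof. by have [[]] := hw. Qed.
Lemma w0 x : 0 <= w x. Proof. by have [[]] := hw. Qed.
Lemma wsup : supB (2 * Rb) w. Proof. by have [[]] := hw. Qed.
Lemma weven : even2 w. Proof. by have [[]] := hw. Qed.
Lemma wI : I2 w = 1. Proof. by have [_ []] := hw. Qed.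
Lemma wac : `|ac w| <= 2 * Rb. Proof. by have [_ []] := hw. Qed.
Lemma wE x : w x = chi x * ff (Pot w x - mu). Proof. by have [_ [_ _]] := hw; apply. Qed.
Lemma wI' : I2 (fun x => `|w x|) = 1.
Proof. by rewrite -wI; apply: eq_I2 => x; rewrite ger0_norm// w0. Qed.
Lemma wnI : I2 (fun x => `|neg w x|) = 1.
Proof. by rewrite -wI' -[RHS](I2_neg' (cl_norm wcl)). Qed.

Lemma w_box x : 0 < w x -> `|x| <= 2 * Rb.
Proof. by move=> h; rewrite leNgt; apply/negP => /wsup e; rewrite e ltxx in h. Qed.

(** The difference is at most [14 * Rb * eta]: 4 from the periodic images, 8 from the opposite
    vortices, 2 from the linear term. *)
Lemma Pot_kern x : `|x| <= 2 * Rb -> `|Pot w x - conv kern w x| <= 7 / 10.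
Proof.
move=> xB; have R1 := Rb1; have e0 := eta0; have [_ se] := small_eta.
have lQ := lint_llip llipQ; have lT := lint_Tc (2 * ac w).
have -> : Pot w x - conv kern w x = conv Q w x - convp (Tc (2 * ac w)) w x + lam w * x.1.
  by rewrite /Pot /kk (conv_kD x lint_kern lQ wcl); ring.
have h3 : `|conv Q w x| <= eta * (4 * Rb).
  rewrite (le_trans (conv_bnd lQ wcl wsup xB (M := eta * (4 * Rb)) _)) ?wI' ?mulr1// => z zB.
  have := Qlip z 0; rewrite Q0 !subr0 => h; rewrite (le_trans h)// ler_wpM2l//.
  by move: zB; move: (`|z|); larw.
have h4 : `|convp (Tc (2 * ac w)) w x| <= eta * (8 * Rb).
  rewrite (le_trans (conv_bnd lT (cl_ng wcl) (supB_neg wsup) xB (M := eta * (8 * Rb)) _)) ?wnI ?mulr1// => z zB.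
  have := Tlip (z + e1 (2 * ac w)) 0; rewrite T0 !subr0 => h; rewrite (le_trans h)// ler_wpM2l//.
  rewrite (le_trans (ler_normD _ _))// norm_e1 normrM ger0_norm//; move: zB wac; move: (`|z|) (`|_|); larw.
have h5 : `|lam w * x.1| <= eta * (2 * Rb).
  rewrite normrM; apply: ler_pM => //; first exact: lam_bnd wcl wI' wsup.
  exact: le_trans (norm1 x) xB.
move: se h3 h4 h5; move: (conv _ _ x) (convp _ _ x) (lam w * _) => a b c.
have := ler_normD (a - b) c; have := ler_normB a b.
have -> : 14 * Rb * eta = 14 * (Rb * eta) by ring.
have -> : eta * (4 * Rb) = 4 * (Rb * eta) by ring.
have -> : eta * (8 * Rb) = 8 * (Rb * eta) by ring.
have -> : eta * (2 * Rb) = 2 * (Rb * eta) by ring.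
move: (Rb * eta) (`|a|) (`|b|) (`|c|) (`|a - b|) (`|a - b + c|); larw.
Qed.

Lemma w_pos x : 0 < w x -> 0 < chi x /\ 0 < Pot w x - mu.
Proof.
rewrite wE => h; have /andP[c0 _] := chi_bnd x.
have [c1|c1] := eqVneq (chi x) 0; first by rewrite c1 mul0r ltxx in h.
split; first by rewrite lt_neqAle eq_sym c1.
by rewrite ltNge; apply/negP => /ff_neg e; rewrite e mulr0 ltxx in h.
Qed.

Lemma w_conv x : 0 < w x -> mu <= conv kern w x + 7 / 10.
Proof.
move=> h; have [_ hp] := w_pos h; have := Pot_kern (w_box h).
by rewrite ler_norml => /andP[_]; move: hp; move: (Pot _ _) (conv _ _ _); larw.
Qed.

Lemma w_le_conv x : 0 < w x -> w x <= conv kern w x + 7 / 10 - mu.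
Proof.
move=> h; have [hc hp] := w_pos h; have := Pot_kern (w_box h); rewrite ler_norml => /andP[_ h1].
apply: (@le_trans _ _ (Pot w x - mu)); last by move: h1; move: (Pot _ _) (conv _ _ _); larw.
rewrite {1}wE; have /andP[c0 c1] := chi_bnd x.
have := ff_le (Pot w x - mu); have := ff_ge0 (Pot w x - mu); rewrite /posp max_l ?(ltW hp)//.
by move: c0 c1; move: (chi x) (Pot w x - mu) (ff _); narw.
Qed.

Lemma conv_kern_split r' x : 0 < r' -> itg (nearK r') ->
  conv kern w x = conv (nearK r') w x + conv (farK r') w x.
Proof.
move=> r0 ni; rewrite -(conv_kD x (lint_itg ni) (lint_llip (lint_farK r0)) wcl).
by congr (conv _ w x); apply/funext => z; rewrite /nearK subrK.
Qed.

Definition M0 (rho : R) : R := 2 * (`|far rho 0| + `|E1| + 1).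

Definition near4 (rho : R) : Prop :=
  [/\ 0 < rho <= 1, itg (nearK rho) & I2 (fun x => `|nearK rho x|) <= 4^-1].

(** The supremum of [w] is at most a quarter of itself, from the near part of the kernel, plus a
    quantity that does not involve [Rb]. *)
Lemma w_le_M0 rho x : near4 rho -> w x <= M0 rho.
Proof.
move=> [/andP[r0 _] ni nS].
have [A A0 hA] := cl_bnd wcl.
pose E := [set y | exists x, y = w x].
have sE : has_sup E.
  split; first by exists (w 0), 0.
  by exists A => _ [y ->]; exact: le_trans (ler_norm _) (hA y).
have wS y : `|w y| <= sup E.
  by rewrite ger0_norm ?w0//; apply: sup_upper_bound => //; exists y.
have M00 : 0 <= M0 rho by rewrite /M0 mulr_ge0// !addr_ge0.
have S0 : 0 <= sup E := le_trans (normr_ge0 _) (wS 0).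
have key y : w y <= sup E / 4 + M0 rho / 2.
  have [h|h] := ltP 0 (w y); last by rewrite (le_trans h)// addr_ge0// divr_ge0.
  have h1 := w_le_conv h; rewrite (conv_kern_split y r0 ni) in h1.
  have h2 : `|conv (nearK rho) w y| <= sup E / 4.
    by rewrite (le_trans (conv_sup y ni wcl wS))// ler_wpM2l.
  have h3 : conv (farK rho) w y <= far rho 0.
    have := conv_le (lint_llip (lint_farK r0)) (lint_cst (far rho 0)) wcl w0 wsup (w_box h)
      (fun z _ => far_decr r0 (nq_ge0 z)).
    by rewrite /conv (I2Z _ (cl_itg wcl)) wI mulr1.
  have := ler_norm (conv (nearK rho) w y); have := ler_norm (far rho 0); have := ler_norm (- E1).
  move: h1 h2 h3 hmu; rewrite normrN /M0.
  by move: (w y) (conv (nearK _) w y) (conv (farK _) w y) (far rho 0) E1 (sup E) => a0 a b c d e; move: (`|a|) (`|c|) (`|d|); larw.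
have : sup E <= sup E / 4 + M0 rho / 2.
  by apply: ge_sup => [|_ [y ->]]; [exists (w 0), 0|exact: key].
by have := wS x; rewrite ger0_norm ?w0//; move: M00; move: (sup E) (M0 rho) (w x); larw.
Qed.

Definition str (r t : R) : R := ((`|t| <= r)%R)%:R.

Lemma str_bnd r t : 0 <= str r t <= 1.
Proof. by rewrite /str ler0n lern1 leq_b1. Qed.

Lemma mbl_str r (f : P -> R) : continuous f -> mbl (fun x => str r (f x)).
Proof.
move=> cf; apply: (measurableT_comp (f := str r)); last exact: continuous_mbl.
have -> : str r = \1_[set t | `|t| <= r].
  by apply/funext => t; rewrite /str indicE mem_setE.
apply: measurable_indic.
rewrite (_ : [set t : R | `|t| <= r] = `[- r, r]%classic); first exact: measurable_itv.
by apply/seteqP; split => t /=; rewrite in_itv/= ler_norml.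
Qed.

Lemma nq_dot (e z : P) : nq e = 1 -> dot e z ^+ 2 <= nq z.
Proof.
move=> he; rewrite -[leRHS]mul1r -he /nq /dot -subr_ge0.
by have -> : (e.1 ^+ 2 + e.2 ^+ 2) * (z.1 ^+ 2 + z.2 ^+ 2) - (e.1 * z.1 + e.2 * z.2) ^+ 2 =
  (e.1 * z.2 - e.2 * z.1) ^+ 2; [ring|exact: sqr_ge0].
Qed.

Lemma dot_lip e x y : `|dot e x - dot e y| <= (`|e.1| + `|e.2|) * `|x - y|.
Proof. by rewrite -dotBr; exact: ler_dot. Qed.

Lemma dot_cont e c : continuous (fun x : P => dot e x + c).
Proof.
apply: llip_continuous => B; exists (`|e.1| + `|e.2|); first by rewrite addr_ge0.
by move=> x y _ _; rewrite (_ : dot e x + c - (dot e y + c) = dot e x - dot e y); [exact: dot_lip|ring].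
Qed.

Lemma strip_arith (k E m : R) : k <= E -> k / 2 <= E -> 0 <= m -> m < 2^-1 -> k * (1 - m) <= E.
Proof. by move=> *; nra. Qed.

(** At a point of the support the potential is at least [mu - 7 / 10]. Mass outside the strip
    contributes at most [kap (r ^ 2)] per unit, and the near part at most [1 / 4]. If the strip
    holds less than half of the mass, a deficit of at least 1 must be covered by the mass inside,
    which contributes at most [|far rho2 0|] per unit. The resulting bound does not involve [Rb]. *)
Lemma strip_mass rho rho2 r e x : near4 rho -> 0 < rho2 -> itg (nearK rho2) ->
  M0 rho * I2 (fun x => `|nearK rho2 x|) <= 4^-1 -> rho2 <= r ^+ 2 -> 0 < r ->
  kap (r ^+ 2) <= E1 - 195 / 100 -> kap (r ^+ 2) / 2 <= E1 - 195 / 100 ->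
  nq e = 1 -> 0 < w x ->
  (`|far rho2 0| + 2)^-1 <= I2 (fun y => w y * str r (dot e y - dot e x)).
Proof.
move=> n4 r20 ni hS rr r0 k1 k2 he wx.
set m := I2 _; set C := `|far rho2 0|.
have C0 : 0 <= C by rewrite /C.
have wy y : `|w y| <= M0 rho by rewrite ger0_norm ?w0//; exact: w_le_M0.
have ms : mbl (fun y => str r (dot e y - dot e x)) := mbl_str r (@dot_cont e (- dot e x)).
have bs y : `|str r (dot e y - dot e x)| <= 1.
  by have /andP[h1 h2] := str_bnd r (dot e y - dot e x); rewrite ger0_norm.
have im : itg (fun y => w y * str r (dot e y - dot e x)) by apply: itgM (cl_itg wcl) ms bs.
have lf := lint_llip (lint_farK r20).
have h2 : `|conv (nearK rho2) w x| <= 4^-1 := le_trans (conv_sup x ni wcl wy) hS.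
have h3 : conv (farK rho2) w x <= C * m + kap (r ^+ 2) * (1 - m).
  have iZ := itgZ (kap (r ^+ 2)) (itgB (cl_itg wcl) im).
  rewrite -wI /m -(I2B (cl_itg wcl) im) -(I2Z _ im) -(I2Z _ (itgB (cl_itg wcl) im)).
  rewrite -(I2D (itgZ C im) iZ).
  apply: I2_le => [||y]; [exact: conv_itg x lf wcl|by apply: itgD => //; exact: itgZ|].
  have wy0 := w0 y; rewrite /farK /str.
  have [h|h] := leP `|dot e y - dot e x| r.
    rewrite mulr1n !mulr1 subrr mulr0 addr0 ler_wpM2r//.
    exact: le_trans (far_decr r20 (nq_ge0 _)) (ler_norm _).
  rewrite mulr0n !mulr0 add0r subr0 ler_wpM2r//.
  have q : r ^+ 2 <= nq (x - y).
    rewrite (le_trans _ (nq_dot _ he))// dotBr -(real_normK (num_real (_ - _))) distrC.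
    by rewrite lerXn2r ?nnegrE// ltW.
  by rewrite far_ge ?(le_trans rr)// kap_anti// exprn_gt0.
have h4 := w_conv wx; rewrite (conv_kern_split x r20 ni) in h4.
have m0 : 0 <= m by apply: I2_ge0 => y; rewrite mulr_ge0 ?w0//; have /andP[] := str_bnd r (dot e y - dot e x).
have h5 := ler_norm (conv (nearK rho2) w x).
have d0 : 0 < C + 2 by lra.
rewrite -div1r ler_pdivrMr//.
have [mh|mh] := leP (2^-1) m; first by nra.
have : kap (r ^+ 2) * (1 - m) <= E1 - 195 / 100.
  exact: strip_arith.
move: h2 h3 h4 h5 hmu m0; move: (conv _ _ x) (conv _ _ x) (`|_|) E1 (kap _ * _) => a b c d k'.
have -> : m * (C + 2) = C * m + 2 * m by ring.
by generalize (C * m); generalize m; larw.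
Qed.

(** The Legendre conjugate of [FF], equivalently the primitive of [ff] that vanishes on the negative
    half-line. *)
Definition Phi (t : R) : R := t * ff t - FF (ff t).

Lemma FF0 : FF 0 = 0.
Proof. by rewrite /FF; ring. Qed.

Lemma Phi_ge t : ff t ^+ 2 / 2 <= Phi t.
Proof. by have := FF_gap t (lexx 0); rewrite FF0 /Phi sub0r sqrrN mul0r subrr mulrC; lra. Qed.

Lemma Phi_ge0 t : 0 <= Phi t.
Proof. by rewrite (le_trans _ (Phi_ge t))// divr_ge0// sqr_ge0. Qed.

Lemma Phi_neg t : t <= 0 -> Phi t = 0.
Proof. by move=> /ff_neg e; rewrite /Phi e FF0 mulr0 subrr. Qed.

Lemma Phi_gap t t' : ff t' * (t - t') <= Phi t - Phi t'.
Proof.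
have := FF_gap t (ff_ge0 t'); have := sqr_ge0 (ff t' - ff t); rewrite /Phi.
by move: (ff t) (ff t') (FF (ff t)) (FF (ff t')) ((ff t' - ff t) ^+ 2); larw.
Qed.

Lemma llip_add g c : llip g -> llip (fun x => g (x + c)).
Proof.
move=> h B; have [L L0 hL] := h (B + `|c|); exists L => // x y xB yB.
have := hL (x + c) (y + c); rewrite (_ : x + c - (y + c) = x - y); last by rewrite opprD addrACA subrr addr0.
by apply; rewrite (le_trans (ler_normD _ _))// lerD2r.
Qed.

Lemma llip_ff g : llip g -> llip (fun x => ff (g x)).
Proof.
by move=> h B; have [L L0 hL] := h B; exists L => // x y xB yB; rewrite (le_trans (ff_lip _ _)) ?hL.
Qed.

Lemma llip_Phi g : llip g -> llip (fun x => Phi (g x)).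
Proof.
move=> h; apply: llipB; first by apply: llipM => //; exact: llip_ff.
move=> B; have [L L0 hL] := h B; have [M M0 hM] := llip_bnd h B.
have fM x : `|x| <= B -> 0 <= ff (g x) <= M.
  move=> /hM hx; rewrite ff_ge0 (le_trans (ff_le _))// /posp ge_max M0 andbT.
  exact: le_trans (ler_norm _) hx.
have S0 : 0 <= Num.sqrt M + M by rewrite addr_ge0// sqrtr_ge0.
exists ((Num.sqrt M + M) * L) => [|x y xB yB]; first by rewrite mulr_ge0.
rewrite (le_trans (FF_lip (fM x xB) (fM y yB)))// -mulrA ler_wpM2l//.
by rewrite (le_trans (ff_lip _ _)) ?hL.
Qed.

Definition th (x : P) : R := Pot w x - mu.

Lemma llip_th : llip th.
Proof. by apply: llipB; [exact: llip_Pot wcl|exact: llip_cst]. Qed.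

Lemma slide_pt (k p v A B : R) : 0 <= k -> 0 <= p -> v * A <= B -> k * v * p * A <= k * p * B.
Proof.
move=> k0 p0 h; have -> : k * v * p * A = k * p * (v * A) by ring.
by rewrite ler_wpM2l// mulr_ge0.
Qed.

(** Since [w = chi * ff (th)] and [ff] is the slope of the convex [Phi], the change of [Pot] is
    bounded by the change of [Phi (th)]. A change of variable moves the translation onto [chi * p],
    and what remains only sees how the cut-off varies along [c]. *)
Lemma slide_le (p : P -> R) (c : P) : llip p -> (forall x, 0 <= p x) ->
  I2 (fun x => w x * p x * (Pot w (x - c) - Pot w x)) <=
  I2 (fun x => (chi (x + c) * p (x + c) - chi x * p x) * Phi (th x)).
Proof.
move=> lp p0; have lth := llip_th; have lP := llip_Pot wcl.
have cwp : cl (fun x => w x * p x) := clM wcl lp.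
have cg : cl (fun x => w x * p x * (Pot w (x - c) - Pot w x)).
  by apply: clM => //; apply: llipB => //; exact: llip_add.
have cxp : cl (fun x => chi x * p x) := clM cl_chi lp.
have lPh := llip_Phi lth.
have c1 : cl (fun x => chi (x + c) * p (x + c) * Phi (th x)) := clM (cl_add c cxp) lPh.
have c2 : cl (fun x => chi x * p x * Phi (th x)) := clM cxp lPh.
rewrite -(I2_add c (cl_itg cg)).
have -> : I2 (fun x => (chi (x + c) * p (x + c) - chi x * p x) * Phi (th x)) =
  I2 (fun x => chi (x + c) * p (x + c) * Phi (th x) - chi (x + c) * p (x + c) * Phi (th (x + c))).
  rewrite (I2B (cl_itg c1) (itg_add c (cl_itg c2))) (I2_add c (cl_itg c2)) -(I2B (cl_itg c1) (cl_itg c2)).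
  by apply: eq_I2 => x; rewrite mulrBl.
apply: I2_le => [||x]; [exact: itg_add (cl_itg cg)|exact: itgB (cl_itg c1) (itg_add c (cl_itg c2))|].
rewrite addrK wE -mulrBr.
have -> : Pot w x - Pot w (x + c) = th x - th (x + c) by rewrite /th; ring.
have /andP[k0 _] := chi_bnd (x + c).
exact: slide_pt k0 (p0 _) (Phi_gap _ _).
Qed.

Definition rest (x : P) : R := conv Q w x - convp (Tc (2 * ac w)) w x + lam w * x.1.

Lemma Pot_rest x : Pot w x = conv kern w x + rest x.
Proof. by rewrite /Pot /kk (conv_kD x lint_kern (lint_llip llipQ) wcl) /rest; ring. Qed.

Lemma rest_lip x y : `|rest x - rest y| <= 3 * eta * `|x - y|.
Proof.
have e0 := eta0; pose B := `|x| + `|y|.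
have xB : `|x| <= B by rewrite lerDl. have yB : `|y| <= B by rewrite lerDr.
have lQ := lint_llip llipQ; have lT := lint_Tc (2 * ac w).
have h3 : `|conv Q w x - conv Q w y| <= eta * `|x - y|.
  by apply: (@conv_lip_g Q w eta (2 * Rb) B lQ wcl e0 wsup wI') => // z z' _ _; exact: Qlip.
have h4 : `|convp (Tc (2 * ac w)) w x - convp (Tc (2 * ac w)) w y| <= eta * `|x - y|.
  apply: (@conv_lip_g _ _ eta (2 * Rb) B lT (cl_ng wcl) e0 (supB_neg wsup) wnI) => // z z' _ _; rewrite /Tc.
  have := Tlip (z + e1 (2 * ac w)) (z' + e1 (2 * ac w)).
  by rewrite (_ : z + e1 (2 * ac w) - (z' + e1 (2 * ac w)) = z - z')// opprD addrACA subrr addr0.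
have h5 : `|lam w * x.1 - lam w * y.1| <= eta * `|x - y|.
  rewrite -mulrBr normrM; apply: ler_pM => //; first exact: lam_bnd wcl wI' wsup.
  exact: norm1 (x - y).
rewrite /rest; move: h3 h4 h5; move: (conv _ _ x) (conv _ _ y) (convp _ _ x) (convp _ _ y) (_ * x.1) (_ * y.1) => a a' b b' c c'.
have -> : a - b + c - (a' - b' + c') = (a - a') - (b - b') + (c - c') by ring.
move: (a - a') (b - b') (c - c') => {a' b' c'} {}a {}b {}c.
have := ler_normD (a - b) c; have := ler_normB a b; rewrite -mulrA.
by move: (`|a - b + c|) (`|a - b|) (`|a|) (`|b|) (`|c|) (eta * _); larw.
Qed.

(** For an even kernel the form is symmetric and translation invariant, so the integral equals
    [- fm g h h / 2], where [h], the difference of [u] and its translate, is of order [t]. The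
    self-interaction exerts no first-order force. *)
Lemma self_shift g u (e : P) : lint g -> (forall x, g (- x) = g x) -> cl u -> `|e| <= 1 ->
  exists2 C : R, 0 <= C & forall t : R, 0 <= t <= 1 ->
  `|I2 (fun x => u x * (conv g u (x - t *: e) - conv g u x))| <= C * t ^+ 2.
Proof.
move=> lg ge cu e1'; have [L [B [L0 B0 uL uB]]] := cu.
pose N := I2 (fun z => `|g z| * box (2 * (B + 1)) z).
have N0 : 0 <= N by apply: I2_ge0 => z; rewrite mulr_ge0// box_ge0.
exists (L * N * (L * (2 * (B + 1)) ^+ 2)); first by apply: mulr_ge0; apply: mulr_ge0 => //; exact: sqr_ge0.
move=> t /andP[t0 t1].
have gs a b : cl a -> cl b -> fm g a b = fm g b a.
  move=> ca cb; rewrite (fm_sym lg ca cb); congr (fm _ b a); apply/funext => z; exact: ge.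
pose c := - (t *: e); pose u' y := u (y + c); have cu' : cl u' := cl_add c cu.
pose h x := u' x - u x; have ch : cl h := clB cu' cu.
have nc : `|c| <= t by rewrite normrN normrZ ger0_norm// ler_piMr.
have hE y : `|h y| <= L * t.
  rewrite (le_trans (uL _ _))// ler_wpM2l// (_ : y + c - y = c)//; first by rewrite addrAC subrr add0r.
have hB : supB (B + 1) h.
  move=> y yB; rewrite /h /u' !uB ?subrr//; first by move: yB; move: (`|y|); larw.
  have := ler_normB (y + c) c; rewrite addrK; move: nc t1 yB; move: (`|y|) (`|y + c|) (`|c|); larw.
have B1 : 0 <= B + 1 by lra.
have Lt : 0 <= L * t by rewrite mulr_ge0.
have l1 := I2_prod_itg cu lg cu'; have l2 := I2_prod_itg cu lg cu.
have -> : I2 (fun x => u x * (conv g u (x - t *: e) - conv g u x)) = fm g u u' - fm g u u.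
  rewrite /fm -(I2B l1 l2); apply: eq_I2 => x; rewrite mulrBr; congr (_ * _ - _).
  by rewrite (conv_add x c lg cu).
have -> : fm g u u' - fm g u u = - (fm g h h / 2).
  have E : fm g h h = fm g u' u' + fm g u u - 2 * fm g u u'.
    have Eh : h = fun x => u' x + (-1) * u x by apply/funext => x; rewrite mulN1r.
    have cn : cl (fun x => u' x + (-1) * u x) by rewrite -Eh.
    rewrite Eh (fm_linl (-1) lg cu' cu cn) (fm_linr (-1) lg cu' cu' cu) (fm_linr (-1) lg cu cu' cu) (gs u' u cu' cu).
    by move: (fm g u' u') (fm g u u) (fm g u u') => r1 r2 r3; ring.
  have Et : fm g u' u' = fm g u u := fm_add c lg cu cu.
  by rewrite E Et; move: (fm g u u) (fm g u u') => r1 r2; field.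
have h1 : `|fm g h h| <= L * t * N * (L * t * (2 * (B + 1)) ^+ 2).
  have h2 := fm_conv_bnd lg ch ch hB (fun x xB => conv_supB lg ch Lt hB hE xB).
  rewrite (le_trans h2)// ler_wpM2l ?mulr_ge0//; exact: I2_supB.
have -> : L * N * (L * (2 * (B + 1)) ^+ 2) * t ^+ 2 = L * t * N * (L * t * (2 * (B + 1)) ^+ 2) by ring.
rewrite normrN normrM (@ger0_norm _ 2^-1)//; apply: le_trans h1.
by rewrite ler_piMr//; lra.
Qed.

Lemma linear_le0 (X C : R) : (forall t : R, 0 < t <= 1 -> t * X <= C * t ^+ 2) -> X <= 0.
Proof.
move=> h; rewrite leNgt; apply/negP => X0.
have C1 : 0 < 2 * (`|C| + 1) by have := normr_ge0 C; lra.
pose t := Num.min 1 (X / (2 * (`|C| + 1))).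
have t0 : 0 < t by rewrite lt_min ltr01 divr_gt0.
have t1 : t <= 1 by rewrite ge_min lexx.
have t2 : t * (2 * (`|C| + 1)) <= X by rewrite -ler_pdivlMr// ge_min lexx orbT.
have h1 : t * X - C * t ^+ 2 <= 0 by rewrite subr_le0 h// t0 t1.
have := @grad_arith X C `|C| t 0 0 (ler_norm C) (normr_ge0 C) t0 t2.
by rewrite add0r => /(_ h1 (lexx 0)).
Qed.

Lemma dot_shift e x (t : R) : nq e = 1 -> dot e (x + t *: e) = dot e x + t.
Proof. by move=> he; rewrite dotDr dotZr [dot e e](_ : _ = nq e) ?he ?mulr1// /dot /nq !expr2. Qed.

Lemma nq1_norm e : nq e = 1 -> `|e| <= 1.
Proof.
move=> he; have /andP[h _] := nq_norm e; rewrite he in h.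
by rewrite -(ler_pXn2r (ltn0Sn 1)) ?nnegrE// expr1n.
Qed.

(** * Sliding the mass across a gap of the support *)

Section gap.
Variables (e : P) (b r : R).

(** Unit directions along which an outward motion does not raise the cut-off; the axes qualify by
    [dir1] and [dir2]. *)
Definition dir : Prop := nq e = 1 /\ forall x (t : R), 0 <= t -> 0 <= dot e x -> chi (x + t *: e) <= chi x.

(** A Lipschitz ramp from [b] to [b + r]. On the support of a profile with a gap it takes only the
    values 0 and 1, so [wR] and [wL] are the pieces on either side. *)
Definition ph (x : P) : R := Num.max 0 (Num.min 1 ((dot e x - b) / r)).
Definition wR x := w x * ph x.
Definition wL x := w x - wR x.
(** The rate at which the attraction grows as the pieces approach. Squared distances are at most
    [32 * Rb ^ 2], and they shrink at rate at least [3 * r], because the pieces are [2 * r] apart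
    and [t <= r]. *)
Definition cR : R := AA * (32 * Rb ^+ 2) `^ (s - 2) * (3 * r).

Lemma ph_bnd x : 0 <= ph x <= 1.
Proof. by rewrite /ph le_max lexx /= ge_max ler01 /= ge_min lexx. Qed.

Lemma ph1 x : 0 < r -> b + r <= dot e x -> ph x = 1.
Proof.
move=> r0 h; have h1 : 1 <= (dot e x - b) / r by rewrite ler_pdivlMr//; move: h; move: (dot _ _); larw.
by rewrite /ph min_l// max_r.
Qed.

Lemma ph0 x : 0 < r -> dot e x <= b -> ph x = 0.
Proof.
move=> r0 h; have h1 : (dot e x - b) / r <= 0 by rewrite ler_pdivrMr// mul0r subr_le0.
by rewrite /ph max_l// ge_min h1 orbT.
Qed.

Lemma ph_llip : 0 < r -> llip ph.
Proof.
move=> r0; have m_lip (x y : R) : `|Num.max 0 (Num.min 1 x) - Num.max 0 (Num.min 1 y)| <= `|x - y|.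
  rewrite -[leRHS]mul1r; move: x y; apply: sym_lip => x y xy; rewrite mul1r ler_norml.
  have [y1|y1] := leP 1 y.
    rewrite (max_r ler01); have [x1|x1] := leP 1 x.
      by rewrite (max_r ler01); apply/andP; split; lra.
    by have [x0|x0] := leP 0 x; apply/andP; split; lra.
  have -> : Num.min 1 x = x by rewrite min_r//; lra.
  by have [x0|x0] := leP 0 x; have [y0|y0] := leP 0 y; apply/andP; split; lra.
move=> B; exists ((`|e.1| + `|e.2|) / r); first by rewrite divr_ge0 ?addr_ge0// ltW.
move=> x y _ _; rewrite (le_trans (m_lip _ _))// -mulrBl normrM normfV (gtr0_norm r0) mulrAC.
rewrite ler_wpM2r ?invr_ge0 ?(ltW r0)//.
by rewrite (_ : dot e x - b - (dot e y - b) = dot e x - dot e y); [exact: dot_lip|ring].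
Qed.

(* If the profile has a gap, sliding the mass on one side of it towards the other side increases the energy, so one of the sides carries no mass. *)
Definition gap : Prop := forall y, b - r < dot e y < b + r -> w y = 0.

Lemma gap_cases x : gap -> 0 < w x -> dot e x <= b - r \/ b + r <= dot e x.
Proof.
move=> hg wx; have [h|h] := leP (dot e x) (b - r); first by left.
right; rewrite leNgt; apply/negP => h2; have := hg x; rewrite h h2 => /(_ isT) e0.
by rewrite e0 ltxx in wx.
Qed.

(** On the support, a shift by [t <= r] cannot change [ph], and [chi] decreases outwards. Elsewhere
    either [Phi] vanishes, or [chi x = 0], and then [chi] or [ph] vanishes at the shifted point. *)
Lemma gap_pt x (t : R) : dir -> gap -> 0 < r -> r <= b -> 0 <= t <= r ->
  (chi (x + t *: e) * ph (x + t *: e) - chi x * ph x) * Phi (th x) <= 0.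
Proof.
move=> [he hc] hg r0 rb /andP[t0 tr].
have P0 := Phi_ge0 (th x).
have [h|h] := leP (th x) 0; first by rewrite Phi_neg// mulr0.
suff : chi (x + t *: e) * ph (x + t *: e) - chi x * ph x <= 0 by move=> k; rewrite mulr_le0_ge0.
have /andP[k0 k1] := chi_bnd x; have /andP[k2 k3] := chi_bnd (x + t *: e).
have /andP[p0 p1] := ph_bnd x; have /andP[p2 p3] := ph_bnd (x + t *: e).
have dt := dot_shift x t he.
have [cx|cx] := eqVneq (chi x) 0.
  rewrite cx mul0r subr0; have [d0|d0] := leP 0 (dot e x).
    by have := hc x t t0 d0; rewrite cx => k; rewrite mulr_le0_ge0.
  rewrite ph0 ?mulr0// dt; move: d0 tr rb; move: (dot _ _); larw.
have wx : 0 < w x.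
  rewrite wE; apply: mulr_gt0; first by rewrite lt_neqAle eq_sym cx.
  rewrite -/(th x) lt_neqAle ff_ge0 andbT eq_sym; apply/negP => /eqP/ff_eq0.
  by rewrite leNgt h.
have [d|d] := gap_cases hg wx.
  rewrite !ph0// ?mulr0 ?subrr// ?dt; move: d tr r0; move: (dot _ _); larw.
rewrite !ph1 ?dt// ?mulr1 ?subr_le0; last by move: d t0; move: (dot _ _); larw.
apply: hc => //; move: d r0 rb; move: (dot _ _); larw.
Qed.

Lemma gap_rhs (t : R) : dir -> gap -> 0 < r -> r <= b -> 0 <= t <= r ->
  I2 (fun x => (chi (x + t *: e) * ph (x + t *: e) - chi x * ph x) * Phi (th x)) <= 0.
Proof.
move=> hd' hg r0 rb t0r.
have cxp : cl (fun x => chi x * ph x) := clM cl_chi (ph_llip r0).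
have cc := clM (clB (cl_add (t *: e) cxp) cxp) (llip_Phi llip_th).
rewrite -I20; apply: I2_le => [||x]; [exact: cl_itg cc|exact: itg0|exact: gap_pt].
Qed.

Lemma wR_ge0 x : 0 <= wR x.
Proof. by rewrite /wR mulr_ge0 ?w0//; have /andP[] := ph_bnd x. Qed.
Lemma wL_ge0 x : 0 <= wL x.
Proof. by rewrite /wL /wR subr_ge0 ler_piMr ?w0//; have /andP[] := ph_bnd x. Qed.
Lemma cl_wR : 0 < r -> cl wR.
Proof. by move=> r0; apply: (clM wcl (ph_llip r0)). Qed.
Lemma cl_wL : 0 < r -> cl wL.
Proof. by move=> r0; apply: (clB wcl (cl_wR r0)). Qed.

Lemma wR_pos x : gap -> 0 < r -> 0 < wR x -> `|x| <= 2 * Rb /\ b + r <= dot e x.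
Proof.
move=> hg r0 h; have wx : 0 < w x.
  by rewrite lt_neqAle w0 andbT eq_sym; apply/eqP => e0; rewrite /wR e0 mul0r ltxx in h.
split; first exact: w_box.
have [d|//] := gap_cases hg wx.
by rewrite /wR ph0 ?mulr0 ?ltxx// in h; move: d r0; move: (dot _ _); larw.
Qed.

Lemma wL_pos x : gap -> 0 < r -> 0 < wL x -> `|x| <= 2 * Rb /\ dot e x <= b - r.
Proof.
move=> hg r0 h; have wx : 0 < w x.
  by rewrite lt_neqAle w0 andbT eq_sym; apply/eqP => e0; rewrite /wL /wR e0 mul0r subrr ltxx in h.
split; first exact: w_box.
have [//|d] := gap_cases hg wx.
by rewrite /wL /wR ph1 ?mulr1 ?subrr ?ltxx// in h.
Qed.

Lemma kern_gain (x y : P) (t : R) : nq e = 1 -> `|x| <= 2 * Rb -> `|y| <= 2 * Rb -> 0 < r ->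
  b + r <= dot e x -> dot e y <= b - r -> 0 <= t <= r ->
  cR * t <= kern (x - t *: e - y) - kern (x - y).
Proof.
move=> he xB yB r0 dx dy /andP[t0 tr]; have R1 := Rb1.
have -> : x - t *: e - y = x - y - t *: e by rewrite addrAC.
set z := x - y; have dz : 2 * r <= dot e z by rewrite /z dotBr; move: dx dy; move: (dot _ _) (dot _ _); larw.
have E : nq (z - t *: e) = nq z - 2 * t * dot e z + t ^+ 2.
  transitivity (nq z - 2 * t * dot e z + t ^+ 2 * nq e); last by rewrite he mulr1.
  rewrite /nq /dot.
  have -> : (z - t *: e).1 = z.1 - t * e.1 by [].
  have -> : (z - t *: e).2 = z.2 - t * e.2 by [].
  by ring.
have hz : nq z <= 32 * Rb ^+ 2.
  have /andP[_ h] := nq_norm z; rewrite (le_trans h)//.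
  have : `|z| <= 4 * Rb by rewrite (le_trans (ler_normB _ _))//; move: xB yB; move: (`|x|) (`|y|); larw.
  by have := normr_ge0 z; move: R1; move: (`|z|); narw.
have q0 : 0 < nq (z - t *: e).
  have := nq_dot (z - t *: e) he; have : dot e (z - t *: e) = dot e z - t.
    by rewrite -scaleNr dot_shift.
  move=> ->; apply: lt_le_trans; rewrite exprn_gt0//; move: dz tr r0; move: (dot _ _); larw.
have qq : nq (z - t *: e) <= nq z by rewrite E; move: dz tr t0; move: (nq z) (dot e z); narw.
have q1 : 0 < nq z := lt_le_trans q0 qq.
have /andP[h _] := kap_bounds q0 qq.
rewrite /kern (le_trans _ h)// /cR -!mulrA; apply: ler_wpM2l; first exact: ltW AA_gt0.
have [ss0 ss1] := sbnd.
apply: ler_pM; [exact: powR_ge0|by rewrite !mulr_ge0// ltW|by apply: powR_anti => //; lra|].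
by rewrite E; move: dz tr t0; move: (nq z) (dot e z); narw.
Qed.

(** First-order balance when [wR] moves towards [wL]: it gains [cR] per unit of mass of [wL], its
    own interaction changes by order [t ^ 2] only, and the regular terms lose at most [3 * eta]. *)
Lemma gap_lhs : nq e = 1 -> gap -> 0 < r -> exists C : R, forall t : R, 0 <= t <= 1 -> t <= r ->
  t * (I2 wR * (cR * I2 wL - 3 * eta)) - C * t ^+ 2 <= I2 (fun x => w x * ph x * (Pot w (x - t *: e) - Pot w x)).
Proof.
move=> he hg r0; have cr := cl_wR r0; have cll := cl_wL r0.
have kev x : kern (- x) = kern x by rewrite /kern nqN.
have [C C0 hC] := self_shift lint_kern kev cr (nq1_norm he).
exists C => t /andP[t0 t1] tr.
have t01 : 0 <= t <= 1 by rewrite t0.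
have t0r : 0 <= t <= r by rewrite t0.
have := hC t t01; rewrite ler_norml => /andP[hS _].
have lkL : llip (conv kern wL) := conv_llip lint_kern cll.
have lkR : llip (conv kern wR) := conv_llip lint_kern cr.
have i1 : itg (fun x => wR x * (conv kern wR (x - t *: e) - conv kern wR x)).
  exact: cl_itg (clM cr (llipB (llip_add (- (t *: e)) lkR) lkR)).
have i2 : itg (fun x => wR x * (conv kern wL (x - t *: e) - conv kern wL x)).
  exact: cl_itg (clM cr (llipB (llip_add (- (t *: e)) lkL) lkL)).
have i3 : itg (fun x => w x * ph x * (Pot w (x - t *: e) - Pot w x)).
  exact: cl_itg (clM cr (llipB (llip_add (- (t *: e)) (llip_Pot wcl)) (llip_Pot wcl))).
have iR := cl_itg cr.
pose c0 := cR * t * I2 wL - 3 * eta * t.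
have key x : c0 * wR x + wR x * (conv kern wR (x - t *: e) - conv kern wR x)
  <= w x * ph x * (Pot w (x - t *: e) - Pot w x).
  rewrite -/(wR x) [c0 * _]mulrC -mulrDr.
  have := wR_ge0 x; rewrite le_eqVlt => /orP[/eqP <-|h]; first by rewrite !mul0r.
  rewrite ler_wpM2l ?wR_ge0//.
  have [xB dx] := wR_pos hg r0 h.
  have sp y : conv kern w y = conv kern wL y + conv kern wR y.
    rewrite -(convD y lint_kern cll cr); congr (conv _ _ y); apply/funext => z; rewrite /wL; ring.
  have hL : cR * t * I2 wL <= conv kern wL (x - t *: e) - conv kern wL x.
    have j1 := conv_itg (x - t *: e) lint_kern cll; have j2 := conv_itg x lint_kern cll.
    rewrite -(I2B j1 j2) -(I2Z _ (cl_itg cll)); apply: I2_le => [||y]; [exact: itgZ (cl_itg cll)|exact: itgB|].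
    rewrite -mulrBl; have := wL_ge0 y; rewrite le_eqVlt => /orP[/eqP <-|hy]; first by rewrite !mulr0.
    have [yB dy] := wL_pos hg r0 hy.
    by rewrite ler_wpM2r ?wL_ge0// kern_gain.
  have := rest_lip (x - t *: e) x; rewrite (_ : x - t *: e - x = - (t *: e)); last by rewrite addrAC subrr add0r.
  rewrite normrN normrZ (ger0_norm t0) => hr.
  have : 3 * eta * (t * `|e|) <= 3 * eta * t.
    by rewrite ler_wpM2l ?mulr_ge0 ?eta0// ler_piMr// nq1_norm.
  have := ler_norm (- (rest (x - t *: e) - rest x)); rewrite normrN.
  rewrite !Pot_rest !sp /c0; move: hL hr; move: (rest _) (rest _) => u v; move: (`|u - v|).
  move: (conv _ _ _) (conv _ _ _) (conv _ _ _) (conv _ _ _) (cR * t * _) (3 * eta * t) (3 * eta * (t * _)); larw.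
have := I2_le (itgD (itgZ c0 iR) i1) i3 key.
rewrite (I2D (itgZ c0 iR) i1) (I2Z c0 iR); apply: le_trans.
rewrite /c0; move: hS; move: (I2 (fun _ => _)) (I2 wR) (I2 wL) (C * _); larw.
Qed.

(** If both sides carried mass, each would carry at least [ms], since a strip of half-width [r]
    about a support point cannot reach across the gap. The first-order gain in [gap_lhs] would be
    positive, against [slide_le] and [gap_rhs]. *)
Lemma gap_side (ms : R) : dir -> gap -> 1 <= r -> r <= b -> 3 * eta < cR * ms -> 0 < ms ->
  (forall x, 0 < w x -> ms <= I2 (fun y => w y * str r (dot e y - dot e x))) ->
  (forall x, b <= dot e x -> w x = 0) \/ (forall x, dot e x <= b -> w x = 0).
Proof.
move=> hd' hg r1 rb hms ms0 hst; have r0 : 0 < r by lra.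
have he : nq e = 1 by case: hd'.
have [[x [xb wx]]|nR] := pselect (exists x, b <= dot e x /\ 0 < w x); last first.
  left => x xb; apply/eqP; rewrite eq_le w0 andbT leNgt; apply/negP => h; apply: nR; exists x; split => //.
have [[y [yb wy]]|nL] := pselect (exists x, dot e x <= b /\ 0 < w x); last first.
  right => y yb; apply/eqP; rewrite eq_le w0 andbT leNgt; apply/negP => h; apply: nL; exists y; split => //.
exfalso.
have iss z : itg (fun y => w y * str r (dot e y - dot e z)).
  apply: (@itgM _ _ 1 (cl_itg wcl) (mbl_str r (@dot_cont e (- dot e z)))) => y'.
  by have /andP[h1 h2] := str_bnd r (dot e y' - dot e z); rewrite ger0_norm.
have mR : ms <= I2 wR.
  have dx : b + r <= dot e x.
    by have [d|//] := gap_cases hg wx; move: d xb r0; move: (dot _ _); larw.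
  apply: (le_trans (hst x wx)); apply: I2_le => [||z]; [exact: iss|exact: cl_itg (cl_wR r0)|].
  have := w0 z; rewrite le_eqVlt => /orP[/eqP wz|wz]; first by rewrite /wR -wz !mul0r.
  rewrite /wR ler_wpM2l ?w0// /str; case: (leP `|dot e z - dot e x| r) => [h|_]; last by rewrite mulr0n; have /andP[] := ph_bnd z.
  rewrite ph1//; have [d|//] := gap_cases hg wz.
  by move: h d dx r0; rewrite ler_norml => /andP[]; move: (dot _ _) (dot _ _); larw.
have mL : ms <= I2 wL.
  have dy : dot e y <= b - r.
    by have [//|d] := gap_cases hg wy; move: d yb r0; move: (dot _ _); larw.
  apply: (le_trans (hst y wy)); apply: I2_le => [||z]; [exact: iss|exact: cl_itg (cl_wL r0)|].
  have := w0 z; rewrite le_eqVlt => /orP[/eqP wz|wz]; first by rewrite /wL /wR -wz !mul0r subrr.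
  rewrite /str; case: (leP `|dot e z - dot e y| r) => [h|_]; last by rewrite mulr0n mulr0 wL_ge0.
  rewrite mulr1n mulr1 /wL /wR ph0 ?mulr0 ?subr0//.
  by move: h dy; rewrite ler_norml => /andP[]; move: (dot _ _) (dot _ _); larw.
have [C hC] := gap_lhs he hg r0.
have : I2 wR * (cR * I2 wL - 3 * eta) <= 0.
  apply: (@linear_le0 _ C) => t /andP[t0 t1].
  have t01 : 0 <= t <= 1 by rewrite (ltW t0).
  have tr : t <= r by lra.
  have t0r : 0 <= t <= r by rewrite (ltW t0).
  have h1 := hC t t01 tr.
  have h2 := slide_le (t *: e) (ph_llip r0) (fun x => let: conj h _ := andP (ph_bnd x) in h).
  have h3 := gap_rhs hd' hg r0 rb t0r.
  by move: (le_trans h1 (le_trans h2 h3)); rewrite subr_le0.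
have cR0 : 0 <= cR by rewrite /cR !mulr_ge0 ?powR_ge0 ?(ltW AA_gt0)// ltW.
have : cR * ms <= cR * I2 wL by rewrite ler_wpM2l.
by move: mR mL hms ms0; move: (I2 wR) (I2 wL) (cR * ms) => u v k; move: (cR * v); narw.
Qed.

End gap.

(** Slab [j] has width [4 * r]. A point in its middle half has its strip of half-width [r] inside
    the slab, so the strips are disjoint and their masses add up. *)
Lemma mass_iter (e : P) (r ms : R) (xs : nat -> P) n : 0 < r ->
  (forall j, (j < n)%N -> 4 * r * j%:R + r < dot e (xs j) < 4 * r * j%:R + 3 * r /\
     ms <= I2 (fun y => w y * str r (dot e y - dot e (xs j)))) ->
  exists S : P -> R, [/\ itg (fun y => w y * S y), n%:R * ms <= I2 (fun y => w y * S y) &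
    forall y, S y <= ((dot e y < 4 * r * n%:R)%R)%:R].
Proof.
move=> r0; elim: n => [|n IH] h.
  exists (fun=> 0); split => [||y]; last by rewrite ler0n.
    by apply: (eq_itg _ itg0) => y; rewrite mulr0.
  by rewrite mul0r; apply: I2_ge0 => y; rewrite mulr0.
have [|S [iS mS bS]] := IH; first by move=> j jn; apply: h; exact: ltnW.
have [/andP[d1 d2] hm] := h n (ltnSn n).
have is' : itg (fun y => w y * str r (dot e y - dot e (xs n))).
  apply: (@itgM _ _ 1 (cl_itg wcl) (mbl_str r (@dot_cont e (- dot e (xs n))))) => y'.
  by have /andP[h1 h2] := str_bnd r (dot e y' - dot e (xs n)); rewrite ger0_norm.
have E y : w y * (S y + str r (dot e y - dot e (xs n))) = w y * S y + w y * str r (dot e y - dot e (xs n)).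
  by rewrite mulrDr.
exists (fun y => S y + str r (dot e y - dot e (xs n))); split.
- by apply: (eq_itg (fun y => esym (E y))); exact: itgD.
- under eq_I2 do rewrite E.
  by rewrite (I2D iS is') -natr1 mulrDl mul1r lerD.
- move=> y; rewrite -[n.+1%:R]natr1 /str; case: (leP `|dot e y - dot e (xs n)| r) => [k|_].
    have [k1 k2] : 4 * r * n%:R < dot e y /\ dot e y < 4 * r * (n%:R + 1).
      move: k; rewrite ler_norml => /andP[k1 k2].
      by rewrite mulrDr mulr1; split; move: d1 d2 k1 k2; move: (dot e y) (dot e _) (4 * r * n%:R); larw.
    have := bS y; rewrite ltNge (ltW k1) /= mulr0n k2 mulr1n => h0.
    by rewrite -[leRHS]add0r lerD.
  rewrite mulr0n addr0 (le_trans (bS y))//.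
  have [k|k] := ltP (dot e y) (4 * r * n%:R); last by rewrite ler0n.
  rewrite (_ : (dot e y < _) = true)//; rewrite (lt_le_trans k)// mulrDr lerDl mulr1; lra.
Qed.

(* Each point of the support has mass at least [ms] in its strip, so fewer than [n] disjoint strips meet the support. *)
Lemma gap_exists (e : P) (r ms : R) n : 0 < r -> 1 < n%:R * ms ->
  (forall x, 0 < w x -> ms <= I2 (fun y => w y * str r (dot e y - dot e x))) ->
  exists2 b : R, 2 * r <= b <= 4 * r * n%:R & gap e b r.
Proof.
move=> r0 nms hst; apply: contrapT => hno.
have H (j : nat) : exists x, (j < n)%N -> 4 * r * j%:R + r < dot e x < 4 * r * j%:R + 3 * r /\
     ms <= I2 (fun y => w y * str r (dot e y - dot e x)).
  apply: contrapT => hx; have jn : (j < n)%N.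
    by rewrite ltnNge; apply/negP => nj; apply: hx; exists 0; rewrite ltnNge nj.
  apply: hno; exists (4 * r * j%:R + 2 * r).
    have : (j.+1%:R : R) <= n%:R by rewrite ler_nat.
    rewrite -natr1; have : 0 <= j%:R :> R by rewrite ler0n.
    by move: r0; move: (j%:R) (n%:R); narw.
  move=> y /andP[y1 y2]; apply/eqP; rewrite eq_le w0 andbT leNgt; apply/negP => wy.
  apply: hx; exists y => _; split; last exact: hst.
  by apply/andP; split; [move: y1|move: y2]; move: (dot _ _) (_ * j%:R); larw.
have [xs hxs] := choice H.
have [S [iS mS bS]] := mass_iter r0 hxs.
have : I2 (fun y => w y * S y) <= I2 w.
  apply: I2_le => [||y]; [exact: iS|exact: cl_itg wcl|].
  by rewrite ler_piMr ?w0// (le_trans (bS y))// lern1 leq_b1.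
by rewrite wI; move: mS nms; move: (I2 _) (_ * ms); larw.
Qed.

Lemma chi_mono1 (sg : R) x (t : R) : sg ^+ 2 = 1 -> 0 <= t -> 0 <= sg * x.1 ->
  chi (x + t *: (sg, 0)) <= chi x.
Proof.
move=> s2 t0 d0; rewrite /chi.
have -> : (x + t *: (sg, 0)).1 = x.1 + t * sg by [].
have -> : (x + t *: (sg, 0)).2 = x.2 by exact: (etrans (congr1 (fun v => x.2 + v) (mulr0 t)) (addr0 _)).
have R1 := Rb1; have R0 : 0 < Rb by lra.
rewrite ler_wpM2r//; first by have /andP[] := tent_bnd (x.2 / Rb).
apply: tent_mono; rewrite !normrM ler_wpM2r//.
have -> : `|x.1| = `|sg * x.1|.
  rewrite normrM (_ : `|sg| = 1) ?mul1r//.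
  by apply/eqP; rewrite -(@eqrXn2 _ 2)// expr1n real_normK ?num_real// s2.
have -> : `|x.1 + t * sg| = `|sg * x.1 + t|.
  have -> : sg * x.1 + t = sg * (x.1 + t * sg).
    by rewrite mulrDr mulrCA -expr2 s2 mulr1.
  rewrite normrM (_ : `|sg| = 1) ?mul1r//.
  by apply/eqP; rewrite -(@eqrXn2 _ 2)// expr1n real_normK ?num_real// s2.
by rewrite !ger0_norm ?addr_ge0// lerDl.
Qed.

Lemma chi_mono2 (sg : R) x (t : R) : sg ^+ 2 = 1 -> 0 <= t -> 0 <= sg * x.2 ->
  chi (x + t *: (0, sg)) <= chi x.
Proof.
move=> s2 t0 d0.
have sw (y : P) : chi y = chi (y.2, y.1) by rewrite /chi mulrC.
rewrite sw (sw x); have := @chi_mono1 sg (x.2, x.1) t s2 t0 d0.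
by congr (chi _ <= _).
Qed.

Lemma dir1 (sg : R) : sg ^+ 2 = 1 -> dir (sg, 0).
Proof.
move=> s2; split; first by rewrite /nq /= s2 expr0n addr0.
move=> x t t0; rewrite /dot /= mul0r addr0 => d0; exact: chi_mono1.
Qed.

Lemma dir2 (sg : R) : sg ^+ 2 = 1 -> dir (0, sg).
Proof.
move=> s2; split; first by rewrite /nq /= s2 expr0n add0r.
move=> x t t0; rewrite /dot /= mul0r add0r => d0; exact: chi_mono2.
Qed.

Lemma conv_subx g v x c : conv g v (x - c) = conv (fun z => g (z - c)) v x.
Proof. by rewrite /conv; apply: eq_I2 => y; rewrite addrAC. Qed.

(** A translation along [x_1] costs nothing to first order: [kk] exerts no force by [self_shift],
    and the mean force of the opposite vortices is [lam w], which the linear term of [Pot]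
    compensates exactly. *)
Lemma trans_lhs (sg : R) : sg ^+ 2 = 1 -> exists C : R, forall t : R, 0 <= t <= 1 ->
  - (C * t ^+ 2) <= I2 (fun x => w x * (Pot w (x - t *: (sg, 0)) - Pot w x)).
Proof.
move=> s2; set e : P := (sg, 0).
have ne : `|e| <= 1 by apply: nq1_norm; rewrite /nq /= s2 expr0n addr0.
have [C C0 hC] := self_shift lint_kk kk_even wcl ne.
exists (C + Cq) => t /andP[t0 t1].
have t01 : 0 <= t <= 1 by rewrite t0.
have := hC t t01; rewrite ler_norml => /andP[hS _].
set c := t *: e in hS *.
have R1 := Rb1.
pose a2 := 2 * ac w; pose Ta := Tc a2; pose T1a := T1c a2.
have lT : lint Ta := lint_Tc a2; have lT1 : lint T1a := lint_T1c a2.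
have lk := lint_kk; have cw := wcl; have cn := cl_ng cw.
have lkw : llip (conv kk w) := conv_llip lk cw.
have lTw : llip (convp Ta w) := conv_llip lT cn.
have lT1w : llip (convp T1a w) := conv_llip lT1 cn.
have ha : `|a2| <= 4 * Rb.
  by rewrite /a2 normrM ger0_norm//; have := wac; move: (`|ac _|); larw.
have i1 : itg (fun x => w x * (conv kk w (x - c) - conv kk w x)).
  exact: cl_itg (clM cw (llipB (llip_add (- c) lkw) lkw)).
have i2 : itg (fun x => w x * convp T1a w x) := I2_prod_itg cw lT1 cn.
have i3 : itg (fun x => w x * (Pot w (x - c) - Pot w x)).
  exact: cl_itg (clM cw (llipB (llip_add (- c) (llip_Pot cw)) (llip_Pot cw))).
have key x : w x * (conv kk w (x - c) - conv kk w x) + (t * sg * (w x * convp T1a w x)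
    + (- (t * sg * lam w) - Cq * t ^+ 2) * w x)
  <= w x * (Pot w (x - c) - Pot w x).
  have := w0 x; rewrite le_eqVlt => /orP[/eqP <-|h]; first by rewrite !mul0r !mulr0 !addr0.
  have xB := w_box h.
  have lG : lint (fun z => Ta z + (- (t * sg) * T1a z + Cq * t ^+ 2)).
    by apply: lintD => //; apply: lintD; [exact: lintZ|exact: lint_cst].
  have hz z : `|z| <= 2 * Rb + 2 * Rb -> Ta (z - c) <= Ta z + (- (t * sg) * T1a z + Cq * t ^+ 2).
    move=> hz.
    have n1 : `|z + e1 a2| <= 8 * Rb.
      rewrite (le_trans (ler_normD _ _))// norm_e1; move: hz ha; move: (`|z|) (`|a2|); larw.
    have sg1 : `|sg| <= 1 by rewrite (le_trans (norm1 e)).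
    have n2 : `|z + e1 a2 + e1 (- (t * sg))| <= 9 * Rb.
      rewrite (le_trans (ler_normD _ _))// norm_e1 normrN normrM (ger0_norm t0).
      have : t * `|sg| <= 1 by rewrite mulr_ile1.
      by move: n1 R1; move: (`|_|) (t * _); larw.
    have n3 : `|z + e1 a2| <= 9 * Rb by move: n1 R1; move: (`|_|); larw.
    have := T1q n3 n2; rewrite ler_norml => /andP[_].
    have -> : z + e1 a2 + e1 (- (t * sg)) = z - c + e1 a2.
      rewrite addrAC; congr (_ + _ + _); apply: (congr2 pair) => //.
      exact: esym (etrans (congr1 -%R (mulr0 t)) (oppr0 _)).
    rewrite -/(Tc a2 (z - c)) -/(Tc a2 z) -/(T1c a2 z) -/Ta -/T1a sqrrN exprMn s2 mulr1.
    by move: (Ta _) (Ta _) (T1a _) (t * sg) (Cq * _); larw.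
  have h1 : convp Ta w (x - c) <= convp Ta w x - t * sg * convp T1a w x + Cq * t ^+ 2.
    rewrite /convp conv_subx.
    have lTs : lint (fun z => Ta (z - c)) := lint_add (- c) lT.
    have nw0 y : 0 <= neg w y by exact: w0.
    apply: (le_trans (conv_le lTs lG cn nw0 (supB_neg wsup) xB hz)).
    have lG2 : lint (fun z => - (t * sg) * T1a z + Cq * t ^+ 2).
      by apply: lintD; [exact: lintZ|exact: lint_cst].
    rewrite (conv_kD x lT lG2 cn) (conv_kD x (lintZ _ lT1) (lint_cst _) cn).
    have -> : conv (fun=> Cq * t ^+ 2) (neg w) x = Cq * t ^+ 2.
      by rewrite /conv (I2Z _ (cl_itg cn)) (I2_neg' cw) wI mulr1.
    have -> : conv (fun z => - (t * sg) * T1a z) (neg w) x = - (t * sg) * conv T1a (neg w) x.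
      rewrite /conv -(I2Z _ (conv_itg x lT1 cn)); apply: eq_I2 => y; ring.
    by rewrite mulNr addrA.
  have E : (x - c).1 = x.1 - t * sg by [].
  rewrite /Pot -/a2 -/Ta E.
  have -> : w x * (conv kk w (x - c) - conv kk w x) + (t * sg * (w x * convp T1a w x)
    + (- (t * sg * lam w) - Cq * t ^+ 2) * w x) = w x * (conv kk w (x - c) - conv kk w x +
     t * sg * convp T1a w x - t * sg * lam w - Cq * t ^+ 2) by ring.
  rewrite ler_wpM2l ?w0//; move: h1; rewrite mulrBr.
  have -> : lam w * (t * sg) = t * sg * lam w by ring.
  move: (conv kk w _) (conv kk w _) (convp Ta w _) (convp Ta w _) (t * sg * convp _ _ _) (t * sg * lam w) (lam w * _) (Cq * _); larw.
have ik := itgZ (- (t * sg * lam w) - Cq * t ^+ 2) (cl_itg cw).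
have ij := itgD (itgZ (t * sg) i2) ik.
have := I2_le (itgD i1 ij) i3 key; apply: le_trans.
rewrite (I2D i1 ij) (I2D (itgZ _ i2) ik) (I2Z _ i2) (I2Z _ (cl_itg cw)) wI mulr1.
rewrite (_ : I2 (fun x => w x * convp T1a w x) = lam w)//.
by move: hS; rewrite mulrDl; move: (I2 _) (t * sg * lam w) (C * _) (Cq * _); larw.
Qed.

Lemma chi_slope (sg : R) x (t : R) : sg ^+ 2 = 1 -> Rb < sg * x.1 -> 0 <= t -> sg * x.1 + t < 2 * Rb ->
  chi (x + t *: (sg, 0)) - chi x <= - (chi x * (t / Rb)).
Proof.
move=> s2 h1 t0 h2; have R1 := Rb1; have R0 : 0 < Rb by lra.
have ns : `|sg| = 1 by apply/eqP; rewrite -(@eqrXn2 _ 2)// expr1n real_normK ?num_real// s2.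
have te (u : R) : 1 <= sg * u <= 2 -> tent u = 2 - sg * u.
  move=> /andP[u1 u2]; have -> : tent u = tent (sg * u) by rewrite /tent normrM ns mul1r.
  by rewrite /tent ger0_norm ?min_r ?max_r//; lra.
rewrite /chi.
have -> : (x + t *: (sg, 0)).1 = x.1 + t * sg by [].
have -> : (x + t *: (sg, 0)).2 = x.2 by exact: (etrans (congr1 (fun v => x.2 + v) (mulr0 t)) (addr0 _)).
have E : sg * ((x.1 + t * sg) / Rb) = (sg * x.1 + t) / Rb.
  by rewrite mulrA; congr (_ / _); rewrite mulrDr mulrCA -expr2 s2 mulr1.
rewrite (te ((x.1 + t * sg) / Rb)) ?(te (x.1 / Rb)) ?E ?mulrA; last 2 first.
- rewrite ler_pdivlMr// ler_pdivrMr// mul1r ltW//= ltW//; move: h2 t0; move: (sg * _); larw.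
- rewrite ler_pdivlMr// ler_pdivrMr// mul1r (ltW h2) andbT; move: h1 t0; move: (sg * _); larw.
have /andP[p0 p1] := tent_bnd (x.2 / Rb).
have -> : (2 - (sg * x.1 + t) / Rb) * tent (x.2 / Rb) - (2 - sg * x.1 / Rb) * tent (x.2 / Rb) =
  - (tent (x.2 / Rb) * (t / Rb)) by field; exact: lt0r_neq0.
rewrite lerN2.
have tR : 0 <= t / Rb by rewrite divr_ge0// ltW.
rewrite -[_ * t / Rb]mulrA.
have : sg * x.1 / Rb >= 1 by rewrite ler_pdivlMr// mul1r ltW.
move: p0 tR; move: (tent _) (t / Rb) (sg * x.1 / Rb) => a c v a0 c0 v1.
by have := mulr_ge0 a0 c0; nra.
Qed.

(** All the mass lies beyond the gap and no other piece attracts it back, so it is translated as a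
    whole. By [trans_lhs] there is no first-order cost, whereas mass beyond [Rb], where [chi]
    strictly decreases, would make the right side of [slide_le] negative at order [t]. *)
Lemma trans_side (sg b r : R) : sg ^+ 2 = 1 -> gap (sg, 0) b r -> 0 < r -> r <= b ->
  (forall x, sg * x.1 <= b -> w x = 0) -> forall x, Rb < sg * x.1 -> w x = 0.
Proof.
move=> s2 hg r0 rb hb x0 hx0; apply/eqP; rewrite eq_le w0 andbT leNgt; apply/negP => wx0.
set e : P := (sg, 0) in hg.
have R1 := Rb1; have R0 : 0 < Rb by lra.
have de x : dot e x = sg * x.1 by rewrite /dot /= mul0r addr0.
have [he hc] := dir1 s2; rewrite -/e in he hc.
have [cx0 tx0] := w_pos wx0.
have h2 : sg * x0.1 < 2 * Rb.
  rewrite ltNge; apply/negP => h; move: cx0; rewrite /chi tent0 ?mul0r ?ltxx//.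
  have ns : `|sg| = 1 by apply/eqP; rewrite -(@eqrXn2 _ 2)// expr1n real_normK ?num_real// s2.
  have nx : `|sg * x0.1| = `|x0.1| by rewrite normrM ns mul1r.
  by rewrite normrM normfV (gtr0_norm R0) ler_pdivlMr// -nx (le_trans h)// ler_norm.
have [L [B [L0 _ wL _]]] := wcl.
pose W := w x0; pose X := chi x0.
(* Within [q / 2] of [x0], points stay on the sloping part of [chi] even after a translation by at
   most [q], and [w] and [chi] keep at least half of their values at [x0]. *)
pose q := Num.min (Num.min ((sg * x0.1 - Rb) / 2) ((2 * Rb - sg * x0.1) / 2)) (Num.min (W / (2 * (L + 1))) (X / 4)).
have W0 : 0 < W by []. have X0 : 0 < X by [].
have L1 : 0 < 2 * (L + 1) by lra.
have q0 : 0 < q.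
  rewrite !lt_min !divr_gt0//; last 2 first.
  - by move: h2; move: (sg * _); larw.
  - by move: hx0; move: (sg * _); larw.
have [q1 q2 q3 q4] : [/\ q <= (sg * x0.1 - Rb) / 2, q <= (2 * Rb - sg * x0.1) / 2, q <= W / (2 * (L + 1)) & q <= X / 4].
  by split; rewrite /q !ge_min lexx ?orbT.
(* The factor [X / 2 / Rb] bounds the decrease of [chi] per unit of translation from below, and the
   other factor bounds [Phi (th x)] from below through [Phi_ge]. *)
clearbody q; pose c := X / 2 / Rb * ((W / 2) ^+ 2 / 2).
have c0 : 0 < c by rewrite /c; apply: mulr_gt0; rewrite divr_gt0// ?divr_gt0// exprn_gt0// divr_gt0.
pose m := I2 (fun x => box (q / 2) (x0 - x)).
have m0 : 0 < m.
  rewrite /m (I2_sub x0 (itg_box _)) I2_box; last by rewrite divr_ge0// ltW.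
  by rewrite exprn_gt0// mulr_gt0// divr_gt0.
have ib := itg_sub x0 (itg_box (q / 2)).
have [C hC] := trans_lhs s2; rewrite -/e in hC.
have phw x : w x * ph e b r x = w x.
  have := w0 x; rewrite le_eqVlt => /orP[/eqP <-|wx]; first by rewrite mul0r.
  have [d|d] := gap_cases hg wx; last by rewrite ph1// mulr1.
  have : w x = 0 by apply: hb; move: d r0; rewrite de; move: (sg * _); larw.
  by move=> ez; rewrite ez ltxx in wx.
(* Rescaling by [tm] lets [t'] run over the whole interval required by [linear_le0] while the actual
   translation stays below 1, [r] and [q]. *)
pose tm := Num.min 1 (Num.min r q).
have : m * c * tm <= 0.
  apply: (@linear_le0 _ (C * tm ^+ 2)) => t' /andP[t'0 t'1].
  pose t := t' * tm.
  have tm0 : 0 < tm by rewrite !lt_min ltr01 r0 q0.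
  have t0 : 0 < t by rewrite mulr_gt0.
  have ttm : t <= tm by rewrite /t ler_piMl// ltW.
  have [t1 tr tq] : [/\ t <= 1, t <= r & t <= q].
    by split; apply: (le_trans ttm); rewrite !ge_min lexx ?orbT.
  have t01 : 0 <= t <= 1 by rewrite (ltW t0).
  have t0r : 0 <= t <= r by rewrite (ltW t0).
  have h1 := hC t t01.
  have h3 := slide_le (t *: e) (@ph_llip e b r r0) (fun x => let: conj h _ := andP (ph_bnd e b r x) in h).
  move: h3; under [in X in X <= _]eq_I2 do rewrite phw.
  move=> h3.
  have cxp : cl (fun x => chi x * ph e b r x) := clM cl_chi (@ph_llip e b r r0).
  have cc := clM (clB (cl_add (t *: e) cxp) cxp) (llip_Phi llip_th).
  have h4 : I2 (fun x => (chi (x + t *: e) * ph e b r (x + t *: e) - chi x * ph e b r x) * Phi (th x)) <= - (c * t) * m.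
    rewrite -(I2Z _ ib); apply: I2_le => [||x]; [exact: cl_itg cc|exact: itgZ|].
    have [xq|xq] := leP `|x0 - x| (q / 2); last by rewrite box0// mulr0 gap_pt.
    rewrite box1// mulr1.
    have d1 : `|sg * x0.1 - sg * x.1| <= q / 2.
      rewrite -mulrBr normrM (le_trans _ xq)//.
      have -> : `|sg| = 1 by apply/eqP; rewrite -(@eqrXn2 _ 2)// expr1n real_normK ?num_real// s2.
      by rewrite mul1r (norm1 (x0 - x)).
    move: d1; rewrite ler_norml => /andP[d1 d2].
    have a1 : Rb < sg * x.1 by move: hx0 d1 d2 q1 q0; generalize (sg * x0.1); generalize (sg * x.1); generalize q; larw.
    have a2 : sg * x.1 + t < 2 * Rb by move: h2 d1 d2 q2 q0 tq; generalize (sg * x0.1); generalize (sg * x.1); generalize q; larw.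
    have wx : W / 2 <= w x.
      have := wL x0 x; rewrite ler_norml => /andP[_]; rewrite -/W.
      have : L * `|x0 - x| <= W / 2.
        apply: (@le_trans _ _ ((L + 1) * (W / (2 * (L + 1))))).
          apply: ler_pM => //; [lra|rewrite (le_trans xq)// (le_trans _ q3)//; lra].
        rewrite le_eqVlt; apply/orP; left; apply/eqP; field; lra.
      by move: (L * _) (w x); larw.
    have wx' : 0 < w x by apply: lt_le_trans wx; rewrite divr_gt0.
    have xx : X / 2 <= chi x.
      have := chi_lip x0 x; rewrite ler_norml => /andP[_]; rewrite -/X.
      have n8 : 2 * `|x0 - x| <= q by rewrite mulrC -ler_pdivlMr.
      by move=> h; move: (le_trans h n8) q4 X0; generalize (chi x); generalize X; generalize q; larw.
    have /andP[k0 k1] := chi_bnd x.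
    have fx : W / 2 <= ff (th x).
      rewrite (le_trans wx)// wE -/(th x); have := ff_ge0 (th x); move: k0 k1; move: (chi x) (ff _); narw.
    have dx : b + r <= dot e x.
      have [d|//] := gap_cases hg wx'.
      by have := hb x; rewrite -de => /(_ (le_trans d _)) h; move: wx'; rewrite h ?ltxx//; lra.
    rewrite !ph1//; last by rewrite dot_shift// (le_trans dx)// lerDl ltW.
    rewrite !mulr1; have sl := chi_slope s2 a1 (ltW t0) a2.
    have P2 : (W / 2) ^+ 2 / 2 <= Phi (th x).
      rewrite (le_trans _ (Phi_ge _))// ler_pM2r// lerXn2r// ?nnegrE ?ff_ge0//.
      by rewrite divr_ge0// ltW.
    have tR : 0 <= t / Rb by rewrite divr_ge0// ltW.
    have -> : c * t = X / 2 * (t / Rb) * ((W / 2) ^+ 2 / 2) by rewrite /c; ring.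
    have z1 : X / 2 * (t / Rb) <= chi x - chi (x + t *: e).
      rewrite (@le_trans _ _ (chi x * (t / Rb)))// ?ler_wpM2r//.
      by move: sl; rewrite -/e; move: (chi _) (chi _) (_ * (t / Rb)); larw.
    have z0 : 0 <= X / 2 * (t / Rb) by rewrite mulr_ge0// divr_ge0// ltW.
    have s0 : 0 <= (W / 2) ^+ 2 / 2 by rewrite divr_ge0// sqr_ge0.
    have := ler_pM z0 s0 z1 P2.
    have -> : (chi x - chi (x + t *: e)) * Phi (th x) = - ((chi (x + t *: e) - chi x) * Phi (th x)) by ring.
    by rewrite lerNr.
  have := le_trans h1 (le_trans h3 h4).
  have -> : t' * (m * c * tm) = c * t * m by rewrite /t; ring.
  have -> : C * tm ^+ 2 * t' ^+ 2 = C * t ^+ 2 by rewrite /t; ring.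
  by move: (C * _) (c * t) => u v; rewrite mulNr lerN2.
have tm0 : 0 < tm by rewrite !lt_min ltr01 r0 q0.
have mct : 0 < m * c * tm by apply: mulr_gt0 => //; exact: mulr_gt0.
by rewrite leNgt mct.
Qed.

(** Each axis direction has a gap with one empty side. If the outer side is empty, [b <= Rb]
    concludes. If the inner one is empty, [trans_side] settles [x_1], and along [x_2] evenness would
    leave no mass at all. *)
Lemma el_support (r ms : R) n : 1 <= r -> 0 < ms -> 1 < n%:R * ms -> 4 * r * n%:R <= Rb ->
  3 * eta < cR r * ms ->
  (forall e, nq e = 1 -> forall x, 0 < w x -> ms <= I2 (fun y => w y * str r (dot e y - dot e x))) ->
  forall x, 0 < w x -> `|x| <= Rb.
Proof.
move=> r1 ms0 nms nR hms hst.
have r0 : 0 < r by lra.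
have sides e : dir e -> exists b : R, [/\ r <= b <= Rb, gap e b r &
    (forall x, b <= dot e x -> w x = 0) \/ (forall x, dot e x <= b -> w x = 0)].
  move=> hd'; have [he _] := hd'.
  have [b /andP[b1 b2] hg] := gap_exists r0 nms (hst e he).
  have rb : r <= b by lra.
  exists b; split => //; first by rewrite rb (le_trans b2).
  exact: (gap_side hd' hg r1 rb hms ms0 (hst e he)).
have one2 : (1 : R) ^+ 2 = 1 by rewrite expr1n.
have mone2 : (-1 : R) ^+ 2 = 1 by rewrite sqrrN expr1n.
have nz : ~ (forall x, w x = 0).
  move=> h; have := wI; rewrite (_ : I2 w = 0) => [/eqP|]; first by rewrite eq_sym oner_eq0.
  by rewrite -I20; exact: eq_I2.
have s1 (sg : R) : sg ^+ 2 = 1 -> forall x, Rb < sg * x.1 -> w x = 0.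
  move=> s2 x hx; have [b [/andP[b1 b2] hg [h|h]]] := sides _ (dir1 s2).
    by apply: h; rewrite /dot /= mul0r addr0; apply: le_trans b2 (ltW hx).
  have hb y : sg * y.1 <= b -> w y = 0 by move=> k; apply: h; rewrite /dot /= mul0r addr0.
  exact: (trans_side s2 hg r0 b1 hb hx).
have s2 x : Rb < x.2 -> w x = 0.
  have [b [/andP[b1 b2] hg [h|h]]] := sides _ (dir2 one2).
    by move=> hx; apply: h; rewrite /dot /= mul0r add0r mul1r; apply: le_trans b2 (ltW hx).
  case: nz => y; have [k|k] := leP y.2 b; first by apply: h; rewrite /dot /= mul0r add0r mul1r.
  by rewrite -weven; apply: h; rewrite /dot /= mul0r add0r mul1r; lra.
move=> x wx; rewrite leNgt; apply/negP => h; move: wx.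
suff -> : w x = 0 by rewrite ltxx.
move: h; rewrite prod_normE lt_max !ltr_normr => /orP[|] /orP[] h.
- by apply: (s1 1 one2); rewrite mul1r.
- by apply: (s1 (-1) mone2); rewrite mulN1r.
- exact: s2.
- by rewrite -weven; apply: s2.
Qed.

(** Where [chi] is 1 it has already left the equation. In the rest of the open box [w] vanishes and
    [chi] does not, so [ff] vanishes there too. *)
Lemma el_interior : (forall x, 0 < w x -> `|x| <= Rb) -> forall x, `|x| < 2 * Rb -> w x = ff (Pot w x - mu).
Proof.
move=> hs' x xB; have R1 := Rb1; have R0 : 0 < Rb by lra.
have [h|h] := leP `|x| Rb; first by rewrite wE chi1// mul1r.
have wx0 : w x = 0.
  apply/eqP; rewrite eq_le w0 andbT leNgt; apply/negP => /hs'.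
  by rewrite leNgt h.
have : chi x != 0.
  have tp t : `|t| < 2 * Rb -> tent (t / Rb) != 0.
    move=> ht; rewrite lt0r_neq0// /tent lt_max; apply/orP; right; rewrite lt_min ltr01 /= subr_gt0.
    by rewrite normrM normfV (gtr0_norm R0) ltr_pdivrMr.
  by rewrite /chi mulf_neq0// tp// (le_lt_trans _ xB)// ?norm1 ?norm2.
by move: wx0; rewrite wE => /eqP; rewrite mulf_eq0 => /orP[/eqP ->|/eqP ->]; rewrite ?eqxx// mulr0.
Qed.

End conc.
End scaled.

(** * Order of choice of the constants *)

Lemma ln_large (N : R) : exists2 q : R, 1 <= q & N <= ln q.
Proof.
exists (expR `|N|); first by rewrite -expR0 ler_expR.
by rewrite expRK ler_norm.
Qed.

(** Here the factor 128 of the kernel is used: [kap 32 = 128 * 32 ^ (s - 1) >= 128 / 32 = 4]. *)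
Lemma E1_ge : s < 1 -> 2 <= E1.
Proof.
move=> s1; have [ss0 ss1] := sbnd.
rewrite /E1 /kap lt_eqF//.
have : (32 : R) `^ (-1) <= 32 `^ (s - 1) by apply: ler_powR; lra.
by rewrite powR_inv1//; lra.
Qed.

(** For [s = 1], [kap] tends to minus infinity. For [s < 1] it tends to 0 from above, but the
    threshold is at least [5 / 100] by [E1_ge], whence the constant [2560 = 128 / (5 / 100)]. *)
Lemma kap_small : exists2 q : R, 1 <= q & forall q', q <= q' ->
  kap q' <= E1 - 195 / 100 /\ kap q' / 2 <= E1 - 195 / 100.
Proof.
suff [q q1 [h1 h2]] : exists2 q : R, 1 <= q & kap q <= E1 - 195 / 100 /\ kap q / 2 <= E1 - 195 / 100.
  exists q => // q' qq; have := kap_anti (lt_le_trans ltr01 q1) qq.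
  by split; lra.
have [ss0 ss1] := sbnd.
have [s1|s1] := eqVneq s 1.
  have [q q1 hq] := ln_large (`|E1| + 2); exists q => //.
  rewrite /kap s1 eqxx; have := ler_norm (- E1); rewrite normrN; have := normr_ge0 E1.
  by move: hq; move: (ln q) (`|E1|) E1 => a b c *; split; lra.
have s1' : s < 1 by rewrite lt_neqAle s1.
have e2 := E1_ge s1'.
have [K K0 K1] : exists2 K : R, 0 < K & 128 / K <= 5 / 100 by exists 2560; lra.
have [q q1 hq] := ln_large (ln K / (1 - s)); exists q => //.
suff : kap q <= 5 / 100 by move=> h; split; lra.
rewrite /kap (negPf s1).
have q0 : 0 < q by lra.
have h : q `^ (s - 1) <= K^-1.
  rewrite -ler_ln ?posrE ?powR_gt0 ?invr_gt0// ln_powR lnV ?posrE//.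
  move: hq; rewrite ler_pdivrMr; last by rewrite subr_gt0.
  by move: (ln q) (ln K) => a b; lra.
by rewrite (le_trans _ K1)// ler_wpM2l.
Qed.

(** The support lies in the box of half-side [Rb], whereas the equation, now without [chi], holds on
    a box twice as large and so covers a neighbourhood of the support. *)
Record profile (Rb eta Cq : R) (Q T T1 w : P -> R) (mu : R) : Prop := Profile {
  prof_cl : cl w;
  prof_ge0 : forall x, 0 <= w x;
  prof_even : even2 w;
  prof_mass : I2 w = 1;
  prof_ac : `|ac w| <= 2 * Rb;
  prof_sup : supB Rb w;
  prof_eq : forall x, `|x| < 2 * Rb -> w x = ff (Pot Q T T1 w x - mu) }.

(** Strip width, strip mass and number of strips come from the kernel alone. They fix the box, and
    [eta] is made small only afterwards, so the same two constants serve every perturbation. *)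
Lemma profile_exists : exists Rb eta0 : R, [/\ 1 <= Rb, 0 < eta0 &
  forall (eta Cq : R) (Q T T1 : P -> R), reg_data Rb eta Cq Q T T1 -> eta <= eta0 ->
  exists w mu, profile Rb eta Cq Q T T1 w mu].
Proof.
have q0 : 0 < 4^-1 :> R by lra.
have [rho n4] := near_small q0.
have M00 : 0 < M0 rho + 1 by rewrite ltr_wpDl// /M0 mulr_ge0// !addr_ge0.
have [rho2 [/andP[r20 r21] ni nS]] := near_small (divr_gt0 q0 M00).
have [r r1 hk] := kap_small.
pose ms : R := (`|far rho2 0| + 2)^-1.
have d0 : 0 < `|far rho2 0| + 2 by have := normr_ge0 (far rho2 0); lra.
have ms0 : 0 < ms by rewrite invr_gt0.
have [n hn] : exists n : nat, 1 < n%:R * ms.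
  exists (Num.bound (`|far rho2 0| + 2)); rewrite ltr_pdivlMr// mul1r.
  by apply: archi_boundP; exact: ltW.
pose Rb : R := 4 * r * n%:R + 2.
have n0 : 0 <= 4 * r * n%:R by rewrite !mulr_ge0//; lra.
have Rb2 : 2 <= Rb by rewrite /Rb; lra.
have c0 : 0 < cR Rb r * ms.
  apply: mulr_gt0 => //; apply: mulr_gt0; last by lra.
  apply: mulr_gt0; first exact: AA_gt0.
  by rewrite powR_gt0// mulr_gt0// exprn_gt0//; lra.
(* The first bound gives the margins of [hsm]; the second keeps [3 * eta] below the attraction
   [cR Rb r * ms]. *)
pose eta0 : R := Num.min (20 * Rb)^-1 (cR Rb r * ms / 4).
exists Rb, eta0; split; first by lra.
  by rewrite lt_min divr_gt0// invr_gt0 andbT; lra.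
move=> eta Cq Q T T1 hd; rewrite le_min => /andP[he1 he2].
have hsm : 2 <= Rb /\ 20 * Rb * eta <= 1.
  split => //; rewrite mulrC -ler_pdivlMr ?div1r//; lra.
have [w [mu [hw hmu]]] := el_exists hd hsm.
have rr : r <= r ^+ 2 by rewrite expr2 ler_peMl//; lra.
have [k1 k2] := hk _ rr.
have r0 : 0 < r by lra.
have hS : M0 rho * I2 (fun x => `|nearK rho2 x|) <= 4^-1.
  apply: (@le_trans _ _ (M0 rho * (4^-1 / (M0 rho + 1)))).
    by rewrite ler_wpM2l// /M0 mulr_ge0// !addr_ge0.
  rewrite mulrA ler_pdivrMr// mulrC ler_wpM2l ?(ltW q0)//; lra.
have hst e : nq e = 1 -> forall x, 0 < w x -> ms <= I2 (fun y => w y * str r (dot e y - dot e x)).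
  move=> e1' x wx; apply: (strip_mass hd hsm hw hmu n4 r20 ni hS _ r0 k1 k2 e1' wx).
  by lra.
have h3 : 3 * eta < cR Rb r * ms by lra.
have nR : 4 * r * n%:R <= Rb by rewrite /Rb; lra.
have sup := el_support hd hw r1 ms0 hn nR h3 hst.
exists w, mu; split.
- exact: wcl hw.
- exact: w0 hw.
- exact: weven hw.
- exact: wI hw.
- exact: wac hw.
- move=> x xR; apply/eqP; rewrite eq_le (w0 hw) andbT leNgt; apply/negP => /sup.
  by rewrite leNgt xR.
- by move=> x xB; exact: (el_interior hd hw sup xB).
Qed.

(** * Regularity of the potential *)

Lemma dfar_lip rho q q' : 0 < rho -> `|dfar rho q - dfar rho q'| <= AA * (2 * rho `^ (s - 3)) * `|q - q'|.
Proof.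
move=> r0; move: q q'; apply: sym_lip => x y xy; have /andP[h1 h2] := dfar_bounds r0 xy.
by rewrite distrC ger0_norm.
Qed.

Lemma far_strict_arith (fx fy dx dy d0 h a b : R) : - dy * h <= fx - fy -> fx - fy <= - dx * h -> 0 <= h ->
  - a <= dx - d0 -> dx - d0 <= a -> - b <= dy - d0 -> dy - d0 <= b -> 0 <= a -> 0 <= b -> forall z, z = - h ->
  - ((a + b) * h) <= fx - fy - d0 * z <= (a + b) * h.
Proof. by move=> h1 h2 h0 *; subst; apply/andP; split; nra. Qed.

(** The slope is Lipschitz, so it may be frozen at any [q0], even far from [q] and [q']; [qk_lip]
    relies on this freedom. *)
Lemma far_strict rho q q' q0 : 0 < rho -> `|far rho q - far rho q' - dfar rho q0 * (q - q')| <=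
  AA * (2 * rho `^ (s - 3)) * (`|q - q0| + `|q' - q0|) * `|q - q'|.
Proof.
move=> r0; set C := AA * _.
have C0 : 0 <= C by rewrite /C mulr_ge0 ?(ltW AA_gt0)// mulr_ge0// powR_ge0.
have key x y : x <= y -> `|far rho x - far rho y - dfar rho q0 * (x - y)| <= C * (`|x - q0| + `|y - q0|) * (y - x).
  move=> xy; have /andP[h1 h2] := far_bounds r0 xy.
  have := dfar_lip x q0 r0; have := dfar_lip y q0 r0; rewrite -/C !ler_norml => /andP[a1 a2] /andP[b1 b2].
  have d0 : 0 <= y - x by rewrite subr_ge0.
  have nx : 0 <= C * `|x - q0| by rewrite mulr_ge0.
  have ny : 0 <= C * `|y - q0| by rewrite mulr_ge0.
  have -> : C * (`|x - q0| + `|y - q0|) * (y - x) = (C * `|x - q0| + C * `|y - q0|) * (y - x) by ring.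
  by apply: (far_strict_arith h1 h2) => //; rewrite opprB.
have [xy|/ltW xy] := leP q q'; first by rewrite (distrC q q') (ger0_norm (_ : 0 <= q' - q)) ?subr_ge0// key.
rewrite (ger0_norm (_ : 0 <= q - q')) ?subr_ge0// addrC [`|q - q0| + _]addrC.
by have := key _ _ xy; rewrite -normrN; congr (`|_| <= _); ring.
Qed.

Lemma llip_nq : llip nq.
Proof.
have l2 : llip (fun x => x.2).
  by move=> B; exists 1 => // x y _ _; rewrite mul1r (norm2 (x - y)).
by apply: llipD; apply: llipM => //; exact: llip_fst.
Qed.

Definition gradF rho (x : P) : P := (2 * dfar rho (nq x) * x.1, 2 * dfar rho (nq x) * x.2).

Lemma llip_gradF rho : 0 < rho -> llip (fun x => (gradF rho x).1) /\ llip (fun x => (gradF rho x).2).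
Proof.
move=> r0.
have ld : llip (fun x => 2 * dfar rho (nq x)).
  apply: llipZ => B; have [L L0 hL] := llip_nq B; exists (AA * (2 * rho `^ (s - 3)) * L).
    by rewrite !mulr_ge0 ?powR_ge0 ?(ltW AA_gt0).
  move=> x y xB yB; rewrite (le_trans (dfar_lip _ _ r0))// -[leRHS]mulrA ler_wpM2l ?hL//.
  by rewrite mulr_ge0 ?(ltW AA_gt0)// mulr_ge0// powR_ge0.
have l2 : llip (fun x => x.2).
  by move=> B; exists 1 => // x y _ _; rewrite mul1r (norm2 (x - y)).
by split; apply: llipM => //; exact: llip_fst.
Qed.

Lemma sub_subr (x y u : P) : x - u - (y - u) = x - y.
Proof. by rewrite opprB addrA subrK. Qed.

Lemma nq_sub x y : nq x - nq y = dot (x + y) (x - y).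
Proof. by rewrite /nq /dot /=; ring. Qed.

Lemma nq_sub_le (B : R) x y : `|x| <= B -> `|y| <= B -> `|nq x - nq y| <= 4 * B * `|x - y|.
Proof.
move=> xB yB; rewrite nq_sub (le_trans (ler_dot _ _))// ler_wpM2r//.
have h1 := le_trans (norm1 x) xB; have h2 := le_trans (norm2 x) xB.
have h3 := le_trans (norm1 y) yB; have h4 := le_trans (norm2 y) yB.
have := ler_normD x.1 y.1; have := ler_normD x.2 y.2 => /=.
by move: h1 h2 h3 h4; move: (`|x.1|) (`|x.2|) (`|y.1|) (`|y.2|) (`|x.1 + y.1|) (`|x.2 + y.2|) => *; lra.
Qed.

Lemma farK_strict rho (B : R) : 0 < rho -> 0 <= B -> exists2 C : R, 0 <= C & forall x y x0,
  `|x| <= B -> `|y| <= B -> `|x0| <= B ->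
  `|farK rho x - farK rho y - dot (gradF rho x0) (x - y)| <= C * (`|x - x0| + `|y - x0|) * `|x - y|.
Proof.
move=> r0 B0; pose C1 : R := AA * (2 * rho `^ (s - 3)); pose C2 : R := AA * rho `^ (s - 2).
have C10 : 0 <= C1 by rewrite /C1 mulr_ge0 ?(ltW AA_gt0)// mulr_ge0// powR_ge0.
have C20 : 0 <= C2 by rewrite /C2 mulr_ge0 ?powR_ge0 ?(ltW AA_gt0).
exists (C1 * (4 * B) * (4 * B) + C2 * 2); first by have B4 : 0 <= 4 * B by [rewrite mulr_ge0]; exact: addr_ge0 (mulr_ge0 (mulr_ge0 C10 B4) B4) (mulr_ge0 C20 _).
move=> x y x0 xB yB x0B.
have -> : farK rho x - farK rho y - dot (gradF rho x0) (x - y) =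
  (far rho (nq x) - far rho (nq y) - dfar rho (nq x0) * (nq x - nq y)) +
  dfar rho (nq x0) * dot ((x - x0) + (y - x0)) (x - y).
  rewrite /farK nq_sub /gradF /dot /=; ring.
rewrite (le_trans (ler_normD _ _))// 2!mulrDl; apply: lerD.
  apply: (le_trans (far_strict _ _ _ r0)); rewrite -/C1.
  have n1 := nq_sub_le xB x0B; have n2 := nq_sub_le yB x0B; have n3 := nq_sub_le xB yB.
  have -> : C1 * (4 * B) * (4 * B) * (`|x - x0| + `|y - x0|) * `|x - y| =
    C1 * (4 * B * `|x - x0| + 4 * B * `|y - x0|) * (4 * B * `|x - y|) by ring.
  apply: ler_pM => //; first by rewrite mulr_ge0// addr_ge0.
  by rewrite ler_wpM2l// lerD.
have -> : C2 * 2 * (`|x - x0| + `|y - x0|) * `|x - y| = C2 * (2 * (`|x - x0| + `|y - x0|) * `|x - y|) by ring.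
rewrite normrM; apply: ler_pM => //.
  by rewrite ler0_norm ?dfar_le0//; exact: dfar_ge.
rewrite (le_trans (ler_dot _ _))// ler_wpM2r//.
have h1 := norm1 (x - x0); have h2 := norm2 (x - x0); have h3 := norm1 (y - x0); have h4 := norm2 (y - x0).
have := ler_normD (x - x0).1 (y - x0).1; have := ler_normD (x - x0).2 (y - x0).2.
move: h1 h2 h3 h4; rewrite -[(x - x0 + (y - x0)).1]/((x - x0).1 + (y - x0).1) -[(x - x0 + (y - x0)).2]/((x - x0).2 + (y - x0).2).
move: (`|(x - x0).1|) (`|(x - x0).2|) (`|(y - x0).1|) (`|(y - x0).2|) (`|_ + _|) (`|_ + _|) => a1 a2 a3 a4 a5 a6.
by move: (`|x - x0|) (`|y - x0|) => b1 b2 *; lra.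
Qed.

Lemma conv_far_sd rho v x0 : 0 < rho -> cl v -> sd (conv (farK rho) v) x0.
Proof.
move=> r0 cv; have [L [B [L0 B0 vL vB]]] := cv.
have [l1 l2] := llip_gradF r0; have lg1 := lint_llip l1; have lg2 := lint_llip l2.
have lf := lint_llip (lint_farK r0).
exists (conv (fun x => (gradF rho x).1) v x0, conv (fun x => (gradF rho x).2) v x0) => e e0.
pose B' : R := `|x0| + 1 + B.
have B'0 : 0 <= B' by rewrite !addr_ge0.
have [C C0 hC] := farK_strict r0 B'0.
pose M := I2 (fun y => `|v y|); have M0 : 0 <= M by exact: I2_ge0.
have D0 : 0 < 2 * (C * M + 1) by rewrite mulr_gt0// ltr_wpDl// mulr_ge0.
exists (Num.min 1 (e / (2 * (C * M + 1)))); first by rewrite lt_min ltr01 divr_gt0.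
move=> x y; rewrite !lt_min => /andP[x1 x2] /andP[y1 y2].
have i1 := conv_itg x lf cv; have i2 := conv_itg y lf cv.
have i3 := conv_itg x0 lg1 cv; have i4 := conv_itg x0 lg2 cv.
have j3 := itgZ (x - y).1 i3; have j4 := itgZ (x - y).2 i4.
have -> : conv (farK rho) v x - conv (farK rho) v y -
   dot (conv (fun x1 => (gradF rho x1).1) v x0, conv (fun x1 => (gradF rho x1).2) v x0) (x - y) =
   I2 (fun u => (farK rho (x - u) * v u - farK rho (y - u) * v u) -
     ((x - y).1 * ((gradF rho (x0 - u)).1 * v u) + (x - y).2 * ((gradF rho (x0 - u)).2 * v u))).
  rewrite (I2B (itgB i1 i2) (itgD j3 j4)) (I2B i1 i2) (I2D j3 j4) (I2Z _ i3) (I2Z _ i4) /dot /conv /=; ring.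
have i5 := itgB (itgB i1 i2) (itgD j3 j4).
rewrite (le_trans (ler_norm_I2 i5))//.
pose K := C * (`|x - x0| + `|y - x0|) * `|x - y|.
have K0 : 0 <= K by rewrite !mulr_ge0// addr_ge0.
apply: (@le_trans _ _ (I2 (fun u => K * `|v u|))).
  apply: I2_le => [||u]; [exact: itg_norm|exact: itgZ (cl_itg (cl_norm cv))|].
  have -> : farK rho (x - u) * v u - farK rho (y - u) * v u -
     ((x - y).1 * ((gradF rho (x0 - u)).1 * v u) + (x - y).2 * ((gradF rho (x0 - u)).2 * v u)) =
     (farK rho (x - u) - farK rho (y - u) - dot (gradF rho (x0 - u)) (x - y)) * v u.
    by rewrite /dot; ring.
  rewrite normrM; have [uB|uB] := leP `|u| B; last by rewrite vB// normr0 !mulr0.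
  rewrite ler_wpM2r//.
  have hb z : `|z - x0| < 1 -> `|z - u| <= B'.
    move=> hz; rewrite (le_trans (ler_normB _ _))// /B' lerD//.
    by have := ler_normD (z - x0) x0; rewrite subrK => h; rewrite (le_trans h)// addrC lerD2l ltW.
  have hx0 : `|x0 - u| <= B' by apply: hb; rewrite subrr normr0.
  have := hC _ _ _ (hb _ x1) (hb _ y1) hx0.
  by rewrite !sub_subr.
rewrite (I2Z _ (cl_itg (cl_norm cv))) -/M /K.
have : (`|x - x0| + `|y - x0|) * (C * M) <= e.
  have hh : `|x - x0| + `|y - x0| <= e / (C * M + 1).
    have -> : e / (C * M + 1) = e / (2 * (C * M + 1)) + e / (2 * (C * M + 1)).
      by field; rewrite lt0r_neq0//; move: D0; move: (C * M) => k; lra.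
    by apply: lerD; exact: ltW.
  have CM : 0 <= C * M by rewrite mulr_ge0.
  rewrite (le_trans (ler_wpM2r CM hh))// mulrAC ler_pdivrMr; last by lra.
  by rewrite ler_wpM2l ?(ltW e0)//; lra.
move=> /(ler_wpM2r (normr_ge0 (x - y))); apply: le_trans.
by rewrite le_eqVlt; apply/orP; left; apply/eqP; ring.
Qed.

(** The near part convolved with a Lipschitz [v] has Lipschitz constant [L] times a small mass, so
    [sd_lim] applies with the far parts as approximants. This covers all [s], although the gradient
    of the kernel is not locally integrable for [s <= 1 / 2]. *)
Lemma conv_kern_sd v x0 : cl v -> sd (conv kern v) x0.
Proof.
move=> cv; apply: sd_lim => e e0; have [L [B [L0 B0 vL vB]]] := cv.
have L1 : 0 < L + 1 by lra.
have [rho [/andP[r0 _] ni nS]] := near_small (divr_gt0 e0 L1).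
exists (conv (farK rho) v); split; first exact: conv_far_sd.
exists 1 => // x y _ _.
have lf := lint_llip (lint_farK r0).
have E z : conv kern v z - conv (farK rho) v z = conv (nearK rho) v z.
  have -> : conv kern v z = conv (nearK rho) v z + conv (farK rho) v z.
    by rewrite -(conv_kD z (lint_itg ni) lf cv); congr (conv _ v z); apply/funext => u; rewrite /nearK subrK.
  by rewrite addrK.
have h := conv_lip_u ni cv vL x y; rewrite -(E x) -(E y) in h.
apply: (le_trans h); apply: ler_wpM2r; first exact: normr_ge0.
apply: (@le_trans _ _ (L * (e / (L + 1)))); first by rewrite ler_wpM2l.
by rewrite mulrA ler_pdivrMr// mulrC ler_wpM2l ?(ltW e0)//; lra.
Qed.

(** * The periodized kernel *)

(* A telescoping majorant, playing the role of [1 / n ^ 2]. *)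
Definition dk (n : nat) : R := n.+1%:R^-1 - n.+2%:R^-1.

Lemma dk_ge n : (n.+1%:R ^+ 2)^-1 <= 2 * dk n.
Proof.
rewrite /dk -[n.+2%:R]natr1; have : 1 <= n.+1%:R :> R by rewrite ler1n.
move: (n.+1%:R) => k k1; have k0 : 0 < k by lra. have k2 : 0 < k + 1 by lra.
have -> : 2 * (k^-1 - (k + 1)^-1) = 2 / (k * (k + 1)) by field; rewrite !lt0r_neq0.
rewrite ler_pdivlMr ?mulr_gt0// mulrC ler_pdivrMr ?exprn_gt0//; nra.
Qed.

Lemma sum_dk n m : \sum_(n <= i < m) dk i <= n.+1%:R^-1.
Proof.
have [nm|mn] := leqP n m; last by rewrite big_geq ?invr_ge0// ltnW.
have E i : dk i = (fun i => - i.+1%:R^-1) i.+1 - (fun i => - i.+1%:R^-1) i :> R.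
  by rewrite /= opprK addrC.
rewrite (eq_bigr _ (fun i _ => E i)) (telescope_sumr (fun i => - i.+1%:R^-1))// opprK addrC.
by rewrite lerBlDr lerDl invr_ge0.
Qed.

Definition psum (a : nat -> R) (n : nat) : R := \sum_(0 <= i < n) a i.
Definition Ser (a : nat -> R) : R := limn (psum a).

Lemma psum_cauchy a C n m : (forall i, `|a i| <= C * dk i) -> (n <= m)%N ->
  `|psum a m - psum a n| <= C / n.+1%:R.
Proof.
move=> h nm; have C0 : 0 <= C.
  have := le_trans (normr_ge0 _) (h 0%N); rewrite pmulr_lge0//.
  by rewrite -(@pmulr_rgt0 _ 2)// (lt_le_trans _ (dk_ge 0))// expr1n invr1.
have -> : psum a m - psum a n = \sum_(n <= i < m) a i.
  by rewrite /psum (big_cat_nat (leq0n n) nm) /= addrAC subrr add0r.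
rewrite (le_trans (ler_norm_sum _ _ _))//.
apply: (le_trans (ler_sum _ (fun i _ => h i))); rewrite -mulr_sumr ler_wpM2l//; exact: sum_dk.
Qed.

Lemma Ser_spec a C : (forall i, `|a i| <= C * dk i) -> psum a @ \oo --> Ser a /\
  forall n, `|psum a n - Ser a| <= C / n.+1%:R.
Proof.
move=> h; have C0 : 0 <= C.
  have := le_trans (normr_ge0 _) (h 0%N); rewrite pmulr_lge0//.
  by rewrite -(@pmulr_rgt0 _ 2)// (lt_le_trans _ (dk_ge 0))// expr1n invr1.
have [n m|L hL] := @cauchy_lim (psum a) C.
  have [nm|/ltnW mn] := leqP n m.
    by rewrite distrC (le_trans (psum_cauchy h nm))// lerDl divr_ge0.
  by rewrite (le_trans (psum_cauchy h mn))// lerDr divr_ge0.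
have cv : psum a @ \oo --> L.
  apply/cvgrPdist_le => e e0.
  exists (Num.bound (C / e)) => // n /= hn; rewrite distrC (le_trans (hL n))//.
  rewrite ler_pdivrMr// mulrC -ler_pdivrMr//.
  have Ce : 0 <= C / e by rewrite divr_ge0// ltW.
  by rewrite (le_trans (ltW (archi_boundP Ce)))// ler_nat leqW.
by rewrite /Ser (cvg_lim _ cv).
Qed.

Lemma Ser_lin a b (c C C' : R) : (forall i, `|a i| <= C * dk i) -> (forall i, `|b i| <= C' * dk i) ->
  Ser (fun i => a i + c * b i) = Ser a + c * Ser b.
Proof.
move=> /Ser_spec[ha _] /Ser_spec[hb _]; apply: cvg_lim => //.
have -> : psum (fun i => a i + c * b i) = fun n => psum a n + c * psum b n.
  by apply/funext => n; rewrite /psum big_split /= mulr_sumr.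
by apply: cvgD => //; apply: cvgMr.
Qed.

Lemma Ser_diff a b (C C' D : R) : (forall i, `|a i| <= C * dk i) -> (forall i, `|b i| <= C' * dk i) ->
  (forall i, `|a i - b i| <= D * dk i) ->
  `|Ser a - Ser b| <= D /\ forall n, `|(psum a n - psum b n) - (Ser a - Ser b)| <= D / n.+1%:R.
Proof.
move=> ha hb hab.
have E : Ser (fun i => a i - b i) = Ser a - Ser b.
  have -> : (fun i => a i - b i) = fun i => a i + (-1) * b i by apply/funext => i; rewrite mulN1r.
  by rewrite (Ser_lin _ ha hb) mulN1r.
have [_ h] := Ser_spec hab.
have Ep n : psum (fun i => a i - b i) n = psum a n - psum b n by rewrite /psum sumrB.
split => [|n]; last by rewrite -E -Ep.
have := h 0%N; rewrite Ep E /psum !big_geq// subrr sub0r normrN divr1; exact.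
Qed.

Lemma kern_strict rho m0 p p' : 0 < rho -> rho <= m0 -> rho <= nq p -> rho <= nq p' ->
  `|kern p - kern p' + AA * m0 `^ (s - 2) * (nq p - nq p')| <=
  AA * (2 * rho `^ (s - 3)) * (`|nq p - m0| + `|nq p' - m0|) * `|nq p - nq p'|.
Proof.
move=> r0 rm rp rp'; have := far_strict (nq p) (nq p') m0 r0.
rewrite !far_ge// /dfar max_l// mulNr opprK; exact.
Qed.

(* The [x_1] derivative of [kern]. *)
Definition tt1 (p : P) : R := - (2 * AA) * p.1 * nq p `^ (s - 2).

Lemma nq_e1 p t : nq (p + e1 t) - nq p = t * (2 * p.1 + t).
Proof. by rewrite /nq /= addr0; ring. Qed.

Lemma kern_quad rho (U t : R) p : 0 < rho -> rho <= nq p -> rho <= nq (p + e1 t) ->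
  `|p.1| <= U -> `|p.1 + t| <= U ->
  `|kern (p + e1 t) - kern p - t * tt1 p| <= (AA * (2 * rho `^ (s - 3)) * (4 * U ^+ 2) + AA * rho `^ (s - 2)) * t ^+ 2.
Proof.
move=> r0 rp rp' pU ptU.
have := kern_strict r0 rp rp' rp; rewrite subrr normr0 addr0 nq_e1.
set C := AA * (2 * _); have C0 : 0 <= C by rewrite /C mulr_ge0 ?(ltW AA_gt0)// mulr_ge0// powR_ge0.
have U0 : 0 <= U := le_trans (normr_ge0 _) pU.
have h1 : `|t * (2 * p.1 + t)| * `|t * (2 * p.1 + t)| <= 4 * U ^+ 2 * t ^+ 2.
  have -> : `|t * (2 * p.1 + t)| * `|t * (2 * p.1 + t)| = t ^+ 2 * (2 * p.1 + t) ^+ 2.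
    by rewrite -normrM -expr2 ger0_norm ?sqr_ge0// exprMn.
  rewrite mulrC ler_wpM2r ?sqr_ge0//.
  move: pU ptU; rewrite !ler_norml => /andP[a1 a2] /andP[b1 b2].
  have : (2 * p.1 + t) ^+ 2 <= (2 * U) ^+ 2.
    by rewrite -[leLHS]real_normK ?num_real// lerXn2r ?nnegrE ?mulr_ge0// ler_norml; apply/andP; split; lra.
  by rewrite exprMn; congr (_ <= _ * _); ring.
have h2 : nq p `^ (s - 2) <= rho `^ (s - 2).
  by have [ss0 ss1] := sbnd; apply: powR_anti => //; lra.
move=> h; rewrite (_ : kern (p + e1 t) - kern p - t * tt1 p =
  (kern (p + e1 t) - kern p + AA * nq p `^ (s - 2) * (t * (2 * p.1 + t))) - AA * nq p `^ (s - 2) * t ^+ 2); last first.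
  by rewrite /tt1; ring.
rewrite (le_trans (ler_normB _ _))// [leRHS]mulrDl lerD//.
  by rewrite (le_trans h)// -[leLHS]mulrA -[leRHS]mulrA ler_wpM2l.
have z : 0 <= AA * nq p `^ (s - 2) := mulr_ge0 (ltW AA_gt0) (powR_ge0 _ _).
rewrite normrM (ger0_norm z) (ger0_norm (sqr_ge0 t)); apply: ler_wpM2r; first exact: sqr_ge0.
by apply: ler_wpM2l => //; exact: ltW AA_gt0.
Qed.

Lemma tt1_lip rho (U : R) p p' : 0 < rho -> rho <= nq p -> rho <= nq p' -> `|p'.1| <= U ->
  `|tt1 p - tt1 p'| <= 2 * (AA * rho `^ (s - 2)) * `|p.1 - p'.1| + 2 * U * (AA * (2 * rho `^ (s - 3))) * `|nq p - nq p'|.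
Proof.
move=> r0 rp rp' pU.
have U0 : 0 <= U := le_trans (normr_ge0 _) pU.
have d1 : dfar rho (nq p) = - (AA * nq p `^ (s - 2)) by rewrite /dfar max_l.
have d2 : dfar rho (nq p') = - (AA * nq p' `^ (s - 2)) by rewrite /dfar max_l.
have -> : tt1 p - tt1 p' = 2 * (dfar rho (nq p) * (p.1 - p'.1)) + 2 * (p'.1 * (dfar rho (nq p) - dfar rho (nq p'))).
  by rewrite d1 d2 /tt1; ring.
rewrite (le_trans (ler_normD _ _))// lerD//.
  rewrite normrM (@ger0_norm _ 2)// -mulrA ler_wpM2l// normrM ler_wpM2r//.
  by rewrite ler0_norm ?dfar_le0//; exact: dfar_ge.
rewrite normrM (@ger0_norm _ 2)// -!mulrA ler_wpM2l// normrM; apply: ler_pM => //.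
by have := dfar_lip (nq p) (nq p') r0; rewrite -!mulrA.
Qed.

Variable l : R.
Hypothesis hl : 0 < l.

Lemma l0 : 0 < l. Proof. exact: hl. Qed.

Definition sh (k : R) (u : P) : P := (u.1, u.2 + k * l).
(** With [|u.2| <= 7 * l / 8], the translate of [u] by [k] periods, [1 <= |k|], is at distance at
    least [|k| * l / 8] from the origin; [cl8] is the square of [l / 8]. *)
Definition DD (U : R) (u : P) : Prop := `|u.1| <= U /\ `|u.2| <= 7 * l / 8.
Definition cl8 : R := (l / 8) ^+ 2.

Lemma cl8_gt0 : 0 < cl8.
Proof. by rewrite /cl8 exprn_gt0// divr_gt0// l0. Qed.

Lemma pow_k (k e : R) (j : nat) : 1 <= k -> e <= - j%:R -> (cl8 * k ^+ 2) `^ e <= cl8 `^ e / (k ^+ 2) ^+ j.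
Proof.
move=> k1 ej; have k0 : 0 <= k by lra.
have c0 := cl8_gt0; have k2 : 1 <= k ^+ 2 by rewrite expr_ge1.
rewrite powRM ?(ltW c0) ?sqr_ge0// ler_wpM2l ?powR_ge0//.
have -> : ((k ^+ 2) ^+ j)^-1 = (k ^+ 2) `^ (- j%:R).
  by rewrite powRN powR_mulrn// sqr_ge0.
exact: ler_powR.
Qed.

Lemma sh_ge (k U : R) u : 1 <= `|k| -> DD U u -> cl8 * `|k| ^+ 2 <= nq (sh k u).
Proof.
move=> k1 [_ u2]; have l0 := l0; rewrite /nq /sh /= /cl8 -exprMn.
rewrite -[leLHS]add0r lerD ?sqr_ge0// -[leRHS]real_normK ?num_real//.
have kl : 0 <= l / 8 * `|k| by rewrite mulr_ge0// divr_ge0// ltW.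
rewrite lerXn2r ?nnegrE//.
have := ler_normB (u.2 + k * l) u.2; rewrite addrAC subrr add0r normrM (gtr0_norm l0).
have : l <= `|k| * l by rewrite ler_peMl// ltW.
move: u2; have -> : l / 8 * `|k| = `|k| * l / 8 by ring.
by move: (`|k| * l) (`|u.2|) (`|u.2 + _|) => a b c; lra.
Qed.

Lemma sh_sub (k U : R) u v : 0 <= U -> 1 <= `|k| -> DD U u -> DD U v ->
  `|nq (sh k u) - nq (sh k v)| <= (2 * U + 4 * l) * `|k| * `|u - v|.
Proof.
move=> U0 k1 [u1 u2] [v1 v2]; have l0 := l0.
rewrite nq_sub (le_trans (ler_dot _ _))//.
have -> : sh k u - sh k v = u - v.
  by apply: (congr2 pair) => //=; rewrite opprD addrACA subrr addr0.
rewrite ler_wpM2r//=.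
have h1 := ler_normD u.1 v.1.
have h2 : `|u.2 + k * l + (v.2 + k * l)| <= `|u.2| + `|v.2| + 2 * (`|k| * l).
  have -> : u.2 + k * l + (v.2 + k * l) = u.2 + v.2 + 2 * (k * l) by ring.
  rewrite (le_trans (ler_normD _ _))// lerD ?ler_normD// normrM (@ger0_norm _ 2)// normrM (gtr0_norm l0)//.
have h3 : U <= `|k| * U by rewrite ler_peMl.
have h4 : l <= `|k| * l by rewrite ler_peMl// ltW.
rewrite mulrDl -!mulrA (mulrC U) (mulrC l).
move: u1 u2 v1 v2 h1 h2 h3 h4.
by move: (`|u.1|) (`|u.2|) (`|v.1|) (`|v.2|) (`|u.1 + _|) (`|u.2 + _ + _|) (`|k| * U) (`|k| * l) => *; lra.
Qed.

Lemma sh_m0 (k U : R) u : 1 <= `|k| -> DD U u -> `|nq (sh k u) - k ^+ 2 * l ^+ 2| <= (U ^+ 2 + 3 * l ^+ 2) * `|k|.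
Proof.
move=> k1 [u1 u2]; have l0 := l0.
have U0 : 0 <= U := le_trans (normr_ge0 _) u1.
have -> : nq (sh k u) - k ^+ 2 * l ^+ 2 = u.1 ^+ 2 + u.2 ^+ 2 + 2 * (u.2 * (k * l)) by rewrite /nq /sh /=; ring.
rewrite (le_trans (ler_normD _ _))// ger0_norm ?addr_ge0 ?sqr_ge0//.
rewrite normrM (@ger0_norm _ 2)// !normrM (gtr0_norm l0).
have s1 : u.1 ^+ 2 <= U ^+ 2 by rewrite -(real_normK (num_real u.1)) lerXn2r ?nnegrE.
have l2 : 0 <= l ^+ 2 by rewrite sqr_ge0.
have s2 : u.2 ^+ 2 <= l ^+ 2.
  rewrite -(real_normK (num_real u.2)) lerXn2r ?nnegrE ?(ltW l0)//; lra.
have s3 : `|u.2| * (`|k| * l) <= 7 / 8 * (`|k| * l ^+ 2).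
  have -> : 7 / 8 * (`|k| * l ^+ 2) = 7 * l / 8 * (`|k| * l) by ring.
  by rewrite ler_wpM2r// mulr_ge0// ltW.
have h3 : U ^+ 2 <= `|k| * U ^+ 2 by rewrite ler_peMl// sqr_ge0.
have h4 : l ^+ 2 <= `|k| * l ^+ 2 by rewrite ler_peMl// sqr_ge0.
have -> : (U ^+ 2 + 3 * l ^+ 2) * `|k| = `|k| * U ^+ 2 + 3 * (`|k| * l ^+ 2) by ring.
move: s1 s2 s3 h3 h4.
by move: (U ^+ 2) (l ^+ 2) (`|k|) (`|u.2|) => a b c d *; nra.
Qed.

Definition kp (n : nat) : R := n.+1%:R.
(* The subtracted constant makes the sum over the periods converge absolutely; it is invisible to a vorticity with zero mean. *)
Definition qk (n : nat) (u : P) : R := kern (sh (kp n) u) + kern (sh (- kp n) u) - 2 * kern (0, kp n * l).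
Definition tn (n : nat) (u : P) : R := tt1 (sh (kp n) u) + tt1 (sh (- kp n) u).

Lemma kp1 n : 1 <= kp n. Proof. by rewrite ler1n. Qed.
Lemma kp_norm n : `|kp n| = kp n. Proof. by rewrite ger0_norm// (le_trans ler01)// kp1. Qed.
Lemma kp_normN n : `|- kp n| = kp n. Proof. by rewrite normrN kp_norm. Qed.

Lemma pow2_dk n : (cl8 * kp n ^+ 2) `^ (s - 2) <= cl8 `^ (s - 2) * (2 * dk n).
Proof.
have [ss0 ss1] := sbnd; have h : s - 2 <= - 1%:R by lra.
by rewrite (le_trans (pow_k (kp1 n) h))// expr1 ler_wpM2l ?powR_ge0// dk_ge.
Qed.

Lemma pow3_dk n : (cl8 * kp n ^+ 2) `^ (s - 3) * kp n ^+ 2 <= cl8 `^ (s - 3) * (2 * dk n).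
Proof.
have [ss0 ss1] := sbnd; have h : s - 3 <= - 2%:R by lra.
have k2 : 0 < kp n ^+ 2 by rewrite exprn_gt0// (lt_le_trans ltr01)// kp1.
apply: (@le_trans _ _ (cl8 `^ (s - 3) / (kp n ^+ 2) ^+ 2 * kp n ^+ 2)).
  by rewrite ler_wpM2r ?(ltW k2)// pow_k// kp1.
rewrite -mulrA (_ : ((kp n ^+ 2) ^+ 2)^-1 * kp n ^+ 2 = (kp n ^+ 2)^-1); last first.
  by field; rewrite lt0r_neq0// (lt_le_trans ltr01)// kp1.
by rewrite ler_wpM2l ?powR_ge0// dk_ge.
Qed.

Lemma rk_gt0 n : 0 < cl8 * kp n ^+ 2.
Proof. by rewrite mulr_gt0 ?cl8_gt0// exprn_gt0// (lt_le_trans ltr01)// kp1. Qed.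

(** A single translate varies at order [kp n ^ (2 * s - 3)], not summable for [s = 1]. With the
    slope of [kap] frozen at [m0 = kp n ^ 2 * l ^ 2], common to both translates, the parts odd in
    the index cancel and [2 * (nq u - nq v)] remains, with a coefficient of order
    [kp n ^ (2 * s - 4)]. The freezing error is of the same order. *)
Lemma qk_lip (U : R) : 0 <= U -> exists2 C : R, 0 <= C & forall n u v, DD U u -> DD U v ->
  `|qk n u - qk n v| <= C * `|u - v| * dk n.
Proof.
move=> U0; have l0 := l0; have A0 := AA_gt0.
pose C1 : R := 2 * U + 4 * l; pose C2 : R := U ^+ 2 + 3 * l ^+ 2; pose A3 := cl8 `^ (s - 3); pose A2 := cl8 `^ (s - 2).
have C10 : 0 <= C1 by rewrite /C1 addr_ge0 ?mulr_ge0 ?(ltW l0).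
have C20 : 0 <= C2 by apply: addr_ge0; [exact: sqr_ge0|apply: mulr_ge0 => //; exact: sqr_ge0].
have A30 : 0 <= A3 by exact: powR_ge0. have A20 : 0 <= A2 by exact: powR_ge0.
pose E1 : R := AA * 2 * C2 * C1 * 8; pose E2 : R := AA * 4 * (U + l) * 4.
have E10 : 0 <= E1 by rewrite /E1 !mulr_ge0// ltW.
have E20 : 0 <= E2 by rewrite /E2 !mulr_ge0 ?addr_ge0// ltW.
exists (E1 * A3 + E2 * A2); first exact: addr_ge0 (mulr_ge0 E10 A30) (mulr_ge0 E20 A20).
move=> n u v hu hv; set h := `|u - v|; have h0 : 0 <= h by exact: normr_ge0.
pose m0 := kp n ^+ 2 * l ^+ 2; pose rho := cl8 * kp n ^+ 2.
have r0 : 0 < rho := rk_gt0 n.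
have rm : rho <= m0.
  rewrite /rho /m0 mulrC ler_wpM2l ?sqr_ge0// /cl8 lerXn2r ?nnegrE ?divr_ge0 ?(ltW l0)//; lra.
have P1 := pow2_dk n; have P2 := pow3_dk n; rewrite -/rho -/A2 -/A3 in P1 P2.
have key k : `|k| = kp n -> `|kern (sh k u) - kern (sh k v) + AA * m0 `^ (s - 2) * (nq (sh k u) - nq (sh k v))|
   <= E1 / 4 * (rho `^ (s - 3) * kp n ^+ 2) * h.
  move=> kn; have k1 : 1 <= `|k| by rewrite kn kp1.
  have ru := sh_ge k1 hu; have rv := sh_ge k1 hv; rewrite kn -/rho in ru rv.
  rewrite (le_trans (kern_strict r0 rm ru rv))//.
  have mu := sh_m0 k1 hu; have mv := sh_m0 k1 hv; have ms := sh_sub U0 k1 hu hv.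
  have kk2 : k ^+ 2 = kp n ^+ 2 by rewrite -kn real_normK// num_real.
  rewrite kk2 -/m0 kn -/C2 in mu mv; rewrite kn -/C1 -/h in ms.
  have p3 := powR_ge0 rho (s - 3).
  have -> : E1 / 4 * (rho `^ (s - 3) * kp n ^+ 2) * h =
    AA * (2 * rho `^ (s - 3)) * (C2 * kp n + C2 * kp n) * (C1 * kp n * h) by rewrite /E1; field.
  apply: ler_pM => //; first by rewrite !mulr_ge0 ?addr_ge0// ltW.
  rewrite ler_wpM2l ?mulr_ge0 ?(ltW A0) ?mulr_ge0//; exact: lerD.
have k1 := key _ (kp_norm n); have k2 := key _ (kp_normN n).
have main : `|AA * m0 `^ (s - 2) * (2 * (nq u - nq v))| <= E2 / 2 * rho `^ (s - 2) * h.
  have [ss0 ss1] := sbnd.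
  have mp : m0 `^ (s - 2) <= rho `^ (s - 2) by apply: powR_anti => //; lra.
  have nB : `|nq u - nq v| <= 4 * (U + l) * h.
    have [u1 u2] := hu; have [v1 v2] := hv; apply: nq_sub_le; apply: norm_leP; lra.
  rewrite normrM [`|2 * _|]normrM (@ger0_norm _ 2)// ger0_norm ?mulr_ge0 ?(ltW A0) ?powR_ge0//.
  have -> : E2 / 2 * rho `^ (s - 2) * h = AA * rho `^ (s - 2) * (2 * (4 * (U + l) * h)) by rewrite /E2; field.
  apply: ler_pM; [by rewrite mulr_ge0 ?powR_ge0 ?(ltW A0)|by rewrite mulr_ge0|by rewrite ler_wpM2l ?(ltW A0)|by rewrite ler_wpM2l].
have -> : qk n u - qk n v =
  (kern (sh (kp n) u) - kern (sh (kp n) v) + AA * m0 `^ (s - 2) * (nq (sh (kp n) u) - nq (sh (kp n) v))) +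
  (kern (sh (- kp n) u) - kern (sh (- kp n) v) + AA * m0 `^ (s - 2) * (nq (sh (- kp n) u) - nq (sh (- kp n) v)))
  - AA * m0 `^ (s - 2) * (2 * (nq u - nq v)).
  by rewrite /qk /nq /sh /=; ring.
have n0 := ler_wpM2l (mulr_ge0 E10 h0) P2; have n1 := ler_wpM2l (mulr_ge0 E20 h0) P1.
rewrite (le_trans (ler_normB _ _))//.
move: k1 k2 main n0 n1 (ler_normD (kern (sh (kp n) u) - kern (sh (kp n) v) + AA * m0 `^ (s - 2) * (nq (sh (kp n) u) - nq (sh (kp n) v)))
  (kern (sh (- kp n) u) - kern (sh (- kp n) v) + AA * m0 `^ (s - 2) * (nq (sh (- kp n) u) - nq (sh (- kp n) v)))).
move: (`|_|) (`|_|) (`|_|) (`|_|) => a b c d.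
move: (rho `^ (s - 3) * kp n ^+ 2) (rho `^ (s - 2)) (dk n) => x y z.
clearbody h E1 E2 A3 A2 => *; lra.
Qed.

(** Each translate is estimated separately: [tt1] carries the factor [p.1], which stays bounded, so
    every term already decays like [kp n ^ (2 * s - 4)]. *)
Lemma tn_lip (U : R) : 0 <= U -> exists2 C : R, 0 <= C & forall n u v, DD U u -> DD U v ->
  `|tn n u - tn n v| <= C * `|u - v| * dk n.
Proof.
move=> U0; have l0 := l0; have A0 := AA_gt0.
pose C1 : R := 2 * U + 4 * l; pose A3 := cl8 `^ (s - 3); pose A2 := cl8 `^ (s - 2).
have C10 : 0 <= C1 by rewrite /C1 addr_ge0 ?mulr_ge0 ?(ltW l0).
have A30 : 0 <= A3 by exact: powR_ge0. have A20 : 0 <= A2 by exact: powR_ge0.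
pose E1 : R := 2 * AA; pose E2 : R := 4 * U * AA * C1.
have E10 : 0 <= E1 by rewrite /E1 mulr_ge0// ltW.
have E20 : 0 <= E2 by rewrite /E2 !mulr_ge0// ltW.
exists (4 * (E1 * A2 + E2 * A3)); first by apply: mulr_ge0 => //; exact: addr_ge0 (mulr_ge0 E10 A20) (mulr_ge0 E20 A30).
move=> n u v hu hv; set h := `|u - v|; have h0 : 0 <= h by exact: normr_ge0.
pose rho := cl8 * kp n ^+ 2; have r0 : 0 < rho := rk_gt0 n.
have P1 := pow2_dk n; have P2 := pow3_dk n; rewrite -/rho -/A2 -/A3 in P1 P2.
have key k : `|k| = kp n -> `|tt1 (sh k u) - tt1 (sh k v)| <= (E1 * rho `^ (s - 2) + E2 * (rho `^ (s - 3) * kp n ^+ 2)) * h.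
  move=> kn; have k1 : 1 <= `|k| by rewrite kn kp1.
  have ru := sh_ge k1 hu; have rv := sh_ge k1 hv; rewrite kn -/rho in ru rv.
  have vU : `|(sh k v).1| <= U by case: hv.
  rewrite (le_trans (tt1_lip r0 ru rv vU))//.
  have ms := sh_sub U0 k1 hu hv; rewrite kn -/C1 -/h in ms.
  have p3 := powR_ge0 rho (s - 3); have p2 := powR_ge0 rho (s - 2).
  rewrite [leRHS]mulrDl; apply: lerD.
    have -> : E1 * rho `^ (s - 2) * h = 2 * (AA * rho `^ (s - 2)) * h by rewrite /E1; ring.
    apply: ler_wpM2l; first by rewrite !mulr_ge0// ltW.
    exact: norm1 (u - v).
  apply: (@le_trans _ _ (2 * U * (AA * (2 * rho `^ (s - 3))) * (C1 * kp n * h))).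
    by apply: ler_wpM2l => //; rewrite !mulr_ge0// ltW.
  have -> : 2 * U * (AA * (2 * rho `^ (s - 3))) * (C1 * kp n * h) = E2 * (rho `^ (s - 3) * kp n) * h by rewrite /E2; ring.
  apply: ler_wpM2r => //; apply: ler_wpM2l => //; apply: ler_wpM2l => //.
  by rewrite expr2 ler_peMl ?kp1// (le_trans ler01)// kp1.
have k1 := key _ (kp_norm n); have k2 := key _ (kp_normN n).
have -> : tn n u - tn n v = (tt1 (sh (kp n) u) - tt1 (sh (kp n) v)) + (tt1 (sh (- kp n) u) - tt1 (sh (- kp n) v)).
  by rewrite /tn; ring.
rewrite (le_trans (ler_normD _ _))// (le_trans (lerD k1 k2))//.
have n0 := ler_wpM2l (mulr_ge0 E20 h0) P2; have n1 := ler_wpM2l (mulr_ge0 E10 h0) P1.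
move: n0 n1; move: (rho `^ (s - 3) * kp n ^+ 2) (rho `^ (s - 2)) (dk n) => x y z.
clearbody h E1 E2 A3 A2 => *; lra.
Qed.

Lemma qk_quad (U : R) : 0 <= U -> exists2 C : R, 0 <= C & forall n u t, DD U u -> DD U (u + e1 t) ->
  `|qk n (u + e1 t) - qk n u - t * tn n u| <= C * t ^+ 2 * dk n.
Proof.
move=> U0; have l0 := l0; have A0 := AA_gt0.
pose A3 := cl8 `^ (s - 3); pose A2 := cl8 `^ (s - 2).
have A30 : 0 <= A3 by exact: powR_ge0. have A20 : 0 <= A2 by exact: powR_ge0.
pose E1 : R := AA; pose E2 : R := 8 * AA * U ^+ 2.
have E10 : 0 <= E1 by exact: ltW.
have E20 : 0 <= E2 by rewrite /E2; apply: mulr_ge0; [rewrite mulr_ge0// ltW|exact: sqr_ge0].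
exists (4 * (E1 * A2 + E2 * A3)); first by apply: mulr_ge0 => //; exact: addr_ge0 (mulr_ge0 E10 A20) (mulr_ge0 E20 A30).
move=> n u t hu hv; have h0 : 0 <= t ^+ 2 by exact: sqr_ge0.
pose rho := cl8 * kp n ^+ 2; have r0 : 0 < rho := rk_gt0 n.
have P1 := pow2_dk n; have P2 := pow3_dk n; rewrite -/rho -/A2 -/A3 in P1 P2.
have she k : sh k (u + e1 t) = sh k u + e1 t.
  by apply: (congr2 pair) => //=; rewrite !addr0.
have key k : `|k| = kp n -> `|kern (sh k u + e1 t) - kern (sh k u) - t * tt1 (sh k u)| <=
    (E1 * rho `^ (s - 2) + E2 * (rho `^ (s - 3) * kp n ^+ 2)) * t ^+ 2.
  move=> kn; have k1 : 1 <= `|k| by rewrite kn kp1.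
  have ru := sh_ge k1 hu; have rv := sh_ge k1 hv; rewrite kn -/rho in ru rv; rewrite she in rv.
  have uU : `|(sh k u).1| <= U by case: hu. have vU : `|(sh k u).1 + t| <= U by case: hv.
  rewrite (le_trans (kern_quad r0 ru rv uU vU))// ler_wpM2r//.
  have p3 := powR_ge0 rho (s - 3).
  rewrite addrC lerD2l.
  have -> : AA * (2 * rho `^ (s - 3)) * (4 * U ^+ 2) = E2 * (rho `^ (s - 3) * 1) by rewrite /E2; ring.
  by apply: ler_wpM2l => //; apply: ler_wpM2l => //; rewrite expr_ge1// ?kp1// (le_trans ler01)// kp1.
have k1 := key _ (kp_norm n); have k2 := key _ (kp_normN n).
have -> : qk n (u + e1 t) - qk n u - t * tn n u =
   (kern (sh (kp n) u + e1 t) - kern (sh (kp n) u) - t * tt1 (sh (kp n) u)) +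
   (kern (sh (- kp n) u + e1 t) - kern (sh (- kp n) u) - t * tt1 (sh (- kp n) u)).
  by rewrite /qk /tn !she; ring.
rewrite (le_trans (ler_normD _ _))// (le_trans (lerD k1 k2))//.
have n0 := ler_wpM2l (mulr_ge0 E20 h0) P2; have n1 := ler_wpM2l (mulr_ge0 E10 h0) P1.
move: n0 n1 h0; move: (rho `^ (s - 3) * kp n ^+ 2) (rho `^ (s - 2)) (dk n) (t ^+ 2) => x y z t2.
clearbody E1 E2 A3 A2 => *; lra.
Qed.

Lemma qk0 n : qk n 0 = 0.
Proof. by rewrite /qk /sh /= !add0r /kern /nq /= mulNr sqrrN; ring. Qed.

Lemma qkN n u : qk n (- u) = qk n u.
Proof.
rewrite /qk; congr (_ - _); rewrite addrC /kern; congr (kap _ + kap _); rewrite /nq /sh /=; ring.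
Qed.

Lemma qk_refl n u : qk n (refl u) = qk n u.
Proof.
rewrite /qk; congr (_ - _); rewrite addrC /kern; congr (kap _ + kap _); rewrite /nq /sh /=; ring.
Qed.

Lemma tn0 n u2 : tn n (0, u2) = 0.
Proof. by rewrite /tn /tt1 /sh /= !mulr0 !mul0r addr0. Qed.

Lemma DD0 (U : R) : 0 <= U -> DD U 0.
Proof. by move=> U0; split; rewrite normr0//; have := l0; lra. Qed.

Lemma qk_bnd (U : R) u : DD U u -> exists C : R, forall n, `|qk n u| <= C * dk n.
Proof.
move=> hu; have U0 : 0 <= U by case: hu => h _; exact: le_trans (normr_ge0 _) h.
have [C C0 hC] := qk_lip U0; exists (C * `|u|) => n.
by have := hC n u 0 hu (DD0 U0); rewrite qk0 !subr0.
Qed.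

Lemma tn_bnd (U : R) u : DD U u -> exists C : R, forall n, `|tn n u| <= C * dk n.
Proof.
move=> hu; have U0 : 0 <= U by case: hu => h _; exact: le_trans (normr_ge0 _) h.
have [C C0 hC] := tn_lip U0; exists (C * `|u - (0, u.2)|) => n.
have h0 : DD U (0, u.2) by case: hu => h1 h2; split => //=; rewrite normr0.
by have := hC n u _ hu h0; rewrite tn0 subr0.
Qed.

(** [Hs] is the renormalized periodized kernel, [Qs] its part from the non-trivial translates, and
    [T1s] the [x_1] derivative of [Hs], as [Hs_quad] shows. *)
Definition Qs (u : P) : R := Ser (qk ^~ u).
Definition T1s (u : P) : R := tt1 u + Ser (tn ^~ u).
Definition Hs (u : P) : R := kern u + Qs u.

Lemma Qs_lip (U : R) : 0 <= U -> exists2 C : R, 0 <= C & forall u v, DD U u -> DD U v ->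
  `|Qs u - Qs v| <= C * `|u - v| /\
  forall n, `|(psum (qk ^~ u) n - psum (qk ^~ v) n) - (Qs u - Qs v)| <= C * `|u - v| / n.+1%:R.
Proof.
move=> U0; have [C C0 hC] := qk_lip U0; exists C => // u v hu hv.
have [Cu hCu] := qk_bnd hu; have [Cv hCv] := qk_bnd hv.
exact: (Ser_diff hCu hCv (fun n => hC n u v hu hv)).
Qed.

Lemma Ser_ext a b : (forall n, a n = b n) -> Ser a = Ser b.
Proof. by move=> /funext ->. Qed.

Lemma Qs0 : Qs 0 = 0.
Proof.
rewrite /Qs (Ser_ext (b := fun=> 0)); last by move=> n; rewrite qk0.
rewrite /Ser (_ : psum (fun=> 0) = fun=> 0) ?lim_cst//.
by apply/funext => n; rewrite /psum big1.
Qed.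

Lemma QsN u : Qs (- u) = Qs u.
Proof. by apply: Ser_ext => n; rewrite qkN. Qed.
Lemma Qs_refl u : Qs (refl u) = Qs u.
Proof. by apply: Ser_ext => n; rewrite qk_refl. Qed.

Local Notation shft := (@Defs.shift R).

(** Positions relative to an opposite vortex: the second coordinate also stays away from 0, so that
    the untranslated term of [Hs] is regular too. *)
Definition EE (U : R) (u : P) : Prop := `|u.1| <= U /\ l / 8 <= `|u.2| <= 7 * l / 8.

Lemma EE_DD (U : R) u : EE U u -> DD U u.
Proof. by move=> [h /andP[_ h2]]. Qed.

Lemma EE_nq (U : R) u : EE U u -> cl8 <= nq u.
Proof.
move=> [_ /andP[h _]]; rewrite /cl8 /nq -[leLHS]add0r lerD ?sqr_ge0// -[leRHS]real_normK ?num_real//.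
by rewrite lerXn2r ?nnegrE// divr_ge0// ltW// l0.
Qed.

Lemma EE_norm (U : R) u : 0 <= U -> EE U u -> `|u| <= U + l.
Proof. by move=> U0 [h /andP[_ h2]]; have l0' := l0; apply: norm_leP; lra. Qed.

Lemma Hs_lip (U : R) : 0 <= U -> exists2 C : R, 0 <= C & forall u v, EE U u -> EE U v ->
  `|Hs u - Hs v| <= C * `|u - v|.
Proof.
move=> U0; have l0 := l0; have [C C0 hC] := Qs_lip U0.
have c0 := cl8_gt0; have K0 : 0 <= AA * cl8 `^ (s - 2) by rewrite mulr_ge0 ?powR_ge0 ?(ltW AA_gt0).
have U4 : 0 <= 4 * (U + l) by rewrite mulr_ge0// addr_ge0// ltW.
exists (AA * cl8 `^ (s - 2) * (4 * (U + l)) + C); first by rewrite addr_ge0// mulr_ge0.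
move=> u v hu hv; have [h _] := hC u v (EE_DD hu) (EE_DD hv).
have -> : Hs u - Hs v = (kern u - kern v) + (Qs u - Qs v) by rewrite /Hs opprD addrACA.
rewrite (le_trans (ler_normD _ _))// mulrDl lerD//.
have := far_lip (nq u) (nq v) c0; rewrite !far_ge ?(EE_nq hu) ?(EE_nq hv)// => h1.
rewrite (le_trans h1)// -[leRHS]mulrA ler_wpM2l//.
exact: nq_sub_le (EE_norm U0 hu) (EE_norm U0 hv).
Qed.

Lemma T1s_lip (U : R) : 0 <= U -> exists2 C : R, 0 <= C & forall u v, EE U u -> EE U v ->
  `|T1s u - T1s v| <= C * `|u - v|.
Proof.
move=> U0; have l0 := l0; have [C C0 hC] := tn_lip U0.
have c0 := cl8_gt0; have K0 : 0 <= AA * cl8 `^ (s - 2) by rewrite mulr_ge0 ?powR_ge0 ?(ltW AA_gt0).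
have K1 : 0 <= AA * (2 * cl8 `^ (s - 3)) by rewrite mulr_ge0 ?(ltW AA_gt0)// mulr_ge0// powR_ge0.
have U4 : 0 <= 4 * (U + l) by rewrite mulr_ge0// addr_ge0// ltW.
set k0 := AA * _ in K0; set k1 := AA * _ in K1.
have D0 : 0 <= 2 * k0 by rewrite mulr_ge0. have D1 : 0 <= 2 * U * k1 by apply: mulr_ge0 K1; exact: mulr_ge0.
exists ((2 * k0 + 2 * U * k1 * (4 * (U + l))) + C).
  exact: addr_ge0 (addr_ge0 D0 (mulr_ge0 D1 U4)) C0.
move=> u v hu hv; have [Cu hCu] := tn_bnd (EE_DD hu); have [Cv hCv] := tn_bnd (EE_DD hv).
have [h _] := Ser_diff hCu hCv (fun n => hC n u v (EE_DD hu) (EE_DD hv)).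
have -> : T1s u - T1s v = (tt1 u - tt1 v) + (Ser (tn ^~ u) - Ser (tn ^~ v)) by rewrite /T1s opprD addrACA.
rewrite (le_trans (ler_normD _ _))// [leRHS]mulrDl lerD//.
have vU : `|v.1| <= U by case: hv.
rewrite (le_trans (tt1_lip c0 (EE_nq hu) (EE_nq hv) vU))// [leRHS]mulrDl; apply: lerD.
  by apply: ler_wpM2l => //; exact: norm1 (u - v).
by rewrite -[leRHS]mulrA; apply: ler_wpM2l => //; exact: nq_sub_le (EE_norm U0 hu) (EE_norm U0 hv).
Qed.

Lemma Hs_quad (U : R) : 0 <= U -> exists2 C : R, 0 <= C & forall u t, EE U u -> EE U (u + e1 t) ->
  `|Hs (u + e1 t) - Hs u - t * T1s u| <= C * t ^+ 2.
Proof.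
move=> U0; have l0 := l0; have [C C0 hC] := qk_quad U0.
have c0 := cl8_gt0.
set K := AA * (2 * cl8 `^ (s - 3)) * (4 * U ^+ 2) + AA * cl8 `^ (s - 2).
have K0 : 0 <= K.
  apply: addr_ge0; last by rewrite mulr_ge0 ?powR_ge0 ?(ltW AA_gt0).
  apply: mulr_ge0; last by apply: mulr_ge0 => //; exact: sqr_ge0.
  by rewrite mulr_ge0 ?(ltW AA_gt0)// mulr_ge0// powR_ge0.
exists (K + C); first exact: addr_ge0.
move=> u t hu hv.
have [C1 h1] := qk_bnd (EE_DD hu); have [C2 h2] := qk_bnd (EE_DD hv); have [C3 h3] := tn_bnd (EE_DD hu).
have h12 n : `|qk n (u + e1 t) + (-1) * qk n u| <= (C2 + C1) * dk n.
  by rewrite mulN1r (le_trans (ler_normB _ _))// mulrDl lerD.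
have E : Ser (fun n => qk n (u + e1 t) - qk n u - t * tn n u) = Qs (u + e1 t) - Qs u - t * Ser (tn ^~ u).
  rewrite (Ser_ext (b := fun n => (qk n (u + e1 t) + (-1) * qk n u) + (- t) * tn n u)); last by move=> n; ring.
  by rewrite (Ser_lin _ h12 h3) (Ser_lin _ h2 h1) mulN1r mulNr.
have [_ hS] := Ser_spec (fun n => hC n u t (EE_DD hu) (EE_DD hv)).
have := hS 0%N; rewrite /psum big_geq// sub0r normrN divr1 E => hQ.
have Er (a b c e f g : R) : a + b - (c + e) - t * (f + g) = (a - c - t * f) + (b - e - t * g) by ring.
have -> : Hs (u + e1 t) - Hs u - t * T1s u = (kern (u + e1 t) - kern u - t * tt1 u) +
  (Qs (u + e1 t) - Qs u - t * Ser (tn ^~ u)) by exact: Er.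
rewrite (le_trans (ler_normD _ _))// [leRHS]mulrDl lerD//.
by apply: (kern_quad c0 (EE_nq hu) (EE_nq hv)); [case: hu|case: hv].
Qed.

Lemma symsum0 (F : int -> R) : symsum F 0 = F 0.
Proof. by rewrite /symsum big_ord_recl big_ord0 addr0 /=; congr (F _). Qed.

Lemma symsumS (F : int -> R) N : symsum F N.+1 = symsum F N + (F N.+1%:Z + F (- N.+1%:Z)).
Proof.
rewrite /symsum doubleS big_ord_recl big_ord_recr /= addrCA; congr (_ + _).
  apply: eq_bigr => i _; congr (F _); rewrite /bump /= add1n !intS.
  by rewrite opprD addrACA subrr add0r.
rewrite addrC; congr (F _ + F _); last by rewrite sub0r.
by rewrite /bump /= add1n -doubleS -addnn PoszD addrK.
Qed.

Lemma psumS a n : psum a n.+1 = psum a n + a n.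
Proof. exact: big_nat_recr. Qed.

Lemma symsum_psum (F : int -> R) N : symsum F N = F 0 + psum (fun n => F n.+1%:Z + F (- n.+1%:Z)) N.
Proof.
elim: N => [|N IH]; first by rewrite symsum0 /psum big_geq// addr0.
by rewrite symsumS IH psumS -addrA.
Qed.

Lemma symsum_succ (F : int -> R) N : symsum (fun k => F (k + 1)) N = symsum F N + (F (N%:Z + 1) - F (- N%:Z)).
Proof.
elim: N => [|N IH]; first by rewrite !symsum0 add0r oppr0 addrC subrK.
rewrite !symsumS IH.
have -> : - N.+1%:Z + 1 = - N%:Z by rewrite -addn1 PoszD opprD subrK.
have -> : N.+1%:Z = N%:Z + 1 by rewrite -addn1 PoszD.
by ring.
Qed.

Lemma shiftE k u : shft l k u = sh k%:~R u.
Proof. by []. Qed.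

Lemma shiftS k u : shft l k (shft l 1 u) = shft l (k + 1) u.
Proof. by apply: (congr2 pair) => //=; rewrite rmorphD /=; ring. Qed.

(** The two extreme terms exchanged when a symmetric window moves by one period. Their squared
    distances differ by order [N] and the slope of [kap] is of order [N ^ (2 * s - 4)], hence the
    rate [1 / N]. *)
Lemma edge (B : R) : 0 <= B -> exists (C : R) (N0 : nat), 0 <= C /\ forall N u, (N0 <= N)%N -> `|u.2| <= B ->
  `|kern (shft l (N%:Z + 1) u) - kern (shft l (- N%:Z) u)| <= C / N.+1%:R.
Proof.
move=> B0; have l0 := l0; have c0 := cl8_gt0.
pose N0 := (Num.bound (2 * B / l)).+1.
have hN0 : 2 * B <= N0%:R * l.
  have h : 0 <= 2 * B / l by rewrite divr_ge0 ?mulr_ge0// ltW.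
  by have := ltW (archi_boundP h); rewrite ler_pdivrMr// => h1; rewrite (le_trans h1)// ler_wpM2r ?(ltW l0)// ler_nat.
pose K := AA * cl8 `^ (s - 2).
have K0 : 0 <= K by rewrite /K mulr_ge0 ?powR_ge0 ?(ltW AA_gt0).
pose D := (2 * B + l) * l.
have D0 : 0 <= D by rewrite /D mulr_ge0 ?addr_ge0 ?mulr_ge0// ltW.
exists (K * D * 6), N0; split; first by apply: mulr_ge0 => //; exact: mulr_ge0.
move=> N u NN uB.
have N1 : 1 <= N%:R :> R by rewrite ler1n (leq_trans _ NN).
have NB : 2 * B <= N%:R * l by rewrite (le_trans hN0)// ler_wpM2r ?(ltW l0)// ler_nat.
pose n : R := N%:R.
have -> : shft l (N%:Z + 1) u = sh (n + 1) u by rewrite shiftE rmorphD /=.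
have -> : shft l (- N%:Z) u = sh (- n) u by rewrite shiftE rmorphN /=.
pose rho := cl8 * n ^+ 2.
have n0 : 0 < n by rewrite (lt_le_trans ltr01).
have r0 : 0 < rho by rewrite mulr_gt0// exprn_gt0.
have key (a : R) : n * l / 8 <= `|a| -> rho <= u.1 ^+ 2 + a ^+ 2.
  move=> h; rewrite -[leLHS]add0r lerD ?sqr_ge0// -[leRHS]real_normK ?num_real//.
  have -> : rho = (n * l / 8) ^+ 2 by rewrite /rho /cl8; ring.
  by rewrite lerXn2r ?nnegrE// divr_ge0// mulr_ge0// ltW.
move: uB; rewrite ler_norml => /andP[u1 u2].
have nl : 0 <= n * l by rewrite mulr_ge0// ltW.
have k1 : rho <= nq (sh (n + 1) u).
  apply: key; rewrite /sh /= mulrDl mul1r ler_normr; apply/orP; left; rewrite /n in nl *; lra.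
have k2 : rho <= nq (sh (- n) u).
  apply: key; rewrite /sh /= mulNr ler_normr; apply/orP; right; rewrite /n in nl *; lra.
have := far_lip (nq (sh (n + 1) u)) (nq (sh (- n) u)) r0; rewrite !far_ge// => h.
rewrite (le_trans h)//.
have [ss0 ss1] := sbnd; have s2 : s - 2 <= - 1%:R by lra.
have p := pow_k N1 s2; rewrite -/n -/rho expr1 in p.
have E : nq (sh (n + 1) u) - nq (sh (- n) u) = (2 * u.2 + l) * l * (2 * n + 1).
  by rewrite /nq /sh /=; ring.
have d : `|nq (sh (n + 1) u) - nq (sh (- n) u)| <= D * (3 * n).
  rewrite E normrM normrM (gtr0_norm l0).
  have h1 : `|2 * u.2 + l| <= 2 * B + l by rewrite ler_norml; apply/andP; split; lra.
  have h2 : `|2 * n + 1| <= 3 * n by rewrite ger0_norm; rewrite /n; lra.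
  by apply: ler_pM => //; [rewrite mulr_ge0// ltW|rewrite /D ler_wpM2r// ltW].
apply: (@le_trans _ _ (AA * (cl8 `^ (s - 2) / n ^+ 2) * (D * (3 * n)))).
  apply: ler_pM => //; first by rewrite mulr_ge0 ?powR_ge0 ?(ltW AA_gt0).
  by rewrite ler_wpM2l ?(ltW AA_gt0).
have -> : AA * (cl8 `^ (s - 2) / n ^+ 2) * (D * (3 * n)) = K * D * 3 / n.
  by rewrite /K; field; exact: lt0r_neq0.
have KD : 0 <= K * D by rewrite mulr_ge0.
rewrite -natr1 -/n ler_pdivrMr// [leRHS]mulrAC ler_pdivlMr; last by lra.
rewrite -[leLHS]mulrA -[leRHS]mulrA ler_wpM2l//; rewrite /n; lra.
Qed.

Definition SN (N : nat) (u : P) : R := symsum (fun k => kern (shft l k u)) N.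
(** These constants may diverge as [N] grows, but they do not depend on the point, so they cancel in
    differences and against a density of zero mean. *)
Definition cN (N : nat) : R := psum (fun n => 2 * kern (0, kp n * l)) N.

Lemma SN_qk N u : SN N u = kern u + psum (qk ^~ u) N + cN N.
Proof.
rewrite /SN symsum_psum -addrA; congr (_ + _).
  by congr kern; case: u => a b; apply: (congr2 pair); rewrite //= mul0r addr0.
rewrite /psum /cN /psum -big_split /=; apply: eq_bigr => n _.
by rewrite /qk subrK !shiftE rmorphN /=.
Qed.

Lemma SN_succ N u : SN N (shft l 1 u) = SN N u + (kern (shft l (N%:Z + 1) u) - kern (shft l (- N%:Z) u)).
Proof.
rewrite /SN -(symsum_succ (fun k => kern (shft l k u))).
by apply: eq_bigr => i _; rewrite shiftS.
Qed.

Lemma inv_cvg0 (u : nat -> R) (C : R) (N0 : nat) : (forall n, (N0 <= n)%N -> `|u n| <= C / n.+1%:R) ->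
  u @ \oo --> (0 : R).
Proof.
move=> h; have C0 : 0 <= C.
  by have := le_trans (normr_ge0 _) (h N0 (leqnn _)); rewrite pmulr_lge0// invr_gt0.
apply/cvgrPdist_le => e e0.
exists (maxn N0 (Num.bound (C / e))) => // n /=; rewrite geq_max => /andP[n0 hn].
rewrite sub0r normrN (le_trans (h n n0))// ler_pdivrMr// mulrC -ler_pdivrMr//.
have Ce : 0 <= C / e by rewrite divr_ge0// ltW.
by rewrite (le_trans (ltW (archi_boundP Ce)))// ler_nat leqW.
Qed.

Lemma cvg_uniqR (a : nat -> R) (L M : R) : a @ \oo --> L -> a @ \oo --> M -> L = M.
Proof. by move=> h1 h2; rewrite -(cvg_lim _ h1)//; apply: cvg_lim. Qed.

(** In the difference of the partial sums at the two points the constants [cN] cancel and the edge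
    terms tend to 0. *)
Lemma Hs_periodic u : `|u.2| <= 7 * l / 8 -> `|u.2 + l| <= 7 * l / 8 -> Hs (shft l 1 u) = Hs u.
Proof.
move=> h1 h2; pose U := `|u.1|.
have d1 : DD U u by split. have d2 : DD U (shft l 1 u) by split => //=; rewrite mul1r.
have [C1 b1] := qk_bnd d1; have [C2 b2] := qk_bnd d2.
have [c1 _] := Ser_spec b1; have [c2 _] := Ser_spec b2.
have B0 := normr_ge0 u.2; have [C [N0 [C0 hE]]] := edge B0.
have ce : (fun N => kern (shft l (N%:Z + 1) u) - kern (shft l (- N%:Z) u)) @ \oo --> (0 : R).
  by apply: (@inv_cvg0 _ C N0) => n n0; exact: hE.
have E : (fun N => (kern (shft l 1 u) + psum (qk ^~ (shft l 1 u)) N) - (kern u + psum (qk ^~ u) N)) =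
   fun N => kern (shft l (N%:Z + 1) u) - kern (shft l (- N%:Z) u).
  apply/funext => N; have := SN_succ N u; rewrite !SN_qk => h.
  by apply: (addrI (kern u + psum (qk ^~ u) N + cN N)); rewrite -h; ring.
have cd : (fun N => (kern (shft l 1 u) + psum (qk ^~ (shft l 1 u)) N) - (kern u + psum (qk ^~ u) N)) @ \oo -->
   Hs (shft l 1 u) - Hs u.
  exact: (cvgB (cvgD (cvg_cst _) c2) (cvgD (cvg_cst _) c1)).
rewrite E in cd; have /eqP := cvg_uniqR cd ce.
by rewrite subr_eq0 => /eqP.
Qed.

Lemma SN_even N u : SN N (- u) = SN N u.
Proof.
rewrite !SN_qk /kern nqN; congr (_ + _ + _); rewrite /psum; apply: eq_bigr => n _; exact: qkN.
Qed.

Lemma conv_pt g v x (K : R) : lint g -> cl v -> 0 <= K ->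
  (forall y, v y != 0 -> `|g (x - y)| <= K) -> `|conv g v x| <= K * I2 (fun y => `|v y|).
Proof.
move=> lg cv K0 h; have i := conv_itg x lg cv.
rewrite (le_trans (ler_norm_I2 i))// -(I2Z _ (cl_itg (cl_norm cv))).
apply: I2_le => [||y]; [exact: itg_norm|exact: itgZ (cl_itg (cl_norm cv))|].
rewrite normrM; have [->|vy] := eqVneq (v y) 0; first by rewrite normr0 !mulr0.
by rewrite ler_wpM2r// h.
Qed.

Lemma conv_pt2 g v x x' (K : R) : lint g -> cl v -> 0 <= K ->
  (forall y, v y != 0 -> `|g (x - y) - g (x' - y)| <= K) -> `|conv g v x - conv g v x'| <= K * I2 (fun y => `|v y|).
Proof.
move=> lg cv K0 h; have i := conv_itg x lg cv; have i' := conv_itg x' lg cv.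
rewrite -(I2B i i') (le_trans (ler_norm_I2 (itgB i i')))// -(I2Z _ (cl_itg (cl_norm cv))).
apply: I2_le => [||y]; [exact: itg_norm (itgB i i')|exact: itgZ (cl_itg (cl_norm cv))|].
rewrite -mulrBl normrM; have [->|vy] := eqVneq (v y) 0; first by rewrite normr0 !mulr0.
by rewrite ler_wpM2r// h.
Qed.

Lemma sh_add (k : R) (u : P) : sh k u = u + (0, k * l).
Proof. by case: u => a b; apply: (congr2 pair); rewrite //= addr0. Qed.

Lemma lint_sh k : lint (fun u => kern (shft l k u)).
Proof.
have := lint_add (0, k%:~R * l) lint_kern.
by under eq_fun do rewrite -sh_add.
Qed.

Lemma shft_sub k (x y : P) : shft l k (x - y) = shft l k x - y.
Proof. by apply: (congr2 pair) => //=; rewrite addrAC. Qed.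

Lemma lint_SN N : lint (SN N).
Proof.
rewrite /SN; elim: N => [|N IH].
  by under eq_fun do rewrite symsum0; exact: lint_sh.
under eq_fun do rewrite symsumS.
by apply: lintD => //; apply: lintD; exact: lint_sh.
Qed.

Lemma sdg_shift f x0 g c : sdg f (x0 + c) g -> sdg (fun x => f (x + c)) x0 g.
Proof.
move=> h e e0; have [r r0 hr] := h e e0; exists r => // x y hx hy.
have := hr (x + c) (y + c).
have E (a b : P) : a + c - (b + c) = a - b by rewrite opprD addrACA subrr addr0.
by rewrite !E; apply.
Qed.

Lemma sd_sh k f x0 : sd f (shft l k x0) -> sd (fun x => f (shft l k x)) x0.
Proof.
have E x : shft l k x = x + (0, k%:~R * l) by exact: sh_add.
move=> [g]; rewrite E => /sdg_shift h; exists g.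
by under eq_fun do rewrite E.
Qed.

(** * Stream function of a density of zero mean *)

Section psi.
Variables (v : P -> R) (Bv : R).
Hypothesis cv : cl v.
Hypothesis v0 : I2 v = 0.
Hypothesis vsup : forall y, v y != 0 -> `|y| <= Bv /\ `|y.2| <= 5 * l / 16.

Definition G0 (x : P) : R := conv kern v x.
Definition PsiN (N : nat) (x : P) : R := conv (SN N) v x.
Definition Psi (x : P) : R := limn (PsiN ^~ x).

Lemma conv_sh k x : conv (fun u => kern (shft l k u)) v x = G0 (shft l k x).
Proof. by apply: eq_I2 => y; rewrite shft_sub. Qed.

Lemma conv_sh2 k k' x :
  conv (fun u => kern (shft l k u) + kern (shft l k' u)) v x = G0 (shft l k x) + G0 (shft l k' x).
Proof. by rewrite (conv_kD x (lint_sh k) (lint_sh k') cv) !conv_sh. Qed.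

Lemma PsiN_sum N x : PsiN N x = symsum (fun k => G0 (shft l k x)) N.
Proof.
elim: N => [|N IH].
  rewrite symsum0 /PsiN /SN /G0 /conv; apply: eq_I2 => y; rewrite symsum0; congr (kern _ * _); exact: shft_sub.
have E : SN N.+1 = fun u => SN N u + (kern (shft l N.+1%:Z u) + kern (shft l (- N.+1%:Z) u)).
  by apply/funext => u; exact: symsumS.
rewrite symsumS -IH {1}/PsiN E.
rewrite (conv_kD x (lint_SN N) (lintD (lint_sh N.+1) (lint_sh (- N.+1%:Z))) cv).
by rewrite (conv_sh2 N.+1%:Z).
Qed.

Lemma sd_PsiN N x0 : sd (PsiN N) x0.
Proof.
have E : PsiN N = fun x => symsum (fun k => G0 (shft l k x)) N by apply/funext => x; exact: PsiN_sum.
have sG k : sd (fun x => G0 (shft l k x)) x0 by apply: sd_sh; exact: conv_kern_sd.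
rewrite E; elim: N {E} => [|N [g1 IH]].
  by under eq_fun do rewrite symsum0; exact: sG.
under eq_fun do rewrite symsumS.
have [g2 h2] := sG N.+1; have [g3 h3] := sG (- N.+1%:Z).
exists (g1 + (g2 + g3)); apply: sdgD => //; exact: sdgD.
Qed.

Definition qsum (N : nat) (u : P) : R := psum (qk ^~ u) N.

Lemma lint_qsum N : lint (qsum N).
Proof.
have -> : qsum N = fun u => SN N u + ((-1) * kern u + - cN N).
  by apply/funext => u; rewrite SN_qk /qsum; ring.
apply: lintD; [exact: lint_SN|apply: lintD; [exact: lintZ lint_kern|exact: lint_cst]].
Qed.

Lemma PsiN_q N x : PsiN N x = G0 x + conv (qsum N) v x.
Proof.
have E : SN N = fun u => kern u + (qsum N u + cN N).
  by apply/funext => u; rewrite SN_qk /qsum addrA.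
have lq := lint_qsum N.
rewrite /PsiN E (conv_kD x lint_kern (lintD lq (lint_cst _)) cv) (conv_kD x lq (lint_cst _) cv).
rewrite [X in _ + (_ + X)](_ : _ = 0) ?addr0//.
by rewrite /conv (I2Z _ (cl_itg cv)) v0 mulr0.
Qed.

(* Clamping makes the regular part of the kernel globally Lipschitz without changing it at the points where it is used. *)
Definition clampR (U : R) (u : P) : P := (clamp1 U u.1, clamp1 (7 * l / 8) u.2).
Definition QU (U : R) (u : P) : R := Qs (clampR U u).

Lemma clamp1_bnd (B t : R) : 0 <= B -> `|clamp1 B t| <= B.
Proof.
by move=> B0; rewrite /clamp1 ler_norml; case: (leP t (- B)) => ?; case: (leP B t) => ?; apply/andP; split; lra.
Qed.

Lemma l78 : 0 <= 7 * l / 8. Proof. by have := l0; lra. Qed.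

Lemma clampR_DD (U : R) u : 0 <= U -> DD U (clampR U u).
Proof. by move=> U0; split; apply: clamp1_bnd => //; exact: l78. Qed.

Lemma clamp1_id (B t : R) : `|t| <= B -> clamp1 B t = t.
Proof. by rewrite ler_norml /clamp1 => /andP[? ?]; case: (leP t (- B)) => ?; case: (leP B t) => ?; lra. Qed.

Lemma clampR_id (U : R) u : DD U u -> clampR U u = u.
Proof. by case: u => a b [h1 h2]; rewrite /clampR !clamp1_id. Qed.

Lemma clampR_lip (U : R) u u' : 0 <= U -> `|clampR U u - clampR U u'| <= `|u - u'|.
Proof.
move=> U0; apply: norm_leP => /=.
  by rewrite (le_trans (clamp1_lip _ _ U0))// (norm1 (u - u')).
by rewrite (le_trans (clamp1_lip _ _ l78))// (norm2 (u - u')).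
Qed.

Lemma QU_lip (U : R) : 0 <= U -> exists2 C : R, 0 <= C & lipf C (QU U).
Proof.
move=> U0; have [C C0 hC] := Qs_lip U0; exists C => // u u'.
have [h _] := hC _ _ (clampR_DD u U0) (clampR_DD u' U0).
by rewrite (le_trans h)// ler_wpM2l// clampR_lip.
Qed.

Lemma lint_QU (U : R) : 0 <= U -> lint (QU U).
Proof. by move=> U0; have [C C0 hC] := QU_lip U0; apply: lint_llip; exact: lipf_llip hC. Qed.

(** A neighbourhood of the period [|x.2| <= l / 2]. With [|y.2| <= 5 * l / 16] on the support of
    [v], differences satisfy [|u.2| <= 14 * l / 16 = 7 * l / 8], as [DD] requires. *)
Definition XX (x : P) : Prop := `|x.2| <= 9 * l / 16.

Lemma XX_DD (U : R) x y : XX x -> `|x| + Bv <= U -> v y != 0 -> DD U (x - y).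
Proof.
move=> hx hU /vsup[h1 h2]; split => /=.
  rewrite (le_trans (ler_normB _ _))// (le_trans _ hU)// lerD ?norm1// (le_trans (norm1 y))//.
rewrite (le_trans (ler_normB _ _))//; move: hx; rewrite /XX; lra.
Qed.

(** The bound on the size of the error gives the limit of the partial sums; the bound on its
    Lipschitz constant gives the differentiability of that limit, through [sd_lim]. *)
Lemma Psi_err (U : R) : 0 <= U -> exists2 C : R, 0 <= C &
  (forall N x, XX x -> `|x| + Bv <= U -> `|PsiN N x - (G0 x + conv (QU U) v x)| <= C / N.+1%:R) /\
  (forall N x x', XX x -> XX x' -> `|x| + Bv <= U -> `|x'| + Bv <= U ->
    `|(PsiN N x - (G0 x + conv (QU U) v x)) - (PsiN N x' - (G0 x' + conv (QU U) v x'))| <= C / N.+1%:R * `|x - x'|).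
Proof.
move=> U0; have [C C0 hC] := Qs_lip U0; pose m := I2 (fun y => `|v y|).
have m0 : 0 <= m by exact: I2_ge0.
have l0 := l0; pose K := C * (U + l).
have K0 : 0 <= K by rewrite /K mulr_ge0// addr_ge0// ltW.
have lQ := lint_QU U0.
pose g N u := qsum N u + (-1) * QU U u.
have lg N : lint (g N) by apply: lintD; [exact: lint_qsum|exact: lintZ].
have E N x : PsiN N x - (G0 x + conv (QU U) v x) = conv (g N) v x.
  rewrite PsiN_q (conv_kD x (lint_qsum N) (lintZ _ lQ) cv).
  have -> : conv (fun z => -1 * QU U z) v x = - conv (QU U) v x.
    transitivity (-1 * conv (QU U) v x); last by rewrite mulN1r.
    by rewrite -(I2Z _ (conv_itg x lQ cv)); apply: eq_I2 => y; rewrite mulrA.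
  by move: (G0 x) (conv _ _ _) (conv _ _ _) => a b c; ring.
exists ((K + C) * m); first by rewrite mulr_ge0// addr_ge0.
split => [N x hx xU|N x x' hx hx' xU xU'].
  rewrite E; apply: (@le_trans _ _ (K / N.+1%:R * m)).
    apply: conv_pt => // [|y vy]; first by rewrite divr_ge0.
    have dd := XX_DD hx xU vy; have [_ h] := hC _ _ dd (DD0 U0).
    have := h N; rewrite Qs0 subr0 /g mulN1r /QU clampR_id// /qsum.
    have -> : psum (qk ^~ 0) N = 0 by rewrite /psum big1// => i _; exact: qk0.
    rewrite !subr0 => h1; rewrite (le_trans h1)// ler_wpM2r ?invr_ge0// /K ler_wpM2l//.
    by have [d1 d2] := dd; apply: norm_leP; lra.
  by rewrite mulrAC ler_wpM2r ?invr_ge0// ler_wpM2r// lerDl.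
rewrite [X in `|X - _|]E [X in `|_ - X|]E; apply: (@le_trans _ _ (C / N.+1%:R * `|x - x'| * m)).
  have C1 : 0 <= C / N.+1%:R by rewrite divr_ge0.
  apply: conv_pt2 => // [|y vy]; first by rewrite mulr_ge0.
  have dd := XX_DD hx xU vy; have dd' := XX_DD hx' xU' vy.
  have [_ h] := hC _ _ dd dd'; have := h N.
  rewrite sub_subr /g /QU !clampR_id// /qsum => h1.
  move: h1; move: (psum (qk^~ (x - y)) N) (psum (qk^~ (x' - y)) N) (Qs (x - y)) (Qs (x' - y)) => a b c d.
  by have -> : a + -1 * c - (b + -1 * d) = a - b - (c - d); [ring|rewrite mulrAC].
have -> : (K + C) * m / N.+1%:R * `|x - x'| = (K + C) * (m / N.+1%:R * `|x - x'|) by ring.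
have -> : C / N.+1%:R * `|x - x'| * m = C * (m / N.+1%:R * `|x - x'|) by ring.
by rewrite ler_wpM2r ?mulr_ge0 ?invr_ge0// lerDr.
Qed.

Lemma cvg_subK (a b : nat -> R) (L M : R) :
  (fun N => a N - b N) @ \oo --> L -> b @ \oo --> M -> a @ \oo --> L + M.
Proof.
move=> h1 h2; have -> : a = fun N => (a N - b N) + b N by apply/funext => N; rewrite subrK.
exact: (cvgD h1 h2).
Qed.

Lemma Psi_XX (U : R) x : XX x -> `|x| + Bv <= U -> 0 <= U -> (fun N => PsiN N x) @ \oo --> (G0 x + conv (QU U) v x : R).
Proof.
move=> hx hU U0; have [C C0 [h _]] := Psi_err U0.
have c0 : (fun N => PsiN N x - (G0 x + conv (QU U) v x)) @ \oo --> (0 : R).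
  by apply: (@inv_cvg0 _ C 0) => n _; exact: h.
by rewrite -[X in _ --> X]add0r; exact: cvg_subK c0 (cvg_cst _).
Qed.

(** Only edge terms remain. The limit is therefore periodic although the partial sums need not be,
    and convergence extends from one period to the plane. *)
Lemma PsiN_step x : (fun N => PsiN N (shft l 1 x) - PsiN N x) @ \oo --> (0 : R).
Proof.
pose B := `|x.2| + l; have B0 : 0 <= B by rewrite addr_ge0// ltW// l0.
have [C [N0 [C0 hC]]] := edge B0; pose m := I2 (fun y => `|v y|).
have m0 : 0 <= m by exact: I2_ge0.
apply: (@inv_cvg0 _ (C * m) N0) => N hN.
pose g u := kern (shft l (N%:Z + 1) u) + (-1) * kern (shft l (- N%:Z) u).
have lg : lint g by apply: lintD; [exact: lint_sh|apply: lintZ; exact: lint_sh].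
have -> : PsiN N (shft l 1 x) - PsiN N x = conv g v x.
  have i1 := conv_itg (shft l 1 x) (lint_SN N) cv; have i2 := conv_itg x (lint_SN N) cv.
  rewrite /PsiN -(I2B i1 i2); apply: eq_I2 => y; rewrite -mulrBl -shft_sub SN_succ /g.
  by rewrite mulN1r addrAC subrr add0r.
rewrite mulrAC; apply: conv_pt => // [|y vy]; first by rewrite divr_ge0.
rewrite /g mulN1r; apply: hC => //.
have [_ h] := vsup vy; rewrite /= (le_trans (ler_normB _ _))// lerD2l (le_trans h)//.
by have := l0; lra.
Qed.

Lemma shftD k k' u : shft l k (shft l k' u) = shft l (k + k') u.
Proof. by apply: (congr2 pair) => //=; rewrite rmorphD /=; ring. Qed.

Lemma shft0 u : shft l 0 u = u.
Proof. by case: u => a b; apply: (congr2 pair); rewrite //= mul0r addr0. Qed.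

Definition PsiL (x : P) (L : R) := (fun N => PsiN N x) @ \oo --> L.

Lemma Psi_succ x L : PsiL x L -> PsiL (shft l 1 x) L.
Proof. by move=> h; have := cvg_subK (PsiN_step x) h; rewrite add0r. Qed.

Lemma Psi_pred x L : PsiL (shft l 1 x) L -> PsiL x L.
Proof.
move=> h; rewrite -[L]add0r; apply: cvg_subK h; rewrite -[X in _ --> X]oppr0.
have -> : (fun N => PsiN N x - PsiN N (shft l 1 x)) = (fun N => - (PsiN N (shft l 1 x) - PsiN N x)).
  by apply/funext => N; rewrite opprB.
exact: cvgN (PsiN_step x).
Qed.

Lemma Psi_shift k x L : PsiL x L -> PsiL (shft l k x) L.
Proof.
have pos (n : nat) y : PsiL y L -> PsiL (shft l n%:Z y) L.
  move=> h; elim: n => [|n IH]; first by rewrite shft0.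
  by rewrite intS -shftD; exact: Psi_succ.
have negc (n : nat) y : PsiL y L -> PsiL (shft l (- n%:Z) y) L.
  move=> h; elim: n => [|n IH]; first by rewrite oppr0 shft0.
  by apply: Psi_pred; rewrite shftD intS opprD addrA subrr add0r.
by case: k => n; [exact: pos|rewrite NegzE; exact: negc].
Qed.

Lemma period_repr (x : P) : exists k, `|(shft l k x).2| <= l / 2.
Proof.
have l0 := l0; exists (- Num.floor (x.2 / l + 2^-1)).
have := Num.Theory.floor_le (x.2 / l + 2^-1); have := Num.Theory.floorD1_gt (x.2 / l + 2^-1).
rewrite /= rmorphD rmorphN /=; move: ((Num.floor _)%:~R) => f h1 h2.
have -> : x.2 = x.2 / l * l by rewrite divfK// lt0r_neq0.
rewrite -mulrDl normrM (gtr0_norm l0) [leRHS]mulrC ler_pM2r// ler_norml.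
by move: (x.2 / l) h1 h2 => q h1 h2; apply/andP; split; lra.
Qed.

Lemma XX_half x : `|x.2| <= l / 2 -> XX x.
Proof. by rewrite /XX => h; have l0 := l0; lra. Qed.

Lemma PsiL_Psi x L : PsiL x L -> Psi x = L.
Proof. by move=> h; apply: cvg_lim. Qed.

Lemma Psi_cvg x : PsiL x (Psi x).
Proof.
have [k hk] := period_repr x; set y := shft l k x in hk.
have U0 : 0 <= `|y| + `|Bv| by rewrite addr_ge0.
have := Psi_XX (XX_half hk) _ U0; rewrite lerD2l ler_norm => /(_ isT) h.
have := Psi_shift (- k) h; rewrite /y shftD addNr shft0 => h'.
by rewrite (PsiL_Psi h').
Qed.

Lemma Psi_per k x : Psi (shft l k x) = Psi x.
Proof. exact: PsiL_Psi (Psi_shift k (@Psi_cvg x)). Qed.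

Lemma Psi_E (U : R) x : XX x -> `|x| + Bv <= U -> 0 <= U -> Psi x = G0 x + conv (QU U) v x.
Proof. by move=> h1 h2 U0; apply: PsiL_Psi; exact: Psi_XX. Qed.

Lemma sd_Psi_XX x0 : `|x0.2| <= l / 2 -> sd Psi x0.
Proof.
move=> h0; have l0 := l0; pose U : R := `|x0| + l + `|Bv|.
have U0 : 0 <= U by rewrite /U !addr_ge0// ltW.
have nearU (x : P) : `|x - x0| < l / 16 -> XX x /\ `|x| + Bv <= U.
  move=> hx; split.
    rewrite /XX; have := le_lt_trans (norm2 (x - x0)) hx => /= h.
    by rewrite -[x.2](subrK x0.2) (le_trans (ler_normD _ _))//; lra.
  rewrite /U; have := ler_normD (x - x0) x0; rewrite subrK => h.
  by have := ler_norm Bv; lra.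
have [C C0 [_ h]] := Psi_err U0; apply: sd_lim => e e0.
have [N hN] : exists N, C / N.+1%:R <= e.
  have Ce : 0 <= C / e by rewrite divr_ge0// ltW.
  exists (Num.bound (C / e)); rewrite ler_pdivrMr// mulrC -ler_pdivrMr//.
  by rewrite (le_trans (ltW (archi_boundP Ce)))// ler_nat.
exists (PsiN N); split; first exact: sd_PsiN.
exists (l / 16) => [|x y hx hy]; first by rewrite divr_gt0.
have [x1 x2] := nearU x hx; have [y1 y2] := nearU y hy.
rewrite (Psi_E x1 x2 U0) (Psi_E y1 y2 U0).
have h' := h N x y x1 y1 x2 y2.
have E (a b c d : R) : b - a - (d - c) = - (a - b - (c - d)) by ring.
by rewrite E normrN (le_trans h')// ler_wpM2r.
Qed.

Lemma sd_Psi x0 : sd Psi x0.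
Proof.
have [k hk] := period_repr x0; have := sd_Psi_XX hk => /sd_sh.
by under eq_fun do rewrite Psi_per.
Qed.

End psi.

(** * Rescaling *)

Section scale.
Variable d : R.

(* [zz] is the centre of the positive vortex and [z2 = zz - (- zz)]. *)
Definition zz : P := (- d, - (l / 4)).
Definition z2 : P := (- (2 * d), - (l / 2)).
(** As [z2.2 = - (l / 2)], points within [rho0] of [z2] have a second coordinate between [l / 8] and
    [7 * l / 8] in absolute value, where [Hs] is regular. *)
Definition rho0 : R := l / 16.
Definition UU : R := 2 * `|zz| + l.
Definition Tz (u : P) : R := Hs (z2 + clamp rho0 u) - Hs z2.
Definition T1z (u : P) : R := T1s (z2 + clamp rho0 u).
(** The homogeneity factor of the kernel. It is at least 1 for [dl <= 1], so dividing the regular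
    terms by it does not enlarge them. *)
Definition sg (dl : R) : R := dl `^ (2 * s - 2).
Definition Qd (dl : R) (u : P) : R := (sg dl)^-1 * QU UU (dl *: u).
Definition Td (dl : R) (u : P) : R := (sg dl)^-1 * Tz (dl *: u).
Definition T1d (dl : R) (u : P) : R := (sg dl)^-1 * (dl * T1z (dl *: u)).

Lemma rho0_gt0 : 0 < rho0. Proof. by rewrite divr_gt0// l0. Qed.
Lemma UU_ge0 : 0 <= UU. Proof. by rewrite addr_ge0 ?mulr_ge0// ltW// l0. Qed.
Lemma sg_gt0 (dl : R) : 0 < dl -> 0 < sg dl. Proof. exact: powR_gt0. Qed.

Lemma sg_inv (dl : R) : 0 < dl <= 1 -> 0 <= (sg dl)^-1 <= 1.
Proof.
move=> /andP[d0 d1]; rewrite invr_ge0 (ltW (sg_gt0 d0))/= invf_le1 ?sg_gt0//.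
have [ss0 ss1] := sbnd; rewrite -(powRr0 dl); apply: ger_powR; first exact/andP.
by lra.
Qed.

Lemma EE_z u : `|u| <= rho0 -> EE UU (z2 + u).
Proof.
move=> hu; have l0 := l0; have := le_trans (norm1 u) hu; have := le_trans (norm2 u) hu.
rewrite /rho0 /EE /UU /= => h2 h1; have hd := norm1 zz; rewrite /= normrN in hd; split.
  by rewrite (le_trans (ler_normD _ _))// normrN normrM ger0_norm//; lra.
move: h2; rewrite ler_norml => /andP[h3 h4].
by rewrite ltr0_norm; [apply/andP; split; lra|lra].
Qed.

Lemma EE_z2 : EE UU z2.
Proof. by rewrite -[z2]addr0; apply: EE_z; rewrite normr0 ltW// rho0_gt0. Qed.

Lemma EE_clamp u : EE UU (z2 + clamp rho0 u).
Proof. by apply: EE_z; apply: clamp_bnd; rewrite ltW// rho0_gt0. Qed.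

Lemma Hs_refl u : Hs (refl u) = Hs u.
Proof. by rewrite /Hs Qs_refl /kern nq_refl. Qed.

(** The two rows are staggered by half a period, so that [z2 + refl p] and [refl (z2 + p)] differ by
    exactly one period of [Hs]. *)
Lemma Tz_refl u : Tz (refl u) = Tz u.
Proof.
have l0 := l0; rewrite /Tz (clamp_refl _ (ltW rho0_gt0)); apply: (congr1 (fun a => a - Hs z2)).
set p := clamp rho0 u; have [_] := EE_clamp u; rewrite -/p => e2.
have pb : `|p.2| <= rho0 by rewrite (le_trans (norm2 _))// clamp_bnd// ltW// rho0_gt0.
have E : shft l 1 (z2 + refl p) = refl (z2 + p).
  by apply: (congr2 pair) => //=; rewrite mul1r; field.
rewrite -(Hs_refl (z2 + p)) -E Hs_periodic//; move: pb; rewrite /rho0 !ler_norml /= => /andP[h1 h2];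
  by apply/andP; split; lra.
Qed.

Lemma clamp1N (B t : R) : 0 <= B -> clamp1 B (- t) = - clamp1 B t.
Proof.
move=> B0; rewrite /clamp1; case: (leP t (- B)) => ?; case: (leP (- t) (- B)) => ?;
  case: (leP B t) => ?; case: (leP B (- t)) => ?; lra.
Qed.

Lemma lipf_scale (C dl : R) f : 0 <= dl -> lipf C f -> lipf (C * dl) (fun u => f (dl *: u)).
Proof.
by move=> d0 h x y; rewrite (le_trans (h _ _))// -scalerBr normrZ (ger0_norm d0) mulrA.
Qed.

Lemma lipf_mul (C k : R) f : 0 <= k <= 1 -> 0 <= C -> lipf C f -> lipf C (fun u => k * f u).
Proof.
move=> /andP[k0 k1] C0 h x y; rewrite -mulrBr normrM (ger0_norm k0).
by rewrite -[leRHS]mul1r ler_pM.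
Qed.

Lemma lipf_le (C C' : R) f : C <= C' -> lipf C f -> lipf C' f.
Proof. by move=> h hf x y; rewrite (le_trans (hf x y))// ler_wpM2r. Qed.

Lemma base_data : exists C : R, [/\ 0 <= C, lipf C (QU UU), lipf C Tz, lipf C T1z &
  (forall u, `|T1z u| <= C) /\ (forall u t, EE UU u -> EE UU (u + e1 t) ->
    `|Hs (u + e1 t) - Hs u - t * T1s u| <= C * t ^+ 2)].
Proof.
have U0 := UU_ge0; have r0 := ltW rho0_gt0.
have [C1 C10 h1] := QU_lip U0; have [C2 C20 h2] := Hs_lip U0.
have [C3 C30 h3] := T1s_lip U0; have [C4 C40 h4] := Hs_quad U0.
have [C5 C50 h5] : exists2 C5 : R, 0 <= C5 & forall u, `|T1z u| <= C5.
  exists (`|T1s z2| + C3 * rho0) => [|u]; first by rewrite addr_ge0// mulr_ge0.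
  rewrite /T1z -[X in `|X|](subrK (T1s z2)) (le_trans (ler_normD _ _))// addrC lerD2l.
  rewrite (le_trans (h3 _ _ (EE_clamp u) EE_z2))// ler_wpM2l//.
  by rewrite addrAC subrr add0r clamp_bnd.
have Tzl : lipf C2 Tz.
  move=> x y; rewrite /Tz opprB addrA subrK.
  rewrite (le_trans (h2 _ _ (EE_clamp x) (EE_clamp y)))// ler_wpM2l//.
  by rewrite opprD addrACA subrr add0r clamp_lip.
have T1l : lipf C3 T1z.
  move=> x y; rewrite (le_trans (h3 _ _ (EE_clamp x) (EE_clamp y)))// ler_wpM2l//.
  by rewrite opprD addrACA subrr add0r clamp_lip.
have [C [c0 c1 c2 c3 [c4 c5]]] : exists C : R, [/\ 0 <= C, C1 <= C, C2 <= C, C3 <= C & C4 <= C /\ C5 <= C].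
  by exists (C1 + C2 + C3 + C4 + C5); do ! split; lra.
exists C; split => //; [exact: lipf_le h1|exact: lipf_le Tzl|exact: lipf_le T1l|split].
  by move=> u; exact: le_trans (h5 u) c5.
by move=> u t h h'; rewrite (le_trans (h4 u t h h'))// ler_wpM2r// sqr_ge0.
Qed.

Lemma scale_refl (dl : R) (x : P) : dl *: refl x = refl (dl *: x).
Proof. by apply: (congr2 pair) => //; exact: mulrN. Qed.

Lemma Tz0 : Tz 0 = 0.
Proof.
have c0 : clamp rho0 0 = 0 by apply: clamp_id; rewrite normr0 ltW// rho0_gt0.
by rewrite /Tz c0 addr0 subrr.
Qed.

Lemma Td0 (dl : R) : Td dl 0 = 0.
Proof.
rewrite /Td.
rewrite scaler0.
rewrite Tz0.
exact: mulr0.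
Qed.

(** Rescaling multiplies Lipschitz constants by [dl], and the prefactor is at most 1, whence
    perturbations of size [C * dl]. The condition [9 * Rb * dl <= rho0] keeps the points of the
    Taylor bound where the clamping in [Tz] is inactive. *)
Lemma reg_scaled : exists2 C : R, 0 <= C & forall Rb dl : R,
  1 <= Rb -> 0 < dl <= 1 -> 9 * Rb * dl <= rho0 -> C * dl <= 1 ->
  reg_data Rb (C * dl) C (Qd dl) (Td dl) (T1d dl).
Proof.
have [C [C0 h1 Tzl T1l [T1bb h4]]] := base_data.
exists C => [//|Rb dl Rb1 dl01 d9 Cd]; have /andP[d0 d1] := dl01.
have si := sg_inv dl01; have /andP[s0 s1] := si; set k := (sg dl)^-1 in si s0 s1.
have dl0 := ltW d0.
split; [|split; [|split]].
- by split => //; rewrite mulr_ge0.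
- split.
  + by rewrite /Qd scaler0 /QU (clampR_id (DD0 UU_ge0)) Qs0 mulr0.
  + move=> x y; apply: le_trans (lipf_mul si _ (lipf_scale dl0 h1) x y) _; first exact: mulr_ge0.
    by [].
  + move=> x; rewrite /Qd scalerN; apply: (congr1 (fun a => (sg dl)^-1 * a)); rewrite /QU -[LHS]QsN; apply: (congr1 Qs).
    by case: (dl *: x) => a b; apply: (congr2 pair); rewrite /= clamp1N ?opprK ?UU_ge0 ?l78.
  + move=> x; rewrite /Qd; apply: (congr1 (fun a => (sg dl)^-1 * a)); rewrite /QU -[LHS]Qs_refl; apply: (congr1 Qs).
    by rewrite scale_refl; case: (dl *: x) => a b; apply: (congr2 pair); rewrite //= clamp1N ?opprK// l78.
- split.
  + exact: Td0.
  + move=> x y; apply: le_trans (lipf_mul si _ (lipf_scale dl0 Tzl) x y) _; first exact: mulr_ge0.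
    by [].
  + move=> x; by rewrite /Td scale_refl (Tz_refl (dl *: x)).
- split.
  + apply: llip_mbl; apply: llipZ; apply: llipZ; exact: lipf_llip (mulr_ge0 C0 dl0) (lipf_scale dl0 T1l).
  + move=> x; rewrite /T1d normrM (ger0_norm s0) normrM (ger0_norm dl0) mulrC.
    rewrite (mulrC dl) -[leRHS]mulr1; apply: ler_pM => //; first by rewrite mulr_ge0.
    by apply: ler_wpM2r.
  + move=> u t hu hut.
    have sc (x : P) : `|x| <= 9 * Rb -> `|dl *: x| <= rho0.
      move=> hx; rewrite normrZ (ger0_norm dl0) (le_trans _ d9)// [leRHS]mulrC ler_wpM2l//.
    have E : dl *: (u + e1 t) = dl *: u + e1 (dl * t).
      by rewrite scalerDr; congr (_ + _); apply: (congr2 pair) => //; exact: mulr0.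
    have b1 := sc _ hu; have b2 := sc _ hut.
    have Eq : z2 + dl *: (u + e1 t) = z2 + dl *: u + e1 (dl * t) by rewrite E addrA.
    have e2 := EE_z b2; rewrite Eq in e2.
    have := h4 _ _ (EE_z b1) e2; rewrite -Eq => h.
    rewrite /Td /T1d /Tz /T1z !clamp_id// -/k.
    have Er (a b c e : R) : k * (a - c) - k * (b - c) - t * (k * (dl * e)) = k * (a - b - dl * t * e) by ring.
    rewrite Er.
    rewrite normrM (ger0_norm s0) (le_trans (ler_wpM2l s0 h))//.
    have t2 : 0 <= t ^+ 2 := sqr_ge0 t.
    have dd1 : dl ^+ 2 <= 1 by rewrite expr_le1.
    rewrite exprMn mulrCA (mulrA k) (mulrA C) -[leRHS]mul1r [leRHS]mulrCA.
    rewrite -[leLHS]mulrA; apply: ler_wpM2l => //; apply: ler_wpM2r => //.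
    by rewrite mulr_ile1// sqr_ge0.
Qed.

Lemma nq_scale (dl : R) (u : P) : nq (dl *: u) = dl ^+ 2 * nq u.
Proof. by transitivity ((dl * u.1) ^+ 2 + (dl * u.2) ^+ 2); rewrite // !exprMn -mulrDr. Qed.

(** For [s = 1] the logarithm adds the constant [- 256 * ln dl]. At [u = 0] both kernels have the
    default value coming from [ln 0 = 0], and the term in [box 0] takes the constant away again. *)
Lemma kern_scale (dl : R) : 0 < dl -> exists c : R, forall u : P, kern (dl *: u) = sg dl * kern u + (c + (- c) * box 0 u).
Proof.
move=> d0; exists (if s == 1 then - 256 * ln dl else 0) => u.
have E := nq_scale dl u.
rewrite /kern E /kap /sg; have d2 : 0 < dl ^+ 2 by rewrite exprn_gt0.
have [s1|s1] := eqVneq s 1.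
  rewrite s1 mulr1 subrr powRr0 mul1r.
  have [->|u0] := eqVneq u 0.
    by rewrite box1 ?normr0// /nq /= expr0n/= addr0 mulr0 ln0//; ring.
  rewrite box0 ?normr_gt0// lnM ?posrE ?nq_gt0// lnXn//; rewrite mulr2n; ring.
rewrite oppr0 mul0r !addr0 powRM ?nq_ge0// ?(ltW d2)//.
rewrite -powR_mulrn ?(ltW d0)// -powRrM; have -> : 2%:R * (s - 1) = 2 * s - 2 by ring.
ring.
Qed.

(** * The vortex pair built from a profile *)

Section vortex.
Variables (Rb eta Cq dl mu : R) (w : P -> R).
Hypothesis hRb : 1 <= Rb.
Hypothesis hdl : 0 < dl <= 1.
Hypothesis h9 : 9 * Rb * dl <= rho0.
Hypothesis hreg : reg_data Rb eta Cq (Qd dl) (Td dl) (T1d dl).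
Hypothesis hw : profile Rb eta Cq (Qd dl) (Td dl) (T1d dl) w mu.
Let wcl := prof_cl hw.

(** The shift by [dl * ac w] puts the mean of [x.1] under [th1] exactly at [- d]. Sums of two points
    of the vortex are then [z2] plus a rescaled displacement by [2 * ac w], as in the energy. *)
Definition cen : P := zz + e1 (dl * ac w).
Definition th1 (x : P) : R := (dl ^+ 2)^-1 * w (dl^-1 *: (x - cen)).
Definition th2 (x : P) : R := th1 (- x).
Definition vv (x : P) : R := th1 x - th2 x.
Definition Bz : R := `|zz| + l / 16.

Lemma dl_gt0 : 0 < dl. Proof. by case/andP: hdl. Qed.
Lemma Rb_ge0 : 0 <= Rb. Proof. exact: le_trans ler01 hRb. Qed.

Lemma th1_E x : th1 (cen + dl *: x) = (dl ^+ 2)^-1 * w x.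
Proof.
by rewrite /th1 [cen + _]addrC addrK scalerA mulVf ?scale1r// lt0r_neq0// dl_gt0.
Qed.

Lemma cen_inv x : cen + dl *: (dl^-1 *: (x - cen)) = x.
Proof. by rewrite scalerA mulfV ?lt0r_neq0 ?dl_gt0// scale1r addrC subrK. Qed.

Lemma cen_zz : `|cen - zz| <= dl * (2 * Rb).
Proof.
rewrite /cen [zz + _]addrC addrK norm_e1 normrM (gtr0_norm dl_gt0).
by rewrite ler_wpM2l ?(ltW dl_gt0)//; exact: prof_ac hw.
Qed.

Lemma th1_sup x : th1 x != 0 -> `|x - cen| <= dl * Rb.
Proof.
rewrite -[x]cen_inv; set u := dl^-1 *: _; rewrite th1_E => h.
rewrite [cen + _]addrC addrK normrZ (gtr0_norm dl_gt0) ler_wpM2l ?(ltW dl_gt0)// leNgt.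
by apply/negP => /(prof_sup hw) w0; rewrite w0 mulr0 eqxx in h.
Qed.

Lemma th1_zz x : th1 x != 0 -> `|x - zz| <= 3 * Rb * dl.
Proof.
move=> /th1_sup h; rewrite -[x](subrK cen) -addrA (le_trans (ler_normD _ _))//.
rewrite (le_trans (lerD h cen_zz))// le_eqVlt; apply/orP; left; apply/eqP; ring.
Qed.

Lemma dl3 : 3 * Rb * dl <= l / 48.
Proof. by move: h9; rewrite /rho0; lra. Qed.

Lemma th1_near x : th1 x != 0 -> `|x| <= Bz /\ - (l / 4) - l / 48 <= x.2 <= - (l / 4) + l / 48.
Proof.
have l0 := l0; move=> /th1_zz h; have {}h := le_trans h dl3; split.
  by rewrite -[x](subrK zz) (le_trans (ler_normD _ _))// addrC lerD2l; lra.
by move: (le_trans (norm2 _) h); rewrite /= opprK ler_norml => /andP[h1 h2]; apply/andP; split; lra.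
Qed.

Lemma cl_th1 : cl th1.
Proof.
have [L [B [L0 B0 wL wB]]] := wcl; have d0 := dl_gt0.
have k0 : 0 <= (dl ^+ 2)^-1 by rewrite invr_ge0 exprn_ge0// ltW.
exists ((dl ^+ 2)^-1 * (L * dl^-1)), (dl * Rb + `|cen|); split.
- by apply: mulr_ge0 => //; rewrite divr_ge0// ltW.
- by rewrite addr_ge0// mulr_ge0 ?Rb_ge0// ltW.
- move=> x y; rewrite /th1 -mulrBr normrM (ger0_norm k0) -[leRHS]mulrA ler_wpM2l//.
  rewrite (le_trans (wL _ _))// -scalerBr normrZ sub_subr.
  by rewrite (gtr0_norm (_ : 0 < dl^-1)) ?invr_gt0// mulrA.
- move=> x; apply: contraTeq => /th1_sup h; rewrite -leNgt -[x](subrK cen).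
  by rewrite (le_trans (ler_normD _ _))// lerD2r.
Qed.

Lemma cl_vv : cl vv.
Proof. exact: clB cl_th1 (cl_neg cl_th1). Qed.

Lemma I2_th1 : I2 th1 = 1.
Proof.
have d0 := dl_gt0; have dn : dl != 0 by rewrite lt0r_neq0.
have := @I2_aff (dl, dl) cen th1 dn dn (cl_itg cl_th1).
rewrite /= (gtr0_norm d0) -expr2 => h.
have : I2 (th1 \o aff (dl, dl) cen) = (dl ^+ 2)^-1.
  rewrite -[RHS]mulr1 -(prof_mass hw) -(I2Z _ (cl_itg wcl)); apply: eq_I2 => x.
  by rewrite -th1_E /=; congr th1; rewrite addrC.
by rewrite h => e; apply: (mulfI (invr_neq0 (expf_neq0 2 dn))); rewrite mulr1.
Qed.

Lemma I2_subst g : itg (fun y => g y * th1 y) ->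
  I2 (fun y => g y * th1 y) = I2 (fun y => g (cen + dl *: y) * w y).
Proof.
move=> hg; have d0 := dl_gt0; have dn : dl != 0 by rewrite lt0r_neq0.
have := @I2_aff (dl, dl) cen _ dn dn hg; rewrite /= (gtr0_norm d0) -expr2 => h.
have d2 : dl ^+ 2 != 0 by rewrite expf_neq0.
apply: (mulfI (invr_neq0 d2)); rewrite -h.
have i := @itg_aff (dl, dl) cen _ dn dn hg.
have E : (fun y => g y * th1 y) \o aff (dl, dl) cen = fun y => (dl ^+ 2)^-1 * (g (cen + dl *: y) * w y).
  apply/funext => y /=; have -> : aff (dl, dl) cen y = cen + dl *: y by rewrite addrC.
  by rewrite th1_E mulrCA.
rewrite E I2Z//; rewrite E in i; have := itgZ (dl ^+ 2) i.
by apply: eq_itg => y; rewrite mulrA mulfV// mul1r.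
Qed.

Lemma I2_vv : I2 vv = 0.
Proof.
have c := cl_th1; rewrite /vv (I2B (cl_itg c) (cl_itg (cl_neg c))).
by rewrite (I2_neg (cl_itg c)) subrr.
Qed.

Lemma vv_sup y : vv y != 0 -> `|y| <= Bz /\ `|y.2| <= 5 * l / 16.
Proof.
have l0 := l0; have [h|h _] := eqVneq (th1 y) 0; last first.
  by have [b /andP[h1 h2]] := th1_near h; split => //; rewrite ler_norml; apply/andP; split; lra.
rewrite /vv h sub0r oppr_eq0 => /th1_near[b /andP[h1 h2]]; rewrite normrN in b; split => //.
by move: h1 h2; rewrite /= ler_norml => h1 h2; apply/andP; split; lra.
Qed.

Local Notation Psi := (Psi vv).
Local Notation Pot := (Pot (Qd dl) (Td dl) (T1d dl) w).
Local Notation lam := (lam (T1d dl) w).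

Lemma cen2 x y : cen + dl *: x + (cen + dl *: y) = z2 + dl *: (x + y + e1 (2 * ac w)).
Proof.
rewrite addrACA -scalerDr; move: (x + y) => u.
rewrite scalerDr [RHS]addrCA [LHS]addrC; congr (_ + _).
apply: (congr2 pair).
  by transitivity (- (2 * d) + dl * (2 * ac w)) => //=; ring.
by transitivity (- (l / 2) + dl * 0) => //=; field.
Qed.

(** The opposite vortex is the image of [th1] under [x |-> - x], so the kernel is evaluated at sums
    of points, which [cen2] places near [z2]. The constant [Hs z2] is the one subtracted in [Tz]. *)
Lemma conv_far x : `|x| <= 2 * Rb ->
  convp (fun u => kern u + QU UU u) th1 (cen + dl *: x) =
  Hs z2 + sg dl * convp (Tc (Td dl) (2 * ac w)) w x.
Proof.
move=> hx; have d0 := dl_gt0.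
have lH : lint (fun u => kern u + QU UU u) by apply: lintD lint_kern (lint_QU UU_ge0).
have lT : lint (Tc (Td dl) (2 * ac w)) by exact: lint_Tc hreg _.
rewrite (convpE _ lH cl_th1) (@I2_subst (fun y => kern (cen + dl *: x + y) + QU UU (cen + dl *: x + y))).
  have i : itg (fun y => Tc (Td dl) (2 * ac w) (x + y) * w y).
    by apply: eq_itg (lintM (lint_add x lT) wcl) => y; rewrite [y + _]addrC.
  transitivity (I2 (fun y => Hs z2 * w y + sg dl * (Tc (Td dl) (2 * ac w) (x + y) * w y))); last first.
    rewrite (I2D (itgZ _ (cl_itg wcl)) (itgZ _ i)) (I2Z _ i) (I2Z _ (cl_itg wcl)).
    by rewrite (prof_mass hw) mulr1 (convpE _ lT wcl).
  apply: eq_I2 => y.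
  have [->|wy] := eqVneq (w y) 0; first by rewrite !mulr0 addr0.
  have yR : `|y| <= Rb by rewrite leNgt; apply/negP => /(prof_sup hw) h; rewrite h eqxx in wy.
  rewrite mulrA -mulrDl cen2 /Tc; set u := x + y + _; congr (_ * _).
  have hu : `|dl *: u| <= rho0.
    rewrite normrZ (gtr0_norm d0) (le_trans _ h9)// [leRHS]mulrC ler_wpM2l ?(ltW d0)//.
    rewrite /u (le_trans (ler_normD _ _))// norm_e1 normrM ger0_norm//.
    have := ler_normD x y; have := prof_ac hw; move: hx yR hRb.
    by move: (`|x|) (`|y|) (`|ac w|) (`|x + y|); intros; lra.
  have e := EE_z hu; rewrite /QU (clampR_id (EE_DD e)) /Td /Tz clamp_id// mulrA.
  by rewrite mulfV ?lt0r_neq0 ?sg_gt0// mul1r addrCA subrr addr0.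
have := lintM (lint_add (cen + dl *: x) lH) cl_th1.
by apply: eq_itg => y; rewrite ![y + _]addrC.
Qed.

Lemma conv_near : exists c : R, forall x,
  conv (fun u => kern u + QU UU u) th1 (cen + dl *: x) = sg dl * conv (kk (Qd dl)) w x + c.
Proof.
have d0 := dl_gt0; have [c hc] := kern_scale d0; exists c => x.
have lH : lint (fun u => kern u + QU UU u) by apply: lintD lint_kern (lint_QU UU_ge0).
have lK : lint (kk (Qd dl)) by exact: lint_kk hreg.
have lB : lint (box 0) by apply: lint_itg; exact: itg_box.
rewrite /conv (@I2_subst (fun y => kern (cen + dl *: x - y) + QU UU (cen + dl *: x - y))); last first.
  exact: conv_itg _ lH cl_th1.
transitivity (conv (fun u => sg dl * kk (Qd dl) u + (c + (- c) * box 0 u)) w x).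
  apply: eq_I2 => y; congr (_ * _).
  have -> : cen + dl *: x - (cen + dl *: y) = dl *: (x - y) by rewrite opprD addrACA subrr add0r scalerBr.
  rewrite hc /kk /Qd; set q := QU _ _; set b := box _ _.
  rewrite mulrDr (mulrA (sg dl)) mulfV ?lt0r_neq0 ?sg_gt0// mul1r; ring.
rewrite (conv_kD x (lintZ _ lK) (lintD (lint_cst _) (lintZ _ lB)) wcl).
rewrite (conv_kD x (lint_cst _) (lintZ _ lB) wcl).
have zc k g : lint g -> conv (fun u => k * g u) w x = k * conv g w x.
  move=> lg; rewrite -(I2Z _ (conv_itg x lg wcl)); apply: eq_I2 => y; exact: esym (mulrA _ _ _).
rewrite !zc// conv_box0// mulr0 addr0; congr (_ + _).
by rewrite /conv (I2Z _ (cl_itg wcl)) (prof_mass hw) mulr1.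
Qed.

Lemma cen_XX x : `|x| <= 2 * Rb -> XX (cen + dl *: x) /\ `|cen + dl *: x| + Bz <= UU.
Proof.
move=> hx; have l0 := l0; have d0 := dl_gt0.
have h : `|cen + dl *: x - zz| <= l / 16.
  rewrite addrAC (le_trans (ler_normD _ _))// normrZ (gtr0_norm d0).
  have := ler_wpM2l (ltW d0) hx; have := cen_zz; have := dl3.
  by move: (Rb) (dl) => r q; lra.
split.
  have := le_trans (norm2 _) h; rewrite /XX; move: (cen + dl *: x) => X h'.
  by rewrite -[X.2](subrK zz.2) (le_trans (ler_normD _ _))//= normrN (gtr0_norm (_ : 0 < l / 4)); move: h' => /=; lra.
have := ler_normD (cen + dl *: x - zz) zz; rewrite subrK /UU /Bz.
by move: (`|cen + _|) (`|zz|) h => a b; lra.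
Qed.

(** Near the vortex the stream function is, up to constants, the rescaled potential without its
    linear term; that term is what the travelling frame restores. *)
Lemma Psi_Pot : exists K : R, forall x, `|x| <= 2 * Rb ->
  Psi (cen + dl *: x) = sg dl * (Pot x - lam * x.1) + K.
Proof.
have [c hc] := conv_near; exists (c - Hs z2) => x hx; have [xX xU] := cen_XX hx.
rewrite (Psi_E cl_vv I2_vv vv_sup xX xU UU_ge0) /G0.
have lQ := lint_QU UU_ge0; have lH := lintD lint_kern lQ.
rewrite -(conv_kD _ lint_kern lQ cl_vv).
have -> : vv = fun y => th1 y + (-1) * neg th1 y by apply/funext => y; rewrite mulN1r.
rewrite (convD _ lH cl_th1 (clZ _ (cl_ng cl_th1))) (convZ _ _ lH (cl_ng cl_th1)) hc.
rewrite -/(convp _ th1 _) (conv_far hx) /Pot; move: (conv _ _ _) (convp _ _ _) (Hs _) => a b e.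
by ring.
Qed.

Lemma Psi_odd x : Psi (- x) = - Psi x.
Proof.
have c1 : PsiL vv x (Psi x) by exact: (@Psi_cvg _ _ cl_vv I2_vv vv_sup x).
apply: (PsiL_Psi (L := - Psi x)); rewrite /PsiL.
have -> : (fun N => PsiN vv N (- x)) = (fun N => - PsiN vv N x).
  apply/funext => N; rewrite /PsiN /conv -[LHS](I2_neg (conv_itg _ (lint_SN N) cl_vv)).
  rewrite -[RHS]mulN1r -(I2Z _ (conv_itg _ (lint_SN N) cl_vv)); apply: eq_I2 => y.
  have Ev : vv (- y) = - vv y by rewrite /vv /th2 opprK opprB.
  by rewrite -opprD SN_even Ev mulrN mulN1r.
exact: cvgN c1.
Qed.

(** The slope of [lam * x.1] back in the original variables, before the normalization [cG] of the
    kernel. *)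
Definition spd : R := lam * sg dl / dl.

Lemma sdg_neg f (X g : P) : sdg f X g -> sdg (fun x => f (- x)) (- X) (- g.1, - g.2).
Proof.
move=> h; have E : aff (-1, -1) 0 (- X) = X.
  by case: (X) => a b; apply: (congr2 pair); rewrite /= addr0 mulN1r opprK.
rewrite -{1}E in h; have := sdg_aff h; rewrite !mulrN1.
suff -> : f \o aff (-1, -1) 0 = fun x => f (- x) by [].
by apply/funext => x; congr f; apply: (congr2 pair); rewrite /= addr0 mulN1r.
Qed.

Lemma sdg_cst (c : R) X : sdg (fun=> c) X 0.
Proof. by apply: sdg_dot => x y; rewrite subrr /dot !mul0r addr0. Qed.

Lemma sdg_th1 x (p : P) : sdg w x p ->
  sdg th1 (cen + dl *: x) ((dl ^+ 2)^-1 * (p.1 * dl^-1), (dl ^+ 2)^-1 * (p.2 * dl^-1)).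
Proof.
move=> h; have dn : dl != 0 by rewrite lt0r_neq0// dl_gt0.
have E Y : aff (dl^-1, dl^-1) (- (dl^-1 *: cen)) Y = dl^-1 *: (Y - cen) by rewrite scalerBr.
have Ex : aff (dl^-1, dl^-1) (- (dl^-1 *: cen)) (cen + dl *: x) = x.
  by rewrite E [cen + _]addrC addrK scalerA mulVf// scale1r.
rewrite -{1}Ex in h; have := sdgZ ((dl ^+ 2)^-1) (sdg_aff h).
suff -> : (fun Y => (dl ^+ 2)^-1 * (w \o aff (dl^-1, dl^-1) (- (dl^-1 *: cen))) Y) = th1 by [].
by apply/funext => Y; rewrite /= E.
Qed.

Lemma sdg_Pot x (g : P) : `|x| < 2 * Rb -> sdg Psi (cen + dl *: x) g ->
  sdg Pot x ((sg dl)^-1 * (g.1 * dl) + lam, (sg dl)^-1 * (g.2 * dl)).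
Proof.
move=> hx h; have [K hK] := Psi_Pot.
have sn : sg dl != 0 by rewrite lt0r_neq0// sg_gt0// dl_gt0.
have E Y : aff (dl, dl) cen Y = cen + dl *: Y by rewrite addrC.
rewrite -E in h; have h1 := sdgZ (sg dl)^-1 (sdg_aff h).
have h2 : sdg (fun y : P => lam * y.1 - (sg dl)^-1 * K) x (lam, 0).
  by apply: sdg_dot => y z; rewrite /dot mul0r addr0 /= mulrBr; ring.
have h3 := sdgD h1 h2.
have r0 : 0 < 2 * Rb - `|x| by rewrite subr_gt0.
have -> : ((sg dl)^-1 * (g.1 * dl) + lam, (sg dl)^-1 * (g.2 * dl)) =
  ((sg dl)^-1 * (g.1 * dl), (sg dl)^-1 * (g.2 * dl)) + (lam, 0) :> P.
  by apply: (congr2 pair); rewrite //= addr0.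
apply: sdg_local r0 _ h3 => y hy.
have hy' : `|y| <= 2 * Rb.
  by have := ler_normD (y - x) x; rewrite subrK; move: hy; move: (`|y|) (`|x|) (`|y - x|); intros; lra.
by rewrite /= E (hK _ hy'); move: Pot => f; field.
Qed.

(** In the open box [w] is [ff] of the potential, so the two gradients are parallel. Outside it, [w]
    vanishes on a ball of radius [Rb]. The differentiability of [th1] comes along, from that of
    [Psi]. *)
Lemma wave1 X (g : P) : sdg Psi X g ->
  exists q : P, sdg th1 X q /\ g.2 * q.1 + (- g.1 - spd) * q.2 = 0.
Proof.
rewrite -[X]cen_inv; set x := dl^-1 *: _ => h.
have dn : dl != 0 by rewrite lt0r_neq0// dl_gt0.
have sn : sg dl != 0 by rewrite lt0r_neq0// sg_gt0// dl_gt0.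
have [hx|hx] := ltP `|x| (2 * Rb).
  have h1 := sdg_Pot hx h; set p : P := (_, _) in h1.
  have h2 := sdgD h1 (sdg_cst (- mu) x); rewrite addr0 in h2.
  have h3 := sdg_comp1 h2 (sd1_ff (Pot x + - mu)).
  set k := df _ in h3; have r0 : 0 < 2 * Rb - `|x| by rewrite subr_gt0.
  have h4 : sdg w x (k * p.1, k * p.2).
    apply: sdg_local r0 _ h3 => y hy; rewrite /= (prof_eq hw)//.
    have := ler_normD (y - x) x; rewrite subrK; move: hy.
    by move: (`|y|) (`|x|) (`|y - x|); intros; lra.
  have h5 := sdg_th1 h4; eexists; split; first exact: h5.
  rewrite /p /spd /=; move: (sg dl) sn lam => a sn b; field.
  by rewrite sn dn.
have h4 : sdg w x 0.
  have R0 : 0 < Rb by exact: lt_le_trans ltr01 hRb.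
  apply: sdg_local R0 _ (sdg_cst 0 x) => y hy; apply: (prof_sup hw).
  have := ler_normD (x - y) y; rewrite subrK; rewrite distrC in hy; move: hx hy.
  by move: (`|y|) (`|x|) (`|x - y|); intros; lra.
have := sdg_th1 h4; rewrite /= !mul0r !mulr0 => h5; exists 0; split => //=.
by rewrite !mulr0 addr0.
Qed.

(** [Psi] is odd, so it has the same gradient at [X] and [- X]; the relation for [th1] at [- X] is
    the one for the opposite vortex at [X], with the same speed. *)
Lemma wave X (g : P) : sdg Psi X g ->
  exists q : P, sdg vv X q /\ g.2 * q.1 + (- g.1 - spd) * q.2 = 0.
Proof.
move=> h; have [q1 [h1 e1]] := wave1 h.
have h' : sdg Psi (- X) g.
  have := sdgZ (-1) (sdg_neg h); rewrite /= !mulN1r !opprK -surjective_pairing.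
  suff -> : (fun x => -1 * Psi (- x)) = Psi by [].
  by apply/funext => x; rewrite Psi_odd mulN1r opprK.
have [q2 [h2 e2]] := wave1 h'; exists (q1 + q2); split.
  have h3 := sdgZ (-1) (sdg_neg h2); rewrite /= !mulN1r !opprK -surjective_pairing in h3.
  have := sdgD h1 h3; suff -> : (fun x => th1 x + -1 * th1 (- x)) = vv by [].
  by apply/funext => x; rewrite mulN1r.
rewrite /= !mulrDr -[RHS]addr0 -{1}e1 -e2; ring.
Qed.

Lemma sd_Psiv X : sd Psi X.
Proof. exact: (sd_Psi cl_vv I2_vv vv_sup). Qed.

Lemma sd_th1 X : sd th1 X.
Proof. by have [g /wave1[q [h _]]] := sd_Psiv X; exists q. Qed.

Lemma sd_th2 X : sd th2 X.
Proof.
have [q h] := sd_th1 (- X); exists (- q.1, - q.2).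
by have := sdg_neg h; rewrite opprK.
Qed.

(** * Periodization *)

Lemma periodize_shift k f x : periodize l f (shft l k x) = periodize l f x.
Proof.
rewrite /periodize [RHS](@reindex_fsbigT _ _ _ _ _ (fun j : int => j + k)).
  by apply: eq_fsbigr => j _; rewrite shftD.
by exists (fun j => j - k) => j; [exact: addrK|exact: subrK].
Qed.

Lemma shftN k (x : P) : - shft l k x = shft l (- k) (- x).
Proof. by apply: (congr2 pair) => //=; rewrite opprD rmorphN mulNr. Qed.

Lemma periodize_neg f x : periodize l (fun y => f (- y)) x = periodize l f (- x).
Proof.
rewrite /periodize [RHS](@reindex_fsbigT _ _ _ _ _ (fun j : int => - j)).
  by apply: eq_fsbigr => j _; rewrite shftN.
by exists (fun j => - j) => j; exact: opprK.
Qed.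

Lemma th1_refl x : th1 (x.1, - (l / 2) - x.2) = th1 x.
Proof.
rewrite /th1 -[in RHS](prof_even hw); congr (_ * w _).
apply: (congr2 pair) => //=.
change (dl^-1 * (- (l / 2) - x.2 - (- (l / 4) + 0)) = - (dl^-1 * (x.2 - (- (l / 4) + 0)))).
by move: (dl^-1) (x.2) => a b; field.
Qed.

(** Evenness of [w] makes [th1] symmetric about [x_2 = - l / 4]; after periodization every line at a
    multiple of [l / 2] from it is an axis. *)
Lemma periodize_refl (m : int) x :
  periodize l th1 (x.1, m%:~R * l - l / 2 - x.2) = periodize l th1 x.
Proof.
rewrite /periodize [RHS](@reindex_fsbigT _ _ _ _ _ (fun j : int => - (m + j))).
  apply: eq_fsbigr => j _; rewrite -[RHS]th1_refl; congr th1; apply: (congr2 pair) => //=.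
  by rewrite rmorphN rmorphD /=; ring.
by exists (fun j => - j - m) => j /=; ring.
Qed.

Definition th0 (x : P) : R := periodize l th1 x - periodize l th2 x.

Lemma periodize_th2 x : periodize l th2 x = periodize l th1 (- x).
Proof. exact: periodize_neg. Qed.

Lemma th0_shift k x : th0 (shft l k x) = th0 x.
Proof. by rewrite /th0 !periodize_shift. Qed.

Lemma th0_refl (m : int) x : th0 (x.1, m%:~R * l - l / 2 - x.2) = th0 x.
Proof.
rewrite /th0 !periodize_th2 periodize_refl; congr (_ - _).
rewrite -(periodize_refl (1 - m) (- x)); congr periodize; apply: (congr2 pair) => //=.
by rewrite rmorphB /=; field.
Qed.

Lemma intr_ge1 (k : int) : k != 0 -> 1 <= `|k%:~R : R|.
Proof. by move=> k0; apply: norm_intr_ge1; rewrite ?intr_eq0 ?intr_int. Qed.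

(** Another translate could contribute only if [l <= 9 * l / 16 + 13 * l / 48], which is false.
    Since [9 / 16] exceeds [1 / 2], the identity holds near a whole period, as differentiation
    requires. *)
Lemma periodize_th1 x : `|x.2| < 9 * l / 16 -> periodize l th1 x = th1 x.
Proof.
move=> hx; have l0 := l0; rewrite /periodize -(@fsbig_widen _ _ _ _ [set 0]) ?fsbig_set1 ?shft0//.
move=> k [_ /= /eqP k0]; apply/eqP; apply: contraT => /th1_near[_ /andP[h1 h2]].
have := ler_wpM2r (ltW l0) (intr_ge1 k0); rewrite mul1r -[X in _ * X](gtr0_norm l0) -normrM.
have -> : k%:~R * l = (shft l k x).2 - x.2 by rewrite /= addrC addKr.
have h3 : `|(shft l k x).2| <= 13 * l / 48 by rewrite ler_norml; apply/andP; split; lra.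
move=> h; have := le_trans h (ler_normB _ _); move: hx h3.
by move: (`|_.2|) (`|x.2|) => a b; intros; lra.
Qed.

Lemma th0_E x : `|x.2| < 9 * l / 16 -> th0 x = vv x.
Proof.
by move=> hx; rewrite /th0 periodize_th2 !periodize_th1//= normrN.
Qed.

Lemma th0_wave X (g : P) : sdg Psi X g ->
  exists q : P, sdg th0 X q /\ g.2 * q.1 + (- g.1 - spd) * q.2 = 0.
Proof.
have [k hk] := period_repr X; set Y := shft l k X in hk => h.
have l0 := l0; have EX : X = Y + (0, (- k)%:~R * l) by rewrite -sh_add -[sh _ _]/(shft l (- k) Y) shftD addNr shft0.
have EY : Y = X + (0, k%:~R * l) by rewrite -sh_add.
have hY : sdg Psi Y g.
  rewrite EX in h; have := sdg_shift h.
  suff -> : (fun x => Psi (x + (0, (- k)%:~R * l))) = Psi by [].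
  by apply/funext => x; rewrite -sh_add; exact: (Psi_per cl_vv I2_vv vv_sup).
have [q [h1 e]] := wave hY; exists q; split => //.
have r0 : 0 < l / 16 by rewrite divr_gt0.
have h2 : sdg th0 Y q.
  apply: sdg_local r0 _ h1 => x hx; apply: th0_E.
  have := le_lt_trans (norm2 _) hx => /= hx2; rewrite -[x.2](subrK Y.2).
  by rewrite (le_lt_trans (ler_normD _ _))//; move: hk hx2; move: (`|_|) (`|_|) => a b; intros; lra.
rewrite EY in h2; have := sdg_shift h2.
suff -> : (fun x => th0 (x + (0, k%:~R * l))) = th0 by [].
by apply/funext => x; rewrite -sh_add; exact: th0_shift.
Qed.

Lemma sd_th0 X : sd th0 X.
Proof. by have [g /th0_wave[q [h _]]] := sd_Psiv X; exists q. Qed.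

(** * Back to the kernel [Gs]: stream function, equation, speed *)

Definition cG : R := if s == 1 then (512 * pi)^-1 else cs s / 128.

(** For [s = 1], [ln (enorm x)] is half of [ln (nq x)], whence [512 = 4 * 128]. The default values
    at the origin agree. *)
Lemma Gs_kern x : Gs s x = cG * kern x.
Proof.
have q0 := nq_ge0 x; rewrite /Gs /cG /kern /kap /enorm -/(nq x); case: eqP => s1; last first.
  rewrite -powR12_sqrt// -powRrM; have -> : 2^-1 * (2 * s - 2) = s - 1 by field.
  by rewrite mulrA divfK// pnatr_eq0.
have p0 : pi != 0 :> R by rewrite lt0r_neq0// pi_gt0.
move: q0; rewrite le_eqVlt => /orP[/eqP <-|q0]; first by rewrite sqrtr0 invr0 !ln0// !mulr0.
rewrite lnV ?posrE ?sqrtr_gt0// -powR12_sqrt ?(ltW q0)// ln_powR.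
by move: p0; move: (@pi R) (ln _) => p a p0; field.
Qed.

Lemma Cs_AA : Cs s = 2 * cG * AA.
Proof.
rewrite /Cs /cG /AA; case: eqP => s1; last by field.
have : pi != 0 :> R by rewrite lt0r_neq0// pi_gt0.
by move: (@pi R) => p p0; field.
Qed.

Definition psi0 (x : P) : R := cG * Psi x.

Lemma mbl_strip : measurable (strip l : set PM).
Proof.
apply: open_prod_mbl; rewrite /strip; have -> : [set y : P | - (l / 2) < y.2 < l / 2] = snd @^-1` `]- (l / 2), l / 2[%classic.
  by apply/seteqP; split => y /=; rewrite in_itv.
apply: open_comp => [x _|]; [exact: cvg_snd|exact: interval_open].
Qed.

(** [vv] vanishes for [|y.2| > 5 * l / 16], so the integral over one period is an integral over the
    plane and the results on [PsiN] apply. *)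
Lemma strip_integrand N x :
  (periodic_integrand s l th0 N x) \_ (strip l) = fun y => cG * (SN N (x - y) * vv y).
Proof.
have l0 := l0; apply/funext => y; rewrite patchE; case: ifPn => [/set_mem|]; rewrite ?notin_setE /strip /= => h.
  rewrite /periodic_integrand th0_E; last by move/andP: h => [h1 h2]; rewrite ltr_norml; apply/andP; split; lra.
  rewrite mulrA; congr (_ * _); rewrite /SN /symsum mulr_sumr; apply: eq_bigr => i _.
  exact: Gs_kern.
have [->|/vv_sup[_]] := eqVneq (vv y) 0; first by rewrite !mulr0.
by rewrite ler_norml => /andP[h1 h2]; case: h; apply/andP; split; lra.
Qed.

Lemma stream : stream_function s l th0 psi0.
Proof.
move=> x; have i N := itgZ cG (conv_itg x (lint_SN N) cl_vv); split => [N|].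
  apply/(integrable_mkcond _ mbl_strip).
  have := i N; rewrite /itg -strip_integrand.
  suff -> : (EFin \o periodic_integrand s l th0 N x) \_ (strip l) = EFin \o ((periodic_integrand s l th0 N x) \_ (strip l)) by [].
  by apply/funext => y /=; rewrite !patchE; case: ifP.
have -> : (fun N => \int[mu2]_(y in strip l) periodic_integrand s l th0 N x y) = fun N => cG * PsiN vv N x.
  apply/funext => N; rewrite Rintegral_mkcond strip_integrand.
  exact: I2Z (conv_itg x (lint_SN N) cl_vv).
have c1 : PsiL vv x (Psi x) by exact: (@Psi_cvg _ _ cl_vv I2_vv vv_sup x).
exact: (cvgM (cvg_cst _) c1).
Qed.

Lemma travelling : travelling_wave s l th0 (0, cG * spd).
Proof.
split => [x|]; first by rewrite -(th0_shift 1 x); congr th0; apply: (congr2 pair) => //=; rewrite mul1r.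
exists psi0; split; [exact: stream|move=> x|move=> x].
  by have [g h] := sd_Psiv x; have [] := sdg_differentiable (sdgZ cG h).
have [g h] := sd_Psiv x; have [q [hq e]] := th0_wave h.
have [_ D1] := sdg_differentiable (sdgZ cG h); have [_ D2] := sdg_differentiable hq.
rewrite /d1 /d2 !D1 !D2 /dot /= !mulr0 !mulr1 !addr0 !add0r subr0.
by rewrite -[RHS](mulr0 cG) -e; ring.
Qed.

(** The factors [sg dl] and [dl] cancel, and [w] has mass 1: [spd] is a mean of [T1z] over points of
    norm at most [6 * Rb * dl], and [T1z 0 = T1s z2]. *)
Lemma spd_est (C : R) : 0 <= C -> lipf C T1z -> `|spd - T1s z2| <= C * (9 * Rb * dl).
Proof.
move=> C0 hC; have d0 := dl_gt0; pose u0 := e1 (2 * ac w).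
have sn : sg dl != 0 by rewrite lt0r_neq0// sg_gt0.
have r0 := ltW rho0_gt0.
pose h (u : P) : R := T1z (dl *: (u + u0)) - T1s z2.
have z0 : T1z 0 = T1s z2.
  by rewrite /T1z (_ : clamp rho0 0 = 0) ?addr0//; apply: clamp_id; rewrite normr0.
have hh u : `|h u| <= C * (dl * `|u + u0|).
  by rewrite /h -z0 (le_trans (hC _ _))// subr0 normrZ (gtr0_norm d0).
have lh : lint h.
  have l1 : lipf (C * dl) (fun u => h (u - u0)).
    move=> x y; rewrite /h !subrK opprB addrA subrK; exact: lipf_scale (ltW d0) hC x y.
  have := lint_add u0 (lint_llip (lipf_llip (mulr_ge0 C0 (ltW d0)) l1)).
  by under eq_fun do rewrite addrK.
have E : T1c (T1d dl) (2 * ac w) = fun u => (sg dl)^-1 * dl * (h u + T1s z2).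
  by apply/funext => u; rewrite /T1c /T1d /h subrK mulrA.
have cn := cl_ng wcl.
have -> : spd - T1s z2 = fmp h w w.
  rewrite /spd /main.lam E /fmp (fm_kZ _ (lintD lh (lint_cst _)) wcl cn).
  rewrite (fm_kD lh (lint_cst _) wcl cn) (fm_kC _ wcl cn) (I2_neg' wcl) (prof_mass hw).
  by move: (fm _ _ _) (T1s z2) (sg dl) sn (lt0r_neq0 d0) => a b k kn dn; field; rewrite kn dn.
have w0 x : `|w x| = w x by rewrite ger0_norm// (prof_ge0 hw).
have i1 := I2_prod_itg wcl lh cn.
have R0 := Rb_ge0; have b0 : 0 <= C * (9 * Rb * dl) by rewrite !mulr_ge0// ltW.
rewrite /fmp (le_trans (ler_norm_I2 i1))// -[leRHS]mulr1 -(prof_mass hw) -(I2Z _ (cl_itg wcl)).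
apply: I2_le => [||x]; [exact: itg_norm|exact: itgZ (cl_itg wcl)|].
rewrite normrM w0 mulrC; have [->|wx] := eqVneq (w x) 0; first by rewrite !mulr0.
have xR : `|x| <= Rb by rewrite leNgt; apply/negP => /(prof_sup hw) e; rewrite e eqxx in wx.
rewrite ler_wpM2r ?(prof_ge0 hw)//.
have hM z : `|z| <= Rb + Rb -> `|h z| <= C * (9 * Rb * dl).
  move=> hz; rewrite (le_trans (hh z))// ler_wpM2l// [leRHS]mulrC ler_wpM2l ?(ltW d0)//.
  rewrite (le_trans (ler_normD _ _))// /u0 norm_e1 normrM ger0_norm//.
  by move: hz (prof_ac hw); move: (`|z|) (`|ac w|) => a b; intros; lra.
have := conv_bnd lh cn (supB_neg (prof_sup hw)) xR hM.
have -> : (fun y => `|neg w y|) = neg w by apply/funext => y; exact: w0.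
by rewrite (I2_neg' wcl) (prof_mass hw) mulr1.
Qed.

Lemma th1_ge0 x : 0 <= th1 x.
Proof. by rewrite /th1 mulr_ge0 ?(prof_ge0 hw)// invr_ge0 exprn_ge0// ltW// dl_gt0. Qed.

(** [th1] is a probability density concentrated near [zz], so testing it evaluates [f] up to its
    oscillation. Composition with [shft l k] moves the centre by [- k] periods. *)
Lemma th1_test (f : P -> R) (k : int) (eps r : R) : continuous f -> 3 * Rb * dl < r ->
  (forall y, `|y - shft l (- k) zz| < r -> `|f y - f (shft l (- k) zz)| <= eps) ->
  itg (fun x => th1 (shft l k x) * f x) /\
  `|I2 (fun x => th1 (shft l k x) * f x) - f (shft l (- k) zz)| <= eps.
Proof.
move=> cf hr hf; set c := shft l (- k) zz; pose v x := th1 (shft l k x).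
have Ev : v = fun x => th1 (x + (0, k%:~R * l)) by apply/funext => x; congr th1; exact: sh_add.
have clv : cl v by rewrite Ev; exact: cl_add cl_th1.
have mv : I2 v = 1 by rewrite Ev (I2_add _ (cl_itg cl_th1)) I2_th1.
have near x : v x != 0 -> `|f x - f c| <= eps.
  move=> /th1_zz h; apply: hf; apply: le_lt_trans hr; apply: le_trans h.
  have -> // : x - shft l (- k) zz = shft l k x - zz.
  by apply: (congr2 pair) => //=; rewrite rmorphN; ring.
have mf : mbl f by exact: continuous_mbl.
have [M0 hM] : exists M0 : R, forall x, `|v x * f x| <= M0 * v x.
  exists (`|f c| + eps) => x; have [->|vx] := eqVneq (v x) 0; first by rewrite mul0r normr0 mulr0.
  rewrite normrM (ger0_norm (th1_ge0 _)) mulrC ler_wpM2r ?th1_ge0//.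
  have := ler_normD (f x - f c) (f c); rewrite subrK => h; rewrite (le_trans h)// addrC lerD2l.
  exact: near.
have i : itg (fun x => v x * f x).
  apply: itg_le (itgZ M0 (cl_itg clv)) hM.
  exact: measurable_funM (cl_mbl clv) mf.
split => //; rewrite -[f c]mulr1 -mv -(I2Z _ (cl_itg clv)) -(I2B i (itgZ _ (cl_itg clv))).
have i2 := itgB i (itgZ (f c) (cl_itg clv)).
rewrite (le_trans (ler_norm_I2 i2))// -[leRHS]mulr1 -mv -(I2Z _ (cl_itg clv)).
apply: I2_le => [||x]; [exact: itg_norm|exact: itgZ (cl_itg clv)|].
have [->|vx] := eqVneq (v x) 0; first by rewrite mul0r !mulr0 subr0 normr0.
rewrite mulrC -mulrBl normrM (ger0_norm (th1_ge0 (shft l k x))) ler_wpM2r ?th1_ge0//.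
exact: near.
Qed.

End vortex.

(** * Weak convergence *)

Lemma fsbig_symsum (F : int -> R) (N : nat) : (forall k, (N < `|k|)%N -> F k = 0) ->
  \sum_(k \in [set: int]) F k = symsum F N.
Proof.
move=> h; pose r := [seq i%:Z - N%:Z | i <- iota 0 N.*2.+1].
have ur : uniq r.
  by rewrite map_inj_uniq ?iota_uniq// => i j /addIr [].
rewrite -(@fsbig_widen _ _ _ _ [set` r])//; last first.
  move=> k [_ /= hk]; apply: h; rewrite ltnNge; apply/negP => kN; apply: hk; apply/mapP.
  case: k kN => n nN.
    exists (n + N)%N; last by rewrite PoszD addrK.
    by rewrite mem_iota add0n ltnS -addnn leq_add2r.
  exists (N - n.+1)%N; last by rewrite NegzE -subzn// addrAC subrr add0r.
  by rewrite mem_iota add0n ltnS (leq_trans (leq_subr _ _))// -addnn leq_addr.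
by rewrite -fsbig_seq// /symsum big_map -[iota _ _]/(index_iota 0 N.*2.+1) big_mkord.
Qed.

Lemma symsum_opp (F : int -> R) N : symsum (fun k => F (- k)) N = symsum F N.
Proof.
elim: N => [|N IH]; first by rewrite !symsum0 oppr0.
by rewrite !symsumS IH opprK [F (- _) + _]addrC.
Qed.

Lemma symsum_close (F G : int -> R) N (e : R) : (forall k, (`|k| <= N)%N -> `|F k - G k| <= e) ->
  `|symsum F N - symsum G N| <= N.*2.+1%:R * e.
Proof.
elim: N => [|N IH] h; first by rewrite !symsum0 mul1r h.
rewrite !symsumS.
have h1 := h N.+1%:Z (leqnn _); have h2 := h (- N.+1%:Z); rewrite abszN in h2; have {}h2 := h2 (leqnn _).
have h3 := IH (fun k kN => h k (leqW kN)).
rewrite [X in `|X|](_ : _ = (symsum F N - symsum G N) +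
  ((F N.+1%:Z - G N.+1%:Z) + (F (- N.+1%:Z) - G (- N.+1%:Z)))); last by ring.
rewrite (le_trans (ler_normD _ _))//.
have -> : N.+1.*2.+1%:R * e = N.*2.+1%:R * e + (e + e) :> R by rewrite doubleS -!natr1; ring.
by rewrite lerD// (le_trans (ler_normD _ _))// lerD.
Qed.

Lemma symsum_I2 (g : int -> P -> R) N : (forall k, (`|k| <= N)%N -> itg (g k)) ->
  itg (fun x => symsum (g ^~ x) N) /\ I2 (fun x => symsum (g ^~ x) N) = symsum (fun k => I2 (g k)) N.
Proof.
elim: N => [|N IH] h.
  rewrite symsum0; have -> : (fun x => symsum (g ^~ x) 0) = g 0 by apply/funext => x; rewrite symsum0.
  by split => //; exact: h.
have [i e] := IH (fun k kN => h k (leqW kN)).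
have i1 := h N.+1%:Z (leqnn _); have i2 : itg (g (- N.+1%:Z)) by apply: h; rewrite abszN.
have -> : (fun x => symsum (g ^~ x) N.+1) = fun x => symsum (g ^~ x) N + (g N.+1%:Z x + g (- N.+1%:Z) x).
  by apply/funext => x; rewrite symsumS.
have i3 := itgD i1 i2; split; first exact: itgD.
by rewrite (I2D i i3) (I2D i1 i2) e symsumS.
Qed.

Lemma unif_int (Q : int -> R -> Prop) : (forall k r r', r' <= r -> Q k r -> Q k r') ->
  (forall k, exists2 r, 0 < r & Q k r) -> forall n, exists2 r, 0 < r & forall k, (`|k| <= n)%N -> Q k r.
Proof.
move=> mono h; elim => [|n [r r0 hr]].
  have [r r0 hr] := h 0; exists r => // k.
  by rewrite leqn0 absz_eq0 => /eqP->.
have [r1 r10 h1] := h n.+1%:Z; have [r2 r20 h2] := h (- n.+1%:Z).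
pose m := Num.min r (Num.min r1 r2).
have [m0 m1 m2] : [/\ m <= r, m <= r1 & m <= r2] by rewrite /m !ge_min !lexx !orbT.
exists m => [|k]; first by rewrite /m !lt_min r0 r10.
rewrite leq_eqVlt => /orP[|kn]; last by apply: mono m0 _; exact: hr.
case: k => k /= /eqP ek; first by rewrite ek; exact: mono m1 h1.
by rewrite NegzE ek; exact: mono m2 h2.
Qed.

Lemma cont_ball (f : P -> R) c (e : R) : continuous f -> 0 < e ->
  exists2 r : R, 0 < r & forall y, `|y - c| < r -> `|f y - f c| <= e.
Proof.
move=> cf e0; have /cvgrPdist_le/(_ e e0) := cf c.
move=> /nbhs_ballP[r /= r0 hr]; exists r => // y hy.
by rewrite distrC; apply: hr; rewrite -ball_normE /ball_ /= distrC.
Qed.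

Lemma compact_supp_bnd (f : P -> R) : compact (supp f) ->
  exists2 K : R, 0 <= K & forall x, f x != 0 -> `|x| <= K.
Proof.
move=> /compact_bounded[M [_ hM]]; exists (`|M| + 1); first by rewrite addr_ge0.
move=> x fx; apply: (hM (`|M| + 1)); last exact: subset_closure.
by rewrite ltr_pwDr// ler_norm.
Qed.

(** Only indices [|k| <= N] matter, and continuity at the finitely many centres gives the tolerance
    [eps / (2 * N.*2.+1)] for each vortex of either sign. The threshold [zeta] is independent of the
    profile. *)
Lemma weak_cvg (f : P -> R) (Rb eps : R) : continuous f -> compact (supp f) -> 1 <= Rb -> 0 < eps ->
  exists2 zeta : R, 0 < zeta & forall (eta Cq dl mu : R) (w : P -> R), 0 < dl <= 1 -> 9 * Rb * dl <= rho0 ->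
    profile Rb eta Cq (Qd dl) (Td dl) (T1d dl) w mu -> dl < zeta ->
  `|I2 (fun x => th0 dl w x * f x)
    - (\sum_(k \in [set: int]) f (shft l k zz) - \sum_(k \in [set: int]) f (- shft l k zz))| <= eps.
Proof.
move=> cf sf Rb1 e0; have [K K0 hK] := compact_supp_bnd sf; have l0 := l0.
(* The extra period accounts for the offset of the centres and the size of the vortices. *)
pose N := (Num.bound (K / l)).+1.
have hN k : `|k%:~R * l| <= K + l -> (`|k| <= N)%N.
  move=> h; have Kl : 0 <= K / l by rewrite divr_ge0// ltW.
  have := archi_boundP Kl; move: h; rewrite normrM (gtr0_norm l0) -ler_pdivlMr//.
  rewrite mulrDl divff ?lt0r_neq0// => h1 h2.
  have h3 : `|k%:~R : R| < N%:R by rewrite (le_lt_trans h1)// /N -natr1 ltrD2r.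
  by rewrite -intr_norm -natr_absz ltr_nat in h3; exact: ltnW.
have cf' : continuous (fun y : P => f (- y)).
  by move=> x; apply: continuous_comp; [exact: opp_continuous|exact: cf].
pose e' := eps / (2 * N.*2.+1%:R).
have n0 : 0 < 2 * N.*2.+1%:R :> R by rewrite mulr_gt0.
have e'0 : 0 < e' by rewrite divr_gt0.
pose Q k (r : R) := (forall y, `|y - shft l k zz| < r -> `|f y - f (shft l k zz)| <= e') /\
  (forall y, `|y - shft l k zz| < r -> `|f (- y) - f (- shft l k zz)| <= e').
have [||r r0 hr] := @unif_int Q _ _ N.
- by move=> k r r' rr [h1 h2]; split => y hy; [apply: h1|apply: h2]; exact: lt_le_trans rr.
- move=> k; have [r1 r10 h1] := cont_ball (shft l k zz) cf e'0.
  have [r2 r20 h2] := cont_ball (shft l k zz) cf' e'0.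
  exists (Num.min r1 r2); first by rewrite lt_min r10.
  by split => y; rewrite lt_min => /andP[? ?]; [exact: h1|exact: h2].
have R3 : 0 < 3 * Rb by rewrite mulr_gt0// (lt_le_trans ltr01).
exists (r / (3 * Rb)); first by rewrite divr_gt0.
move=> eta Cq dl mu w hdl h9 hw; rewrite ltr_pdivlMr// mulrC => hd.
have t0 k (x : P) : f x != 0 -> (N < `|k|)%N -> th1 dl w (shft l k x) = 0 /\ th1 dl w (shft l k (- x)) = 0.
  move=> /hK hx; rewrite ltnNge => /negP kN.
  have key (y : P) : `|y| <= K -> th1 dl w (shft l k y) = 0.
    move=> hy; apply/eqP; apply: contraT => /(th1_near hdl h9 hw)[_ /andP[h1 h2]]; case: kN; apply: hN.
    have -> : k%:~R * l = (shft l k y).2 - y.2 by rewrite /= addrC addKr.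
    have b1 : `|(shft l k y).2| <= l by rewrite ler_norml; apply/andP; split; lra.
    by rewrite (le_trans (ler_normB _ _))// addrC lerD// (le_trans (norm2 y)).
  by split; apply: key; rewrite ?normrN.
have p0 k : (N < `|k|)%N -> f (shft l k zz) = 0 /\ f (- shft l k zz) = 0.
  rewrite ltnNge => /negP kN; have key : K < `|shft l k zz|.
    rewrite ltNge; apply/negP => hz; case: kN; apply: hN; have := le_trans (norm2 _) hz => /= h.
    have -> : k%:~R * l = (- (l / 4) + k%:~R * l) + l / 4 by ring.
    by rewrite (le_trans (ler_normD _ _))// lerD// gtr0_norm; lra.
  by split; apply/eqP; apply: contraTT key => /hK; rewrite ?normrN -leNgt.
have -> : \sum_(k \in [set: int]) f (shft l k zz) = symsum (fun k => f (shft l (- k) zz)) N.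
  by rewrite (symsum_opp (fun k => f (shft l k zz))); apply: fsbig_symsum => k /p0[].
have -> : \sum_(k \in [set: int]) f (- shft l k zz) = symsum (fun k => f (- shft l (- k) zz)) N.
  by rewrite (symsum_opp (fun k => f (- shft l k zz))); apply: fsbig_symsum => k /p0[].
pose g1 k x := th1 dl w (shft l k x) * f x; pose g2 k x := th1 dl w (shft l k x) * f (- x).
have t1 k : (`|k| <= N)%N -> itg (g1 k) /\ `|I2 (g1 k) - f (shft l (- k) zz)| <= e'.
  move=> kN; apply: (th1_test Rb1 hdl hw cf hd).
  by have [|h _] := hr (- k); rewrite ?abszN.
have t2 k : (`|k| <= N)%N -> itg (g2 k) /\ `|I2 (g2 k) - f (- shft l (- k) zz)| <= e'.
  move=> kN; apply: (th1_test Rb1 hdl hw cf' hd).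
  by have [|_ h] := hr (- k); rewrite ?abszN.
have [i1 s1] := @symsum_I2 g1 N (fun k kN => (t1 k kN).1).
have [i2 s2] := @symsum_I2 g2 N (fun k kN => (t2 k kN).1).
have E : (fun x => th0 dl w x * f x) = fun x => symsum (g1 ^~ x) N - symsum (g2 ^~ (- x)) N.
  apply/funext => x; have [fx|fx] := eqVneq (f x) 0.
    by rewrite fx mulr0 /symsum !big1 ?subr0// => i _; rewrite /g1 /g2 ?opprK fx mulr0.
  rewrite /th0 periodize_th2 mulrBl /periodize; congr (_ - _).
    rewrite (@fsbig_symsum _ N) => [|k /(t0 _ _ fx)[]//].
    by rewrite /symsum mulr_suml.
  rewrite (@fsbig_symsum _ N) => [|k /(t0 _ _ fx)[]//].
  by rewrite /symsum mulr_suml; apply: eq_bigr => i _; rewrite /g2 opprK.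
have i2' : itg (fun x => symsum (g2 ^~ (- x)) N).
  by apply: eq_itg (itg_sub 0 i2) => y; rewrite sub0r.
rewrite E (I2B i1 i2') (I2_neg i2) s1 s2.
have c1 := symsum_close (fun k kN => (t1 k kN).2); have c2 := symsum_close (fun k kN => (t2 k kN).2).
have Ee : N.*2.+1%:R * e' = eps / 2 
  by rewrite /e'; have : N.*2.+1%:R != 0 :> R by []; move: (N.*2.+1%:R : R) => n hn; field.
have Er (a b c e : R) : a - b - (c - e) = (a - c) - (b - e) by ring.
rewrite Er (le_trans (ler_normB _ _))// (le_trans (lerD c1 c2))// Ee; lra.
Qed.

Lemma tt1_shft k : tt1 (shft l k z2) =
  2 * AA * (2 * d / (4 * d ^+ 2 + ((- k)%:~R * l + l / 2) ^+ 2) `^ (2 - s)).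
Proof.
have E : nq (shft l k z2) = 4 * d ^+ 2 + ((- k)%:~R * l + l / 2) ^+ 2.
  by rewrite /nq /= rmorphN /=; ring.
by rewrite /tt1 E -powRN opprB /=; move: (_ `^ _) AA => a b; ring.
Qed.

(** As [z2.2 = - (l / 2)], the translate by [k] gives the term of index [- k], and symmetric sums do
    not see this change. The factor [AA] cancels by [Cs_AA]. *)
Lemma speed_lim : Cs s * limn (symsum (fun k : int =>
    2 * d / (4 * d ^+ 2 + (k%:~R * l + l / 2) ^+ 2) `^ (2 - s))) = cG * T1s z2.
Proof.
set G := fun k : int => _; have A0 := AA_gt0; have An : AA != 0 by rewrite lt0r_neq0.
have [C b] := tn_bnd (EE_DD EE_z2); have [c _] := Ser_spec b.
have E : symsum G = fun N => (2 * AA)^-1 * (tt1 z2 + psum (tn ^~ z2) N).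
  apply/funext => N; apply: (mulfI (_ : 2 * AA != 0)); first by rewrite mulf_neq0.
  rewrite mulrA mulfV ?mulf_neq0// mul1r -(symsum_opp G).
  transitivity (symsum (fun k => tt1 (shft l k z2)) N).
    by rewrite /symsum mulr_sumr; apply: eq_bigr => i _; rewrite tt1_shft.
  rewrite symsum_psum shft0; congr (_ + _); rewrite /psum; apply: eq_bigr => n _.
have -> : limn (symsum G) = (2 * AA)^-1 * T1s z2.
  rewrite E; apply: cvg_lim => //; exact: (cvgM (cvg_cst _) (cvgD (cvg_cst _) c)).
by rewrite Cs_AA; field.
Qed.

Lemma cvg_right0 (F : R -> R) (L : R) :
  (forall eps, 0 < eps -> exists2 z : R, 0 < z & forall e, 0 < e -> e < z -> `|F e - L| <= eps) ->
  F e @[e --> 0^'+] --> L.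
Proof.
move=> h; apply/cvgrPdist_le => eps e0; have [z z0 hz] := h _ e0.
near=> e; rewrite distrC; apply: hz; near: e; [exact: nbhs_right_gt|exact: nbhs_right_lt].
Unshelve. all: by end_near.
Qed.

(** The closure costs at most [r] in sup norm and the Euclidean norm a factor [sqrt 2];
    [sqrt 2 * 4 * r < 8 * r] leaves the strict inequality of an open disc. *)
Lemma supp_disc (f : P -> R) (z : P) (r b : R) : 0 < r -> 8 * r <= b ->
  (forall x, f x != 0 -> `|x - z| <= 3 * r) -> supp f `<=` disc z b.
Proof.
move=> r0 rb hf x /(_ _ (nbhsx_ballx x r r0))[y [/hf hy]].
rewrite -ball_normE /ball_ /= => hxy; rewrite /disc /=.
have h : `|x - z| <= 4 * r.
  by have := ler_normD (x - y) (y - z); rewrite addrA subrK; move: (`|_ - z|) hy hxy; intros; lra.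
have b0 : 0 < b by lra.
have /andP[_ h2] := nq_norm (x - z).
have h3 : nq (x - z) < b ^+ 2.
  apply: (le_lt_trans h2); apply: (@le_lt_trans _ _ (2 * (4 * r) ^+ 2)).
    by rewrite ler_pM2l// lerXn2r ?nnegrE ?mulr_ge0// ltW.
  apply: (@lt_le_trans _ _ ((8 * r) ^+ 2)); last by rewrite lerXn2r ?nnegrE ?mulr_ge0// ltW.
  have := exprn_gt0 2 r0; rewrite !exprMn; lra.
by rewrite /enorm -/(nq (x - z)) -[ltRHS](ger0_norm (ltW b0)) -sqrtr_sqr ltr_sqrt// exprn_gt0.
Qed.

Lemma dirac_test (f : P -> R) (p : P) : continuous f -> \int[\d_p]_x f x = f p.
Proof.
move=> cf; rewrite /Rintegral integral_dirac//; first by rewrite diracT mul1e.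
by apply/measurable_EFinP; exact: continuous_mbl.
Qed.

Lemma main_result : exists tau : R, 1 < tau <= 2 /\
  forall sigma : R -> R,
    (forall e : R, 0 < e -> 0 < sigma e) ->
    (exists C : R, 0 < C /\ \forall e \near 0^'+, sigma e / e <= C) ->
    (e `^ tau / sigma e @[e --> 0^'+] --> (0 : R)) ->
  exists (e0 L : R) (theta0 theta1 theta2 : R -> R * R -> R) (W : R -> R),
    [/\ 0 < e0, 0 < L,
        forall e : R, 0 < e < e0 ->
          travelling_wave s l (theta0 e) (0, W e) /\
          [/\ C1 (theta0 e), C1 (theta1 e) & C1 (theta2 e)] /\
          (forall k : int,
             symmetric_line2 (k%:~R * l + l / 4) (theta0 e) /\
             symmetric_line2 (k%:~R * l - l / 4) (theta0 e)) /\
          (forall x : R * R, theta0 e x =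
             periodize l (theta1 e) x - periodize l (theta2 e) x) /\
          supp (theta1 e) `<=` disc (- d, - (l / 4)) (L * e) /\
          supp (theta2 e) `<=` disc (d, l / 4) (L * sigma e),
        (W e - Cs s * limn (symsum (fun k : int =>
             2 * d / (4 * d ^+ 2 + (k%:~R * l + l / 2) ^+ 2) `^ (2 - s)))
          @[e --> 0^'+] --> (0 : R)) &
        cvg_to_dirac_combs theta0
          (fun k : int => (- d, k%:~R * l - l / 4))
          (fun k : int => (d, k%:~R * l + l / 4))].
Proof.
exists 2; split; first by rewrite ltr1n lexx.
move=> sigma sg0 _ _.
have [Rb [eta0 [Rb1 eta00 hprof]]] := profile_exists.
have [C C0 hreg] := reg_scaled; have [C' [C'0 _ _ hT1 _]] := base_data.
have Rp : 0 < Rb by exact: lt_le_trans ltr01 Rb1.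
have Cp : 0 < C + 1 by lra.
(* Below [dmax], [dl] is at most 1, the rescaled box fits in radius [rho0], and [C * dl] is at most
   1 and [eta0]. *)
pose dmax : R := Num.min 1 (Num.min (rho0 / (9 * Rb)) (Num.min 1 eta0 / (C + 1))).
have dm0 : 0 < dmax.
  by rewrite /dmax !lt_min ltr01 !divr_gt0 ?mulr_gt0 ?rho0_gt0//= lt_min ltr01.
have hd (dl : R) : 0 < dl -> dl <= dmax ->
    [/\ 0 < dl <= 1, 9 * Rb * dl <= rho0, C * dl <= 1 & C * dl <= eta0].
  move=> d0; rewrite /dmax !le_min => /andP[d1 /andP[d2 d3]].
  have d4 : C * dl <= Num.min 1 eta0.
    have dd : dl * (C + 1) <= Num.min 1 eta0 by rewrite -ler_pdivlMr.
    by apply: le_trans dd; rewrite mulrC ler_wpM2l ?(ltW d0)//; lra.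
  move: d4; rewrite le_min => /andP[d4 d5]; split => //; first by rewrite d0.
  by rewrite mulrC -ler_pdivlMr// mulr_gt0.
(* The profile is chosen as a function of [dl], with the default 0 out of range, so that the
   families in [e] are actual functions. *)
have ex (dl : R) : exists w : P -> R, 0 < dl <= dmax ->
    exists mu, profile Rb (C * dl) C (Qd dl) (Td dl) (T1d dl) w mu.
  have [/andP[d0 d1]|h] := boolP (0 < dl <= dmax); last by exists (fun=> 0).
  have [h1 h2 h3 h4] := hd _ d0 d1.
  by have [w [mu hw]] := hprof _ _ _ _ _ (hreg _ _ Rb1 h1 h2 h3) h4; exists w => _; exists mu.
have [wf hwf] := choice ex.
pose dl e : R := Num.min e (sigma e).
have hdl e : 0 < e -> e < dmax -> [/\ 0 < dl e, dl e <= e, dl e <= sigma e & dl e <= dmax].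
  move=> e0 e1; have d1 : dl e <= e by rewrite /dl ge_min lexx.
  by split => //; [rewrite /dl lt_min e0 sg0|rewrite /dl ge_min lexx orbT|exact: le_trans d1 (ltW e1)].
(* The factor 8 is that of [supp_disc], applied with [r = Rb * dl e]. *)
exists dmax, (8 * Rb), (fun e => th0 (dl e) (wf (dl e))), (fun e => th1 (dl e) (wf (dl e))),
  (fun e => th2 (dl e) (wf (dl e))), (fun e => cG * spd (dl e) (wf (dl e))); split.
- exact: dm0.
- by rewrite mulr_gt0.
- move=> e /andP[e0 e1]; have [d0 d1 d2 d3] := hdl e e0 e1.
  have [h1 h2 h3 h4] := hd _ d0 d3; have hr := hreg _ _ Rb1 h1 h2 h3.
  have [mu hw] : exists mu, profile Rb (C * dl e) C (Qd (dl e)) (Td (dl e)) (T1d (dl e)) (wf (dl e)) mu.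
    by apply: hwf; rewrite d0.
  split; first exact: travelling hw.
  split.
    by split; apply: sd_C1 => x; [exact: sd_th0 hw x|exact: sd_th1 hw x|exact: sd_th2 hw x].
  split.
    (* [th0_refl] with index [m] reflects in [x_2 = m * l / 2 - l / 4]: the index [2 * k + 1] gives
       [k * l + l / 4], and [2 * k] gives [k * l - l / 4]. *)
    move=> k; split => x.
      rewrite -[RHS](th0_refl hw (2 * k + 1)); congr th0; apply: (congr2 pair) => //.
      by rewrite rmorphD rmorphM /=; field.
    rewrite -[RHS](th0_refl hw (2 * k)); congr th0; apply: (congr2 pair) => //.
    by rewrite rmorphM /=; field.
  have rp : 0 < Rb * dl e by rewrite mulr_gt0.
  have bnd x : th1 (dl e) (wf (dl e)) x != 0 -> `|x - zz| <= 3 * (Rb * dl e).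
    by move=> /(th1_zz h1 hw); rewrite mulrA.
  split => //; split.
    by apply: supp_disc rp _ bnd; rewrite -mulrA !ler_wpM2l// ltW.
  apply: supp_disc rp _ _ => [|x /bnd]; first by rewrite -mulrA !ler_wpM2l// ltW.
  have -> // : - x - zz = - (x - (d, l / 4)).
    by apply: (congr2 pair); rewrite /= !opprK ?opprB addrC.
  by rewrite normrN.
- rewrite speed_lim; apply: cvg_right0 => eps eps0.
  pose M : R := `|cG| * (C' * (9 * Rb)); have M0 : 0 <= M by rewrite /M !mulr_ge0// ltW.
  exists (Num.min dmax (eps / (M + 1))); first by rewrite lt_min dm0 divr_gt0//; lra.
  move=> e e0; rewrite lt_min => /andP[e1 e2].
  have [d0 d1 d2 d3] := hdl e e0 e1; have [h1 h2 h3 h4] := hd _ d0 d3.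
  have [mu hw] : exists mu, profile Rb (C * dl e) C (Qd (dl e)) (Td (dl e)) (T1d (dl e)) (wf (dl e)) mu.
    by apply: hwf; rewrite d0.
  have h := spd_est Rb1 h1 hw C'0 hT1; rewrite subr0 -mulrBr normrM.
  rewrite (le_trans (ler_wpM2l (normr_ge0 _) h))//.
  have -> : `|cG| * (C' * (9 * Rb * dl e)) = M * dl e by rewrite /M !mulrA.
  have M1 : 0 < M + 1 by lra.
  move: e2; rewrite ltr_pdivlMr// => e2; apply: (@le_trans _ _ (M * e)); first by rewrite ler_wpM2l.
  by move: e2; rewrite mulrDr mulr1 mulrC; lra.
- move=> phi cphi sphi; apply: cvg_right0 => eps eps0.
  have [z z0 hz] := weak_cvg cphi sphi Rb1 eps0.
  exists (Num.min dmax z); first by rewrite lt_min dm0.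
  move=> e e0; rewrite lt_min => /andP[e1 e2].
  have [d0 d1 d2 d3] := hdl e e0 e1; have [h1 h2 h3 h4] := hd _ d0 d3.
  have [mu hw] : exists mu, profile Rb (C * dl e) C (Qd (dl e)) (Td (dl e)) (T1d (dl e)) (wf (dl e)) mu.
    by apply: hwf; rewrite d0.
  have := hz _ _ _ _ _ h1 h2 hw (le_lt_trans d1 e2).
  congr (`| _ - (_ - _)| <= eps).
    by apply: eq_fsbigr => k _; rewrite dirac_test//; congr phi; apply: (congr2 pair) => //=; rewrite addrC.
  (* The negative centres [- shft l k zz] are [(d, l / 4 - k * l)], hence the change of index. *)
  rewrite (@reindex_fsbigT _ _ _ _ _ (fun j : int => - j) (fun k => phi (- shft l k zz))).
    apply: eq_fsbigr => k _; rewrite dirac_test//; congr phi; apply: (congr2 pair) => /=; first by rewrite opprK.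
    by rewrite rmorphN /=; ring.
  by exists (fun j => - j) => j; exact: opprK.
Qed.
End scale.
End main.

Theorem theorem1p3 (R : realType) (s l d : R)
    (hs : 0 < s <= 1) (hl : 0 < l) (hd : 0 <= d) :
  exists tau : R, 1 < tau <= 2 /\
  forall sigma : R -> R,
    (forall e : R, 0 < e -> 0 < sigma e) ->
    (exists C : R, 0 < C /\ \forall e \near 0^'+, sigma e / e <= C) ->
    (e `^ tau / sigma e @[e --> 0^'+] --> (0 : R)) ->
  exists (e0 L : R) (theta0 theta1 theta2 : R -> R * R -> R) (W : R -> R),
    [/\ 0 < e0, 0 < L,
        forall e : R, 0 < e < e0 ->
          travelling_wave s l (theta0 e) (0, W e) /\
          [/\ C1 (theta0 e), C1 (theta1 e) & C1 (theta2 e)] /\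
          (forall k : int,
             symmetric_line2 (k%:~R * l + l / 4) (theta0 e) /\
             symmetric_line2 (k%:~R * l - l / 4) (theta0 e)) /\
          (forall x : R * R, theta0 e x =
             periodize l (theta1 e) x - periodize l (theta2 e) x) /\
          supp (theta1 e) `<=` disc (- d, - (l / 4)) (L * e) /\
          supp (theta2 e) `<=` disc (d, l / 4) (L * sigma e),
        (W e - Cs s * limn (symsum (fun k : int =>
             2 * d / (4 * d ^+ 2 + (k%:~R * l + l / 2) ^+ 2) `^ (2 - s)))
          @[e --> 0^'+] --> (0 : R)) &
        cvg_to_dirac_combs theta0
          (fun k : int => (- d, k%:~R * l - l / 4))
          (fun k : int => (d, k%:~R * l + l / 4))].
Proof. exact (main_result hs hl d). Qed.
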